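(* For $\lambda\in\mathbb{Z}^r$ and $j\geq 0$, there exists a polynomial functor $\mathcal{P}_{\lambda}^j$ of degree $|\lambda|$ such that \[ H^j\left(Fl_{n},\mathcal{O}_{Fl_{n}}(\lambda^{[n]})\right) \cong \mathcal{P}_{\lambda}^j(\mathbf{k}^n)\] as $\operatorname{GL}_n$-representations, for all $n\geq r$ with $n\geq\max\{i-\lambda_i:i=1,\dots,r\}$.
   Context: $\mathbf{k}$ is an algebraically closed field. $Fl_n$ is the variety of complete flags $0\subset V_1\subset\cdots\subset V_{n-1}\subset V_n=\mathbf{k}^n$, $\dim V_i=i$. For $\lambda\in\mathbb{Z}^n$, $\mathcal{O}_{Fl_n}(\lambda)=\bigotimes_{i=1}^n (\mathcal{V}_{n+1-i}/\mathcal{V}_{n-i})^{\otimes\lambda_i}$, where $\mathcal{V}_i$ is the tautological rank $i$ subbundle of $\mathbf{k}^n\otimes\mathcal{O}_{Fl_n}$ (so that $H^0(Fl_n,\mathcal{O}_{Fl_n}(d,0,\dots,0))=\operatorname{Sym}^d(\mathbf{k}^n)$). For $\lambda\in\mathbb{Z}^r$, $|\lambda|=\lambda_1+\cdots+\lambda_r$, and for $n\geq r$, $\lambda^{[n]}=(\lambda_1,\dots,\lambda_r,0,\dots,0)\in\mathbb{Z}^n$. A polynomial functor of degree $d$ is a functor $\mathcal{P}$ from finite dimensional $\mathbf{k}$-vector spaces to itself such that the maps $\operatorname{Hom}(V,W)\to\operatorname{Hom}(\mathcal{P}(V),\mathcal{P}(W))$ are polynomial and $\mathcal{P}(c\cdot\mathrm{id}_V)=c^d\cdot\mathrm{id}_{\mathcal{P}(V)}$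 for all $c\in\mathbf{k}$ (the only one of negative degree is $0$). *)

(* Defs.v *)
From HB Require Import structures.
From mathcomp Require Import all_boot all_order all_algebra.
From mathcomp Require Import boolp classical_sets functions topology_structure.
(* The notations of [mpoly] clash with those of the topology files. *)
From mathcomp Require Import -(notations) mpoly.

Set Implicit Arguments.
Unset Strict Implicit.
Unset Printing Implicit Defensive.

Import GRing.Theory.
Local Open Scope classical_set_scope.
Local Open Scope ring_scope.

Section Subquotient.
Variables (k : fieldType) (V : lmodType k).

Record subspace := Subspace {
  subspace_set :> V -> Prop;
  subspace0 : subspace_set 0;
  subspaceP : forall (a : k) (u v : V),
    subspace_set u -> subspace_set v -> subspace_set (a *: u + v)
}.

Lemma subspaceD (S : subspace) u v : S u -> S v -> S (u + v).
Proof. by move=> Su Sv; rewrite -[u]scale1r; apply: subspaceP. Qed.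

Lemma subspaceZ (S : subspace) a u : S u -> S (a *: u).
Proof.
by move=> Su; rewrite -[_ *: _]addr0; apply: subspaceP => //; apply: subspace0.
Qed.

Lemma subspaceN (S : subspace) u : S u -> S (- u).
Proof. by move=> Su; rewrite -scaleN1r; apply: subspaceZ. Qed.

Lemma subspaceB (S : subspace) u v : S u -> S v -> S (u - v).
Proof. by move=> Su Sv; apply: subspaceD => //; apply: subspaceN. Qed.

Variables Z B : subspace.

Definition coset (z : V) : set V := [set v | B (v - z)].

(* The cosets z + B with z in Z, i.e. the quotient Z / B for B contained
   in Z. *)
Definition subquot : Type :=
  {A : set V | exists2 z, Z z & A = coset z}.

Definition cls (z : V) (Zz : Z z) : subquot :=
  exist _ (coset z) (ex_intro2 _ _ z Zz erefl).

Lemma subquot_inj (A A' : subquot) : sval A = sval A' -> A = A'.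
Proof. by case: A A' => [S ?] [S' ?] /= e; apply: eq_exist. Qed.

Definition crepr (A : subquot) : V := sval (cid2 (svalP A)).

Lemma crepr_in A : Z (crepr A).
Proof. by rewrite /crepr; case: cid2. Qed.

Lemma crepr_coset A : sval A = coset (crepr A).
Proof. by rewrite /crepr; case: cid2. Qed.

Lemma cls_eq z z' (Zz : Z z) (Zz' : Z z') :
  cls Zz = cls Zz' <-> B (z - z').
Proof.
split=> [/(congr1 sval) /= e | Bz].
  suff: coset z z by rewrite e.
  by rewrite /coset /= subrr; apply: subspace0.
apply: subquot_inj => /=; apply/predeqP => v; rewrite /coset /=; split=> Bv.
  by rewrite -(subrKA z); apply: subspaceD.
by rewrite -(subrKA z') -[z' - z]opprB; apply: subspaceB.
Qed.

Lemma crepr_cls z (Zz : Z z) : B (crepr (cls Zz) - z).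
Proof.
apply/(cls_eq (crepr_in _) Zz); apply: subquot_inj; exact: esym (crepr_coset _).
Qed.

Lemma clsE A : A = cls (crepr_in A).
Proof. by apply: subquot_inj; exact: crepr_coset. Qed.

HB.instance Definition _ := gen_eqMixin subquot.
HB.instance Definition _ := gen_choiceMixin subquot.

Definition subquot_add A A' :=
  cls (subspaceD (crepr_in A) (crepr_in A')).
Definition subquot_opp A := cls (subspaceN (crepr_in A)).
Definition subquot_scale (a : k) A := cls (subspaceZ a (crepr_in A)).
Definition subquot_zero := cls (subspace0 Z).

Lemma cls_add u v (Zu : Z u) (Zv : Z v) :
  subquot_add (cls Zu) (cls Zv) = cls (subspaceD Zu Zv).
Proof.
by apply/cls_eq; rewrite opprD addrACA; apply: subspaceD; apply: crepr_cls.
Qed.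

Lemma cls_opp u (Zu : Z u) : subquot_opp (cls Zu) = cls (subspaceN Zu).
Proof. by apply/cls_eq; rewrite -opprD; apply/subspaceN/crepr_cls. Qed.

Lemma cls_scale a u (Zu : Z u) :
  subquot_scale a (cls Zu) = cls (subspaceZ a Zu).
Proof. by apply/cls_eq; rewrite -scalerBr; apply/subspaceZ/crepr_cls. Qed.

Let same u v (Zu : Z u) (Zv : Z v) : u = v -> cls Zu = cls Zv.
Proof. by move=> e; apply/cls_eq; rewrite e subrr; apply: subspace0. Qed.

Fact subquot_addA : associative subquot_add.
Proof.
move=> A A' A''; rewrite [A]clsE [A']clsE [A'']clsE !cls_add.
by apply: same; rewrite addrA.
Qed.

Fact subquot_addC : commutative subquot_add.
Proof.
by move=> A A'; rewrite [A]clsE [A']clsE !cls_add; apply: same; rewrite addrC.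
Qed.

Fact subquot_add0 : left_id subquot_zero subquot_add.
Proof. by move=> A; rewrite [A]clsE cls_add; apply: same; rewrite add0r. Qed.

Fact subquot_addN : left_inverse subquot_zero subquot_opp subquot_add.
Proof.
by move=> A; rewrite [A]clsE cls_opp cls_add; apply: same; rewrite addNr.
Qed.

HB.instance Definition _ := GRing.isZmodule.Build subquot
  subquot_addA subquot_addC subquot_add0 subquot_addN.

Fact subquot_scaleA a b A :
  subquot_scale a (subquot_scale b A) = subquot_scale (a * b) A.
Proof.
by rewrite [A]clsE !cls_scale; apply: same; rewrite scalerA.
Qed.

Fact subquot_scale1 : left_id 1 subquot_scale.
Proof. by move=> A; rewrite [A]clsE cls_scale; apply: same; rewrite scale1r. Qed.

Fact subquot_scaleDr : right_distributive subquot_scale +%R.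
Proof.
move=> a A A'; rewrite [A]clsE [A']clsE /GRing.add /= cls_add !cls_scale cls_add.
by apply: same; rewrite scalerDr.
Qed.

Fact subquot_scaleDl A : {morph subquot_scale^~ A : a b / a + b}.
Proof.
move=> a b; rewrite [A]clsE !cls_scale [in RHS]/GRing.add /= cls_add.
by apply: same; rewrite scalerDl.
Qed.

HB.instance Definition _ := GRing.Zmodule_isLmodule.Build k subquot
  subquot_scaleA subquot_scale1 subquot_scaleDr subquot_scaleDl.

End Subquotient.

(* Sheaves of k-vector spaces on X whose sections over U are functions on
   p @^-1` U, such as the sections of a line bundle on X seen as functions on
   the associated frame bundle p : E -> X.  To avoid dependent types a section
   is a total function on E, of which only the restriction to p @^-1` U
   matters; gluing of compatible sections then reduces to [sec_local]. *)
Record funsheaf (k : fieldType) (X : topologicalType) (E : Type) (p : E -> X) :=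
  FunSheaf {
  sec : set X -> set (E -> k^o);
  sec0 : forall U, sec U 0;
  secP : forall U (a : k) s t, sec U s -> sec U t -> sec U (a *: s + t);
  sec_ext : forall U s t,
    (forall e, U (p e) -> s e = t e) -> sec U s -> sec U t;
  sec_res : forall U W s, W `<=` U -> sec U s -> sec W s;
  sec_local : forall U s, open U ->
    (forall x, U x -> exists2 W, open_nbhs x W & sec W s) -> sec U s
}.

(* Sheaf cohomology, computed by Godement's canonical simplicial resolution
     F -> T F -> T (T F) -> ...,   (T F)(U) = \prod_(x in U) F_x,
   a resolution by flasque sheaves with differential the alternating sum of
   the coface maps T^i(eta) : T^m F -> T^m.+1 F, where eta : G -> T G sends a
   section to the family of its germs.  Unfolding the definition, an element
   of (T^n.+1 F)(X) is given by a family of germs s(x_0, ..., x_n) in F_{x_n}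
   for x_0 in X, x_1 in a neighbourhood of x_0, x_2 in a neighbourhood of x_1
   (depending on x_0 and x_1), etc., two families being equal when they agree
   on all (x_0, ..., x_n) for possibly smaller such neighbourhoods
   (Godement, Topologie algebrique et theorie des faisceaux, II.6.4).  Cochains
   below are representatives of such families, the germ s(x_0, ..., x_n) being
   represented by a function on E, and [null] is the equality to zero. *)
Section Cohomology.
Variables (k : fieldType) (X : topologicalType) (E : Type) (p : E -> X).

Definition tlast n (t : n.+1.-tuple X) : X := tnth t ord_max.

(* for all x_0, for all x_1 near x_0, ..., for all x_n near x_(n-1) *)
Fixpoint near_chain n : (n.+1.-tuple X -> Prop) -> Prop :=
  match n with
  | 0 => fun P => forall x, P [tuple x]
  | m.+1 => fun P => near_chain (fun t : m.+1.-tuple X =>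
      \forall x \near tlast t, P [tuple of rcons t x])
  end.

Definition precochain n : lmodType k := n.+1.-tuple X -> E -> k^o.

Definition null n (s : precochain n) : Prop :=
  near_chain (fun t => \forall x \near tlast t, forall e, p e = x -> s t e = 0).

Definition face n (i : 'I_n.+2) (t : n.+2.-tuple X) : n.+1.-tuple X :=
  [tuple tnth t (lift i l) | l < n.+1].

(* The i-th coface forgets x_i; for i = n.+1 the germ s(x_0, ..., x_n) at x_n
   is extended to a neighbourhood and its germ at x_(n+1) is taken, which does
   not change the function that represents it. *)
Definition diff n (s : precochain n) : precochain n.+1 :=
  fun t e => \sum_(i < n.+2) (-1) ^+ i * s (face i t) e.

Lemma near_chain_mono n (P Q : n.+1.-tuple X -> Prop) :
  (forall t, P t -> Q t) -> near_chain P -> near_chain Q.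
Proof.
elim: n P Q => [|n IHn] P Q PQ /=; first by move=> nP x; apply: PQ.
by apply: IHn => t; apply: filterS => x; apply: PQ.
Qed.

Lemma near_chainI n (P Q : n.+1.-tuple X -> Prop) :
  near_chain P -> near_chain Q -> near_chain (fun t => P t /\ Q t).
Proof.
elim: n P Q => [|n IHn] P Q /= nP nQ; first by move=> x; split.
by apply: near_chain_mono (IHn _ _ nP nQ) => t [Pt Qt]; apply: filterI.
Qed.

Lemma near_chainT n (P : n.+1.-tuple X -> Prop) :
  (forall t, P t) -> near_chain P.
Proof.
elim: n P => [|n IHn] P PT /=; first by move=> x.
by apply: IHn => t; apply: filterE.
Qed.

Lemma null0 n : null (0 : precochain n).
Proof. by apply: near_chainT => t; apply: filterE. Qed.

Lemma nullP n (a : k) (s t : precochain n) :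
  null s -> null t -> null (a *: s + t).
Proof.
move=> ns nt; apply: near_chain_mono (near_chainI ns nt) => u [].
apply: filterS2 => x s0 t0 e pe.
by have -> : (a *: s + t) u e = a * s u e + t u e by []; rewrite s0 // t0 // mulr0 addr0.
Qed.

Lemma diff0 n : diff (0 : precochain n) = 0.
Proof.
by apply/funext => t; apply/funext => e; apply: big1 => i _; rewrite mulr0.
Qed.

Lemma diffP n (a : k) (s t : precochain n) :
  diff (a *: s + t) = a *: diff s + diff t.
Proof.
apply/funext => u; apply/funext => e.
have -> : (a *: diff s + diff t) u e = a * diff s u e + diff t u e by [].
rewrite /diff mulr_sumr -big_split /=.
by apply: eq_bigr => i _; rewrite mulrCA -mulrDr.
Qed.

Lemma diffK n (s : precochain n) : diff (diff s) = 0.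
Proof.
apply/funext => t; apply/funext => e.
pose G (q : 'I_n.+3 * 'I_n.+2) : k :=
  (-1) ^+ q.1 * ((-1) ^+ q.2 * s (face q.2 (face q.1 t)) e).
pose h (q : 'I_n.+3 * 'I_n.+2) : 'I_n.+3 * 'I_n.+2 :=
  if (q.2 < q.1)%N then (inord q.2, inord q.1.-1) else (inord q.2.+1, inord q.1).
have hlt (q : 'I_n.+3 * 'I_n.+2) : (q.2 < q.1)%N ->
    ((h q).1 = q.2 :> nat) * ((h q).2 = q.1.-1 :> nat).
  case: q => i l /= li; rewrite /h /= li /=; rewrite !inordK //.
    by have := ltn_ord i; case: (nat_of_ord i) li.
  by rewrite ltnS ltnW.
have hge (q : 'I_n.+3 * 'I_n.+2) : (q.1 <= q.2)%N -> ((h q).1 = q.2.+1 :> nat) * ((h q).2 = q.1 :> nat).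
  case: q => i l /= il; rewrite /h /= ltnNge il /=.
  rewrite !inordK //; first exact: leq_ltn_trans il (ltn_ord l). by rewrite ltnS ltn_ord.
have h_inj (q q' : 'I_n.+3 * 'I_n.+2) : q.1 = q'.1 :> nat -> q.2 = q'.2 :> nat -> q = q'.
  by case: q q' => i l [i' l'] /= /val_inj -> /val_inj ->.
have hK : involutive h.
  move=> q; have [il | li] := leqP q.1 q.2.
    have [e1 e2] := hge q il.
    have li' : ((h q).2 < (h q).1)%N by rewrite e1 e2 ltnS.
    by apply: h_inj; rewrite !(hlt _ li') ?e1 ?e2.
  have [e1 e2] := hlt q li.
  have i0 : (0 < q.1)%N by apply: leq_ltn_trans li.
  have il' : ((h q).1 <= (h q).2)%N by rewrite e1 e2 -ltnS prednK.
  by apply: h_inj; rewrite !(hge _ il') ?e1 ?e2 ?prednK.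
transitivity (\sum_q G q).
  rewrite /diff -(pair_bigA _ (fun i l => G (i, l))) /=.
  by apply: eq_bigr => i _; rewrite mulr_sumr.
rewrite (bigID (fun q : 'I_n.+3 * 'I_n.+2 => (q.2 < q.1)%N)) /=.
rewrite [X in _ + X](reindex_inj (inv_inj hK)) /=.
rewrite [X in _ + X](eq_bigl (fun q : 'I_n.+3 * 'I_n.+2 => (q.2 < q.1)%N)); last first.
  move=> q /=; have [il | li] := leqP q.1 q.2.
    by rewrite !(hge _ il) ltnS il.
  rewrite !(hlt _ li) -leqNgt -ltnS prednK //.
  by apply: leq_ltn_trans li.
rewrite -big_split; apply: big1 => q li /=.
have i0 : (0 < q.1)%N by apply: leq_ltn_trans li.
have fE : face (h q).2 (face (h q).1 t) = face q.2 (face q.1 t).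
  apply: eq_from_tnth => m; rewrite !tnth_mktuple; congr tnth.
  apply: val_inj; rewrite /= !(hlt _ li) /bump. move: li i0; case: (nat_of_ord q.1) => // a; rewrite ltnS /= => li _.
  have [am|ma] := leqP a m.
     rewrite (leq_trans li am) /= !add1n  ltnS am (leq_trans (leq_trans li am)) //.
  rewrite add0n; have [lm|ml] := leqP q.2 m; rewrite ?add1n ?add0n ?ltnS.
    by rewrite leqNgt ma.
   by rewrite leqNgt ltnW.
rewrite /G fE !(hlt _ li) -[X in (-1)^+X * _ + _](prednK i0) exprS mulN1r mulNr addrC.
by rewrite mulrCA subrr.
Qed.

Lemma tlast_rcons n (t : n.+1.-tuple X) x : tlast [tuple of rcons t x] = x.
Proof. by rewrite /tlast (tnth_nth x) /= nth_rcons size_tuple ltnn eqxx. Qed.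

Lemma face_rcons_max n (t : n.+1.-tuple X) x :
  face ord_max [tuple of rcons t x] = t.
Proof.
apply: eq_from_tnth => l; rewrite tnth_mktuple !(tnth_nth x) /= nth_rcons.
have -> : bump n.+1 l = l by rewrite /bump leqNgt ltn_ord.
by rewrite size_tuple ltn_ord.
Qed.

Lemma face_rcons_lift n (t : n.+2.-tuple X) x (i : 'I_n.+2) :
  face (lift ord_max i) [tuple of rcons t x] = [tuple of rcons (face i t) x].
Proof.
have iE : lift ord_max i = i :> nat by rewrite lift_max.
apply: eq_from_tnth => l; rewrite tnth_mktuple !(tnth_nth x) /= !nth_rcons.
rewrite -[bump _ i]/(nat_of_ord (lift ord_max i)) iE size_tuple size_map size_enum_ord.
have [ln | nl] := ltnP l n.+1.
  have bl : (bump i l < n.+2)%N by rewrite /bump; case: (i <= l)%N; [rewrite ltnS | apply: ltnW].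
  rewrite bl (nth_map ord0) ?size_enum_ord // (tnth_nth x) /=.
  by rewrite nth_enum_ord.
have -> : nat_of_ord l = n.+1 by apply/eqP; rewrite eqn_leq nl -ltnS ltn_ord.
have -> : bump i n.+1 = n.+2 by rewrite /bump -[(i <= _)%N]ltnS ltn_ord.
by rewrite !ltnn !eqxx.
Qed.

Lemma near_chain_face n (R : n.+1.-tuple X -> X -> Prop) (i : 'I_n.+2) :
  near_chain (fun t => \forall x \near tlast t, R t x) ->
  near_chain (fun t : n.+2.-tuple X =>
    \forall x \near tlast t, R (face i t) x).
Proof.
elim: n R i => [|n IHn] R i; case: (unliftP ord_max i) => [j|] ->; move=> nR.
- move=> x; apply: filterE => y.
  have -> : face (lift ord_max j) [tuple of rcons [tuple x] y] = [tuple y].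
    apply: eq_from_tnth => l; rewrite tnth_mktuple !(tnth_nth x) /=.
    by rewrite [j]ord1 [l]ord1.
  by rewrite tlast_rcons; apply: (nR y).
- move=> x; apply: filterS (near_join (nR x)) => y.
  by rewrite tlast_rcons face_rcons_max.
- pose S (t : n.+1.-tuple X) y := \forall x \near y, R [tuple of rcons t y] x.
  have nS : near_chain (fun t => \forall y \near tlast t, S t y).
    apply: near_chain_mono (nR : near_chain (n := n) _) => t.
    by apply: filterS => y; rewrite tlast_rcons.
  suff : near_chain (fun t : n.+2.-tuple X => \forall y \near tlast t,
    \forall x \near tlast [tuple of rcons t y],
      R (face (lift ord_max j) [tuple of rcons t y]) x) by [].
  apply: near_chain_mono (IHn S j nS) => t; apply: filterS => y.
  by rewrite tlast_rcons face_rcons_lift.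
- suff : near_chain (fun t : n.+2.-tuple X => \forall y \near tlast t,
    \forall x \near tlast [tuple of rcons t y],
      R (face ord_max [tuple of rcons t y]) x) by [].
  apply: near_chain_mono nR => t /near_join; apply: filterS => y.
  by rewrite tlast_rcons face_rcons_max.
Qed.

Lemma diff_faces n (s : precochain n) :
  diff s = \sum_(i < n.+2) (-1) ^+ i *: (fun t => s (face i t)) :> precochain n.+1.
Proof. by apply/funext => t; apply/funext => e; rewrite !fct_sumE. Qed.

Lemma null_diff n (s : precochain n) : null s -> null (diff s).
Proof.
move=> ns; rewrite diff_faces.
apply: (big_ind (fun s : precochain n.+1 => null s)).
- exact: null0.
- by move=> u v nu nv; rewrite -[u]scale1r; apply: nullP.
move=> i _; rewrite -[_ *: _]addr0; apply: nullP; last exact: null0.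
exact: (near_chain_face (R := fun t x => forall e, p e = x -> s t e = 0)).
Qed.

Variable F : funsheaf k p.

Definition cochain n (s : precochain n) : Prop :=
  near_chain (fun t => exists2 W, open_nbhs (tlast t) W & sec F W (s t)).

Lemma cochain0 n : cochain (0 : precochain n).
Proof.
apply: near_chainT => t; exists setT; last exact: sec0.
by split=> //; apply: openT.
Qed.

Lemma cochainP n (a : k) (s t : precochain n) :
  cochain s -> cochain t -> cochain (a *: s + t).
Proof.
move=> cs ct; apply: near_chain_mono (near_chainI cs ct).
move=> u [[W oW sW] [W' oW' tW']].
exists (W `&` W'); first exact: open_nbhsI.
by apply: secP; [apply: sec_res sW | apply: sec_res tW'] => x [].
Qed.

Fact cocycle0 n : cochain (0 : precochain n) /\ null (diff (0 : precochain n)).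
Proof. by split; [apply: cochain0 | rewrite diff0; apply: null0]. Qed.

Fact cocycleP n (a : k) (s t : precochain n) :
  cochain s /\ null (diff s) -> cochain t /\ null (diff t) ->
  cochain (a *: s + t) /\ null (diff (a *: s + t)).
Proof.
move=> [cs ns] [ct nt]; split; first exact: cochainP.
by rewrite diffP; apply: nullP.
Qed.

Definition cocycle n : subspace (precochain n) :=
  Subspace (@cocycle0 n) (@cocycleP n).

Definition bounds n : precochain n -> Prop :=
  match n with
  | 0 => fun s => null s
  | m.+1 => fun s => exists2 s' : precochain m, cochain s' & null (s - diff s')
  end.

Fact coboundary0 n : bounds (0 : precochain n).
Proof.
case: n => [|n]; first exact: null0.
by exists 0; [apply: cochain0 | rewrite diff0 subr0; apply: null0].
Qed.

Fact coboundaryP n (a : k) (s t : precochain n) :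
  bounds s -> bounds t -> bounds (a *: s + t).
Proof.
case: n s t => [|n] s t; first exact: nullP.
move=> [s' cs ns] [t' ct nt]; exists (a *: s' + t'); first exact: cochainP.
by rewrite diffP opprD addrACA -scalerBr; apply: nullP.
Qed.

Definition coboundary n : subspace (precochain n) :=
  Subspace (@coboundary0 n) (@coboundaryP n).

Lemma cochain_diff n (s : precochain n) : cochain s -> cochain (diff s).
Proof.
move=> cs; rewrite diff_faces.
apply: (big_ind (fun s : precochain n.+1 => cochain s)).
- exact: cochain0.
- by move=> u v nu nv; rewrite -[u]scale1r; apply: cochainP.
move=> i _; rewrite -[_ *: _]addr0; apply: cochainP; last exact: cochain0.
pose R (t : n.+1.-tuple X) x := exists2 W, open_nbhs x W & sec F W (s t).
have nR : near_chain (fun t => \forall x \near tlast t, R t x).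
  apply: near_chain_mono cs => t [W [oW Wt] sW].
  by apply: filterS (open_nbhs_nbhs (conj oW Wt)) => x Wx; exists W.
apply: near_chain_mono (near_chain_face i nR) => t.
exact: nbhs_singleton.
Qed.

Lemma null_cochain n (s : precochain n) : null s -> cochain s.
Proof.
apply: near_chain_mono => t; rewrite /prop_near1 nbhsE => -[W oW s0].
exists W => //; apply: sec_ext (sec0 F W) => e We.
by rewrite (s0 _ We e erefl).
Qed.

Lemma coboundary_cocycle n (s : precochain n) :
  coboundary n s -> cocycle n s.
Proof.
case: n s => [|n] s; first by move=> ns; split; [apply: null_cochain | apply: null_diff].
move=> [s' cs' ns].
have -> : s = 1 *: (s - diff s') + diff s' by rewrite scale1r subrK.
apply: subspaceP; first by split; [apply: null_cochain | apply: null_diff].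
by split; [apply: cochain_diff | rewrite diffK; apply: null0].
Qed.

Definition cohomology n : lmodType k := subquot (cocycle n) (coboundary n).

(* Pullback along a self-map of X covered by a self-map of E that pulls back
   sections to sections. *)
Record sheaf_endo := SheafEndo {
  endo_base : X -> X;
  endo_total : E -> E;
  endo_comm : forall e, p (endo_total e) = endo_base (p e);
  endo_open : forall U, open U -> open (endo_base @^-1` U);
  endo_sec : forall U s, sec F U s -> sec F (endo_base @^-1` U) (s \o endo_total)
}.

Variable f : sheaf_endo.

Definition pull_cochain n (s : precochain n) : precochain n :=
  fun t e => s [tuple of map (endo_base f) t] (endo_total f e).

Lemma endo_near x (P : X -> Prop) :
  (\forall y \near endo_base f x, P y) -> \forall y \near x, P (endo_base f y).
Proof.
move=> fP.
have [W [oW Wx] WP] : exists2 W, open_nbhs (endo_base f x) W & W `<=` P.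
  by move: fP; rewrite /prop_near1 nbhsE.
rewrite /prop_near1 nbhsE; exists (endo_base f @^-1` W); first by split=> //; apply: endo_open.
by move=> y /= Wy; apply: WP.
Qed.

Lemma tlast_map n (t : n.+1.-tuple X) :
  tlast [tuple of map (endo_base f) t] = endo_base f (tlast t).
Proof. by rewrite /tlast tnth_map. Qed.

Lemma near_chain_pull n (P : n.+1.-tuple X -> Prop) :
  near_chain P -> near_chain (fun t => P [tuple of map (endo_base f) t]).
Proof.
elim: n P => [|n IHn] P /=.
  move=> nP x; have -> // : [tuple of map (endo_base f) [tuple x]]
    = [tuple endo_base f x].
  exact: val_inj.
move/IHn; apply: near_chain_mono => t; rewrite tlast_map => /endo_near.
apply: filterS => x; congr P; apply: val_inj => /=; by rewrite map_rcons.
Qed.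

Lemma null_pull n (s : precochain n) : null s -> null (pull_cochain s).
Proof.
move/near_chain_pull; apply: near_chain_mono => t; rewrite tlast_map.
move/endo_near; apply: filterS => x s0 e pe; apply: s0.
by rewrite endo_comm pe.
Qed.

Lemma cochain_pull n (s : precochain n) : cochain s -> cochain (pull_cochain s).
Proof.
move/near_chain_pull; apply: near_chain_mono => t [W [oW Wt] sW].
exists (endo_base f @^-1` W); last exact: endo_sec sW.
by split; [apply: endo_open | move: Wt; rewrite tlast_map].
Qed.

Lemma diff_pull n (s : precochain n) :
  diff (pull_cochain s) = pull_cochain (diff s).
Proof.
apply/funext => t; apply/funext => e; apply: eq_bigr => i _.
rewrite /pull_cochain /face; congr (_ * s _ _); apply: eq_from_tnth => l.
by rewrite tnth_map !tnth_mktuple tnth_map.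
Qed.

Lemma cocycle_pull n (s : precochain n) :
  cocycle n s -> cocycle n (pull_cochain s).
Proof.
by case=> cs ns; split; [apply: cochain_pull
                        | rewrite diff_pull; apply: null_pull].
Qed.

Lemma coboundary_pull n (s : precochain n) :
  coboundary n s -> coboundary n (pull_cochain s).
Proof.
case: n s => [|n] s; first exact: null_pull.
move=> [s' cs ns]; exists (pull_cochain s'); first exact: cochain_pull.
by rewrite diff_pull; apply: (null_pull ns).
Qed.

Definition cohomology_pull n (c : cohomology n) : cohomology n :=
  cls (coboundary n) (cocycle_pull (crepr_in c)).

Lemma cohomology_pull_cls n (s : precochain n) (Zs : cocycle n s) :
  cohomology_pull (cls (coboundary n) Zs)
  = cls (coboundary n) (cocycle_pull Zs).
Proof. by apply/cls_eq; apply: (coboundary_pull (crepr_cls _ Zs)). Qed.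

End Cohomology.

Section Flags.
Variables (k : fieldType) (n : nat).

Record GL := MkGL { glmx :> 'M[k]_n; glmxP : glmx \in unitmx }.

Fact GLmul_subproof (g h : GL) : g *m h \in unitmx.
Proof. by rewrite unitmx_mul !glmxP. Qed.
Definition GLmul (g h : GL) := MkGL (GLmul_subproof g h).

Fact GLinv_subproof (g : GL) : invmx g \in unitmx.
Proof. by rewrite unitmx_inv glmxP. Qed.
Definition GLinv (g : GL) := MkGL (GLinv_subproof g).

Lemma GL_inj (g h : GL) : g = h :> 'M_n -> g = h.
Proof.
case: g h => [g gP] [h hP] /= e; rewrite -{}e in hP *.
by congr MkGL; apply: eq_irrelevance.
Qed.

Definition is_flag (V : {ffun 'I_n.+1 -> {vspace 'cV[k]_n}}) : bool :=
  [forall i : 'I_n.+1, \dim (V i) == i]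
  && [forall i : 'I_n.+1, forall j : 'I_n.+1, (i <= j)%N ==> (V i <= V j)%VS].

Definition flag : Type := {V | is_flag V}.

HB.instance Definition _ := Choice.on flag.

Definition GLlin (g : GL) : 'End('cV[k]_n) := linfun (mulmx g).

Lemma GLlinE (g : GL) v : GLlin g v = g *m v.
Proof. by rewrite lfunE. Qed.

Lemma lker_GLlin (g : GL) : lker (GLlin g) = 0%VS.
Proof.
apply/eqP/lker0P => u v; rewrite !GLlinE => /(congr1 (mulmx (invmx g))).
by rewrite !mulKmx ?glmxP.
Qed.

(* The flag spanned by the columns of g: V_i is the span of the first i. *)
Definition frame_flag_fun (g : GL) : {ffun 'I_n.+1 -> {vspace 'cV[k]_n}} :=
  [ffun i => <<take (nat_of_ord i) [seq col j g | j <- enum 'I_n]>>%VS].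

Lemma free_cols (g : GL) : free [seq col j g | j <- enum 'I_n].
Proof.
set s := map _ _; have sz : size s = n by rewrite size_map size_enum_ord.
pose t := [tuple col j g | j < n].
have -> : s = t by [].
apply/freeP => c /= e0 i.
have : g *m (\col_j c j) = 0.
  apply/colP => l; rewrite -[RHS](congr1 (fun v : 'cV_n => v l 0) e0).
  rewrite mxE summxE; apply: eq_bigr => j _.
  by rewrite (nth_map i) ?size_enum_ord // nth_ord_enum !mxE mulrC.
move/(congr1 (mulmx (invmx g))); rewrite mulKmx ?glmxP // mulmx0.
by move/colP/(_ i); rewrite !mxE.
Qed.

Fact frame_flag_subproof (g : GL) : is_flag (frame_flag_fun g).
Proof.
set s := [seq col j g | j <- enum 'I_n].
have fs : free s by apply: free_cols.
apply/andP; split; apply/forallP => i.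
  rewrite ffunE; have /eqP -> : free (take i s).
    by apply: (@catl_free _ _ (drop i s)); rewrite cat_take_drop.
  rewrite size_take size_map size_enum_ord; case: ltnP => // ni.
  by rewrite eqn_leq ni -ltnS ltn_ord.
apply/forallP => j; apply/implyP => ij; rewrite !ffunE; apply: sub_span => v.
by rewrite -{1}(take_takel _ ij); apply: mem_take.
Qed.

Definition frame_flag (g : GL) : flag := exist (fun V => is_flag V) _ (frame_flag_subproof g).

Fact GLflag_subproof (g : GL) (V : flag) :
  is_flag [ffun i => (GLlin g @: sval V i)%VS].
Proof.
case/andP: (svalP V) => /forallP dV /forallP sV.
apply/andP; split; apply/forallP => i.
  by rewrite ffunE limg_dim_eq // lker_GLlin capv0.
apply/forallP => j; apply/implyP => ij; rewrite !ffunE; apply: limgS.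
by move/forallP/(_ j)/implyP: (sV i); apply.
Qed.

Definition GLflag (g : GL) (V : flag) : flag :=
  exist (fun V => is_flag V) _ (GLflag_subproof g V).

Lemma frame_flagM (g h : GL) : frame_flag (GLmul g h) = GLflag g (frame_flag h).
Proof.
apply: val_inj; apply/ffunP => i; rewrite !ffunE limg_span map_take.
congr <<take _ _>>%VS; rewrite -[RHS]map_comp; apply: eq_map => j /=.
by rewrite GLlinE !colE mulmxA.
Qed.

Lemma frame_flagMr (g b : GL) :
  is_trig_mx b^T -> frame_flag (GLmul g b) = frame_flag g.
Proof.
move=> /is_trig_mxP tb; apply: val_inj; apply/ffunP => i; apply/eqP.
have dim_fl h : \dim (sval (frame_flag h) i) = i.
  by case/andP: (svalP (frame_flag h)) => /forallP/(_ i)/eqP.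
rewrite eqEdim !dim_fl leqnn andbT /= !ffunE; apply/span_subvP => v.
rewrite -map_take => /mapP[j jI ->].
have ji : (j < i)%N by have := index_ltn jI; rewrite index_enum_ord.
have -> : col j (g *m b) = \sum_l b l j *: col l g.
  by apply/colP => m; rewrite !mxE summxE; apply: eq_bigr => l _; rewrite !mxE mulrC.
apply: memv_suml => l _; have [jl | lj] := ltnP j l.
  by have := tb j l jl; rewrite mxE => ->; rewrite scale0r mem0v.
apply: memvZ; apply: memv_span; rewrite -map_take; apply: map_f.
by rewrite in_take ?mem_enum // index_enum_ord (leq_ltn_trans lj).
Qed.

Definition mxeval (q : mpoly (n * n) k) (g : 'M[k]_n) : k := meval (mxvec g 0) q.

Lemma mxeval0 g : mxeval 0 g = 0. Proof. exact: meval0. Qed.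
Lemma mxeval1 g : mxeval 1 g = 1. Proof. exact: meval1. Qed.
Lemma mxevalC c g : mxeval (mpolyC _ c) g = c. Proof. exact: mevalC. Qed.
Lemma mxevalD a q g : mxeval (a + q) g = mxeval a g + mxeval q g.
Proof. exact: mevalD. Qed.
Lemma mxevalM a q g : mxeval (a * q) g = mxeval a g * mxeval q g.
Proof. exact: mevalM. Qed.

(* The Zariski topology of Fl_n = GL_n / B, i.e. the quotient topology along
   [frame_flag]. *)
Definition flag_open (U : set flag) : Prop :=
  forall g : GL, U (frame_flag g) ->
  exists2 q : mpoly (n * n) k, mxeval q g != 0
    & forall g' : GL, mxeval q g' != 0 -> U (frame_flag g').

Fact flag_openT : flag_open setT.
Proof. by move=> g _; exists 1 => //; rewrite /mxeval meval1 oner_neq0. Qed.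

Fact flag_openI : setI_closed flag_open.
Proof.
move=> U W oU oW g [Ug Wg].
have [q qg qU] := oU _ Ug; have [q' q'g q'W] := oW _ Wg.
exists (q * q') => [|g']; rewrite mxevalM mulf_eq0 negb_or.
  by apply/andP.
by case/andP => /qU ? /q'W.
Qed.

Fact flag_open_bigU (I : Type) (f : I -> set flag) :
  (forall i, flag_open (f i)) -> flag_open (\bigcup_i f i).
Proof.
move=> of_ g [i _ fg]; have [q qg qf] := of_ i _ fg.
by exists q => // g' /qf ?; exists i.
Qed.

HB.instance Definition _ :=
  isOpenTopological.Build flag flag_openT flag_openI flag_open_bigU.

Variable lam : n.-tuple int.

(* Local sections of O(lam) over U.  An element of the fibre
     \bigotimes_i (V_{n+1-i} / V_{n-i})^{lam_i}
   at a flag V is a function s on the frames g of V (the invertible g such that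
   the first i columns span V_i), homogeneous of degree - lam_i in the
   nonzero vector of the line V_{n+1-i} / V_{n-i} given by the column number
   n+1-i of g.  Two frames of V differ by right multiplication by an upper
   triangular matrix b, which scales that vector by the corresponding diagonal
   entry of b. *)
Definition frame_char (b : 'M[k]_n) : k :=
  \prod_(i < n) b (rev_ord i) (rev_ord i) ^ (- tnth lam i).

Definition line_sec (U : set flag) (s : GL -> k^o) : Prop :=
  (forall g b : GL, U (frame_flag g) -> is_trig_mx b^T ->
     s (GLmul g b) = frame_char b * s g) /\
  (forall g : GL, U (frame_flag g) ->
     exists a q : mpoly (n * n) k, mxeval q g != 0 /\
       forall g' : GL, U (frame_flag g') -> mxeval q g' != 0 ->
         s g' = mxeval a g' / mxeval q g').

Fact line_sec0 U : line_sec U 0.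
Proof.
split=> [g b _ _ | g _]; first by rewrite mulr0.
exists 0, 1; split=> [|g' _ _]; first by rewrite mxeval1 oner_neq0.
by rewrite mxeval0 mul0r.
Qed.

Fact line_secP U (a : k) s t :
  line_sec U s -> line_sec U t -> line_sec U (a *: s + t).
Proof.
have astE g : (a *: s + t) g = a * s g + t g by [].
move=> [sB sreg] [tB treg]; split=> [g b Ug tb | g Ug].
  by rewrite !astE sB // tB // mulrDr mulrCA.
have [c [q [qg sE]]] := sreg _ Ug; have [c' [q' [q'g tE]]] := treg _ Ug.
exists (mpolyC _ a * c * q' + c' * q), (q * q').
split=> [|g' Ug']; rewrite ?(mxevalD, mxevalM, mxevalC) mulf_eq0 negb_or.
  by apply/andP.
case/andP=> qg' q'g'; rewrite astE sE // tE //.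
by rewrite mulrA addf_div // [X in _ = _ / X]mulrC.
Qed.

Fact line_sec_ext U s t :
  (forall g, U (frame_flag g) -> s g = t g) -> line_sec U s -> line_sec U t.
Proof.
move=> st [sB sreg]; split=> [g b Ug tb | g /sreg [a [q [qg sE]]]].
  by rewrite -!st ?frame_flagMr // sB.
by exists a, q; split=> // g' Ug' qg'; rewrite -st // sE.
Qed.

Fact line_sec_res U W s : W `<=` U -> line_sec U s -> line_sec W s.
Proof.
move=> WU [sB sreg]; split=> [g b /WU | g /WU /sreg [a [q [qg sE]]]].
  exact: sB.
by exists a, q; split=> // g' /WU; apply: sE.
Qed.

Fact line_sec_local U s : open U ->
  (forall V, U V -> exists2 W, open_nbhs V W & line_sec W s) -> line_sec U s.
Proof.
move=> _ sloc; split=> [g b Ug | g Ug].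
  by have [W [_ Wg] [sB _]] := sloc _ Ug; apply: sB.
have [W [oW Wg] [_ /(_ _ Wg) [a [q [qg sE]]]]] := sloc _ Ug.
have [q' q'g q'W] : exists2 q' : mpoly (n * n) k, mxeval q' g != 0
    & forall g' : GL, mxeval q' g' != 0 -> W (frame_flag g') by apply: oW.
exists (a * q'), (q * q'); split=> [|g' Ug'].
  by rewrite mxevalM mulf_eq0 negb_or; apply/andP.
rewrite !mxevalM mulf_eq0 negb_or => /andP[qg' q'g'].
by rewrite sE //; [rewrite invfM mulrACA divff // mulr1 | apply: q'W].
Qed.

Definition line_bundle : funsheaf k frame_flag :=
  FunSheaf line_sec0 line_secP line_sec_ext line_sec_res line_sec_local.

Lemma GLmulA (g h b : GL) : GLmul g (GLmul h b) = GLmul (GLmul g h) b.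
Proof. by apply: GL_inj; rewrite /= mulmxA. Qed.

Lemma mxeval_mull (h : GL) q :
  exists q', forall g : GL, mxeval q' g = mxeval q (GLmul h g).
Proof.
pose lq := [tuple \sum_l lin_mulmx (h : 'M_n) l m *: mpolyX k (mnm1 l)
           | m < n * n].
exists (comp_mpoly lq q) => g.
rewrite /mxeval comp_mpoly_meval; apply: meval_eq => m.
rewrite tnth_map tnth_ord_tuple /= -mul_vec_lin mxE raddf_sum /=.
by apply: eq_bigr => l _; rewrite mevalZ mevalXU mulrC.
Qed.

Fact GLflag_open (h : GL) U : open U -> open (GLflag h @^-1` U).
Proof.
move=> oU; suff: flag_open (GLflag h @^-1` U) by [].
move=> g Ug; have [|q qg qU] := oU (GLmul h g); first by rewrite frame_flagM.
have [q' q'E] := mxeval_mull h q.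
exists q' => [|g']; rewrite q'E // => /qU.
by rewrite frame_flagM.
Qed.

Fact line_sec_mull (h : GL) U s :
  line_sec U s -> line_sec (GLflag h @^-1` U) (s \o GLmul h).
Proof.
move=> [sB sreg]; split=> [g b Ug tb | g Ug] /=.
  by rewrite GLmulA sB // frame_flagM.
have [|a [q [qg sE]]] := sreg (GLmul h g); first by rewrite frame_flagM.
have [a' a'E] := mxeval_mull h a; have [q' q'E] := mxeval_mull h q.
exists a', q'; rewrite q'E; split=> // g' Ug'; rewrite a'E q'E => q'g'.
by rewrite sE // frame_flagM.
Qed.

Definition line_endo (h : GL) : sheaf_endo line_bundle :=
  @SheafEndo _ _ _ _ line_bundle _ _
    (frame_flagM h) (@GLflag_open h) (@line_sec_mull h).

Definition flag_cohomology (j : nat) : lmodType k := cohomology line_bundle j.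

(* h acts on O(lam) by (h . s)(g) = s(h^-1 g), covering V |-> h V on Fl_n. *)
Definition GLact (j : nat) (h : GL) (c : flag_cohomology j) :
    flag_cohomology j :=
  cohomology_pull (line_endo (GLinv h)) c.

End Flags.

Section PolynomialFunctors.
Variable k : fieldType.

Definition polynomial_map (V W : vectType k) (f : V -> W) : Prop :=
  exists q : 'I_(\dim {:W}) -> mpoly (\dim {:V}) k, forall v i,
    coord (vbasis {:W}) i (f v)
    = meval (fun l => coord (vbasis {:V}) l v) (q i).

(* For d < 0, [c ^ d] is the inverse of [c ^ (- d)] and [0 ^ d = 0]; over an
   infinite field [pf_scalar] and [pf_poly] then force the functor to be 0. *)
Record polyfunctor (d : int) := PolyFunctor {
  pf_obj :> vectType k -> vectType k;
  pf_map : forall V W : vectType k, 'Hom(V, W) -> 'Hom(pf_obj V, pf_obj W);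
  pf_id : forall V : vectType k, pf_map (\1 : 'End(V))%VF = \1%VF;
  pf_comp : forall (U V W : vectType k) (f : 'Hom(V, W)) (g : 'Hom(U, V)),
    pf_map (f \o g)%VF = (pf_map f \o pf_map g)%VF;
  pf_poly : forall V W : vectType k, polynomial_map (@pf_map V W);
  pf_scalar : forall (V : vectType k) (c : k),
    pf_map (c *: (\1 : 'End(V))%VF) = c ^ d *: \1%VF
}.

End PolynomialFunctors.

Definition weight_sum r (lam : r.-tuple int) : int := \sum_(i < r) tnth lam i.

(* lam^[n], for r <= n *)
Definition pad r (lam : r.-tuple int) n : n.-tuple int :=
  [tuple nth 0 lam i | i < n].

(* Main.v *)
(* A flag is given by linear forms, the rows of an invertible matrix M up to the
   group B of lower triangular matrices, so that a section of O(lam) is a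
   function of M, semi-invariant of weight lam under B.  Functions of M and of a
   sequence of unitriangular matrices, semi-invariant under B, form a
   bar resolution of O(lam) by sheaves that are acyclic for the Godement
   resolution (partitions of unity from the Nullstellensatz and from
   homogenisation under the torus).  Hence the cohomology of O(lam) is that of
   the complex of such functions on GL_n x U^(j+1).  When lam_i >= i - n, the
   subcomplex of the functions that are polynomial in M has the same cohomology:
   this is proved by induction on n, with the Cech complex of the chart where
   the entries of the first row of M do not vanish.  Its rows are exact since
   the Laurent monomials with only negative exponents are excluded by the weight
   lam_1 > -n, and in a column one entry of the first row may be used to
   eliminate (Shapiro's lemma for the reduction to n - 1).  Finally, for
   lam^[n] a limit along the torus shows that polynomial cochains only depend on
   the first r rows of M, that is, on a linear map from k^n to k^r, which makes
   sense with any space V instead of k^n and defines the polynomial functor. *)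
Require Import Defs.
From HB Require Import structures.
From mathcomp Require Import all_boot all_order all_algebra.
From mathcomp Require Import boolp classical_sets functions topology_structure.
From mathcomp Require Import -(notations) mpoly.
From mathcomp Require Import ring zify.
Set Implicit Arguments.
Unset Strict Implicit.
Unset Printing Implicit Defensive.
Import Order.TTheory GRing.Theory Num.Theory.
Local Open Scope ring_scope.

(** * Homogeneous bar complex *)

(** Torus weights can be extracted in every characteristic, as coefficients of a polynomial in c,
    but nothing averages over the unipotent group U; this forces the bar complex. A cochain with at
    least one point (M, u_1, ..., u_p) comes with the matrix u_1 M, on which B acts through its
    torus alone. A torus-invariant function of u_1 M may therefore multiply semi-invariant cochains.
    This makes the sheaves with p >= 1 acyclic, and the same device serves in both row computations
    of the Cech complex. The comparison of polynomial with regular cochains is stated as acyclicity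
    of the quotient regular/polynomial. Such quotients are not formed: a complex is a predicate on
    functions together with a second predicate for the cochains that count as zero. Isomorphisms
    between cohomologies are linear relations between cocycles, so that equivariance is checked by
    translating both sides of a relation. Finite dimension is not imported from geometry: it comes
    from the positivity of torus weights on polynomial cochains. *)

Section Alternating.

(** The alternating sum over the omission of one entry, with augmentation: [D f [:: x] = f [::]].
    Peeling the head makes the identities provable by induction, without pairing the terms of a
    double sum. *)
Fixpoint D (A : Type) (V : zmodType) (f : seq A -> V) (t : seq A) : V :=
  if t is x :: t' then f t' - D (fun u => f (x :: u)) t' else 0.

Lemma eq_D (A : Type) (V : zmodType) n (f g : seq A -> V) :
  (forall t, size t = n -> f t = g t) ->
  forall t, size t = n.+1 -> D f t = D g t.
Proof.
move=> fg t; elim: t n f g fg => [|x t IHt] n f g fg //= [st].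
rewrite fg //; congr (_ - _); case: n fg st => [|n] fg st.
  by rewrite (size0nil st).
by apply: (IHt n) => // u su; apply: fg; rewrite /= su.
Qed.

Lemma D_morph (A : Type) (V W : zmodType) (L : V -> W) (f : seq A -> V) t :
  (forall u v, L (u - v) = L u - L v) -> D (fun u => L (f u)) t = L (D f t).
Proof.
move=> LB; have L0 : L 0 = 0 by rewrite -(subrr 0) LB subrr.
by elim: t f => [|x t IHt] f //=; rewrite LB (IHt (fun u => f (x :: u))).
Qed.

Lemma D_map (A B : Type) (V : zmodType) (h : A -> B) (f : seq B -> V) t :
  D f (map h t) = D (fun u => f (map h u)) t.
Proof. by elim: t f => [|x t IHt] f //=; rewrite IHt. Qed.

Lemma DB (A : Type) (V : zmodType) (f g : seq A -> V) t :
  D (fun u => f u - g u) t = D f t - D g t.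
Proof.
elim: t f g => [|x t IHt] f g /=; first by rewrite subrr.
by rewrite IHt !opprD !opprK addrACA.
Qed.

Lemma D0 (A : Type) (V : zmodType) t : D (fun _ : seq A => 0 : V) t = 0.
Proof. by elim: t => [|x t IHt] //=; rewrite IHt subrr. Qed.

Lemma D_sum (A : Type) (V : zmodType) (I : Type) (r : seq I)
    (f : I -> seq A -> V) t :
  D (fun u => \sum_(i <- r) f i u) t = \sum_(i <- r) D (f i) t.
Proof.
elim: r => [|i r IHr].
  rewrite big_nil -[RHS](D0 V t); congr D; apply/funext => u; exact: big_nil.
rewrite big_cons -IHr; have -> : D (fun u => \sum_(j <- i :: r) f j u) t =
    D (fun u => f i u - (- \sum_(j <- r) f j u)) t.
  by congr D; apply/funext => u; rewrite big_cons opprK.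
rewrite DB; congr (_ + _).
by rewrite (D_morph (L := @GRing.opp V)) ?opprK // => u v; rewrite opprD.
Qed.

Lemma DD (A : Type) (V : zmodType) (f : seq A -> V) t : D (D f) t = 0.
Proof.
elim: t f => [|x t IHt] f //=.
by rewrite (DB f) (IHt (fun u => f (x :: u))) subr0 subrr.
Qed.

(** [Q] depends on the sequence because a Cech cochain at t lives on the intersection indexed by t;
    the insertion hypothesis is restriction to a smaller intersection. *)
Lemma D_closed (A : Type) (V : zmodType) (Q : seq A -> V -> Prop) n f :
  (forall t u v, Q t u -> Q t v -> Q t (u - v)) ->
  (forall t1 i t2 v, Q (t1 ++ t2) v -> Q (t1 ++ i :: t2) v) ->
  (forall t, size t = n -> Q t (f t)) ->
  forall t, size t = n.+1 -> Q t (D f t).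
Proof.
move=> QB Qi Qf t; elim: t n Q f QB Qi Qf => [|x t IHt] n Q f QB Qi Qf //= [st].
have Qx : Q (x :: t) (f t) by apply: (Qi [::]); apply: Qf.
apply: (QB _ _ _ Qx); case: n Qf st => [|n] Qf st.
  by rewrite [X in D _ X](size0nil st) /= -(subrr (f t)); apply: QB.
apply: (IHt n (fun t v => Q (x :: t) v)) => //.
- by move=> t0 u v; apply: QB.
- by move=> t1 i t2 v; apply: (Qi (x :: t1)).
by move=> u su; apply: Qf; rewrite /= su.
Qed.

Lemma D_sumE (A : Type) (R : pzRingType) (f : seq A -> R) t :
  D f t = \sum_(i < size t) (-1) ^+ i * f (take i t ++ drop i.+1 t).
Proof.
elim: t f => [|x t IHt] f /=; first by rewrite big_ord0.
rewrite big_ord_recl expr0 mul1r drop0 IHt; congr (_ + _).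
rewrite -sumrN; apply: eq_bigr => i _ /=.
by rewrite exprS mulN1r mulNr.
Qed.

(** The classical prism operator, the alternating sum of f(x_0, ..., x_i, phi x_i, ..., phi x_p). *)
Fixpoint prism (A : Type) (V : zmodType) (phi : A -> A) (f : seq A -> V) t : V :=
  if t is x :: t' then
    f (x :: phi x :: map phi t') - prism phi (fun u => f (x :: u)) t'
  else 0.

Lemma prismB (A : Type) (V : zmodType) (phi : A -> A) (f g : seq A -> V) t :
  prism phi (fun u => f u - g u) t = prism phi f t - prism phi g t.
Proof.
elim: t f g => [|x t IHt] f g /=; first by rewrite subrr.
by rewrite IHt !opprD !opprK addrACA.
Qed.

Lemma prism_homotopy (A : Type) (V : comPzRingType) (phi : A -> A)
    (f : seq A -> V) t :
  D (prism phi f) t + prism phi (D f) t = f (map phi t) - f t.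
Proof.
elim: t f => [|x t IHt] f /=; first by rewrite add0r subrr.
rewrite (DB (fun u => f (x :: phi x :: map phi u))).
rewrite (prismB phi f (D (fun u => f (x :: u)))).
have := IHt (fun u => f (x :: u)); rewrite !D_map.
set a := D _ t; set b := prism _ _ t; set c := D _ t => abE.
have -> : a = f (x :: map phi t) - f (x :: t) - b by rewrite -abE addrK.
ring.
Qed.

Lemma prism_sumE (A : Type) (R : pzRingType) (phi : A -> A) (f : seq A -> R) t :
  prism phi f t =
  \sum_(i < size t) (-1) ^+ i * f (take i.+1 t ++ map phi (drop i t)).
Proof.
elim: t f => [|x t IHt] f /=; first by rewrite big_ord0.
rewrite big_ord_recl expr0 mul1r take0 IHt; congr (_ + _).
rewrite -sumrN; apply: eq_bigr => i _ /=.
by rewrite exprS mulN1r mulNr.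
Qed.

End Alternating.

(** * Double complexes *)

Section DoubleComplex.
Variables (k : fieldType) (V : lmodType k) (d e : V -> V).
Variables (S N : nat -> nat -> V -> Prop).

(** One ambient module carries all bidegrees. [S p m] are the cochains and [N p m] those that count
    as zero, so the double complex meant is S/N. *)
Record dcx : Prop := Dcx {
  dcx_dP : forall a u v, d (a *: u + v) = a *: d u + d v;
  dcx_eP : forall a u v, e (a *: u + v) = a *: e u + e v;
  dcx_dd : forall u, d (d u) = 0;
  dcx_ee : forall u, e (e u) = 0;
  dcx_de : forall u, d (e u) = e (d u);
  dcx_SP : forall p m a u v, S p m u -> S p m v -> S p m (a *: u + v);
  dcx_NP : forall p m a u v, N p m u -> N p m v -> N p m (a *: u + v);
  dcx_N0 : forall p m, N p m 0;
  dcx_NS : forall p m u, N p m u -> S p m u;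
  dcx_dS : forall p m u, S p m u -> S p.+1 m (d u);
  dcx_eS : forall p m u, S p m u -> S p m.+1 (e u);
  dcx_dN : forall p m u, N p m u -> N p.+1 m (d u);
  dcx_eN : forall p m u, N p m u -> N p m.+1 (e u)
}.
Hypothesis H : dcx.
Let dP := dcx_dP H. Let eP := dcx_eP H. Let dd := dcx_dd H.
Let ee := dcx_ee H. Let de := dcx_de H. Let SP := dcx_SP H.
Let NP := dcx_NP H. Let N0 := dcx_N0 H. Let NS := dcx_NS H.
Let dS := dcx_dS H. Let eS := dcx_eS H. Let dN := dcx_dN H.
Let eN := dcx_eN H.

Definition rowex p m := forall z, S p m z -> N p.+1 m (d z) ->
  if p is q.+1 then exists2 y, S q m y & N q.+1 m (z - d y) else N 0 m z.
Definition colex p m := forall z, S p m z -> N p m.+1 (e z) ->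
  if m is q.+1 then exists2 y, S p q y & N p q.+1 (z - e y) else N p 0 z.
Definition zrowex m := forall p z,
  S p m z -> N p m.+1 (e z) -> N p.+1 m (d z) ->
  if p is q.+1 then exists2 y, S q m y & N q m.+1 (e y) /\ N q.+1 m (z - d y)
  else N 0 m z.

Let dB u v : d (u - v) = d u - d v.
Proof. by rewrite -scaleN1r addrC dP addrC scaleN1r. Qed.
Let eB u v : e (u - v) = e u - e v.
Proof. by rewrite -scaleN1r addrC eP addrC scaleN1r. Qed.
Let d0 : d 0 = 0. Proof. by have := dB 0 0; rewrite !subrr. Qed.
Let e0 : e 0 = 0. Proof. by have := eB 0 0; rewrite !subrr. Qed.
Let ND p m u v : N p m u -> N p m v -> N p m (u + v).
Proof. by move=> ? ?; rewrite -[u]scale1r; apply: NP. Qed.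
Let NB p m u v : N p m u -> N p m v -> N p m (u - v).
Proof. by move=> ? ?; rewrite -scaleN1r addrC; apply: NP. Qed.
Let SB p m u v : S p m u -> S p m v -> S p m (u - v).
Proof. by move=> ? ?; rewrite -scaleN1r addrC; apply: SP. Qed.
Let NE p m u v : N p m (u - v) -> N p m v -> N p m u.
Proof. by move=> nuv nv; rewrite -(subrK v u); apply: ND. Qed.
Let NE' p m u v : N p m (u - v) -> N p m u -> N p m v.
Proof.
by move=> nuv nu; rewrite -(subKr u v); apply: NB nu nuv.
Qed.
Let S0 p m : S p m 0. Proof. exact/NS/N0. Qed.

Lemma zrowex0 :
  (forall p, rowex p 0) -> (forall p, colex p.+1 0) -> zrowex 0.
Proof.
move=> rex cex [|p] z Sz Nez Ndz; first exact: (rex 0).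
exists 0 => //; by rewrite e0 d0 subr0; split=> //; apply: cex Nez.
Qed.

(** Write z = e a. Then d a is a cocycle for both differentials one row lower; induction corrects a
    by an [e]-cocycle into some d a2, and e a2 is the primitive of z. *)
Lemma zrowexS m : (forall p, rowex p m) -> (forall p, rowex p m.+1) ->
  (forall p, colex p.+1 m.+1) -> zrowex m -> zrowex m.+1.
Proof.
move=> rex rex1 cex zex [|p] z Sz Nez Ndz; first exact: (rex1 0).
have [a Sa Nza] := cex p z Sz Nez.
have Nda : N p.+2 m.+1 (e (d a)).
  by rewrite -de; apply: NE' Ndz; rewrite -dB; apply: dN.
have [z' Sz' [Nez' Nz']] := zex p.+2 (d a) (dS Sa) Nda ltac:(by rewrite dd).
have [a2 Sa2 Na2] := rex p.+1 (a - z') (SB Sa Sz') ltac:(by rewrite dB).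
exists (e a2); first exact: eS.
split; first by rewrite ee.
have -> : z - d (e a2) = z - e a + e (a - z' - d a2) + e z'.
  by rewrite !eB de !addrA subrK addrAC subrK.
by apply: ND => //; apply: ND => //; apply: eN.
Qed.

Lemma zrowexP M : (forall p m, (m <= M)%N -> rowex p m) ->
  (forall p m, (m <= M)%N -> colex p.+1 m) -> forall m, (m <= M)%N -> zrowex m.
Proof.
move=> rex cex; elim=> [|m IHm] mM.
  by apply: zrowex0 => p; [apply: rex | apply: cex].
apply: zrowexS; try by move=> p; (apply: rex || apply: cex); rewrite // ltnW.
by apply: IHm; apply: ltnW.
Qed.

(** The same chase in column 0, whose exactness is the goal: it suffices that d z is an
    [e]-coboundary in column 1. The other columns enter through [zrowex m] only, which allows an
    induction on m. *)
Lemma first_column_transfer m z a :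
  rowex 0 m.+1 -> rowex 1 m -> zrowex m ->
  S 0 m.+1 z -> S 1 m a -> N 1 m.+1 (d z - e a) ->
  exists2 y, S 0 m y & N 0 m.+1 (z - e y).
Proof.
move=> rex1 rex zex Sz Sa Nza.
have Nda : N 2 m.+1 (e (d a)).
  by rewrite -de; apply: NE' (N0 _ _); have := dN Nza; rewrite dB dd.
have [z' Sz' [Nez' Nz']] := zex 2 (d a) (dS Sa) Nda ltac:(by rewrite dd).
have [a2 Sa2 Na2] := rex (a - z') (SB Sa Sz') ltac:(by rewrite dB).
exists a2 => //; apply: rex1; first exact: SB (eS _).
have -> : d (z - e a2) = d z - e a + e (a - z' - d a2) + e z'.
  by rewrite !eB dB de !addrA subrK addrAC subrK.
by apply: ND => //; apply: ND => //; apply: eN.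
Qed.

Lemma first_column_exact : (forall p m, rowex p m) ->
  (forall p m, colex p.+1 m) -> forall m, colex 0 m.
Proof.
move=> rex cex [|m] z Sz Nez.
  apply: (rex 0) => //; apply: (cex 0 0); first exact: dS.
  by rewrite -de; apply: dN.
have [|a Sa Na] := cex 0 m.+1 (d z) (dS Sz); first by rewrite -de; apply: dN.
apply: first_column_transfer Sz Sa Na => //.
by apply: (zrowexP (M := m)).
Qed.

(** The zigzag d z = e y_1, d y_1 = e y_2, ..., d y_i = e b from column p to row 0. When the rows m
    >= 1 and the columns p >= 1 are exact, it relates the cohomology of column 0 to that of row 0.
    It is a relation since the y's are not chosen; p varies for the induction. *)
Fixpoint zig i p z b := if i is j.+1
  then exists2 y, S p.+1 i y & N p.+1 i.+1 (d z - e y) /\ zig j p.+1 y b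
  else N p.+1 1 (d z - e b).

Lemma zigP i p a z b z' b' :
  zig i p z b -> zig i p z' b' -> zig i p (a *: z + z') (a *: b + b').
Proof.
elim: i p z z' => [|i IHi] p z z' /=.
  move=> zb zb'; rewrite dP eP opprD addrACA -scalerBr; exact: NP.
move=> [y Sy [Ny yb]] [y' Sy' [Ny' yb']].
exists (a *: y + y'); first exact: SP.
split; last exact: IHi.
by rewrite dP eP opprD addrACA -scalerBr; exact: NP.
Qed.

Hypothesis rex : forall p m, rowex p m.+1.
Hypothesis cex : forall p m, colex p.+1 m.

Lemma zig_total i p z : S p i.+1 z -> N p.+1 i.+2 (d (e z)) ->
  exists2 b, S (p + i).+1 0 b & N (p + i).+2 0 (d b) /\ zig i p z b.
Proof.
elim: i p z => [|i IHi] p z Sz Nz.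
  rewrite de in Nz; have [b Sb Nb] := cex (dS Sz) Nz.
  rewrite addn0; exists b => //; split => //; apply: (cex (m := 0) (dS Sb)).
  by rewrite -de; apply: NE' (N0 _ _); have := dN Nb; rewrite dB dd.
rewrite de in Nz; have [y Sy Ny] := cex (dS Sz) Nz.
have Ndey : N p.+2 i.+2 (d (e y)).
  by apply: NE' (N0 _ _); have := dN Ny; rewrite dB dd.
by have [b] := IHi p.+1 y Sy Ndey; rewrite addSnnS => Sb [Nb yb]; exists b => //; split=> //; exists y.
Qed.

Lemma zig_surj i p b : S (p + i).+1 0 b -> N (p + i).+2 0 (d b) ->
  exists2 z, S p i.+1 z & N p.+1 i.+2 (d (e z)) /\ zig i p z b.
Proof.
elim: i p b => [|i IHi] p b.
  rewrite addn0 => Sb Nb; have [||z Sz Nz] := rex (p := p.+1) (m := 0) (z := e b).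
  - exact: eS.
  - by rewrite de; apply: eN.
  exists z => //; split; last first.
    by rewrite /= -[X in N _ _ X]opprB -sub0r; apply: NB.
  by rewrite de; apply: NE' (N0 _ _); have := eN Nz; rewrite eB ee.
rewrite -addSnnS => Sb Nb; have [y Sy [Ny yb]] := IHi _ _ Sb Nb.
have [||z Sz Nz] := rex (p := p.+1) (m := i.+1) (z := e y) => //.
  exact: eS.
exists z => //; split.
  by rewrite de; apply: NE' (N0 _ _); have := eN Nz; rewrite eB ee.
by exists y => //; split=> //; rewrite -[X in N _ _ X]opprB -sub0r; apply: NB.
Qed.

(** When p + i = 0, y would lie in bidegree (0, 0), the augmentation term, which must not produce
    boundaries; hence it is then required to vanish. *)
Definition zbound p i z := exists y x,
  [/\ S p i y, if p is q.+1 then S q i.+1 x else x = 0,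
      (p + i == 0)%N -> y = 0 & N p i.+1 (z - e y - d x)].
Definition bbound p i b :=
  if (p + i)%N is q.+1 then exists2 x, S q.+1 0 x & N q.+2 0 (b - d x)
  else N 1 0 b.

Lemma zig_inj1 i p z b : S p i.+1 z -> S (p + i).+1 0 b ->
  zig i p z b -> zbound p i z -> bbound p i b.
Proof.
elim: i p z b => [|i IHi] p z b Sz; rewrite ?addn0 => Sb /=.
  move=> Nzb [y [x [Sy Sx y0 Nz]]].
  have Nb : N p.+1 0 (b - d y).
    apply: (cex (m := 0)); first exact: SB (dS _).
    have -> : e (b - d y) = d (z - e y - d x) - (d z - e b).
      by rewrite !dB dd subr0 eB de [RHS]addrC opprB addrA subrK.
    exact: NB (dN Nz) _.
  rewrite /bbound addn0; case: p Sz Sb Sx Sy y0 Nz Nb {Nzb} => [|p] Sz Sb Sx Sy y0 Nz Nb.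
    by rewrite y0 // d0 subr0 in Nb.
  by exists y.
move=> [y Sy [Nzy yb]] [y' [x [Sy' Sx y0 Nz]]].
have Ny : N p.+1 i.+2 (e (y - d y')).
  have -> : e (y - d y') = d (z - e y' - d x) - (d z - e y).
    by rewrite !dB dd subr0 eB de [RHS]addrC opprB addrA subrK.
  exact: NB (dN Nz) _.
have [y2 Sy2 Ny2] := cex (SB Sy (dS Sy')) Ny.
rewrite -addSnnS in Sb.
have : bbound p.+1 i b.
  apply: (IHi _ y) => //; exists y2, y'; split=> //.
  by rewrite addrAC.
by rewrite /bbound -addSnnS.
Qed.

Lemma zig_inj2 i p z b : S p i.+1 z -> S (p + i).+1 0 b ->
  zig i p z b -> bbound p i b -> zbound p i z.
Proof.
elim: i p z b => [|i IHi] p z b Sz; rewrite ?addn0 => Sb /=.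
  move=> Nzb; rewrite /bbound addn0; case: p Sz Sb Nzb => [|p] Sz Sb Nzb.
    move=> Nb; exists 0, 0; split=> //; rewrite d0 e0 !subr0.
    by apply: (rex (p := 0) Sz); apply: NE Nzb _; apply: eN.
  move=> [x Sx Nx]; have := rex (SB Sz (eS Sx)).
  have Nd : N p.+2 1 (d (z - e x)).
    have -> : d (z - e x) = (d z - e b) + e (b - d x).
      by rewrite dB eB de !addrA subrK.
    by apply: ND => //; apply: eN.
  by move=> /(_ Nd) [x' Sx' Nx']; exists x, x'; split.
move=> [y Sy [Nzy yb]] bb; rewrite -addSnnS in Sb.
have [|y' [x' [Sy' Sx' _ Ny]]] := IHi _ _ _ Sy Sb yb; first by rewrite /bbound addSnnS.
have Nd : N p.+1 i.+2 (d (z - e x')).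
  have -> : d (z - e x') = (d z - e y) + e (y - e y' - d x').
    by rewrite !eB dB ee subr0 de !addrA subrK.
  by apply: ND => //; apply: eN.
have := rex (SB Sz (eS Sx')) Nd.
case: p Sz Sb Sy Sx' Sy' Nzy Ny Nd yb bb => [|p] Sz Sb Sy Sx' Sy' Nzy Ny Nd yb bb.
  by move=> Nz; exists x', 0; split=> //; rewrite d0 subr0.
by move=> [x2 Sx2 Nx2]; exists x', x2; split.
Qed.

End DoubleComplex.

Lemma DP (k : fieldType) (A : Type) (V : lmodType k) a (f g : seq A -> V) t :
  D (a *: f + g) t = a *: D f t + D g t.
Proof.
elim: t f g => [|x t IHt] f g /=; first by rewrite scaler0 add0r.
by rewrite (IHt (fun u => f (x :: u))) scalerBr opprD addrACA.
Qed.

Lemma dcx_cech (k : fieldType) (A : Type) (V : lmodType k) (e : V -> V)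
    (S N : seq A -> nat -> V -> Prop) :
  (forall a u v, e (a *: u + v) = a *: e u + e v) -> (forall u, e (e u) = 0) ->
  (forall t m a u v, S t m u -> S t m v -> S t m (a *: u + v)) ->
  (forall t m a u v, N t m u -> N t m v -> N t m (a *: u + v)) ->
  (forall t m, N t m 0) -> (forall t m u, N t m u -> S t m u) ->
  (forall t1 i t2 m u, S (t1 ++ t2) m u -> S (t1 ++ i :: t2) m u) ->
  (forall t1 i t2 m u, N (t1 ++ t2) m u -> N (t1 ++ i :: t2) m u) ->
  (forall t m u, S t m u -> S t m.+1 (e u)) ->
  (forall t m u, N t m u -> N t m.+1 (e u)) ->
  dcx (V := seq A -> V) (@D A V) (fun c t => e (c t))
    (fun p m c => forall t, size t = p -> S t m (c t))
    (fun p m c => forall t, size t = p -> N t m (c t)).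
Proof.
move=> eP ee SP NP N0 NS Si Ni eS eN.
have eB u v : e (u - v) = e u - e v by rewrite -scaleN1r addrC eP addrC scaleN1r.
have SB t m u v : S t m u -> S t m v -> S t m (u - v).
  by move=> ? ?; rewrite -scaleN1r addrC; apply: SP.
have NB t m u v : N t m u -> N t m v -> N t m (u - v).
  by move=> ? ?; rewrite -scaleN1r addrC; apply: NP.
split.
- by move=> a u v; apply/funext => t; exact: (DP a u v t).
- by move=> a u v; apply/funext => t; exact: eP.
- by move=> u; apply/funext => t; exact: (DD u t).
- by move=> u; apply/funext => t; exact: ee.
- by move=> u; apply/funext => t; exact: (D_morph u t eB).
- by move=> p m a u v Su Sv t st; apply: SP; [apply: Su | apply: Sv].
- by move=> p m a u v Su Sv t st; apply: NP; [apply: Su | apply: Sv].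
- by move=> q m t _; apply: N0.
- by move=> p m u Nu t st; apply/NS/Nu.
- move=> q m u Su; apply: (D_closed (Q := fun t v => S t m v)) => //.
    by move=> t v w; apply: SB.
  by move=> t1 i t2 v; apply: Si.
- by move=> p m u Su t st; apply/eS/Su.
- move=> q m u Su; apply: (D_closed (Q := fun t v => N t m v)) => //.
    by move=> t v w; apply: NB.
  by move=> t1 i t2 v; apply: Ni.
- by move=> p m u Su t st; apply/eN/Su.
Qed.

(** * Godement cochains *)

Section Localization.
Local Open Scope classical_set_scope.
Variable X : topologicalType.

(* Godement cochains with values in T, with m points, over U: the value at
   (x_1, ..., x_m) is a section over a neighbourhood of x_m, for x_1 in U,
   x_2 near x_1, etc. *)
Fixpoint loc (T : Type) (Q : set X -> T -> Prop) m (U : set X) (s : seq X -> T)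
    : Prop :=
  if m is m'.+1 then
    forall x, U x -> exists2 W, open_nbhs x W & loc Q m' W (fun t => s (x :: t))
  else Q U (s [::]).

Definition restrictive T (Q : set X -> T -> Prop) :=
  forall U W v, W `<=` U -> Q U v -> Q W v.

Lemma loc_res T (Q : set X -> T -> Prop) m U W s :
  restrictive Q -> W `<=` U -> loc Q m U s -> loc Q m W s.
Proof. by move=> Qr WU; case: m => [|m] /=; [apply: Qr | move=> Us x /WU /Us]. Qed.

Lemma eq_loc T (Q : set X -> T -> Prop) m U s s' :
  (forall t, size t = m -> s t = s' t) -> loc Q m U s -> loc Q m U s'.
Proof.
elim: m U s s' => [|m IHm] U s s' ss' /=; first by rewrite ss'.
move=> Us x /Us [W xW Ws]; exists W => //; apply: IHm Ws => t st.
by apply: ss'; rewrite /= st.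
Qed.

Lemma loc_map T T' (Q : set X -> T -> Prop) (Q' : set X -> T' -> Prop) h m U s :
  (forall U v, Q U v -> Q' U (h v)) -> loc Q m U s ->
  loc Q' m U (fun t => h (s t)).
Proof.
move=> QQ'; elim: m U s => [|m IHm] U s /=; first exact: QQ'.
by move=> Us x /Us [W xW Ws]; exists W => //; apply: IHm.
Qed.

Lemma loc_map2 T T' T2 (Q : set X -> T -> Prop) (Q' : set X -> T' -> Prop)
    (Q2 : set X -> T2 -> Prop) h m U s s' :
  restrictive Q -> restrictive Q' ->
  (forall U v v', Q U v -> Q' U v' -> Q2 U (h v v')) ->
  loc Q m U s -> loc Q' m U s' -> loc Q2 m U (fun t => h (s t) (s' t)).
Proof.
move=> Qr Q'r QQ'; elim: m U s s' => [|m IHm] U s s' /=; first exact: QQ'.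
move=> Us Us' x Ux; have [W xW Ws] := Us x Ux; have [W' xW' Ws'] := Us' x Ux.
exists (W `&` W'); first exact: open_nbhsI.
by apply: IHm; [apply: loc_res Ws | apply: loc_res Ws'] => // y [].
Qed.

(** Local solvability lifts to Godement cochains without gluing, because values at different chains
    of points are independent of each other. *)
Lemma loc_choice T T' (Q : set X -> T -> Prop) (R : set X -> T * T' -> Prop)
    (v0 : T') m U s :
  (forall U v x, open U -> U x -> Q U v -> 
     exists2 W, open_nbhs x W & exists v', R W (v, v')) ->
  loc Q m.+1 U s -> exists s' : seq X -> T', loc R m.+1 U (fun t => (s t, s' t)).
Proof.
move=> QR; elim: m U s => [|m IHm] U s Us.
  have pick x : exists v, U x ->
      exists2 W, open_nbhs x W & R W (s [:: x], v).
    case: (pselect (U x)) => [Ux|nU]; last by exists v0.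
    have [W [oW Wx] Ws] := Us x Ux.
    by have [W' xW' [v Rv]] := QR W _ x oW Wx Ws; exists v => _; exists W'.
  have [r rP] := choice pick.
  exists (fun t => if t is x :: _ then r x else v0) => x Ux.
  exact: rP.
have pick x : exists r, U x ->
    exists2 W, open_nbhs x W & loc R m.+1 W (fun t => (s (x :: t), r t)).
  case: (pselect (U x)) => [Ux|nU]; last by exists (fun=> v0).
  have [W xW Ws] := Us x Ux; have [r rP] := IHm W (fun t => s (x :: t)) Ws.
  by exists r => _; exists W.
have [r rP] := choice pick.
exists (fun t => if t is x :: t' then r x t' else v0) => x Ux.
exact: rP.
Qed.

End Localization.

Section Godement.
Local Open Scope classical_set_scope.
Variables (k : fieldType) (X : topologicalType) (E : Type) (p : E -> X).
Notation V := (E -> k^o).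

Definition vanishes (U : set X) (s : V) := forall e, U (p e) -> s e = 0.

Lemma vanishes_res : restrictive vanishes.
Proof. by move=> U W s WU Us e /WU /Us. Qed.

Lemma vanishesP U (a : k) s t :
  vanishes U s -> vanishes U t -> vanishes U (a *: s + t).
Proof.
move=> s0 t0 e Ue; have -> : (a *: s + t) e = a * s e + t e by [].
by rewrite s0 // t0 // mulr0 addr0.
Qed.

Lemma loc0 (Q : set X -> V -> Prop) m U :
  (forall W, Q W 0) -> loc Q m U (0 : seq X -> V).
Proof.
move=> Q0; elim: m U => [|m IHm] U //= x Ux.
by exists setT => //; split=> //; apply: openT.
Qed.

Lemma loc_lin (Q : set X -> V -> Prop) m U a (s t : seq X -> V) :
  restrictive Q -> (forall W b u v, Q W u -> Q W v -> Q W (b *: u + v)) ->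
  loc Q m U s -> loc Q m U t -> loc Q m U (a *: s + t).
Proof.
move=> Qr QP; apply: (loc_map2 (h := fun u v => a *: u + v)) => // W u v.
exact: QP.
Qed.

Lemma loc_sub (Q : set X -> V -> Prop) m U (s t : seq X -> V) :
  restrictive Q -> (forall W b u v, Q W u -> Q W v -> Q W (b *: u + v)) ->
  loc Q m U s -> loc Q m U t -> loc Q m U (s - t).
Proof.
move=> Qr QP Qs Qt; have -> : s - t = -1 *: t + s by rewrite scaleN1r addrC.
exact: loc_lin.
Qed.

Lemma loc_D (Q : set X -> V -> Prop) m U (s : seq X -> V) :
  restrictive Q -> (forall W b u v, Q W u -> Q W v -> Q W (b *: u + v)) ->
  open U -> loc Q m U s -> loc Q m.+1 U (D s).
Proof.
move=> Qr QP; elim: m U s => [|m IHm] U s oU Us x Ux.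
  by exists U => //=; rewrite subr0.
have [W [oW Wx] Ws] := Us x Ux.
exists (U `&` W); first exact: open_nbhsI.
suff: loc Q m.+1 (U `&` W) (s - D (fun t => s (x :: t))) by [].
apply: loc_sub => //.
  by apply: loc_res Us => // y [].
apply: (IHm _ (fun t => s (x :: t))); first exact: openI.
by apply: loc_res Ws => // y [].
Qed.

Definition covered I (U : set X) (W : I -> set X) (t : seq I) : set X :=
  [set x | U x /\ foldr (fun i P => W i x /\ P) True t].

Lemma covered_cons I U (W : I -> set X) i t :
  covered U W (i :: t) = covered (U `&` W i) W t.
Proof. by apply/predeqP => x; rewrite /covered /=; split=> [[? []]|[[? ?] ?]]. Qed.

Lemma covered_insert I U (W : I -> set X) t1 i t2 :
  covered U W (t1 ++ i :: t2) `<=` covered U W (t1 ++ t2).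
Proof.
elim: t1 U => [|j t1 IH] U /=; last by rewrite !covered_cons.
by rewrite covered_cons => x [[? ?] ?].
Qed.

Variable sec : set X -> V -> Prop.
Hypothesis sec_res : restrictive sec.
Hypothesis secP : forall U a u v, sec U u -> sec U v -> sec U (a *: u + v).
Hypothesis sec_van : forall U u, vanishes U u -> sec U u.

Definition cech_exact (U : set X) I (W : I -> set X) := forall q c,
  (forall t, size t = q -> sec (covered U W t) (c t)) ->
  (forall t, size t = q.+1 -> vanishes (covered U W t) (D c t)) ->
  if q is r.+1 then exists2 y : seq I -> V,
    forall t, size t = r -> sec (covered U W t) (y t)
    & forall t, size t = r.+1 -> vanishes (covered U W t) (c t - D y t)
  else vanishes U (c [::]).

Definition godement_exact U m := forall s, loc sec m U s ->
  loc vanishes m.+1 U (D s) ->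
  if m is q.+1 then exists2 y, loc sec q U y & loc vanishes q.+1 U (s - D y)
  else vanishes U (s [::]).

Variable Bas : set X -> Prop.
Hypothesis bas_open : forall U, Bas U -> open U.
Hypothesis basI : forall U W, Bas U -> Bas W -> Bas (U `&` W).
Hypothesis bas_nbhs : forall (U : set X) x, open U -> U x ->
  exists2 W, Bas W & W x /\ W `<=` U.
Hypothesis bas_compact : forall U (W : X -> set X), Bas U ->
  (forall x, U x -> Bas (W x) /\ W x x) ->
  exists n (x : 'I_n -> X),
    (forall i, U (x i)) /\ forall y, U y -> exists i, W (x i) y.
Hypothesis bas_cech : forall U n (W : 'I_n -> set X), Bas U ->
  (forall i, Bas (W i) /\ W i `<=` U) ->
  (forall y, U y -> exists i, W i y) -> cech_exact U W.

Section Cover.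
Variables (U : set X) (n : nat) (W : 'I_n -> set X).
Hypothesis bU : Bas U.
Hypothesis bW : forall i, Bas (W i) /\ W i `<=` U.
Hypothesis cW : forall y, U y -> exists i, W i y.

Lemma bas_covered t : Bas (covered U W t).
Proof.
elim: t U bU => [|i t IHt] U' bU'.
  by have -> : covered U' W [::] = U' by apply/predeqP => x; split=> [[]|].
by rewrite covered_cons; apply/IHt/basI => //; case: (bW i).
Qed.

Let S q m (c : seq 'I_n -> seq X -> V) :=
  forall t, size t = q -> loc sec m (covered U W t) (c t).
Let N q m (c : seq 'I_n -> seq X -> V) :=
  forall t, size t = q -> loc vanishes m (covered U W t) (c t).
Let V' : lmodType k := seq 'I_n -> seq X -> V.
Let d (c : V') : V' := D c.
Let e (c : V') : V' := fun t => D (c t).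

Lemma dcx_cover : dcx d e S N.
Proof.
pose S1 (t : seq 'I_n) m (s : seq X -> V) := loc sec m (covered U W t) s.
pose N1 (t : seq 'I_n) m (s : seq X -> V) := loc vanishes m (covered U W t) s.
apply: (@dcx_cech _ _ _ (@D X V) S1 N1).
- by move=> a u v; apply/funext => t; exact: (DP a u v t).
- by move=> u; apply/funext => t; exact: DD.
- by move=> t m a u v; apply: loc_lin.
- by move=> t m a u v; apply: loc_lin => //; [exact: vanishes_res | exact: vanishesP].
- by move=> t m; apply: loc0.
- move=> t m u; apply: (loc_map (h := id)) => W' v; exact: sec_van.
- by move=> t1 i t2 m u; apply: loc_res => //; apply: covered_insert.
- by move=> t1 i t2 m u; apply: loc_res; [exact: vanishes_res | apply: covered_insert].
- by move=> t m u; apply: loc_D => //; apply/bas_open/bas_covered.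
move=> t m u; apply: loc_D; [exact: vanishes_res | exact: vanishesP |].
exact/bas_open/bas_covered.
Qed.

Lemma covered_nil : covered U W [::] = U.
Proof. by apply/predeqP => x; split=> [[]|]. Qed.

(** For m = 0 this is the Cech hypothesis. For m > 0 the row contracts: a cochain is evaluated near
    its first point x, so prepending an index [a x] whose open set contains x is a homotopy. *)
Lemma cover_rowex q m : rowex d S N q m.
Proof.
case: m => [|m] z Sz Nz.
  have := @bas_cech U n W bU bW cW q (fun t => z t [::]).
  have Nz' t : size t = q.+1 -> vanishes (covered U W t) (D (fun u => z u [::]) t).
    move=> st; have := Nz t st; rewrite /d /=.
    by rewrite -(D_morph (L := fun s : seq X -> V => s [::])).
  move=> /(_ (fun t st => Sz t st) Nz').
  case: q Sz Nz {Nz'} => [|q] Sz Nz.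
    by move=> z0 t /size0nil ->; rewrite covered_nil.
  move=> [y Sy Ny]; exists (fun t _ => y t); first exact: Sy.
  move=> t st; have := Ny t st.
  rewrite /d /= -[(z - _) t [::]]/(z t [::] - D (fun (t : seq 'I_n) (_ : seq X) => y t) t [::]).
  by rewrite -[D (fun (t : seq 'I_n) (_ : seq X) => y t) t [::]](D_morph (L := fun s : seq X -> V => s [::])).
(* The choice function [a] needs an index also for the points outside [U]; a point of [U] provides
   one. *)
case: (pselect (exists y, U y)) => [[x0 Ux0]|nU]; last first.
  case: q Sz Nz => [|q] Sz Nz; first by move=> t _ x [Ux _]; case: nU; exists x.
  exists 0; first by move=> t _ x [Ux _]; case: nU; exists x.
  by move=> t _ x [Ux _]; case: nU; exists x.
have [i0 _] := cW Ux0.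
have pick x : exists i, U x -> W i x.
  case: (pselect (U x)) => [Ux|?]; last by exists i0.
  by have [i Wi] := cW Ux; exists i.
have [a aP] := choice pick.
have cov_a t x : covered U W t x -> covered U W (a x :: t) x.
  by case=> Ux tx; split=> //=; split=> //; apply: aP.
case: q Sz Nz => [|q] Sz Nz.
  move=> t /size0nil -> x Ux; have := Nz [:: a x] erefl x (cov_a _ _ Ux).
  by rewrite /d /= subr0.
exists (fun t' u => if u is x :: u' then z (a x :: t') u else 0).
  move=> t st x Ux.
  exact: (Sz (a x :: t) (congr1 succn st) x (cov_a _ _ Ux)).
move=> t st x Ux.
have [W' xW' Ws] := Nz (a x :: t) (congr1 succn st) x (cov_a _ _ Ux).
exists W' => //; congr (loc vanishes m W' _): Ws; apply/funext => u.
have L (c : seq 'I_n -> seq X -> V) t0 u0 : D c t0 u0 = D (fun t => c t u0) t0.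
  by rewrite -[LHS](D_morph (L := fun s : seq X -> V => s u0)).
rewrite /d.
have -> : D z (a x :: t) (x :: u) = z t (x :: u) - D (fun t => z (a x :: t)) t (x :: u).
  by [].
have -> : forall (y : seq 'I_n -> seq X -> V), (z - D y) t (x :: u) = z t (x :: u) - D y t (x :: u) by [].
by rewrite !L.
Qed.

End Cover.

(** Cartan's criterion. Near x a cocycle s is the coboundary of s(x, -), and by compactness finitely
    many x suffice. In the Cech double complex of the resulting cover the problem moves to column 1,
    with one point less, where the induction applies to the intersections. *)
Theorem cartan_acyclicity m U : Bas U -> godement_exact U m.
Proof.
elim/ltn_ind: m U => m IHm U bU s Us Ns.
case: m IHm Us Ns => [|m] IHm Us Ns.
  move=> e Ue; have [W [_ We] /(_ e We)] := Ns (p e) Ue.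
  by rewrite /= subr0.
have pick x : exists W : set X, U x -> [/\ Bas W, W x, W `<=` U,
    loc sec m W (fun t => s (x :: t)) &
    loc vanishes m.+1 W (s - D (fun t => s (x :: t)))].
  case: (pselect (U x)) => [Ux|?]; last by exists U.
  have [W [oW Wx] Ws] := Us x Ux; have [W' [oW' W'x] Ws'] := Ns x Ux.
  have [W2 bW2 [W2x W2U]] := bas_nbhs (openI (openI oW oW') (bas_open bU))
    (conj (conj Wx W'x) Ux).
  exists W2 => _; split=> //.
  - by move=> y /W2U [].
  - by apply: (@loc_res _ _ sec m W) Ws => // y /W2U [[]].
  by apply: (@loc_res _ _ vanishes m.+1 W') Ws'; [exact: vanishes_res | move=> y /W2U [[]]].
have [W0 W0P] := choice pick.
have [|n [x [Ux cx]]] := bas_compact (W := W0) bU.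
  by move=> x Ux; case: (W0P x Ux).
pose W i := W0 (x i).
have bW i : Bas (W i) /\ W i `<=` U by have [] := W0P _ (Ux i).
have H := dcx_cover bU bW.
have cex q l : (l <= m)%N -> colex (fun c : seq 'I_n -> seq X -> V => (fun t => D (c t)))
    (fun q m c => forall t, size t = q -> loc sec m (covered U W t) (c t))
    (fun q m c => forall t, size t = q -> loc vanishes m (covered U W t) (c t))
    q.+1 l.
  move=> lm z Sz Nz.
  have ex t : size t = q.+1 -> exists y, if l is r.+1 then
      loc sec r (covered U W t) y /\ loc vanishes r.+1 (covered U W t) (z t - D y)
      else loc vanishes 0 (covered U W t) (z t).
    move=> st; have := IHm l lm _ (bas_covered bU bW t) _ (Sz t st) (Nz t st).
    by case: (l) => [|r]; [exists 0 | move=> [y ? ?]; exists y].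
  case: l lm Sz Nz ex => [|l] lm Sz Nz ex; first by move=> t /ex[].
  have pick' t : exists y, size t = q.+1 -> loc sec l (covered U W t) y /\
      loc vanishes l.+1 (covered U W t) (z t - D y).
    case: (pselect (size t = q.+1)) => [/ex[y]|?]; last by exists 0.
    by exists y.
  have [y yP] := choice pick'.
  by exists y => t /yP[].
have rex := cover_rowex bU bW cx.
have zex := zrowexP H (fun q l _ => rex q l) cex (leqnn m).
pose z : seq 'I_n -> seq X -> V := fun=> s.
pose a : seq 'I_n -> seq X -> V :=
  fun t => if t is i :: _ then fun u => s (x i :: u) else 0.
have [] := first_column_transfer H (rex 0 m.+1) (rex 1 m) zex (z := z) (a := a).
- by move=> t /size0nil ->; rewrite covered_nil.
- move=> [|i []] // _; have [_ _ _ Ws _] := W0P _ (Ux i).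
  by apply: loc_res Ws => // y [_ []].
- move=> [|i []] // _; have [_ _ _ _ Ws] := W0P _ (Ux i).
  have -> : (D z - (fun t => D (a t))) [:: i] = s - D (fun u => s (x i :: u)).
    by rewrite -[LHS]/(s - 0 - _) subr0.
  by apply: loc_res Ws; [exact: vanishes_res | move=> y [_ []]].
move=> y Sy Ny; exists (y [::]).
  by have := Sy [::] erefl; rewrite covered_nil.
by have := Ny [::] erefl; rewrite covered_nil.
Qed.

End Godement.

(** * Polynomial functions *)

Section Polynomial.

(** A root of p X + 1 is nonzero and is not a root of p. *)
Lemma poly_eq0_nz (k : closedFieldType) (p : {poly k}) :
  (forall c, c != 0 -> p.[c] = 0) -> p = 0.
Proof.
move=> p0; apply/eqP; apply: contraT => pn0.
have [|c] := closed_rootP (p * 'X + 1) _.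
  by rewrite size_MXaddC (negPf pn0) /= eqSS size_poly_eq0.
rewrite /root !hornerE => /eqP pc.
have c0 : c != 0.
  by apply/eqP => c0; move: pc; rewrite c0 mulr0 add0r => /eqP; rewrite oner_eq0.
by move: pc; rewrite p0 // mul0r add0r => /eqP; rewrite oner_eq0.
Qed.

Lemma poly_eq0_open (k : closedFieldType) (p q : {poly k}) :
  q != 0 -> (forall c, q.[c] != 0 -> p.[c] = 0) -> p = 0.
Proof.
move=> q0 pq; have /eqP : p * q = 0.
  apply: poly_eq0_nz => c _; rewrite hornerM.
  by have [->|/pq ->] := eqVneq q.[c] 0; rewrite ?mulr0 ?mul0r.
by rewrite mulf_eq0 (negPf q0) orbF => /eqP.
Qed.

Lemma poly_inj (k : closedFieldType) (p q : {poly k}) :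
  (forall c, c != 0 -> p.[c] = q.[c]) -> p = q.
Proof.
move=> pq; apply/eqP; rewrite -subr_eq0; apply/eqP/poly_eq0_nz => c c0.
by rewrite hornerD hornerN pq // subrr.
Qed.

Section Pol.
Variable k : closedFieldType.

(** The algebra generated by the coordinate functions in [C]. Its elements are functions and not
    formal polynomials, so that semi-invariance is a pointwise identity and substitution is
    composition. *)
Inductive pol (X : Type) (C : (X -> k) -> Prop) : (X -> k) -> Prop :=
| pol_cst c : pol C (fun=> c)
| pol_gen f : C f -> pol C f
| polD f g : pol C f -> pol C g -> pol C (fun x => f x + g x)
| polM f g : pol C f -> pol C g -> pol C (fun x => f x * g x).

Lemma eq_pol X (C : (X -> k) -> Prop) f g : f =1 g -> pol C f -> pol C g.
Proof. by move=> /funext ->. Qed.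

Lemma polN X (C : (X -> k) -> Prop) f : pol C f -> pol C (fun x => - f x).
Proof.
by move/(polM (pol_cst C (-1))); apply: eq_pol => x; rewrite mulN1r.
Qed.

Lemma polB X (C : (X -> k) -> Prop) f g :
  pol C f -> pol C g -> pol C (fun x => f x - g x).
Proof. by move=> pf /polN; apply: polD. Qed.

Lemma pol_sum X (C : (X -> k) -> Prop) (I : Type) (r : seq I) (P : pred I) F :
  (forall i, P i -> pol C (F i)) -> pol C (fun x => \sum_(i <- r | P i) F i x).
Proof.
move=> pF; elim: r => [|i r IHr].
  by apply: eq_pol (pol_cst C 0) => x; rewrite big_nil.
have [Pi|Pi] := boolP (P i).
  by apply: eq_pol (polD (pF i Pi) IHr) => x; rewrite big_cons Pi.
by apply: eq_pol IHr => x; rewrite big_cons (negPf Pi).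
Qed.

Lemma pol_prod X (C : (X -> k) -> Prop) (I : Type) (r : seq I) (P : pred I) F :
  (forall i, P i -> pol C (F i)) -> pol C (fun x => \prod_(i <- r | P i) F i x).
Proof.
move=> pF; elim: r => [|i r IHr].
  by apply: eq_pol (pol_cst C 1) => x; rewrite big_nil.
have [Pi|Pi] := boolP (P i).
  by apply: eq_pol (polM (pF i Pi) IHr) => x; rewrite big_cons Pi.
by apply: eq_pol IHr => x; rewrite big_cons (negPf Pi).
Qed.

Lemma polX X (C : (X -> k) -> Prop) n f : pol C f -> pol C (fun x => f x ^+ n).
Proof.
move=> pf; elim: n => [|n IHn]; first exact: pol_cst.
by apply: eq_pol (polM pf IHn) => x; rewrite exprS.
Qed.

Lemma pol_det X (C : (X -> k) -> Prop) n (A : X -> 'M[k]_n) :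
  (forall i j, pol C (fun x => A x i j)) -> pol C (fun x => \det (A x)).
Proof.
move=> pA; rewrite /determinant; apply: pol_sum => s _.
by apply: polM; [apply: pol_cst | apply: pol_prod].
Qed.

Lemma pol_mulmx X (C : (X -> k) -> Prop) m n p (A : X -> 'M[k]_(m, n))
    (B : X -> 'M[k]_(n, p)) :
  (forall i j, pol C (fun x => A x i j)) ->
  (forall i j, pol C (fun x => B x i j)) ->
  forall i j, pol C (fun x => (A x *m B x) i j).
Proof.
move=> pA pB i j.
apply: (@eq_pol _ _ (fun x => \sum_l A x i l * B x l j)).
  by move=> x; rewrite mxE.
by apply: pol_sum => l _; apply: polM.
Qed.

Lemma pol_adj X (C : (X -> k) -> Prop) n (A : X -> 'M[k]_n) :
  (forall i j, pol C (fun x => A x i j)) ->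
  forall i j, pol C (fun x => (\adj (A x)) i j).
Proof.
move=> pA i j.
apply: (@eq_pol _ _ (fun x => cofactor (A x) j i)); first by move=> x; rewrite mxE.
apply: polM; first exact: pol_cst.
by apply: pol_det => a b; apply: eq_pol (pA (lift j a) (lift i b)) => x; rewrite !mxE.
Qed.

Lemma pol_subst X X' (C : (X -> k) -> Prop) (C' : (X' -> k) -> Prop) phi f :
  (forall g, C g -> pol C' (fun x => g (phi x))) ->
  pol C f -> pol C' (fun x => f (phi x)).
Proof.
move=> Cp; elim=> {f} [c|f /Cp //|f g _ pf _ pg|f g _ pf _ pg].
- exact: pol_cst.
- exact: polD.
exact: polM.
Qed.

Definition reg X (C : (X -> k) -> Prop) (dom : X -> Prop) (q f : X -> k) :=
  exists N a, pol C a /\ forall x, dom x -> q x != 0 -> f x = a x / q x ^+ N.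

Section Reg.
Variables (X : Type) (C : (X -> k) -> Prop) (dom : X -> Prop) (q : X -> k).
Hypothesis pq : pol C q.

Lemma eq_reg f g : (forall x, dom x -> q x != 0 -> f x = g x) ->
  reg C dom q f -> reg C dom q g.
Proof.
move=> fg [N [a [pa fE]]]; exists N, a; split=> // x dx qx.
by rewrite -fg // fE.
Qed.

Lemma reg_pol f : pol C f -> reg C dom q f.
Proof. by move=> pf; exists 0, f; split=> // x _ _; rewrite expr0 divr1. Qed.

Lemma reg_ge f N a N' : pol C a -> (N <= N')%N ->
  (forall x, dom x -> q x != 0 -> f x = a x / q x ^+ N) ->
  exists a', pol C a' /\ forall x, dom x -> q x != 0 -> f x = a' x / q x ^+ N'.
Proof.
move=> pa NN' fE; exists (fun x => a x * q x ^+ (N' - N)).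
split=> [|x dx qx]; first by apply/polM/polX.
have -> : q x ^+ N' = q x ^+ (N' - N) * q x ^+ N by rewrite -exprD subnK.
by rewrite fE // invfM mulrA mulfK // expf_neq0.
Qed.

Lemma regD f g : reg C dom q f -> reg C dom q g ->
  reg C dom q (fun x => f x + g x).
Proof.
move=> [N [a [pa fE]]] [M [b [pb gE]]].
have [a' [pa' fE']] := reg_ge pa (leq_addr M N) fE.
have [b' [pb' gE']] := reg_ge pb (leq_addl N M) gE.
exists (N + M)%N, (fun x => a' x + b' x); split=> [|x dx qx]; first exact: polD.
by rewrite fE' // gE' // mulrDl.
Qed.

Lemma regM f g : reg C dom q f -> reg C dom q g ->
  reg C dom q (fun x => f x * g x).
Proof.
move=> [N [a [pa fE]]] [M [b [pb gE]]].
exists (N + M)%N, (fun x => a x * b x); split=> [|x dx qx]; first exact: polM.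
by rewrite fE // gE // exprD mulrACA invfM.
Qed.

Lemma regN f : reg C dom q f -> reg C dom q (fun x => - f x).
Proof.
move/(regM (reg_pol (pol_cst C (-1)))); apply: eq_reg => x _ _.
by rewrite mulN1r.
Qed.

Lemma regB f g : reg C dom q f -> reg C dom q g ->
  reg C dom q (fun x => f x - g x).
Proof. by move=> rf /regN; apply: regD. Qed.

Lemma reg_sum (I : Type) (r : seq I) (P : pred I) F :
  (forall i, P i -> reg C dom q (F i)) ->
  reg C dom q (fun x => \sum_(i <- r | P i) F i x).
Proof.
move=> pF; elim: r => [|i r IHr].
  by apply: eq_reg (reg_pol (pol_cst C 0)) => x _ _; rewrite big_nil.
have [Pi|Pi] := boolP (P i).
  by apply: eq_reg (regD (pF i Pi) IHr) => x _ _; rewrite big_cons Pi.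
by apply: eq_reg IHr => x _ _; rewrite big_cons (negPf Pi).
Qed.

Lemma reg_prod (I : Type) (r : seq I) (P : pred I) F :
  (forall i, P i -> reg C dom q (F i)) ->
  reg C dom q (fun x => \prod_(i <- r | P i) F i x).
Proof.
move=> pF; elim: r => [|i r IHr].
  by apply: eq_reg (reg_pol (pol_cst C 1)) => x _ _; rewrite big_nil.
have [Pi|Pi] := boolP (P i).
  by apply: eq_reg (regM (pF i Pi) IHr) => x _ _; rewrite big_cons Pi.
by apply: eq_reg IHr => x _ _; rewrite big_cons (negPf Pi).
Qed.

Lemma regX n f : reg C dom q f -> reg C dom q (fun x => f x ^+ n).
Proof.
move=> pf; elim: n => [|n IHn]; first exact/reg_pol/pol_cst.
by apply: eq_reg (regM pf IHn) => x _ _; rewrite exprS.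
Qed.

Lemma reg_mulmx m n p (A : X -> 'M[k]_(m, n)) (B : X -> 'M[k]_(n, p)) :
  (forall i j, reg C dom q (fun x => A x i j)) ->
  (forall i j, reg C dom q (fun x => B x i j)) ->
  forall i j, reg C dom q (fun x => (A x *m B x) i j).
Proof.
move=> pA pB i j.
apply: (@eq_reg (fun x => \sum_l A x i l * B x l j)).
  by move=> x _ _; rewrite mxE.
by apply: reg_sum => l _; apply: regM.
Qed.

Lemma reg_subst X' (C' : (X' -> k) -> Prop) (phi : X -> X') f :
  (forall g, C' g -> reg C dom q (fun x => g (phi x))) ->
  pol C' f -> reg C dom q (fun x => f (phi x)).
Proof.
move=> Cp; elim=> {f} [c|f /Cp //|f g _ pf _ pg|f g _ pf _ pg].
- exact/reg_pol/pol_cst.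
- exact: regD.
exact: regM.
Qed.

End Reg.

(** Along a one-parameter family the coefficients in c are again polynomial functions of the
    remaining argument; this is how weight components are extracted below. *)
Lemma pol_expand X X' (C : (X -> k) -> Prop) (C' : (X' -> k) -> Prop)
    (phi : k -> X' -> X) f :
  (forall g, C g -> exists P : X' -> {poly k},
     [/\ forall i, pol C' (fun x => (P x)`_i),
         exists K, forall x, (size (P x) <= K)%N
       & forall c x, g (phi c x) = (P x).[c]]) ->
  pol C f -> exists P : X' -> {poly k},
     [/\ forall i, pol C' (fun x => (P x)`_i),
         exists K, forall x, (size (P x) <= K)%N
       & forall c x, f (phi c x) = (P x).[c]].
Proof.
move=> Cp; elim=> {f} [c|f /Cp //|f g _ [P [pP [K sP] fE]] _ [Q [pQ [L sQ] gE]]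
  |f g _ [P [pP [K sP] fE]] _ [Q [pQ [L sQ] gE]]].
- exists (fun=> c%:P); split=> [i||c' x].
  + exact: pol_cst.
  + by exists 1 => x; apply: size_polyC_leq1.
  by rewrite hornerC.
- exists (fun x => P x + Q x); split=> [i||c x].
  + by apply: eq_pol (polD (pP i) (pQ i)) => x; rewrite coefD.
  + exists (maxn K L) => x; apply: leq_trans (size_polyD _ _) _.
    by rewrite geq_max !leq_max sP sQ orbT.
  by rewrite hornerD fE gE.
exists (fun x => P x * Q x); split=> [i||c x].
+ apply: (@eq_pol _ _ (fun x => \sum_(j < i.+1) (P x)`_j * (Q x)`_(i - j))).
    by move=> x; rewrite coefM.
  by apply: pol_sum => j _; apply: polM.
+ exists (K + L)%N => x; apply: leq_trans (size_polyMleq _ _) _.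
  by apply: leq_trans (leq_pred _) _; apply: leq_add.
by rewrite hornerM fE gE.
Qed.

Lemma pol_curve X (C : (X -> k) -> Prop) (gam : k -> X) f :
  (forall g, C g -> exists P : {poly k}, forall c, g (gam c) = P.[c]) ->
  pol C f -> exists P : {poly k}, forall c, f (gam c) = P.[c].
Proof.
move=> Cg /(@pol_expand _ unit _ (fun=> True) (fun c _ => gam c)) [|P [_ _ PE]].
  move=> g /Cg[P PE]; exists (fun=> P); split=> [i||c _]; last exact: PE.
    exact: pol_cst.
  by exists (size P).
by exists (P tt) => c; exact: (PE c tt).
Qed.

End Pol.

(** f is expressed through finitely many of its own values, by Gaussian elimination on the a_i with
    a point where a_0 does not vanish as pivot. The v_i may be arbitrary vectors, whereas values of
    f keep whatever property f has, such as being a cocycle. *)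
Lemma interpolation (k : fieldType) (Y : Type) (V : lmodType k) s
    (a : 'I_s -> Y -> k) (v : 'I_s -> V) (f : Y -> V) :
  (forall y, f y = \sum_i a i y *: v i) ->
  exists m (y : 'I_m -> Y) (c : 'I_m -> 'I_s -> k),
    forall z, f z = \sum_j (\sum_i c j i * a i z) *: f (y j).
Proof.
elim: s a v f => [|s IHs] a v f fE.
  exists 0, (fun i : 'I_0 => False_rect _ (notF (ltn_ord i))), (fun _ _ => 0) => z.
  by rewrite fE !big_ord0.
case: (pselect (exists y, a ord0 y != 0)) => [[y0 ay0]|na]; last first.
  have [|m [y [c cE]]] := IHs (fun i => a (lift ord0 i)) (fun i => v (lift ord0 i)) f.
    move=> y; rewrite fE big_ord_recl; have -> : a ord0 y = 0.
      by apply/eqP; apply: contraT => ay; case: na; exists y.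
    by rewrite scale0r add0r.
  exists m, y, (fun j i => if unlift ord0 i is Some i' then c j i' else 0) => z.
  rewrite {1}cE; apply: eq_bigr => j _; congr (_ *: _).
  rewrite big_ord_recl unlift_none mul0r add0r; apply: eq_bigr => i _.
  by rewrite liftK.
pose b (i : 'I_s) := a (lift ord0 i) y0 / a ord0 y0.
pose g z := f z - (a ord0 z / a ord0 y0) *: f y0.
have [|m [y [c cE]]] := IHs
    (fun i z => a (lift ord0 i) z - b i * a ord0 z) (fun i => v (lift ord0 i)) g.
  move=> z; rewrite /g !fE !big_ord_recl scalerDr scalerA mulfVK // opprD addrACA.
  rewrite subrr add0r scaler_sumr -sumrB; apply: eq_bigr => i _.
  rewrite scalerA -scalerBl /b; congr ((_ - _) *: _).
  by rewrite mulrC mulrA mulrAC.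
pose c' (j : 'I_m.+1) (i : 'I_s.+1) : k :=
  if unlift ord0 j is Some j' then
    if unlift ord0 i is Some i' then c j' i' else - \sum_i c j' i * b i
  else if unlift ord0 i is Some i' then
    - \sum_j' c j' i' * (a ord0 (y j') / a ord0 y0)
    else (a ord0 y0)^-1 + \sum_j' (\sum_i c j' i * b i) * (a ord0 (y j') / a ord0 y0).
exists m.+1, (fun j => if unlift ord0 j is Some j' then y j' else y0), c' => z.
pose e j z := \sum_i c j i * (a (lift ord0 i) z - b i * a ord0 z).
have eE j : \sum_i c' (lift ord0 j) i * a i z = e j z.
  rewrite big_ord_recl /c' liftK unlift_none /e addrC mulNr mulr_suml -sumrB.
  by apply: eq_bigr => i _; rewrite liftK; ring.
transitivity ((\sum_i c' ord0 i * a i z) *: f y0 + \sum_j e j z *: f (y j));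
  last first.
  rewrite [RHS]big_ord_recl unlift_none; congr (_ + _).
  by apply: eq_bigr => j _; rewrite eE liftK.
have -> : f z = g z + (a ord0 z / a ord0 y0) *: f y0 by rewrite subrK.
rewrite cE; under eq_bigr => j _ do rewrite -/(e j z) scalerBr scalerA.
rewrite sumrB addrAC [RHS]addrC -addrA; congr (_ + _).
rewrite -scaler_suml -scalerBl; congr (_ *: _).
rewrite big_ord_recl {1}/c' !unlift_none mulrDl [a _ _ / _]mulrC -addrA.
congr (_ + _).
have -> : \sum_(i < s) c' ord0 (lift ord0 i) * a (lift ord0 i) z =
    - \sum_j (\sum_i c j i * a (lift ord0 i) z) * (a ord0 (y j) / a ord0 y0).
  rewrite -sumrN; under [RHS]eq_bigr do rewrite mulr_suml -sumrN.
  rewrite [RHS]exchange_big; apply: eq_bigr => i _ /=.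
  rewrite /c' unlift_none liftK mulNr mulr_suml -sumrN.
  by apply: eq_bigr => j _; ring.
rewrite mulr_suml -sumrB -sumrN; apply: eq_bigr => j _.
rewrite /e !mulr_suml -sumrB -sumrN; apply: eq_bigr => i _; ring.
Qed.

End Polynomial.

(** * Hilbert's Nullstellensatz by Nagata normalization *)

Section Nullstellensatz.
Variable k : closedFieldType.

Lemma kronecker_inj n K (u v : 'I_n -> nat) :
  (forall i, u i < K)%N -> (forall i, v i < K)%N ->
  (\sum_i u i * K ^ i = \sum_i v i * K ^ i)%N -> u =1 v.
Proof.
elim: n u v => [|n IHn] u v uK vK; first by move=> _ [].
have E (w : 'I_n.+1 -> nat) : (\sum_i w i * K ^ i = w ord0 +
    (\sum_(i < n) w (lift ord0 i) * K ^ i) * K)%N.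
  rewrite big_ord_recl expn0 muln1 big_distrl; congr (_ + _)%N.
  by apply: eq_bigr => i _; rewrite /= /bump /= add1n expnS mulnAC -mulnA (mulnC K).
have K0 : (0 < K)%N by apply: leq_ltn_trans (uK ord0).
rewrite !E => uv.
have uv0 : u ord0 = v ord0.
  have := congr1 (modn^~ K) uv; rewrite !(addnC (_ ord0)) !modnMDl.
  by rewrite !modn_small.
move: uv; rewrite uv0 => /addnI /eqP; rewrite eqn_pmul2r // => /eqP uv i.
case: (unliftP ord0 i) => [j|] -> //.
exact: (IHn (fun j => u (lift ord0 j)) (fun j => v (lift ord0 j))).
Qed.

Section Graph.
Variables (A : comNzRingType) (h : {rmorphism k -> A}).

(* The pairs (P(a), P(c)) for P a polynomial. *)
Inductive gr n (a : 'I_n -> A) (c : 'I_n -> k) : A -> k -> Prop :=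
| gr_cst z : gr a c (h z) z
| gr_var i : gr a c (a i) (c i)
| grD x y u v : gr a c x u -> gr a c y v -> gr a c (x + y) (u + v)
| grM x y u v : gr a c x u -> gr a c y v -> gr a c (x * y) (u * v).

Variables (n : nat) (b : 'I_n -> A) (c : 'I_n -> k).

Lemma gr0 : gr b c 0 0. Proof. by rewrite -(rmorph0 h); apply: gr_cst. Qed.
Lemma gr1 : gr b c 1 1. Proof. by rewrite -{1}(rmorph1 h); apply: gr_cst. Qed.
Lemma grN x u : gr b c x u -> gr b c (- x) (- u).
Proof.
move=> xu; rewrite -mulN1r -[- u]mulN1r; apply: grM => //.
by rewrite -{1}(rmorph1 h) -rmorphN; apply: gr_cst.
Qed.
Lemma grB x y u v : gr b c x u -> gr b c y v -> gr b c (x - y) (u - v).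
Proof. by move=> xu /grN; apply: grD. Qed.
Lemma gr_sum (I : Type) (r : seq I) F G : (forall i, gr b c (F i) (G i)) ->
  gr b c (\sum_(i <- r) F i) (\sum_(i <- r) G i).
Proof.
by move=> FG; elim/big_rec2: _ => [|i y x _ xy]; [exact: gr0 | apply: grD].
Qed.
Lemma gr_prod (I : Type) (r : seq I) F G : (forall i, gr b c (F i) (G i)) ->
  gr b c (\prod_(i <- r) F i) (\prod_(i <- r) G i).
Proof.
by move=> FG; elim/big_rec2: _ => [|i y x _ xy]; [exact: gr1 | apply: grM].
Qed.

Definition grp (q : {poly A}) (Q : {poly k}) := forall j, gr b c q`_j Q`_j.

Lemma grp_C x u : gr b c x u -> grp x%:P u%:P.
Proof. by move=> xu j; rewrite !coefC; case: (j == 0)%N => //; apply: gr0. Qed.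
Lemma grpXn i : grp 'X^i 'X^i.
Proof. by move=> j; rewrite !coefXn; case: (_ == _); [apply: gr1|apply: gr0]. Qed.
Lemma grpD p q P Q : grp p P -> grp q Q -> grp (p + q) (P + Q).
Proof. by move=> pP qQ j; rewrite !coefD; apply: grD. Qed.
Lemma grpB p q P Q : grp p P -> grp q Q -> grp (p - q) (P - Q).
Proof. by move=> pP qQ j; rewrite !coefB; apply: grB. Qed.
Lemma grpM p q P Q : grp p P -> grp q Q -> grp (p * q) (P * Q).
Proof.
by move=> pP qQ j; rewrite !coefM; apply: gr_sum => i; apply: grM.
Qed.
Lemma grp_map P : grp (map_poly h P) P.
Proof. by move=> j; rewrite coef_map; apply: gr_cst. Qed.

(** Division by a monic polynomial uses ring operations only, so it runs over A and over k at the
    same time and the two remainders correspond. *)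
Lemma grp_div (g : {poly A}) (G : {poly k}) e : grp g G ->
  g \is monic -> G \is monic -> size g = e.+1 -> size G = e.+1 ->
  forall q Q, grp q Q -> exists r R s T,
  [/\ grp r R, (size r <= e)%N, (size R <= e)%N, q = s * g + r & Q = T * G + R].
Proof.
move=> gG mg mG sg sG q Q qQ.
have [N [lq lQ]] : exists N, (size q <= N)%N /\ (size Q <= N)%N.
  by exists (maxn (size q) (size Q)); rewrite leq_maxl leq_maxr.
elim: N q Q qQ lq lQ => [|N IHN] q Q qQ lq lQ.
  by exists q, Q, 0, 0; rewrite !mul0r !add0r; split=> //; apply: leq_trans (leq0n e).
have [eN|Ne] := leqP e N; last first.
  by exists q, Q, 0, 0; rewrite !mul0r !add0r; split=> //; apply: leq_trans Ne.
have red (R : nzRingType) (p f : {poly R}) : (size p <= N.+1)%N -> f \is monic ->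
    size f = e.+1 -> (size (p - p`_N *: 'X^(N - e) * f)%R <= N)%N.
  move=> sp mf sf; apply/leq_sizeP => j; rewrite leq_eqVlt => /orP[/eqP <-|Nj].
    rewrite coefB -scalerAl coefZ coefXnM ltnNge leq_subr /= subKn //.
    by move: mf; rewrite monicE /lead_coef sf => /eqP /= ->; rewrite mulr1 subrr.
  rewrite coefB -scalerAl coefZ coefXnM.
  rewrite (leq_sizeP _ _ sp) // ltnNge (leq_trans (leq_subr _ _) (ltnW Nj)) /=.
  rewrite [f`_ _]nth_default ?mulr0 ?subrr // sf ltn_subRL.
  by rewrite subnK.
have [] := IHN (q - q`_N *: 'X^(N - e) * g) (Q - Q`_N *: 'X^(N - e) * G).
- apply: grpB => //; apply: grpM => //; rewrite -!mul_polyC.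
  by apply: grpM; [apply: grp_C | apply: grpXn].
- exact: red.
- exact: red.
move=> r [R [s [T [rR sr sR qE QE]]]].
exists r, R, (s + q`_N *: 'X^(N - e)), (T + Q`_N *: 'X^(N - e)).
split=> //; first by rewrite mulrDl addrAC -qE subrK.
by rewrite mulrDl addrAC -QE subrK.
Qed.

End Graph.

(* After Nagata's substitution, P becomes monic in the variable X. *)
Section Nagata.
Variables (n K : nat) (P : mpoly n.+1 k).

Definition nweight (m : multinom n.+1) := (\sum_(i < n.+1) m i * K ^ i)%N.

Definition nag (A : comNzRingType) (b : 'I_n -> A) (i : 'I_n.+1) : {poly A} :=
  if unlift ord0 i is Some j then (b j)%:P + 'X^(K ^ i) else 'X.

Definition npoly (A : comNzRingType) (h : k -> A) (b : 'I_n -> A) : {poly A} :=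
  \sum_(m <- msupp P) (h (mcoeff m P))%:P * \prod_i nag b i ^+ m i.

Hypothesis K0 : (0 < K)%N.

Let mon (A : comNzRingType) e (f : {poly A}) := f \is monic /\ size f = e.+1.

Let monM (A : comNzRingType) e e' (f f' : {poly A}) :
  mon e f -> mon e' f' -> mon (e + e')%N (f * f').
Proof.
move=> [mf sf] [mf' sf']; split; first by rewrite monicMr.
by rewrite size_monicM // ?monic_neq0 // sf sf' addSn addnS.
Qed.

Lemma nag_monic (A : comNzRingType) (b : 'I_n -> A) (m : multinom n.+1) :
  \prod_i nag b i ^+ m i \is monic /\
  size (\prod_i nag b i ^+ m i) = (nweight m).+1.
Proof.
rewrite /nweight; elim/big_rec2: _ => [|i y x _ mx].
  by split; [exact: monic1 | rewrite size_poly1].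
apply: monM => //; elim: (m i) => [|j IHj].
  by rewrite expr0; split; [exact: monic1 | rewrite size_poly1].
rewrite exprS mulSn; apply: monM => //; rewrite /nag.
case: (unliftP ord0 i) => [l|] -> /=; last by split; [exact: monicX | rewrite size_polyX].
have s : (size ((b l)%:P : {poly A}) < size ('X^(K ^ bump 0 l) : {poly A}))%N.
  by rewrite size_polyXn ltnS (leq_trans (size_polyC_leq1 _)) // expn_gt0 K0.
split; last by rewrite addrC size_polyDl // size_polyXn.
by rewrite monicE addrC lead_coefDl // lead_coefXn.
Qed.

Hypothesis Pn0 : P != 0.
Hypothesis PK : forall m, m \in msupp P -> forall i, (m i < K)%N.

(** The monomials of P acquire pairwise distinct degrees, the numbers whose base-K digits are their
    exponents, so the heaviest one alone gives the leading term. [m0] is chosen before A: the same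
    scalar then normalizes over A and over k. *)
Lemma npoly_monic : exists m0, m0 \in msupp P /\
  forall (A : comNzRingType) (h : {rmorphism k -> A}) (b : 'I_n -> A),
  let g := (h (mcoeff m0 P)^-1)%:P * npoly h b in
  g \is monic /\ size g = (nweight m0).+1.
Proof.
have [m1 m1P] : exists m, m \in msupp P.
  case E : (msupp P) => [|m s]; first by move: Pn0; rewrite -msupp_eq0 E.
  by exists m; rewrite inE eqxx.
have [m0 m0P m0max] : exists2 m0, m0 \in msupp P &
    forall m, m \in msupp P -> (nweight m <= nweight m0)%N.
  have : forall s : seq (multinom n.+1), m1 \in s -> exists2 m0, m0 \in s &
      forall m, m \in s -> (nweight m <= nweight m0)%N.
    move=> s m1s; pose f (i : 'I_(size s)) := nweight (nth m1 s i).
    have i0 : (index m1 s < size s)%N by rewrite index_mem.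
    have [i _ iP] := arg_maxnP f (erefl : xpredT (Ordinal i0)).
    exists (nth m1 s i); first exact: mem_nth.
    move=> m ms; rewrite -(nth_index m1 ms).
    have im : (index m s < size s)%N by rewrite index_mem.
    exact: (iP (Ordinal im)).
  by apply.
exists m0; split=> // A h b g.
pose M := \prod_i nag b i ^+ m0 i.
have hc : h (mcoeff m0 P)^-1 * h (mcoeff m0 P) = 1.
  by rewrite -rmorphM mulVf ?rmorph1 // -mcoeff_msupp.
have gE : g = M + (h (mcoeff m0 P)^-1)%:P *
    (\sum_(m <- msupp P | m != m0) (h (mcoeff m P))%:P * \prod_i nag b i ^+ m i).
  rewrite /g /npoly (bigD1_seq m0) ?msupp_uniq //= mulrDr mulrA -polyCM hc.
  by rewrite polyC1 mul1r.
have [mM sM] := nag_monic b m0.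
have szC (x : A) (f : {poly A}) : (size (x%:P * f)%R <= size f)%N.
  by rewrite mul_polyC; apply: size_scale_leq.
have sr : (size ((h (mcoeff m0 P)^-1)%:P * (\sum_(m <- msupp P | m != m0)
    (h (mcoeff m P))%:P * \prod_i nag b i ^+ m i))%R < size M)%N.
  rewrite sM ltnS; apply: leq_trans (szC _ _) _.
  rewrite big_seq_cond; apply: (leq_trans (size_sum _ _ _)).
  apply/bigmax_leqP_seq => m _ /andP[mP mm0].
  apply: leq_trans (szC _ _) _; have [_ ->] := nag_monic b m.
  rewrite ltn_neqAle m0max // andbT; apply: contra mm0 => /eqP wm.
  apply/eqP/mnmP; apply: (kronecker_inj (K := K)) => //; exact: PK.
split; last by rewrite gE size_polyDl.
by rewrite gE monicE lead_coefDl // -monicE.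
Qed.

End Nagata.

Section Main.
Variables (A : comNzRingType) (h : {rmorphism k -> A}) (I : A -> Prop).
Hypothesis ID : forall x y, I x -> I y -> I (x + y).
Hypothesis IM : forall x y, I y -> I (x * y).
Hypothesis I1 : ~ I 1.

Lemma mmap_gr n (a : 'I_n -> A) c x v : gr h a c x v ->
  exists P : mpoly n k, x = mmap h a P /\ v = meval c P.
Proof.
elim=> {x v} [z|i|x y u v _ [P [-> ->]] _ [Q [-> ->]]|x y u v _ [P [-> ->]] _ [Q [-> ->]]].
- by exists (mpolyC n z); rewrite mmapC mevalC.
- by exists (mpolyX k (mnm1 i)); rewrite mmapX mmap1U mevalXU.
- by exists (P + Q); rewrite mmapD mevalD.
by exists (P * Q); rewrite rmorphM mevalM.
Qed.

Section Extend.
Variables (n : nat) (b : 'I_n -> A) (c : 'I_n -> k) (y : A).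
Hypothesis I0 : I 0.
Hypothesis bc : forall x v, gr h b c x v -> I x -> v = 0.
Variables (g : {poly A}) (G : {poly k}) (e : nat).
Hypothesis gG : grp h b c g G.
Hypothesis mg : g \is monic.
Hypothesis mG : G \is monic.
Hypothesis sg : size g = e.+1.
Hypothesis sG : size G = e.+1.
Hypothesis Ig : I g.[y].

(** A determinant trick. If q(y) were in I, the remainders of X^i q modulo g, i < e, would form a
    matrix that kills the vector of powers of y modulo I. Its determinant would then lie in I, while
    its counterpart over k is the determinant of the identity. *)
Lemma no_unit q : grp h b c q 1 -> ~ I q.[y].
Proof.
move=> q1 Iq.
have [e0|e0] := posnP e.
  apply: I1; move: sg; rewrite e0 => /eqP/size_poly1P[x _ gx].
  by move: mg Ig; rewrite gx monicE lead_coefC => /eqP ->; rewrite hornerC.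
have step (i : 'I_e) : exists r : {poly A}, [/\ grp h b c r 'X^i,
    (size r <= e)%N & I r.[y]].
  have [r [R [s [T [rR sr sR qE QE]]]]] := grp_div gG mg mG sg sG
    (grpM (grpXn h b c i) q1).
  have T0 : T = 0.
    apply/eqP; apply: contraT => Tn0.
    have : (size (T * G)%R <= e)%N.
      have -> : T * G = 'X^i - R by rewrite -[X in X - R]mulr1 QE addrK.
      rewrite (leq_trans (size_polyD _ _)) // geq_max size_polyXn ltn_ord.
      by rewrite size_polyN.
    rewrite size_Mmonic // sG addnS /= -[X in (_ <= X)%N]add0n leq_add2r.
    by rewrite leqn0 size_poly_eq0 (negPf Tn0).
  exists r; split=> //.
    by move: QE; rewrite T0 mul0r add0r mulr1 => ->.
  have -> : r = 'X^i * q - s * g by rewrite qE addrC addKr.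
  rewrite hornerD hornerN !hornerM -mulNr.
  by apply: ID; apply: IM.
have [r rP] := choice step.
pose Mr := \matrix_(i < e, j < e) (r i)`_j.
have dM : gr h b c (\det Mr) 1.
  rewrite -(det1 _ e) /determinant; apply: gr_sum => s; apply: grM.
    rewrite -[X in gr _ _ _ X _](rmorph_sign h); apply: gr_cst.
  apply: gr_prod => i; rewrite !mxE.
  by have [qi _ _] := rP i; rewrite -val_eqE eq_sym -coefXn; apply: qi.
have := bc dM; suff Id : I (\det Mr) by move=> /(_ Id)/eqP; rewrite oner_eq0.
pose v : 'cV[A]_e := \col_j y ^+ j.
have Iv i : I ((Mr *m v) i 0).
  have [_ sr Ir] := rP i; rewrite mxE; move: Ir.
  rewrite (horner_coef_wide _ sr).
  congr I; by apply: eq_bigr => j _; rewrite !mxE.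
have : I ((\adj Mr *m (Mr *m v)) (Ordinal e0) 0).
  rewrite mxE; elim/big_ind: _ => [||i _]; [exact: I0 | exact: ID | exact: IM].
by rewrite mulmxA mul_adj_mx mul_scalar_mx !mxE expr0 mulr1.
Qed.

Let J Q := exists2 q, grp h b c q Q & I q.[y].

(** [J] is an ideal of k[X] that contains G. A nonzero element of least size generates it, and is
    not constant by [no_unit], so it has a root. *)
Lemma common_root : exists c0, forall Q, J Q -> Q.[c0] = 0.
Proof.
have JM S Q : J Q -> J (S * Q).
  move=> [q qQ Iq]; exists (map_poly h S * q); first by apply: grpM => //; apply: grp_map.
  by rewrite hornerM; apply: IM.
have JB P Q : J P -> J Q -> J (P - Q).
  move=> [p pP Ip] [q qQ Iq]; exists (p - q); first exact: grpB.
  by rewrite hornerD hornerN -mulN1r; apply: ID => //; apply: IM.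
have JG : J G by exists g.
pose Pm m := `[< exists Q, [/\ J Q, Q != 0 & size Q = m] >].
have exP : exists m, Pm m.
  by exists (size G); apply/asboolP; exists G; rewrite monic_neq0.
have [m1 /asboolP[Q0 [JQ0 Q0n0 sQ0]] mmin] := ex_minnP exP.
have dvd Q : J Q -> Q0 %| Q.
  move=> JQ; rewrite /dvdp; apply: contraT => rn0.
  have : Pm (size (Q %% Q0)).
    apply/asboolP; exists (Q %% Q0); split=> //.
    have -> : Q %% Q0 = Q - Q %/ Q0 * Q0 by rewrite {2}(divp_eq Q Q0) [X in _ = X - _]addrC addrK.
    by apply: JB => //; apply: JM.
  by move/mmin; rewrite -sQ0 leqNgt ltn_modp Q0n0.
have [|c0 rc0] := closed_rootP Q0 _; last first.
  by exists c0 => Q /dvd/dvdpP[S ->]; rewrite hornerM (rootP rc0) mulr0.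
apply/eqP => /eqP/size_poly1P[z z0 Q0z].
have [q q1 Iq] := JM z^-1%:P _ JQ0.
by apply: no_unit Iq; move: q1; rewrite Q0z -polyCM mulVf.
Qed.

End Extend.

(** Working with a ring A and an ideal I avoids finitely generated algebras and quotients. Either
    the a_i satisfy no nontrivial relation modulo I, or Nagata's substitution makes the first of
    them integral, modulo I, over n modified elements; [common_root] then extends the point found by
    induction. *)
Theorem nullstellensatz n (a : 'I_n -> A) : I 0 ->
  exists c : 'I_n -> k, forall x v, gr h a c x v -> I x -> v = 0.
Proof.
move=> I0; elim: n a => [|n IHn] a.
  exists (fun=> 0) => x v xv Ix; apply/eqP; apply: contraT => v0; case: I1.
  have -> : 1 = h v^-1 * x; last exact: IM.
  suff -> : x = h v by rewrite -rmorphM mulVf ?rmorph1.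
  elim: xv {Ix v0} => // [[]//|x' y u w _ -> _ ->|x' y u w _ -> _ ->].
    by rewrite rmorphD.
  by rewrite rmorphM.
case: (pselect (exists P : mpoly n.+1 k, P != 0 /\ I (mmap h a P))); last first.
  move=> nP; exists (fun=> 0) => x v /mmap_gr[P [-> ->]] IP.
  have [->|Pn0] := eqVneq P 0; first by rewrite meval0.
  by case: nP; exists P.
move=> [P [Pn0 IP]]; pose y := a ord0.
pose K := (msize P).+1.
have PK m : m \in msupp P -> forall i, (m i < K)%N.
  move=> mP i; rewrite ltnS; apply: leq_trans (ltnW (msize_mdeg_lt mP)).
  by rewrite mdegE (bigD1 i) //= leq_addr.
pose b (j : 'I_n) := a (lift ord0 j) - y ^+ (K ^ (lift ord0 j)).
have [c bc] := IHn b.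
have [m0 [m0P m0M]] := npoly_monic (erefl : (0 < K)%N) Pn0 PK.
have [mg sg] := m0M A h b; have [mG sG] := m0M k idfun c.
have gG : grp h b c ((h (mcoeff m0 P)^-1)%:P * npoly K P h b)
    ((idfun (mcoeff m0 P)^-1)%:P * npoly K P idfun c).
  apply: grpM; first by apply/grp_C/gr_cst.
  rewrite /npoly; elim/big_rec2: _ => [|m x z _ xz].
    by move=> j; rewrite !coef0; apply: gr0.
  apply: grpD => //; apply: grpM; first by apply/grp_C/gr_cst.
  elim/big_rec2: _ => [|i x' z' _ xz']; first exact: (grpXn h b c 0).
  apply: grpM => //; elim: (m i) => [|j IHj]; first exact: (grpXn h b c 0).
  rewrite !exprS; apply: grpM => //; rewrite /nag.
  case: unliftP => [l|] _; last exact: (grpXn h b c 1).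
  by apply: grpD; [apply/grp_C/gr_var | apply: grpXn].
have Ig : I ((h (mcoeff m0 P)^-1)%:P * npoly K P h b).[y].
  rewrite hornerM; apply: IM.
  have -> // : (npoly K P h b).[y] = mmap h a P.
  rewrite /npoly horner_sum; apply: eq_bigr => m _; rewrite hornerM hornerC.
  congr (_ * _); rewrite horner_prod; apply: eq_bigr => i _; rewrite horner_exp.
  congr (_ ^+ _); rewrite /nag; case: (unliftP ord0 i) => [j|] ->; rewrite ?hornerX //.
  by rewrite !hornerE /b subrK.
have [c0 c0P] := common_root I0 bc gG mg mG sg sG Ig.
exists (fun i => if unlift ord0 i is Some j then c j + c0 ^+ (K ^ i) else c0).
move=> x v xv; have [q [Q [qQ -> ->]]] : exists q Q,
    [/\ grp h b c q Q, x = q.[y] & v = Q.[c0]].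
  elim: xv => {x v} [z|i|x z u v _ [q [Q [qQ -> ->]]] _ [r [R [rR -> ->]]]
    |x z u v _ [q [Q [qQ -> ->]]] _ [r [R [rR -> ->]]]].
  - by exists (h z)%:P, z%:P; rewrite !hornerC; split=> //; apply/grp_C/gr_cst.
  - exists (nag K b i), (nag K c i); rewrite /nag.
    case: (unliftP ord0 i) => [j|] ->.
      rewrite !hornerE; split=> //; last by rewrite /b subrK.
      by apply: grpD; [apply/grp_C/gr_var | apply: grpXn].
    by rewrite !hornerX; split=> //; apply: (grpXn h b c 1).
  - by exists (q + r), (Q + R); rewrite !hornerD; split=> //; apply: grpD.
  by exists (q * r), (Q * R); rewrite !hornerM; split=> //; apply: grpM.
by move=> Iq; apply: c0P; exists q.
Qed.

End Main.
End Nullstellensatz.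

(** * The Nullstellensatz for functions, and homogenisation *)

Section FunctionForm.
Variable k : closedFieldType.

Definition gens (X : Type) S (x : 'I_S -> X -> k) (f : X -> k) :=
  exists a, f = x a.

Lemma pol_mpoly X S (x : 'I_S -> X -> k) f : pol (gens x) f ->
  exists P : mpoly S k, forall e, f e = meval (fun a => x a e) P.
Proof.
elim=> {f} [c|f [a ->]|f g _ [P PE] _ [Q QE]|f g _ [P PE] _ [Q QE]].
- by exists (mpolyC S c) => e; rewrite mevalC.
- by exists (mpolyX k (mnm1 a)) => e; rewrite mevalXU.
- by exists (P + Q) => e; rewrite mevalD PE QE.
by exists (P * Q) => e; rewrite mevalM PE QE.
Qed.

Lemma mpoly_pol X S (C : (X -> k) -> Prop) (x : 'I_S -> X -> k) (P : mpoly S k) :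
  (forall a, pol C (x a)) -> pol C (fun e => meval (fun a => x a e) P).
Proof.
move=> Cx.
apply: (@eq_pol _ _ _ (fun e => \sum_(m <- msupp P) mcoeff m P *
    \prod_(i < S) x i e ^+ m i)); first by move=> e; rewrite mevalE.
apply: pol_sum => m _; apply: polM; first exact: pol_cst.
by apply: pol_prod => i _; apply: polX.
Qed.

(** Rabinowitsch's trick: coordinate [ord0] of [x'] is a new variable y, and I is generated by the
    [Q t] and by 1 - y F. *)
Lemma nullstellensatz_cover (X : Type) S (x : 'I_S -> X -> k) (T : Type)
    (Q : T -> X -> k) (F : X -> k) :
  (forall c : 'I_S -> k, exists e, forall a, x a e = c a) ->
  (forall t, pol (gens x) (Q t)) -> pol (gens x) F ->
  (forall e, F e != 0 -> exists t, Q t e != 0) ->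
  exists K s (t : 'I_s -> T) (g : 'I_s -> X -> k),
    (forall i, pol (gens x) (g i)) /\
    forall e, F e ^+ K = \sum_i g i e * Q (t i) e.
Proof.
move=> xsurj pQ pF FQ.
pose x' (a : 'I_S.+1) (ey : X * k) := if unlift ord0 a is Some b then x b ey.1 else ey.2.
have pol1 f : pol (gens x) f -> pol (gens x') (fun ey => f ey.1).
  apply: pol_subst => _ [a ->]; apply: pol_gen; exists (lift ord0 a).
  by apply/funext => ey; rewrite /x' liftK.
have poly' : pol (gens x') (fun ey => ey.2).
  by apply: pol_gen; exists ord0; apply/funext => ey; rewrite /x' unlift_none.
pose I (P : mpoly S.+1 k) := exists s (t : 'I_s -> T) (g : 'I_s -> X * k -> k) h,
  [/\ forall i, pol (gens x') (g i), pol (gens x') h &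
  forall e, meval (fun a => x' a e) P =
    \sum_i g i e * Q (t i) e.1 + h e * (1 - e.2 * F e.1)].
have I0 : I 0.
  exists 0, (fun i : 'I_0 => False_rect _ (notF (ltn_ord i))), (fun _ _ => 0), (fun=> 0).
  split=> [i||e]; try exact: pol_cst.
  by rewrite meval0 big_ord0 mul0r addr0.
have ID P1 P2 : I P1 -> I P2 -> I (P1 + P2).
  move=> [s1 [t1 [g1 [h1 [pg1 ph1 E1]]]]] [s2 [t2 [g2 [h2 [pg2 ph2 E2]]]]].
  exists (s1 + s2)%N, (fun i => match fintype.split i with inl j => t1 j | inr j => t2 j end),
    (fun i => match fintype.split i with inl j => g1 j | inr j => g2 j end), (fun e => h1 e + h2 e).
  split=> [i||e]; [by case: fintype.split | exact: polD |].
  rewrite mevalD E1 E2 big_split_ord /= mulrDl addrACA; congr (_ + _ + _).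
    by apply: eq_bigr => i _; rewrite (unsplitK (inl i)).
  by apply: eq_bigr => i _; rewrite (unsplitK (inr i)).
have IM P1 P2 : I P2 -> I (P1 * P2).
  move=> [s2 [t2 [g2 [h2 [pg2 ph2 E2]]]]].
  have p1 : pol (gens x') (fun e => meval (fun a => x' a e) P1).
    by apply: mpoly_pol => a; apply: pol_gen; exists a.
  exists s2, t2, (fun i e => meval (fun a => x' a e) P1 * g2 i e),
    (fun e => meval (fun a => x' a e) P1 * h2 e).
  split=> [i||e]; try exact: polM.
  rewrite mevalM E2 mulrDr mulr_sumr mulrA; congr (_ + _).
  by apply: eq_bigr => i _; rewrite mulrA.
case: (pselect (I 1)) => [|I1]; last first.
  have [c cP] := nullstellensatz (@mpolyC S.+1 k) ID IM I1
    (fun i => mpolyX k (mnm1 i)) I0.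
  have {}cP P : I P -> meval c P = 0.
    apply: cP; rewrite {1}(mpolyE P) mevalE; apply: gr_sum => m.
    rewrite -mul_mpolyC; apply: grM; first exact: gr_cst.
    rewrite mpolyXE_id; apply: gr_prod => i; elim: (m i) => [|j IHj].
      by rewrite !expr0; apply: gr1.
    by rewrite !exprS; apply: grM => //; apply: gr_var.
  have [e eE] := xsurj (fun a => c (lift ord0 a)).
  have cE a : x' a (e, c ord0) = c a.
    by rewrite /x'; case: (unliftP ord0 a) => [b|] -> //; apply: eE.
  have Qe t : Q t e = 0.
    have [P PE] := pol_mpoly (pol1 _ (pQ t)).
    have -> : Q t e = meval (fun a => x' a (e, c ord0)) P by rewrite -PE.
    rewrite (meval_eq _ cE); apply: cP.
    exists 1, (fun=> t), (fun _ _ => 1), (fun=> 0); split=> [i||ey]; try exact: pol_cst.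
    by rewrite big_ord1 mul1r mul0r addr0 -PE.
  have Fe : 1 - c ord0 * F e = 0.
    have p1 : pol (gens x') (fun ey => 1 - ey.2 * F ey.1).
      by apply: polB; [apply: pol_cst | apply: polM => //; apply: pol1].
    have [P PE] := pol_mpoly p1.
    have -> : 1 - c ord0 * F e = meval (fun a => x' a (e, c ord0)) P by rewrite -PE.
    rewrite (meval_eq _ cE); apply: cP.
    exists 0, (fun i : 'I_0 => False_rect _ (notF (ltn_ord i))), (fun _ _ => 0), (fun=> 1).
    split=> [i||ey]; try exact: pol_cst.
    by rewrite big_ord0 mul1r add0r -PE.
  have /FQ[t] : F e != 0.
    by apply/eqP => F0; move/eqP: Fe; rewrite F0 mulr0 subr0 oner_eq0.
  by rewrite Qe eqxx.
move=> [s [t [g [h [pg ph E]]]]].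
have rg i : reg (gens x) (fun=> True) F (fun e => g i (e, (F e)^-1)).
  apply: (reg_subst pF _ (pg i)) => _ [a ->]; rewrite /x'.
  case: (unlift ord0 a) => [b|] /=; first by apply/reg_pol/pol_gen; exists b.
  exists 1, (fun=> 1); split; first exact: pol_cst.
  by move=> e _ _; rewrite expr1 mul1r.
have [N NP] := choice rg.
pose N0 := (\max_i N i)%N.
have /choice[a aP] i : exists a, pol (gens x) a /\ forall e, True -> F e != 0 ->
    g i (e, (F e)^-1) = a e / F e ^+ N0.
  have [a [pa aE]] := NP i; apply: (reg_ge pF pa _ aE).
  exact: leq_bigmax.
(* The extra factor F makes both sides vanish where F does, since the substitution of 1/F for y says
   nothing there. *)
exists N0.+1, s, t, (fun i e => F e * a i e); split=> [i|e].
  by apply: polM => //; case: (aP i).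
have [F0|Fn0] := eqVneq (F e) 0.
  by rewrite F0 exprS mul0r big1 // => i _; rewrite !mul0r.
rewrite exprS; have := E (e, (F e)^-1); rewrite meval1 /= mulVf // subrr mulr0 addr0.
move/(congr1 (fun z => F e * (F e ^+ N0 * z))); rewrite mulr1 => ->.
rewrite !mulr_sumr; apply: eq_bigr => i _.
have [_ ->] := aP i => //; rewrite -!mulrA; congr (_ * _).
by rewrite mulrCA [_ ^+ _ * _]mulrA mulfV ?mul1r // expf_neq0.
Qed.

(* Extraction of the homogeneous part in a relation between homogeneous
   functions, for an action of the multiplicative group by scalings. *)
Lemma homogenize_relation X (C : (X -> k) -> Prop) (sg : k -> X -> X)
    (s : nat) (g P : 'I_s -> X -> k) (Q : X -> k) (w : 'I_s -> nat) (wQ : nat) :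
  (forall c c' x, sg c (sg c' x) = sg (c * c') x) ->
  (forall f, C f -> exists d : nat, forall c x, f (sg c x) = c ^+ d * f x) ->
  (forall i, pol C (g i)) ->
  (forall i c x, c != 0 -> P i (sg c x) = c ^+ w i * P i x) ->
  (forall c x, c != 0 -> Q (sg c x) = c ^+ wQ * Q x) ->
  (forall x, \sum_i g i x * P i x = Q x) ->
  exists g' : 'I_s -> X -> k,
  [/\ forall i, pol C (g' i), forall x, \sum_i g' i x * P i x = Q x,
      forall i c x, c != 0 -> c ^+ w i * g' i (sg c x) = c ^+ wQ * g' i x &
      forall i (tau : X -> X) (u v : k), v != 0 ->
        (forall c x, sg c (tau x) = tau (sg c x)) ->
        (forall x, u * g i (tau x) = v * g i x) ->
        forall x, u * g' i (tau x) = v * g' i x].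
Proof.
move=> sgM Csg pg Psg Qsg gPQ.
have ex i : exists G : X -> {poly k}, [/\ forall d, pol C (fun x => (G x)`_d),
    exists K, forall x, (size (G x) <= K)%N
    & forall c x, g i (sg c x) = (G x).[c]].
  apply: pol_expand (pg i) => f Cf; have [d fE] := Csg f Cf.
  exists (fun x => f x *: 'X^d); split=> [j||c x].
  - apply: (@eq_pol _ _ _ (fun x => f x * (j == d)%:R)).
      by move=> x; rewrite coefZ coefXn.
    by apply: polM; [apply: pol_gen | apply: pol_cst].
  - by exists d.+1 => x; rewrite (leq_trans (size_scale_leq _ _)) ?size_polyXn.
  by rewrite hornerZ hornerXn fE mulrC.
have [G GP] := choice ex.
(* The part of g_i that pairs with P_i to the weight of Q; when P_i alone exceeds this weight, there
   is none. *)
pose g' i x := if (w i <= wQ)%N then (G i x)`_(wQ - w i) else 0.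
exists g'; split=> [i|x|i c x c0|i tau u v v0 st gt x].
- rewrite /g'; case: leqP => _; last exact: pol_cst.
  by case: (GP i).
- have : \sum_i G i x * 'X^(w i) * (P i x)%:P = (Q x) *: 'X^wQ.
    apply: poly_inj => c c0; rewrite horner_sum hornerZ hornerXn mulrC -Qsg //.
    rewrite -gPQ; apply: eq_bigr => i _; rewrite !hornerM hornerXn hornerC.
    by have [_ _ <-] := GP i; rewrite Psg // mulrA.
  move/(congr1 (fun p : {poly k} => p`_wQ)); rewrite coefZ coefXn eqxx mulr1 => <-.
  rewrite coef_sum; apply: eq_bigr => i _.
  rewrite coefMC coefMXn /g' ltnNge; by case: leqP.
- rewrite /g'; case: leqP => wi; last by rewrite !mulr0.
  have -> : G i (sg c x) = \poly_(d < size (G i x)) (c ^+ d * (G i x)`_d).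
    apply: poly_inj => c' _; have [_ _ GE] := GP i; rewrite -GE sgM GE.
    rewrite horner_poly horner_coef; apply: eq_bigr => d _.
    by rewrite exprMn; ring.
  rewrite coef_poly; case: ltnP => ns; last by rewrite nth_default // !mulr0.
  by rewrite mulrA -exprD addnC subnK.
rewrite /g'; case: leqP => _; last by rewrite !mulr0.
have E : u *: G i (tau x) = v *: G i x.
  apply: poly_inj => c _; rewrite !hornerZ.
  by have [_ _ GE] := GP i; rewrite -!GE st gt.
by rewrite -!coefZ E.
Qed.

End FunctionForm.

(** * Triangular matrices *)

Section Triangular.
Variable k : fieldType.

Lemma invmx_mul n (A B : 'M[k]_n) : A \in unitmx -> B \in unitmx ->
  invmx (A *m B) = invmx B *m invmx A.
Proof.
move=> uA uB; rewrite -[RHS](mulKmx (_ : A *m B \in unitmx)).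
  by rewrite -mulmxA [B *m _]mulmxA mulmxV // mul1mx mulmxV // mulmx1.
by rewrite unitmx_mul uA.
Qed.

Lemma trig_mulmx n (A B : 'M[k]_n) :
  is_trig_mx A -> is_trig_mx B -> is_trig_mx (A *m B).
Proof.
move=> /is_trig_mxP tA /is_trig_mxP tB; apply/is_trig_mxP => i j ij.
rewrite mxE big1 // => l _; have [il|li] := ltnP i l.
  by rewrite tA // mul0r.
by rewrite tB ?mulr0 //; apply: leq_ltn_trans ij.
Qed.

Lemma trig_mulmx_diag n (A B : 'M[k]_n) i :
  is_trig_mx A -> is_trig_mx B -> (A *m B) i i = A i i * B i i.
Proof.
move=> /is_trig_mxP tA /is_trig_mxP tB.
rewrite mxE (bigD1 i) //= big1 ?addr0 // => l li.
have [il|] := ltnP i l; first by rewrite tA // mul0r.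
by rewrite leq_eqVlt val_eqE (negPf li) => /tB ->; rewrite mulr0.
Qed.

Lemma trig_unitP n (A : 'M[k]_n) : is_trig_mx A ->
  (A \in unitmx) = [forall i, A i i != 0].
Proof.
move=> tA; rewrite unitmxE unitfE det_trig // prodf_seq_neq0.
apply/allP/forallP => [nz i|nz i _]; first exact: (nz i (mem_index_enum i)).
exact: nz.
Qed.

Lemma trig_unit_diag n (A : 'M[k]_n) i :
  is_trig_mx A -> A \in unitmx -> A i i != 0.
Proof. by move=> tA; rewrite trig_unitP // => /forallP. Qed.

Lemma trig_invmx n (A : 'M[k]_n) :
  is_trig_mx A -> A \in unitmx -> is_trig_mx (invmx A).
Proof.
move=> tA uA; apply/is_trig_mxP => i j.
have [m] := ubnP (val i); elim: m i => // m IHm i im ij.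
have /matrixP/(_ i j) := mulmxV uA; rewrite !mxE (bigD1 i) //= big1 => [|l li].
  rewrite addr0 -val_eqE /= (ltn_eqF ij) => /eqP; rewrite mulf_eq0.
  by rewrite (negPf (trig_unit_diag i tA uA)) => /eqP.
have [il|] := ltnP i l; first by move/is_trig_mxP: tA => ->; rewrite ?mul0r.
rewrite leq_eqVlt val_eqE (negPf li) /= => l_i.
by rewrite IHm ?mulr0 //; [apply: leq_trans l_i _ | apply: ltn_trans ij].
Qed.

Lemma trig_invmx_diag n (A : 'M[k]_n) i :
  is_trig_mx A -> A \in unitmx -> (invmx A) i i = (A i i)^-1.
Proof.
move=> tA uA; have := trig_mulmx_diag i tA (trig_invmx tA uA).
rewrite mulmxV // mxE eqxx => e1.
by rewrite -[LHS](mulKf (trig_unit_diag i tA uA)) -e1 mulr1.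
Qed.

Definition unitri n (u : 'M[k]_n) := is_trig_mx u && [forall i, u i i == 1].

Lemma unitriP n (u : 'M[k]_n) :
  reflect (is_trig_mx u /\ forall i, u i i = 1) (unitri u).
Proof.
by apply: (iffP andP) => [[? /eqfunP]|[? /eqfunP]].
Qed.

Lemma unitri_unit n (u : 'M[k]_n) : unitri u -> u \in unitmx.
Proof.
case/unitriP => tu du; rewrite trig_unitP //; apply/forallP => i.
by rewrite du oner_neq0.
Qed.

Lemma unitriM n (u v : 'M[k]_n) : unitri u -> unitri v -> unitri (u *m v).
Proof.
move=> /unitriP[tu du] /unitriP[tv dv]; apply/unitriP; split=> [|i].
  exact: trig_mulmx.
by rewrite trig_mulmx_diag // du dv mulr1.
Qed.

Lemma unitriV n (u : 'M[k]_n) : unitri u -> unitri (invmx u).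
Proof.
move=> uu; have uu' := unitri_unit uu; move: uu => /unitriP[tu du].
apply/unitriP; split=> [|i]; first exact: trig_invmx.
by rewrite trig_invmx_diag // du invr1.
Qed.

Definition UT n : Type := {u : 'M[k]_n | unitri u}.

Fact UTof_subproof n (A : 'M[k]_n) :
  unitri (\matrix_(i, j) if (j < i)%N then A i j else (i == j)%:R).
Proof.
apply/unitriP; split=> [|i]; last by rewrite mxE ltnn eqxx.
apply/is_trig_mxP => i j ij; rewrite mxE ltnNge (ltnW ij) /=.
by rewrite -val_eqE /= (ltn_eqF ij).
Qed.
(** Everything but the strict lower part is overwritten, so that elements of the group can be given
    by arbitrary matrix expressions, including formulas that make sense only on an open set. *)
Definition UTof n (A : 'M[k]_n) : UT n := exist (@unitri n) _ (UTof_subproof A).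

Lemma UTofE n (A : 'M[k]_n) : unitri A -> sval (UTof A) = A.
Proof.
case/unitriP=> /is_trig_mxP tA dA; apply/matrixP => i j; rewrite mxE.
have [//|ij|/val_inj ->] := ltngtP j i; last by rewrite eqxx dA.
by rewrite -val_eqE /= (ltn_eqF ij) tA.
Qed.

Lemma UT_inj n (u v : UT n) : sval u = sval v -> u = v.
Proof. exact: val_inj. Qed.

Definition UT1 n : UT n := UTof 1%:M.
Lemma UT1E n : sval (UT1 n) = 1%:M.
Proof.
apply: UTofE; apply/unitriP; split=> [|i]; last by rewrite mxE eqxx.
exact: scalar_mx_is_trig.
Qed.

Definition dg n (b : 'M[k]_n) : 'M[k]_n := diag_mx (\row_i b i i).

Lemma dg_trig n (b : 'M[k]_n) : is_trig_mx (dg b).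
Proof. exact: diag_mx_is_trig. Qed.

Lemma dg_diag n (b : 'M[k]_n) i : dg b i i = b i i.
Proof. by rewrite !mxE eqxx. Qed.

Lemma dgM n (b c : 'M[k]_n) : is_trig_mx b -> is_trig_mx c ->
  dg (b *m c) = dg b *m dg c.
Proof.
move=> tb tc; rewrite /dg mulmx_diag; congr diag_mx; apply/rowP => i.
by rewrite !mxE -trig_mulmx_diag // mxE.
Qed.

Lemma dg_mul n p (b : 'M[k]_n) (A : 'M[k]_(n, p)) i j : (dg b *m A) i j = b i i * A i j.
Proof. by rewrite mul_diag_mx !mxE. Qed.

Definition lowu n (b : 'M[k]_n) := is_trig_mx b && (b \in unitmx).

Lemma lowuM n (b c : 'M[k]_n) : lowu b -> lowu c -> lowu (b *m c).
Proof.
move=> /andP[tb ub] /andP[tc uc]; rewrite /lowu trig_mulmx //=.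
by rewrite unitmx_mul ub.
Qed.

Lemma unitri_lowu n (u : 'M[k]_n) : unitri u -> lowu u.
Proof. by move=> uu; rewrite /lowu unitri_unit // andbT; case/andP: uu. Qed.

Lemma unitri_dg n (u : 'M[k]_n) : unitri u -> dg u = 1%:M.
Proof.
case/unitriP=> _ du; rewrite -(diag_const_mx n 1); congr diag_mx.
by apply/rowP => i; rewrite !mxE du.
Qed.

(** A pair (M, u) stands for the point u M of the U-orbit of M. When b with diagonal part t moves M
    to b M, this point must move to t u M, so that u becomes t u b^-1 ([cj_mul]). *)
Definition cj n (b : 'M[k]_n) (u : UT n) : UT n :=
  UTof (dg b *m sval u *m invmx b).

Lemma cjE n (b : 'M[k]_n) (u : UT n) : lowu b ->
  sval (cj b u) = dg b *m sval u *m invmx b.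
Proof.
case/andP=> tb ub; apply: UTofE.
have /unitriP[tu du] := svalP u; have td := dg_trig b.
apply/unitriP; split=> [|i].
  by apply/trig_mulmx; [apply: trig_mulmx | apply: trig_invmx].
rewrite trig_mulmx_diag ?trig_mulmx ?trig_invmx // trig_mulmx_diag //.
by rewrite du mulr1 dg_diag trig_invmx_diag // mulfV // trig_unit_diag.
Qed.

Lemma cj_mul n (b : 'M[k]_n) (u : UT n) (M : 'M[k]_n) : lowu b ->
  sval (cj b u) *m (b *m M) = dg b *m (sval u *m M).
Proof.
by move=> lb; rewrite cjE // !mulmxA mulmxKV //; case/andP: lb.
Qed.

Lemma cjM n (b c : 'M[k]_n) u : lowu b -> lowu c ->
  cj b (cj c u) = cj (b *m c) u.
Proof.
move=> lb lc; apply: UT_inj; have lbc := lowuM lb lc; rewrite !cjE //.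
move: lb lc => /andP[tb ub] /andP[tc uc].
by rewrite dgM // invmx_mul // !mulmxA.
Qed.

Definition chi n (lam : 'I_n -> int) (b : 'M[k]_n) : k :=
  \prod_(i < n) b i i ^ lam i.

Lemma chi_unitri n (lam : 'I_n -> int) (u : 'M[k]_n) : unitri u -> chi lam u = 1.
Proof.
by case/unitriP => _ du; apply: big1 => i _; rewrite du exp1rz.
Qed.

Section LU.
Variable n : nat.
Implicit Types (M b : 'M[k]_n).

Definition wd (i : 'I_n) : 'I_i -> 'I_n := widen_ord (ltnW (ltn_ord i)).
Definition corner (i : 'I_n) M : 'M[k]_i := \matrix_(a, c) M (wd a) (wd c).
(** The product of all leading principal minors: its nonvanishing locus is the big cell, where M has
    an LU decomposition. *)
Definition Delta M : k := (\prod_(i < n) \det (corner i M)) * \det M.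

Lemma sum_wd (i : 'I_n) (F : 'I_n -> k) : (forall l : 'I_n, (i <= l)%N -> F l = 0) ->
  \sum_l F l = \sum_(a < i) F (wd a).
Proof.
move=> F0; rewrite (bigID (fun l : 'I_n => (l < i)%N)) /= [X in _ + X]big1.
  by rewrite addr0 (big_ord_narrow (ltnW (ltn_ord i))).
by move=> l; rewrite -leqNgt; apply: F0.
Qed.

Lemma corner_mul i b M : is_trig_mx b -> corner i (b *m M) = corner i b *m corner i M.
Proof.
move=> /is_trig_mxP tb; apply/matrixP => a c; rewrite !mxE (sum_wd (i := i)).
  by apply: eq_bigr => l _; rewrite !mxE.
by move=> l il; rewrite tb ?mul0r //=; apply: leq_trans il.
Qed.

Lemma corner_trig i b : is_trig_mx b -> is_trig_mx (corner i b).
Proof. by move=> /is_trig_mxP tb; apply/is_trig_mxP => a c ac; rewrite mxE tb. Qed.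

Lemma Delta_semi : exists w : 'I_n -> nat, forall b M, is_trig_mx b ->
  Delta (b *m M) = (\prod_i b i i ^+ w i) * Delta M.
Proof.
exists (fun l => (\sum_(i < n) (l < i) + 1)%N) => b M tb.
have cE : \prod_(i < n) \det (corner i (b *m M)) =
    (\prod_(i < n) \prod_(a < i) b (wd a) (wd a)) * \prod_(i < n) \det (corner i M).
  rewrite -big_split; apply: eq_bigr => i _ /=.
  rewrite corner_mul // det_mulmx det_trig ?corner_trig //; congr (_ * _).
  by apply: eq_bigr => a _; rewrite mxE.
have wE : \prod_i b i i ^+ (\sum_(j < n) (i < j) + 1) =
    (\prod_(i < n) \prod_(a < i) b (wd a) (wd a)) * \prod_i b i i.
  rewrite -big_split /=; under eq_bigr do rewrite exprD expr1.
  rewrite !big_split /=; congr (_ * _); under eq_bigr do rewrite -prodrXr.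
  rewrite exchange_big; apply: eq_bigr => i _ /=.
  rewrite (bigID (fun l : 'I_n => (l < i)%N)) /= [X in _ * X]big1 ?mulr1; last first.
    by move=> l /negPf ->; rewrite expr0.
  rewrite (big_ord_narrow (ltnW (ltn_ord i))) /=.
  by apply: eq_bigr => a _; rewrite ltn_ord expr1.
rewrite /Delta cE wE det_mulmx det_trig //.
by rewrite mulrACA.
Qed.

(** The inverse of the lower unitriangular factor in M = L U. Row i solves the linear system with
    matrix [corner i M] that kills the first i entries of row i of [tau M *m M]. *)
Definition tau M : UT n := UTof (\matrix_(i, j)
  - \sum_(a < i | wd a == j) ((\row_c M i (wd c)) *m invmx (corner i M)) 0 a).

Lemma Delta_unit M : Delta M != 0 ->
  M \in unitmx /\ forall i, corner i M \in unitmx.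
Proof.
rewrite mulf_eq0 negb_or => /andP[cM dM]; split; first by rewrite unitmxE unitfE.
move=> i; rewrite unitmxE unitfE.
by move: cM; rewrite prodf_seq_neq0 => /allP/(_ i (mem_index_enum i)).
Qed.

Lemma tau_upper M : Delta M != 0 -> is_trig_mx (sval (tau M) *m M)^T.
Proof.
move=> /Delta_unit[_ cM]; apply/is_trig_mxP => c i ci; rewrite mxE mxE.
rewrite (bigD1 i) //= mxE ltnn eqxx mul1r.
pose r := (\row_c M i (wd c)) *m invmx (corner i M).
rewrite (eq_bigr (fun j : 'I_n => - ((j < i)%N%:R * ((\sum_(a < i | wd a == j) r 0 a) * M j c)))).
  rewrite sumrN [X in _ - X](_ : _ = M i c) ?subrr //.
  transitivity (\sum_(j < n) (j < i)%N%:R * ((\sum_(a < i | wd a == j) r 0 a) * M j c)).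
    by rewrite [RHS](bigD1 i) //= ltnn mul0r add0r.
  rewrite (sum_wd (i := i)); last by move=> l il; rewrite ltnNge il mul0r.
  have : r *m corner i M = \row_c M i (wd c) by rewrite mulmxKV.
  move: r => r /rowP/(_ (Ordinal ci)); rewrite !mxE.
  have -> : wd (Ordinal ci) = c by apply: val_inj.
  move=> <-; apply: eq_bigr => a _.
  rewrite (ltn_ord a : (wd a < i)%N) mul1r !mxE.
  have -> : wd (Ordinal ci) = c by apply: val_inj.
  by congr (_ * _); rewrite (big_pred1 a).
move=> j ji; rewrite !mxE; case: ltnP => ij; first by rewrite mul1r mulNr.
by rewrite eq_sym (negPf ji) mul0r mul0r oppr0.
Qed.

(** Two candidates differ by a matrix that is both lower unitriangular and upper triangular.
    Uniqueness yields the equivariance [tau_cj]. *)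
Lemma tau_unique M (u v : UT n) : M \in unitmx ->
  is_trig_mx (sval u *m M)^T -> is_trig_mx (sval v *m M)^T -> u = v.
Proof.
move=> uM tu tv; apply: UT_inj.
have uu := unitri_unit (svalP u).
have uuM : sval u *m M \in unitmx by rewrite unitmx_mul uu.
pose w := sval v *m invmx (sval u).
have wu : unitri w by apply: unitriM (svalP v) (unitriV (svalP u)).
have wE : w *m (sval u *m M) = sval v *m M by rewrite mulmxA mulmxKV.
have tw : is_trig_mx w^T.
  have -> : w = sval v *m M *m invmx (sval u *m M) by rewrite -wE mulmxK.
  by rewrite trmx_mul trig_mulmx // trmx_inv trig_invmx // unitmx_tr.
have w1 : w = 1%:M.
  move: w wu tw {wE} => w /unitriP[/is_trig_mxP wl dw] /is_trig_mxP tw.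
  apply/matrixP => i j; rewrite mxE.
  have [ij|ji|/val_inj ->] := ltngtP i j; last by rewrite eqxx dw.
    by rewrite wl // -val_eqE /= (ltn_eqF ij).
  by have := tw j i ji; rewrite mxE => ->; rewrite -val_eqE /= (gtn_eqF ji).
by rewrite -[sval v](mulmxKV uu) -/w w1 mul1mx.
Qed.

Lemma tau_cj b M : lowu b -> Delta M != 0 -> Delta (b *m M) != 0 ->
  tau (b *m M) = cj b (tau M).
Proof.
move=> lb DM DbM; have [uM _] := Delta_unit DM.
apply: (@tau_unique (b *m M)); first by rewrite unitmx_mul uM; case/andP: lb => _ ->.
  exact: tau_upper.
rewrite cj_mul // trmx_mul trig_mulmx //; first exact: tau_upper.
by rewrite tr_diag_mx diag_mx_is_trig.
Qed.

(** The upper unitriangular factor of the LU decomposition: a canonical point of the B-orbit of M,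
    which depends rationally on M. It turns polynomial functions into B-invariant ones. *)
Definition normal M :=
  invmx (dg (sval (tau M) *m M)) *m (sval (tau M) *m M).

Lemma normal_orbit M : Delta M != 0 -> exists2 b, lowu b & normal M = b *m M.
Proof.
move=> DM; have [uM _] := Delta_unit DM; have tr := tau_upper DM.
rewrite /normal; set r := _ *m M in tr *.
have ur : r \in unitmx by rewrite unitmx_mul uM unitri_unit ?(svalP (tau M)).
have ud : dg r \in unitmx.
  rewrite trig_unitP ?dg_trig //; apply/forallP => i; rewrite dg_diag.
  by have := trig_unit_diag i tr; rewrite unitmx_tr [_^T _ _]mxE => /(_ ur).
exists (invmx (dg r) *m sval (tau M)); last by rewrite mulmxA.
apply: lowuM; last exact: (unitri_lowu (svalP (tau M))).
by rewrite /lowu unitmx_inv ud trig_invmx // dg_trig.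
Qed.

Lemma normal_semi b M : lowu b -> Delta M != 0 -> Delta (b *m M) != 0 ->
  normal (b *m M) = normal M.
Proof.
move=> lb DM DbM; have [uM _] := Delta_unit DM.
rewrite /normal tau_cj // cj_mul //; set r := _ *m M.
have db : dg b \in unitmx.
  case/andP: lb => tb ub; rewrite trig_unitP ?dg_trig //; apply/forallP => i.
  by rewrite dg_diag trig_unit_diag.
have -> : dg (dg b *m r) = dg b *m dg r.
  rewrite /dg mulmx_diag; congr diag_mx; apply/rowP => i.
  by rewrite [LHS]mxE dg_mul !mxE.
have ud : dg r \in unitmx.
  have tr := tau_upper DM.
  have ur : r \in unitmx by rewrite unitmx_mul uM unitri_unit ?(svalP (tau M)).
  rewrite trig_unitP ?dg_trig //; apply/forallP => i; rewrite dg_diag.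
  by have := trig_unit_diag i tr; rewrite unitmx_tr [_^T _ _]mxE => /(_ ur).
have -> : invmx (dg b *m dg r) = invmx (dg r) *m invmx (dg b).
  by rewrite invmx_mul.
by rewrite mulmxA mulmxKV.
Qed.

End LU.
End Triangular.

(** * Coordinate functions and regularity of the LU decomposition *)

Section Coordinates.
Variable k : closedFieldType.

Definition coordM r n (f : 'M[k]_(r, n) -> k) := exists i j, f = fun M => M i j.
(** Positions beyond the end of the sequence read as the identity matrix, so the same coordinates
    serve for all numbers of points. *)
Definition coordU r n (f : 'M[k]_(r, n) * seq (UT k r) -> k) :=
  (exists i j, f = fun x => x.1 i j) \/
  (exists l i j, f = fun x => sval (nth (UT1 k r) x.2 l) i j).

Lemma pol_entry r n i j : pol (@coordM r n) (fun M => M i j).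
Proof. by apply: pol_gen; exists i, j. Qed.

Lemma pol_coordM_U r n f : pol (@coordM r n) f -> pol (@coordU r n) (fun x => f x.1).
Proof. by apply: pol_subst => _ [i [j ->]]; apply: pol_gen; left; exists i, j. Qed.

Lemma pol_entryU r n l i j :
  pol (@coordU r n) (fun x => sval (nth (UT1 k r) x.2 l) i j).
Proof. by apply: pol_gen; right; exists l, i, j. Qed.

Lemma pol_coordM_gens n f : pol (@coordM n n) f ->
  pol (gens (fun (a : 'I_(n * n)) (M : 'M[k]_n) => mxvec M 0 a)) f.
Proof.
apply: (pol_subst (phi := id)) => _ [i [j ->]]; apply: pol_gen.
by exists (mxvec_index i j); apply/funext => M; rewrite mxvecE.
Qed.

Lemma pol_gens_coordM n f :
  pol (gens (fun (a : 'I_(n * n)) (M : 'M[k]_n) => mxvec M 0 a)) f ->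
  pol (@coordM n n) f.
Proof.
apply: (pol_subst (phi := id)) => _ [a ->]; case/mxvec_indexP: a => i j.
by apply: eq_pol (pol_entry i j) => M; rewrite mxvecE.
Qed.

Lemma pol_mxeval n f : pol (@coordM n n) f ->
  exists q : mpoly (n * n) k, forall M, mxeval q M = f M.
Proof. by move=> /pol_coordM_gens/pol_mpoly[q qE]; exists q => M; rewrite qE. Qed.

Lemma mxeval_pol n (q : mpoly (n * n) k) : pol (@coordM n n) (mxeval q).
Proof.
by apply/pol_gens_coordM/mpoly_pol => a; apply: pol_gen; exists a.
Qed.

Lemma cover_power n (T : Type) (Q : T -> 'M[k]_n -> k) (F : 'M[k]_n -> k) :
  (forall t, pol (@coordM n n) (Q t)) -> pol (@coordM n n) F ->
  (forall M, F M != 0 -> exists t, Q t M != 0) ->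
  exists K s (t : 'I_s -> T) (g : 'I_s -> 'M[k]_n -> k),
    (forall i, pol (@coordM n n) (g i)) /\
    forall M, F M ^+ K = \sum_i g i M * Q (t i) M.
Proof.
move=> pQ pF FQ.
have [||||K [s [t [g [pg gE]]]]] := nullstellensatz_cover (T := T) (Q := Q)
  (F := F) (x := fun (a : 'I_(n * n)) (M : 'M[k]_n) => mxvec M 0 a).
- move=> c; exists (vec_mx (\row_a c a)) => a.
  by rewrite vec_mxK mxE.
- by move=> t; apply/pol_coordM_gens.
- exact/pol_coordM_gens.
- exact: FQ.
by exists K, s, t, g; split=> // i; apply/pol_gens_coordM.
Qed.

Lemma reg_invmx X (C : (X -> k) -> Prop) dom q m (A : X -> 'M[k]_m) : pol C q ->
  (forall i j, reg C dom q (fun x => A x i j)) ->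
  reg C dom q (fun x => (\det (A x))^-1) ->
  (forall x, dom x -> q x != 0 -> A x \in unitmx) ->
  forall i j, reg C dom q (fun x => (invmx (A x)) i j).
Proof.
move=> pq rA rd uA i j.
have rdet p (B : X -> 'M[k]_p) : (forall i j, reg C dom q (fun x => B x i j)) ->
    reg C dom q (fun x => \det (B x)).
  move=> rB; rewrite /determinant; apply: reg_sum => // s _.
  by apply: regM => //; [apply/reg_pol/pol_cst | apply: reg_prod].
apply: (@eq_reg _ _ _ _ _ (fun x => (\det (A x))^-1 * cofactor (A x) j i)).
  by move=> x dx qx; rewrite /invmx uA // !mxE.
apply: regM => //; apply: regM => //; first exact/reg_pol/pol_cst.
apply: rdet => a b; apply: eq_reg (rA (lift j a) (lift i b)) => x _ _.
by rewrite !mxE.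
Qed.

Lemma reg_inv_factor X (C : (X -> k) -> Prop) dom q f g : pol C g ->
  (forall x, dom x -> q x = f x * g x) -> reg C dom q (fun x => (f x)^-1).
Proof.
move=> pg qE; exists 1, g; split=> // x dx qx; rewrite expr1 qE // invfM.
have : f x * g x != 0 by rewrite -qE.
by rewrite mulf_eq0 negb_or => /andP[_ g0]; rewrite mulrCA mulfV // mulr1.
Qed.

Section LUreg.
Variable n : nat.

Lemma pol_Delta : pol (@coordM n n) (@Delta k n).
Proof.
apply: polM; last by apply: pol_det => i j; apply: pol_entry.
apply: pol_prod => i _; apply: pol_det => a b.
by apply: eq_pol (pol_entry (wd a) (wd b)) => M; rewrite mxE.
Qed.

Let C := @coordM n n.
Let all := fun _ : 'M[k]_n => True.

Lemma reg_det_inv : reg C all (@Delta k n) (fun M => (\det M)^-1).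
Proof.
apply: (@reg_inv_factor _ _ _ _ _ (fun M : 'M[k]_n => \prod_(i < n) \det (corner i M))).
  apply: pol_prod => i _; apply: pol_det => a b.
  by apply: eq_pol (pol_entry (wd a) (wd b)) => M; rewrite mxE.
by move=> M _; rewrite mulrC.
Qed.

Lemma tau_reg i j : reg C all (@Delta k n) (fun M => sval (tau M) i j).
Proof.
apply: (@eq_reg _ _ _ _ _ (fun M : 'M[k]_n => if (j < i)%N then
  - \sum_(a < i | wd a == j) ((\row_c M i (wd c)) *m invmx (corner i M)) 0 a
  else (i == j)%:R)).
  by move=> M _ _; rewrite !mxE.
case: (j < i)%N => /=; last exact/reg_pol/pol_cst.
apply: regN; apply: (reg_sum pol_Delta) => a _.
apply: (reg_mulmx pol_Delta) => [b c|b c].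
  by apply: eq_reg (reg_pol _ _ (pol_entry i (wd c))) => M _ _; rewrite mxE.
apply: (reg_invmx pol_Delta) => [b' c'||M _ /Delta_unit[]//].
  by apply: eq_reg (reg_pol _ _ (pol_entry (wd b') (wd c'))) => M _ _; rewrite mxE.
apply: (@reg_inv_factor _ _ _ _ _
    (fun M : 'M[k]_n => (\prod_(l < n | l != i) \det (corner l M)) * \det M)).
  apply: polM; last by apply: pol_det => ? ?; apply: pol_entry.
  apply: pol_prod => l _; apply: pol_det => a' b'.
  by apply: eq_pol (pol_entry (wd a') (wd b')) => M; rewrite mxE.
by move=> M _; rewrite /Delta (bigD1 i) //= mulrA.
Qed.

Lemma normal_reg i j : reg C all (@Delta k n) (fun M => normal M i j).
Proof.
pose r (M : 'M[k]_n) := sval (tau M) *m M.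
have rr a b : reg C all (@Delta k n) (fun M => r M a b).
  apply: (reg_mulmx pol_Delta) => [c d|c d]; first exact: tau_reg.
  exact/reg_pol/pol_entry.
have rd (M : 'M[k]_n) : Delta M != 0 -> (dg (r M) \in unitmx) /\ \det (dg (r M)) = \det M.
  move=> DM; have tr := tau_upper DM; have [uM _] := Delta_unit DM.
  have dE : \det (dg (r M)) = \det M.
    rewrite det_trig ?dg_trig //; transitivity (\det (r M)^T).
      by rewrite det_trig //; apply: eq_bigr => l _; rewrite dg_diag [RHS]mxE.
    rewrite det_tr /r det_mulmx det_trig; last by case/andP: (svalP (tau M)).
    by rewrite big1 ?mul1r // => l _; case/unitriP: (svalP (tau M)).
  by split=> //; rewrite unitmxE dE -unitmxE.
apply: (reg_mulmx pol_Delta) => [a b|a b]; last exact: rr.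
apply: (reg_invmx pol_Delta) => [c d||M _ /rd[]//].
  apply: (@eq_reg _ _ _ _ _ (fun M : 'M[k]_n => r M c c *+ (c == d))).
    by move=> M _ _; rewrite !mxE.
  case: (c == d); first exact: rr.
  apply: (@eq_reg _ _ _ _ _ (fun=> 0)); last exact/reg_pol/pol_cst.
  by [] .
by apply: eq_reg reg_det_inv => M _ /rd[_ ->].
Qed.

End LUreg.
End Coordinates.

(** * The flag variety *)

Section FlagCharts.
Local Open Scope classical_set_scope.
Variables (k : closedFieldType) (n : nat).
Notation G := (GL k n).

Definition antidiag : 'M[k]_n := \matrix_(i, j) (j == rev_ord i)%:R.

Lemma antidiag_mul p (A : 'M[k]_(n, p)) i j : (antidiag *m A) i j = A (rev_ord i) j.
Proof.
rewrite mxE (bigD1 (rev_ord i)) //= mxE eqxx mul1r big1 ?addr0 // => l /negPf li.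
by rewrite mxE li mul0r.
Qed.

Lemma mul_antidiag p (A : 'M[k]_(p, n)) i j : (A *m antidiag) i j = A i (rev_ord j).
Proof.
rewrite mxE (bigD1 (rev_ord j)) //= mxE rev_ordK eqxx mulr1 big1 ?addr0 // => l lj.
by rewrite mxE -(inj_eq rev_ord_inj) rev_ordK eq_sym (negPf lj) mulr0.
Qed.

Lemma antidiagK : antidiag *m antidiag = 1%:M.
Proof.
apply/matrixP => i j; rewrite antidiag_mul !mxE -(inj_eq rev_ord_inj) !rev_ordK.
by rewrite (inj_eq rev_ord_inj) eq_sym.
Qed.

Lemma antidiag_unit : antidiag \in unitmx.
Proof. by case: (mulmx1_unit antidiagK). Qed.

Fact Mof_subproof (g : G) : antidiag *m invmx g \in unitmx.
Proof. by rewrite unitmx_mul antidiag_unit unitmx_inv glmxP. Qed.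
(* The rows of [Mof g] are linear forms; the i-th subspace of the flag of g
   is the common kernel of the first n - i of them. *)
Definition Mof (g : G) : G := MkGL (Mof_subproof g).

Fact gof_subproof (M : G) : invmx M *m antidiag \in unitmx.
Proof. by rewrite unitmx_mul antidiag_unit unitmx_inv glmxP. Qed.
Definition gof (M : G) : G := MkGL (gof_subproof M).

Lemma invJ : invmx antidiag = antidiag.
Proof.
by rewrite -[RHS](mulKmx antidiag_unit) antidiagK mulmx1.
Qed.

Lemma MofK g : gof (Mof g) = g.
Proof.
apply: GL_inj => /=; rewrite invmx_mul ?antidiag_unit ?unitmx_inv ?glmxP //.
by rewrite invmxK invJ -mulmxA antidiagK mulmx1.
Qed.

Lemma gofK M : Mof (gof M) = M.
Proof.
apply: GL_inj => /=; rewrite invmx_mul ?antidiag_unit ?unitmx_inv ?glmxP //.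
by rewrite invmxK invJ mulmxA antidiagK mul1mx.
Qed.

Definition fl (M : G) : flag k n := frame_flag (gof M).

Lemma trig_antidiag (b : 'M[k]_n) :
  is_trig_mx b -> is_trig_mx (antidiag *m b *m antidiag)^T.
Proof.
move=> /is_trig_mxP tb; apply/is_trig_mxP => i j ij.
rewrite mxE mul_antidiag antidiag_mul; apply: tb => /=.
by rewrite ltn_sub2l // (leq_trans _ (ltn_ord j)).
Qed.

Lemma trig_antidiag' (b : 'M[k]_n) :
  is_trig_mx b^T -> is_trig_mx (antidiag *m b *m antidiag).
Proof.
move=> /is_trig_mxP tb; apply/is_trig_mxP => i j ij.
rewrite mul_antidiag antidiag_mul; have := tb (rev_ord j) (rev_ord i).
by rewrite mxE; apply => /=; rewrite ltn_sub2l // (leq_trans _ (ltn_ord j)).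
Qed.

Lemma fl_low (b M : G) : is_trig_mx b -> fl (GLmul b M) = fl M.
Proof.
move=> tb; pose c : 'M_n := antidiag *m invmx b *m antidiag.
have uc : c \in unitmx by rewrite !unitmx_mul antidiag_unit unitmx_inv glmxP.
have -> : fl (GLmul b M) = frame_flag (GLmul (gof M) (MkGL uc)).
  congr frame_flag; apply: GL_inj => /=.
  rewrite invmx_mul ?glmxP // /c !mulmxA; congr (_ *m _).
  by rewrite -[_ *m antidiag *m antidiag]mulmxA antidiagK mulmx1.
by rewrite frame_flagMr // /c; apply/trig_antidiag/trig_invmx => //; apply: glmxP.
Qed.

(** Column j is picked in a complement of V_j in V_(j+1), so the first i columns span V_i by a count
    of dimensions. *)
Lemma flag_frame (V : flag k n) : exists g : G, frame_flag g = V.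
Proof.
case/andP: (svalP V) => /forallP dV /forallP sV.
have dVi i : \dim (sval V i) = i by apply/eqP.
have sVij (i j : 'I_n.+1) : (i <= j)%N -> (sval V i <= sval V j)%VS.
  by move=> ij; move/forallP/(_ j)/implyP: (sV i); apply.
pose V' i := sval V (inord i).
have dV' i : (i <= n)%N -> \dim (V' i) = i by move=> ?; rewrite dVi inordK.
pose v (j : 'I_n) := vpick (V' j.+1 :\: V' j)%VS.
pose s := [seq v j | j <- enum 'I_n].
have sz : size s = n by rewrite size_map size_enum_ord.
have span_s i : (i <= n)%N -> <<take i s>>%VS = V' i.
  elim: i => [|i IHi] i_n.
    rewrite take0 span_nil; apply/esym/eqP; rewrite -dimv_eq0 dV' //.
  rewrite (take_nth 0) ?sz // -cats1 span_cat span_seq1 IHi ?(ltnW i_n) //.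
  rewrite (nth_map (Ordinal i_n)) ?size_enum_ord // (nth_ord_enum (Ordinal i_n) (Ordinal i_n)).
  have sVi : (V' i <= V' i.+1)%VS by apply: sVij; rewrite !inordK // ltnW.
  have vin := memv_pick (V' i.+1 :\: V' i)%VS.
  have vV : v (Ordinal i_n) \in V' i.+1 by apply: (subvP (diffvSl _ _)) vin.
  have vnV : v (Ordinal i_n) \notin V' i.
    apply: contraTN isT => vVi.
    have : v (Ordinal i_n) \in ((V' i.+1 :\: V' i) :&: V' i)%VS by rewrite memv_cap vin.
    rewrite capv_diff memv0 vpick0 diffv_eq0 => /dimvS.
    by rewrite !dV' ?(ltnW i_n) // ltnn.
  have sVv : (V' i + <[v (Ordinal i_n)]> <= V' i.+1)%VS.
    by rewrite subv_add sVi -memvE.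
  apply/eqP; rewrite eqEdim sVv dV' // ltnNge; apply: contra vnV => di.
  have /eqP -> : V' i == (V' i + <[v (Ordinal i_n)]>)%VS.
    by rewrite eqEdim addvSl dV' // ltnW.
  by rewrite memvE addvSr.
pose g : 'M[k]_n := \matrix_(a, j) v j a 0.
have colg j : col j g = v j by apply/colP => a; rewrite !mxE.
have fs : free s.
  by rewrite /free -(take_oversize (leqnn (size s))) sz span_s // dV' // take_oversize ?sz.
have ug : g \in unitmx.
  rewrite -unitmx_tr -row_free_unit; apply: inj_row_free => c c0.
  apply/rowP => i; rewrite [RHS]mxE; pose t := [tuple v j | j < n].
  have /freeP ft : free t by [].
  apply: (ft (fun j => c 0 j)).
  apply/colP => a; rewrite summxE [RHS]mxE.
  move/rowP/(_ a): c0; rewrite !mxE => e0; rewrite -[RHS]e0; apply: eq_bigr => j _.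
  by rewrite (nth_map j) ?size_enum_ord // nth_ord_enum !mxE.
exists (MkGL ug); apply: val_inj; apply/ffunP => i; rewrite ffunE /=.
rewrite (_ : [seq col j g | j <- enum 'I_n] = s); last by apply: eq_map.
rewrite span_s; last by rewrite -ltnS.
by rewrite /V' inord_val.
Qed.

Lemma flP (V : flag k n) : exists M, fl M = V.
Proof. by have [g <-] := flag_frame V; exists (Mof g); rewrite /fl MofK. Qed.

Lemma fl_inj (M M' : G) : fl M = fl M' ->
  exists2 b : G, is_trig_mx b & M' = GLmul b M.
Proof.
move=> MM'; pose c := GLmul (GLinv (gof M)) (gof M').
have g1 : GLmul (GLinv (gof M)) (gof M) = MkGL (unitmx1 _ _).
  by apply: GL_inj; rewrite /= mulVmx // gof_subproof.
have c1 : frame_flag c = frame_flag (MkGL (unitmx1 _ _)).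
  by rewrite -g1 !frame_flagM -/(fl M) -/(fl M') MM'.
have tc : is_trig_mx (c : 'M_n)^T.
  apply/is_trig_mxP => j i ji; rewrite mxE.
  have : col j c \in sval (frame_flag c) (inord j.+1).
    rewrite ffunE /= inordK ?ltnS //; apply: memv_span; rewrite -map_take.
    by apply: map_f; rewrite in_take ?mem_enum // index_enum_ord.
  rewrite c1 ffunE /= inordK ?ltnS // => cj.
  (* The i-th coordinate form vanishes on the first j + 1 <= i columns of the identity, hence on
     column j of c. *)
  pose f : 'Hom('cV[k]_n, 'cV[k]_1) := linfun (mulmx (delta_mx 0 i)).
  have : (<<take j.+1 [seq col j0 1%:M | j0 <- enum 'I_n]>> <= lker f)%VS.
    apply/span_subvP => v; rewrite -map_take => /mapP[l lj ->].
    have := index_ltn lj; rewrite index_enum_ord => lj'.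
    have il : (i == l) = false.
      by rewrite -val_eqE; apply: gtn_eqF; apply: leq_trans lj' ji.
    by rewrite memv_ker lfunE /= colE mul1mx mul_delta_mx_cond il.
  move/subvP/(_ _ cj); rewrite memv_ker lfunE /= -rowE => /eqP/matrixP/(_ 0 0).
  by rewrite !mxE.
pose b0 : 'M_n := antidiag *m invmx c *m antidiag.
have ub0 : b0 \in unitmx by rewrite !unitmx_mul antidiag_unit unitmx_inv glmxP.
have tb0 : is_trig_mx b0.
  apply: trig_antidiag'; rewrite trmx_inv trig_invmx // unitmx_tr; exact: glmxP.
exists (MkGL ub0) => //; apply: GL_inj; rewrite /= /b0.
have -> : (c : 'M_n) = antidiag *m M *m (invmx M' *m antidiag).
  by rewrite /= invmx_mul ?antidiag_unit ?unitmx_inv ?glmxP // invmxK invJ.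
rewrite !invmx_mul ?unitmx_mul ?antidiag_unit ?unitmx_inv ?glmxP // invmxK invJ.
by rewrite !mulmxA antidiagK mul1mx -!mulmxA [antidiag *m (_ *m M)]mulmxA antidiagK mul1mx mulVmx ?mulmx1 ?glmxP.
Qed.

Lemma reg_det_pol (F : 'M[k]_n -> k) (phi : 'M[k]_n -> 'M[k]_n) :
  pol (@coordM k n n) F ->
  (forall i j, reg (@coordM k n n) (fun M => M \in unitmx) (fun M => \det M)
     (fun M => phi M i j)) ->
  exists N F', pol (@coordM k n n) F' /\
    forall M : G, F' M = F (phi M) * \det M ^+ N.
Proof.
move=> pF rphi.
have pdet : pol (@coordM k n n) (fun M => \det M).
  by apply: pol_det => i j; apply: pol_entry.
have [|N [a [pa aE]]] := reg_subst (dom := fun M : 'M[k]_n => M \in unitmx)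
    pdet (phi := phi) _ pF.
  by move=> _ [i [j ->]]; apply: rphi.
exists N, a; split=> // M; have uM : \det M != 0 by rewrite -unitfE -unitmxE glmxP.
by rewrite aE ?glmxP // mulfVK // expf_neq0.
Qed.

Lemma reg_inv_entry i j :
  reg (@coordM k n n) (fun M => M \in unitmx) (fun M => \det M)
    (fun M => (invmx M) i j).
Proof.
have pdet : pol (@coordM k n n) (fun M => \det M).
  by apply: pol_det => ? ?; apply: pol_entry.
apply: reg_invmx => // [a b|]; first exact/reg_pol/pol_entry.
by exists 1, (fun=> 1); split=> [|x _ _]; [exact: pol_cst | rewrite expr1 mul1r].
Qed.

Lemma pol_of_G (q : mpoly (n * n) k) : exists N F,
  pol (@coordM k n n) F /\ forall M : G, F M = mxeval q (gof M) * \det M ^+ N.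
Proof.
apply: (reg_det_pol (phi := fun M => invmx M *m antidiag)); first exact: mxeval_pol.
move=> i j; apply: eq_reg (reg_inv_entry i (rev_ord j)) => M _ _.
by rewrite mul_antidiag.
Qed.

Lemma pol_to_G F : pol (@coordM k n n) F -> exists N (q : mpoly (n * n) k),
  forall g : G, mxeval q g = F (Mof g) * \det g ^+ N.
Proof.
move=> pF; have [|N [F' [pF' F'E]]] :=
    reg_det_pol (phi := fun M => antidiag *m invmx M) pF.
  move=> i j; apply: eq_reg (reg_inv_entry (rev_ord i) j) => M _ _.
  by rewrite antidiag_mul.
by have [q qE] := pol_mxeval pF'; exists N, q => g; rewrite qE F'E.
Qed.

(** Semi-invariance makes {F != 0} descend to an open set of flags. By the last clause its preimage
    is principal in the affine space of all matrices, where the Nullstellensatz applies. *)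
Definition semi_pol (F : 'M[k]_n -> k) :=
  [/\ pol (@coordM k n n) F,
      exists w : 'I_n -> nat, forall b M, lowu b ->
        F (b *m M) = (\prod_i b i i ^+ w i) * F M
    & forall M, F M != 0 -> M \in unitmx].

Definition bas (W : set (flag k n)) :=
  exists2 F, semi_pol F & forall M : G, W (fl M) <-> F M != 0.

Lemma det_neq0 (M : G) : \det M != 0.
Proof. by rewrite -unitfE -unitmxE glmxP. Qed.

Lemma bas_open W : bas W -> open W.
Proof.
move=> [F [pF _ _] WF]; suff: flag_open W by [].
move=> g; have [N [q qE]] := pol_to_G pF.
rewrite -(MofK g) -/(fl _) => /WF Fg.
exists q; first by rewrite MofK qE mulf_neq0 // expf_neq0 // det_neq0.
move=> g'; rewrite qE -(MofK g') -/(fl _) MofK => Fg'; apply/WF.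
by move: Fg'; rewrite mulf_eq0 negb_or => /andP[].
Qed.

Lemma semi_polM F F' : semi_pol F -> semi_pol F' -> semi_pol (fun M => F M * F' M).
Proof.
move=> [pF [w wE] uF] [pF' [w' w'E] uF']; split; first exact: polM.
  exists (fun i => w i + w' i)%N => b M tb; rewrite wE // w'E // mulrACA -big_split.
  by congr (_ * _); apply: eq_bigr => i _; rewrite exprD.
by move=> M; rewrite mulf_eq0 negb_or => /andP[/uF].
Qed.

Lemma basI U W : bas U -> bas W -> bas (U `&` W).
Proof.
move=> [F sF UF] [F' sF' WF']; exists (fun M => F M * F' M); first exact: semi_polM.
move=> M; rewrite mulf_eq0 negb_or; split.
  by case=> /UF -> /WF' ->.
by case/andP=> /UF ? /WF'.
Qed.

Lemma semi_pol_Delta (h : G) : semi_pol (fun M => Delta (M *m h)).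
Proof.
split.
- apply: (pol_subst (phi := fun M => M *m h)) (pol_Delta k n) => _ [i [j ->]].
  by apply: pol_mulmx => ? ?; [apply: pol_entry | apply: pol_cst].
- by have [w wE] := Delta_semi k n; exists w => b M /andP[tb _]; rewrite -mulmxA wE.
by move=> M /Delta_unit[]; rewrite unitmx_mul => /andP[].
Qed.

Lemma Delta1 : Delta (1%:M : 'M[k]_n) != 0.
Proof.
rewrite /Delta det1 mulr1 prodf_seq_neq0; apply/allP => i _ /=.
have -> : corner i (1%:M : 'M[k]_n) = 1%:M.
  by apply/matrixP => a b; rewrite !mxE -val_eqE.
by rewrite det1 oner_neq0.
Qed.

Lemma tau1 : tau (1%:M : 'M[k]_n) = UT1 k n.
Proof.
apply: (@tau_unique _ _ 1%:M); rewrite ?unitmx1 //.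
  exact: tau_upper Delta1.
by rewrite UT1E mulmx1 trmx1 scalar_mx_is_trig.
Qed.

Lemma normal1 : normal (1%:M : 'M[k]_n) = 1%:M.
Proof.
rewrite /normal tau1 UT1E mulmx1 unitri_dg ?invmx1 ?mulmx1 //.
by rewrite -(UT1E k n); apply: (svalP (UT1 k n)).
Qed.

Lemma reg_translate (h : G) f :
  reg (@coordM k n n) (fun=> True) (@Delta k n) f ->
  reg (@coordM k n n) (fun=> True) (fun M => Delta (M *m h)) (fun M => f (M *m h)).
Proof.
move=> [N [a [pa aE]]]; exists N, (fun M => a (M *m h)); split=> [|M _ DM].
  apply: (pol_subst (phi := fun M => M *m h)) pa => _ [i [j ->]].
  by apply: pol_mulmx => ? ?; [apply: pol_entry | apply: pol_cst].
exact: aE.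
Qed.

(** A polynomial F0 that cuts out a neighbourhood of M0 need not be semi-invariant. It becomes
    invariant when evaluated at [nf M], a point of the orbit of M that is rational on a translated
    big cell, and powers of [Dh] clear the denominators. The translation h is returned as well: the
    bar complex will be contracted over this cell. *)
Lemma bas_nbhs (U : set (flag k n)) x : open U -> U x ->
  exists (h : G) W, [/\ bas W, W x, W `<=` U &
    forall M : G, W (fl M) -> Delta (M *m h) != 0].
Proof.
have [M0 <-] := flP x => oU UM0.
have [q q0 qU] : exists2 q, mxeval q (gof M0) != 0
    & forall g' : G, mxeval q g' != 0 -> U (frame_flag g') := oU _ UM0.
have [N [F0 [pF0 F0E]]] := pol_of_G q.
have F0U (M : G) : F0 M != 0 -> U (fl M).
  by rewrite F0E mulf_eq0 negb_or => /andP[/qU].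
(* This h moves M0 to the identity, a point of the big cell that [normal] fixes. *)
pose h := GLinv M0; pose Dh M := Delta (M *m h).
pose nf M := normal (M *m h) *m M0.
have [pDh [w wE] uDh] : semi_pol Dh := semi_pol_Delta h.
have [|K [a [pa aE]]] := reg_subst (dom := fun=> True) pDh (phi := nf) _ pF0.
  move=> _ [i [j ->]].
  apply: (reg_mulmx pDh) => a b; last exact/reg_pol/pol_cst.
  exact: (reg_translate h (@normal_reg k n a b)).
(* One power of [Dh] more than the denominators require, so that F vanishes off the translated
   cell. *)
pose F M := a M * Dh M.
have FE M : F M = (if Dh M == 0 then 0 else F0 (nf M)) * Dh M ^+ K.+1.
  rewrite /F; have [->|D0] := eqVneq (Dh M) 0; first by rewrite mulr0 mul0r.
  have aF : F0 (nf M) * Dh M ^+ K = a M by rewrite aE // mulfVK // expf_neq0.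
  by rewrite exprSr [RHS]mulrA aF.
have low_mul b M : lowu b -> (b *m M) *m h = b *m (M *m h) by rewrite mulmxA.
have Dh_low b M : lowu b -> (Dh (b *m M) == 0) = (Dh M == 0).
  move=> lb; rewrite wE // mulf_eq0; apply/orb_idl => /eqP.
  move/eqP; rewrite prodf_seq_eq0 => /hasP[i _ /=]; rewrite expf_eq0 => /andP[_].
  by case/andP: lb => tb ub; rewrite (negPf (trig_unit_diag i tb ub)).
have sF : semi_pol F.
  split; first exact: polM.
    exists (fun i => w i * K.+1)%N => b M lb; rewrite !FE Dh_low //.
    have [_|D0] := eqVneq (Dh M) 0; first by rewrite !mul0r mulr0.
    have -> : nf (b *m M) = nf M.
      by rewrite /nf low_mul // normal_semi // -low_mul // -/(Dh _) Dh_low.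
    rewrite wE // exprMn mulrCA; congr (_ * _).
    by rewrite -prodrXl; apply: eq_bigr => i _; rewrite exprM.
  by move=> M; rewrite mulf_eq0 negb_or => /andP[_ /uDh].
have M0h : M0 *m h = 1%:M by rewrite /= mulmxV // glmxP.
have hM0 : h *m M0 = 1%:M by rewrite /= mulVmx // glmxP.
have FU (M : G) : F M != 0 -> U (fl M) /\ Dh M != 0.
  rewrite FE; have [_|D0] := eqVneq (Dh M) 0; first by rewrite mul0r eqxx.
  rewrite mulf_eq0 negb_or => /andP[F0n _]; split=> //.
  have [b lb bE] := normal_orbit D0; move: F0n; rewrite /nf bE -!mulmxA hM0 mulmx1.
  case/andP: lb => tb ub; move=> /(F0U (GLmul (MkGL ub) M)).
  by rewrite fl_low.
have F_fl (M M' : G) : fl M = fl M' -> F M != 0 -> F M' != 0.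
  move=> /fl_inj[b tb ->] FM; have lb : lowu b by rewrite /lowu tb glmxP.
  have [_ [w' w'E] _] := sF; rewrite w'E // mulf_neq0 //.
  rewrite prodf_seq_neq0; apply/allP => i _ /=; apply: expf_neq0.
  by apply: trig_unit_diag => //; apply: glmxP.
exists h, [set V | exists2 M, fl M = V & F M != 0]; split.
- exists F => // M; split=> [[M' MM']|FM]; first exact: F_fl.
  by exists M.
- exists M0 => //; rewrite FE /Dh M0h (negPf Delta1) mulf_neq0 ?expf_neq0 ?Delta1 //.
  rewrite /nf M0h normal1 mul1mx F0E mulf_neq0 // expf_neq0 //; exact: det_neq0.
- by move=> V [M <- /FU[]].
by move=> M [M' MM' FM']; have [] := FU M (F_fl _ _ MM' FM').
Qed.

End FlagCharts.

(** * Torus-invariant partitions of unity *)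

Section PartitionOfUnity.
Variables (k : closedFieldType) (n : nat).

Definition scl (d : 'I_n -> k) (M : 'M[k]_n) : 'M[k]_n := \matrix_(i, j) (d i * M i j).

Lemma scl_dg (b M : 'M[k]_n) : scl (fun i => b i i) M = dg b *m M.
Proof. by apply/matrixP => i j; rewrite dg_mul mxE. Qed.

Lemma sclM d d' (M : 'M[k]_n) : scl d (scl d' M) = scl (fun i => d i * d' i) M.
Proof. by apply/matrixP => i j; rewrite !mxE mulrA. Qed.

Definition tsemi (w : 'I_n -> nat) (F : 'M[k]_n -> k) :=
  forall d M, (forall i, d i != 0) -> F (scl d M) = (\prod_i d i ^+ w i) * F M.

Definition row_scl (l : 'I_n) (c : k) := fun i : 'I_n => if i == l then c else 1.

Lemma tsemi_row w F l c M : tsemi w F -> c != 0 ->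
  F (scl (row_scl l c) M) = c ^+ w l * F M.
Proof.
move=> tw c0; rewrite tw; last first.
  by move=> i; rewrite /row_scl; case: ifP => // _; apply: oner_neq0.
congr (_ * _); rewrite (bigD1 l) //= /row_scl eqxx big1 ?mulr1 // => i /negPf ->.
by rewrite expr1n.
Qed.

Lemma scl_row_ind (P : 'M[k]_n -> Prop) d M : (forall i, d i != 0) -> P M ->
  (forall l c M, c != 0 -> P M -> P (scl (row_scl l c) M)) -> P (scl d M).
Proof.
move=> d0 PM Pstep.
pose dl (ls : seq 'I_n) i := if i \in ls then d i else 1.
have dP ls : uniq ls -> P (scl (dl ls) M).
  elim: ls => [_|l ls IHls /= /andP[lls /IHls Pls]].
    suff -> : scl (dl [::]) M = M by [].
    by apply/matrixP => i j; rewrite mxE mul1r.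
  suff -> : scl (dl (l :: ls)) M = scl (row_scl l (d l)) (scl (dl ls) M).
    exact: Pstep.
  apply/matrixP => i j; rewrite !mxE mulrA; congr (_ * _); rewrite /dl /row_scl in_cons.
  by have [->|_] := eqVneq i l; rewrite ?mul1r // (negPf lls) mulr1.
suff -> : scl d M = scl (dl (enum 'I_n)) M by apply/dP/enum_uniq.
by apply/matrixP => i j; rewrite !mxE /dl mem_enum.
Qed.

(** One row is treated at a time. Row scalings commute, so the last clause of [homogenize_relation]
    keeps the homogeneity already obtained in the other rows. *)
Lemma homogenize_rows s (g P : 'I_s -> 'M[k]_n -> k) (Q : 'M[k]_n -> k) w wQ :
  (forall i, pol (@coordM k n n) (g i)) -> (forall i, tsemi (w i) (P i)) ->
  tsemi wQ Q -> (forall M, \sum_i g i M * P i M = Q M) ->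
  exists g' : 'I_s -> 'M[k]_n -> k,
  [/\ forall i, pol (@coordM k n n) (g' i), forall M, \sum_i g' i M * P i M = Q M &
     forall i l c M, c != 0 -> 
       c ^+ w i l * g' i (scl (row_scl l c) M) = c ^+ wQ l * g' i M].
Proof.
move=> pg tP tQ gPQ.
suff H (ls : seq 'I_n) : exists g' : 'I_s -> 'M[k]_n -> k,
  [/\ forall i, pol (@coordM k n n) (g' i), forall M, \sum_i g' i M * P i M = Q M &
     forall i l c M, l \in ls -> c != 0 -> 
       c ^+ w i l * g' i (scl (row_scl l c) M) = c ^+ wQ l * g' i M].
  have [g' [pg' gE' gh]] := H (enum 'I_n); exists g'; split=> // i l c M c0.
  by apply: gh; rewrite ?mem_enum.
elim: ls => [|l ls [g1 [pg1 gE1 gh1]]]; first by exists g.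
have [||||g2 [pg2 gE2 gh2 gk2]] := homogenize_relation
  (sg := fun c => scl (row_scl l c)) (w := fun i => w i l) (wQ := wQ l) _ _ pg1 _ _ gE1.
- move=> c c' M; rewrite sclM; congr scl; apply/funext => i.
  by rewrite /row_scl; case: ifP; rewrite ?mulr1.
- move=> _ [i [j ->]]; exists (i == l) => c M; rewrite mxE /row_scl.
  by case: (i == l).
- by move=> i c M c0; apply: tsemi_row.
- by move=> c M c0; apply: tsemi_row.
exists g2; split=> // i l' c M; rewrite in_cons => /orP[/eqP -> c0|l'ls c0].
  exact: gh2.
apply: (gk2 i (scl (row_scl l' c))) => [|c' x|x].
- exact: expf_neq0.
- by rewrite !sclM; congr scl; apply/funext => j; rewrite mulrC.
exact: gh1.
Qed.

(** The Nullstellensatz writes F^K as a combination of the Fi^N; once its coefficients are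
    homogenized, each term divided by F^K is torus-invariant. N is free so that the weights can
    absorb poles of prescribed order along Fi = 0. *)
Lemma partition_of_unity N m (F : 'M[k]_n -> k) (Fi : 'I_m -> 'M[k]_n -> k) wF w :
  pol (@coordM k n n) F -> tsemi wF F ->
  (forall i, pol (@coordM k n n) (Fi i)) -> (forall i, tsemi (w i) (Fi i)) ->
  (forall M, F M != 0 -> exists i, Fi i M != 0) ->
  exists K (g : 'I_m -> 'M[k]_n -> k),
  [/\ forall i, pol (@coordM k n n) (g i),
      forall M, F M != 0 -> \sum_i g i M * Fi i M ^+ N / F M ^+ K = 1 &
      forall i d M, (forall i, d i != 0) -> F M != 0 ->
        g i (scl d M) * Fi i (scl d M) ^+ N / F (scl d M) ^+ K =
        g i M * Fi i M ^+ N / F M ^+ K].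
Proof.
move=> pF tF pFi tFi FFi.
have [|M /FFi[i Fi0]|K [s [t [g0 [pg0 gE0]]]]] :=
    cover_power (Q := fun i M => Fi i M ^+ N) _ pF.
- by move=> i; apply: polX.
- by exists i; apply: expf_neq0.
pose g1 i M := \sum_(j | t j == i) g0 j M.
have pg1 i : pol (@coordM k n n) (g1 i) by apply: pol_sum.
have gE1 M : \sum_i g1 i M * Fi i M ^+ N = F M ^+ K.
  rewrite gE0 (partition_big t predT) //=; apply: eq_bigr => i _.
  by rewrite mulr_suml; apply: eq_bigr => j /eqP ->.
have tX w' F' e : tsemi w' F' -> tsemi (fun l => w' l * e)%N (fun M => F' M ^+ e).
  move=> t' d M d0; rewrite t' // exprMn; congr (_ * _).
  by rewrite -prodrXl; apply: eq_bigr => i _; rewrite exprM.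
have [g [pg gE gh]] := homogenize_rows pg1 (fun i => tX _ _ N (tFi i)) (tX _ _ K tF) gE1.
exists K, g; split=> // [M FM|i d M d0 FM].
  by rewrite -mulr_suml gE divff // expf_neq0.
pose f M := g i M * Fi i M ^+ N / F M ^+ K.
suff [] : F (scl d M) != 0 /\ f (scl d M) = f M by [].
apply: (@scl_row_ind (fun M' => F M' != 0 /\ f M' = f M) d M) => // l c M' c0 [FM' <-].
have FlM : F (scl (row_scl l c) M') = c ^+ wF l * F M' by apply: tsemi_row.
split; first by rewrite FlM mulf_neq0 // expf_neq0.
rewrite /f (tsemi_row _ _ (tX _ _ K tF)) // (tsemi_row _ _ (tX _ _ N (tFi i))) //.
have := gh i l c M' c0; move: (g i _) (g i M') => x y xy.
rewrite mulrCA -[_ * (Fi i M' ^+ N)]mulrC mulrA.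
have cK : c ^+ (wF l * K) != 0 by apply: expf_neq0.
rewrite invfM.
transitivity ((c ^+ (w i l * N) * x) * Fi i M' ^+ N / (c ^+ (wF l * K)) / F M' ^+ K).
  by ring.
rewrite xy; field.
by rewrite cK expf_neq0.
Qed.

End PartitionOfUnity.

(** * Bar resolution of a line bundle *)

Section BarSheaf.
Local Open Scope classical_set_scope.
Variables (k : closedFieldType) (n : nat) (lam : 'I_n -> int).
Notation G := (GL k n).

Definition frames := (G * seq (UT k n))%type.
Definition base (e : frames) : flag k n := fl e.1.

(* The sheaf whose global sections are the p-cochains of the unipotent group
   with coefficients in the functions on GL_n, semi-invariant of weight lam
   under the torus, written homogeneously; for p = 0 it is O(lam). *)
Definition bar_sec p (U : set (flag k n)) (s : frames -> k^o) : Prop :=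
  [/\ forall M us, U (fl M) -> size us <> p -> s (M, us) = 0,
      forall (b M : G) us, U (fl M) -> is_trig_mx b -> size us = p ->
        s (GLmul b M, map (cj b) us) = chi lam b * s (M, us)
    & forall M0 : G, U (fl M0) -> exists q a,
      [/\ pol (@coordM k n n) q, pol (@coordU k n n) a, q M0 != 0 &
        forall (M : G) us, U (fl M) -> size us = p -> q M != 0 ->
          s (M, us) = a (M : 'M_n, us) / q M]].

Lemma bar_sec_res p : restrictive (bar_sec p).
Proof.
move=> U W s WU [s0 sb sr]; split=> [M us /WU|b M us /WU|M0 /[dup] /WU].
- exact: s0.
- exact: sb.
move=> /sr[q [a [pq pa q0 sE]]] _; exists q, a; split=> // M us /WU.
exact: sE.
Qed.

Lemma bar_secP p U (c : k) (s t : frames -> k^o) :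
  bar_sec p U s -> bar_sec p U t -> bar_sec p U (c *: s + t).
Proof.
have E e : (c *: s + t) e = c * s e + t e by [].
move=> [s0 sb sr] [t0 tb tr]; split=> [M us UM us_p|b M us UM trb us_p|M0 UM0].
- by rewrite E s0 // t0 // mulr0 addr0.
- by rewrite !E sb // tb // mulrDr mulrCA.
have [q [a [pq pa q0 sE]]] := sr M0 UM0.
have [r [b [pr pb r0 tE]]] := tr M0 UM0.
exists (fun M => q M * r M), (fun x => c * a x * r x.1 + b x * q x.1).
split=> [|||M us UM us_p].
- exact: polM.
- apply: polD; apply: polM => //; try exact: pol_coordM_U.
  by apply: polM => //; apply: pol_cst.
- exact: mulf_neq0.
rewrite mulf_eq0 negb_or => /andP[qM rM].
by rewrite E sE // tE // mulrA addf_div //= [X in _ = _ / X]mulrC.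
Qed.

Lemma bar_sec_van p U s : vanishes base U s -> bar_sec p U s.
Proof.
move=> s0; split=> [M us UM _|b M us UM tb _|M0 UM0].
- exact: (s0 (M, us)).
- rewrite (s0 (GLmul b M, _)) ?(s0 (M, us)) ?mulr0 //.
  by rewrite /base /= fl_low.
exists (fun=> 1), (fun=> 0); split=> [|||M us UM _ _].
- exact: pol_cst.
- exact: pol_cst.
- exact: oner_neq0.
by rewrite (s0 (M, us)) // mul0r.
Qed.

(** The argument for regular functions on a principal open set: local denominators combine to a
    power of F, and the local numerators combine with the same coefficients. *)
Lemma bar_sec_global p U F s : semi_pol F -> (forall M : G, U (fl M) <-> F M != 0) ->
  bar_sec p U s -> exists N a, pol (@coordU k n n) a /\
    forall (M : G) us, F M != 0 -> size us = p -> s (M, us) = a (M : 'M_n, us) / F M ^+ N.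
Proof.
move=> [pF _ uF] UF [_ _ sr].
pose T := {M0 : G | F M0 != 0}.
have ex (t : T) : exists qa : ('M[k]_n -> k) * ('M[k]_n * seq (UT k n) -> k),
    [/\ pol (@coordM k n n) qa.1, pol (@coordU k n n) qa.2, qa.1 (sval t) != 0 &
        forall (M : G) us, U (fl M) -> size us = p -> qa.1 M != 0 ->
          s (M, us) = qa.2 (M : 'M_n, us) / qa.1 M].
  case: t => M0 /= /UF /sr[q [a [? ? ? ?]]]; by exists (q, a).
have [qa qaP] := choice ex.
(* With squares, the local identity can be used in the form q a = q^2 s, which holds also where q
   vanishes. *)
have [|M FM|K [m [t [g [pg gE]]]]] := cover_power (Q := fun t M => (qa t).1 M ^+ 2) _ pF.
- by move=> t; apply: polX; case: (qaP t).
- pose t : T := exist (fun M0 : G => F M0 != 0) (MkGL (uF M FM)) FM.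
  by exists t; apply: expf_neq0; case: (qaP t).
exists K, (fun x => \sum_i g i x.1 * ((qa (t i)).1 x.1 * (qa (t i)).2 x)); split.
  apply: pol_sum => i _; have [pq pa _ _] := qaP (t i).
  by apply: polM; [exact: pol_coordM_U | apply: polM => //; exact: pol_coordM_U].
move=> M us FM us_p; have FK : F M ^+ K != 0 by apply: expf_neq0.
apply: (mulIf FK); rewrite mulfVK // gE mulr_sumr /=; apply: eq_bigr => i _.
have [_ _ _ sE] := qaP (t i); rewrite mulrCA; congr (_ * _).
have [->|qn0] := eqVneq ((qa (t i)).1 M) 0; first by rewrite expr2 !mul0r mulr0.
rewrite sE //; last exact/UF.
by rewrite expr2; field.
Qed.

Lemma bas_compact U (W : flag k n -> set (flag k n)) : bas U ->
  (forall x, U x -> bas (W x) /\ W x x) ->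
  exists m (x : 'I_m -> flag k n),
    (forall i, U (x i)) /\ forall y, U y -> exists i, W (x i) y.
Proof.
move=> [F [pF _ uF] UF] UW.
pose T := {x | U x}.
have ex (t : T) : exists Q, semi_pol Q /\ forall M : G, W (sval t) (fl M) <-> Q M != 0.
  by case: t => x /= /UW[[Q sQ QE] _]; exists Q.
have [Q QP] := choice ex.
have [t|M FM|K [m [t [g [pg gE]]]]] := cover_power (Q := Q) _ pF.
- by have [[]] := QP t.
- have Ux : U (fl (MkGL (uF M FM))) by apply/UF.
  exists (exist _ _ Ux); have [_ QE] := QP (exist _ _ Ux).
  by apply/(QE (MkGL (uF M FM))); case: (UW _ Ux).
exists m, (fun i => sval (t i)); split=> [i|y]; first exact: (svalP (t i)).
have [M <-] := flP y => /UF FM; apply: contrapT => nW.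
have : F M ^+ K != 0 by apply: expf_neq0.
rewrite gE big1 ?eqxx // => i _; have [_ QE] := QP (t i).
have [->|Qn0] := eqVneq (Q (t i) M) 0; first by rewrite mulr0.
by case: nW; exists i; apply/QE.
Qed.

(** B acts on this matrix through its diagonal part ([first_pt_cj]), so a torus-invariant function
    of it is B-invariant. *)
Definition first_pt (x : 'M[k]_n * seq (UT k n)) : 'M[k]_n :=
  sval (head (UT1 k n) x.2) *m x.1.

Lemma pol_first_pt f : pol (@coordM k n n) f ->
  pol (@coordU k n n) (fun x => f (first_pt x)).
Proof.
apply: pol_subst => _ [i [j ->]]; apply: pol_mulmx => a b.
  apply: (@eq_pol _ _ _ (fun x : 'M[k]_n * seq (UT k n) => sval (nth (UT1 k n) x.2 0) a b)).
    by case=> M [|u us].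
  exact: pol_entryU.
by apply: (@pol_coordM_U k n n (fun M => M a b)); apply: pol_entry.
Qed.

Lemma first_pt_semi F x : semi_pol F -> F (first_pt x) = F x.1.
Proof.
move=> [_ [w wE] _]; have uu := svalP (head (UT1 k n) x.2).
rewrite /first_pt wE; last exact: unitri_lowu.
by rewrite big1 ?mul1r // => i _; case/unitriP: uu => _ ->; rewrite expr1n.
Qed.

Lemma first_pt_cj (b : G) (M : 'M[k]_n) us : is_trig_mx b -> us != [::] ->
  first_pt (b *m M, map (cj b) us) = dg b *m first_pt (M, us).
Proof.
by case: us => // u us tb _; rewrite /first_pt /= cj_mul // /lowu tb glmxP.
Qed.

Lemma semi_tsemi (F : 'M[k]_n -> k) : semi_pol F -> exists w, tsemi w F.
Proof.
move=> [_ [w wE] _]; exists w => d M d0.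
have -> : scl d M = diag_mx (\row_i d i) *m M.
  by apply/matrixP => i j; rewrite mul_diag_mx !mxE.
rewrite wE.
  by congr (_ * _); apply: eq_bigr => i _; rewrite !mxE eqxx mulr1n.
rewrite /lowu diag_mx_is_trig trig_unitP ?diag_mx_is_trig //.
by apply/forallP => i; rewrite !mxE eqxx mulr1n.
Qed.

(** Extension by zero from {F Fi != 0} to {F != 0}: the factor Fi^(N+1) of w cancels the pole of s
    along Fi = 0 and still vanishes there. *)
Lemma bar_sec_mul p U F F1 N N' s (w : 'M[k]_n -> k) (W : set (flag k n)) Fi g (K : nat) a :
  semi_pol F -> semi_pol F1 -> (forall M, F M != 0 -> F1 M != 0) -> (N' <= N)%N -> (forall M : G, U (fl M) <-> F M != 0) -> semi_pol Fi ->
  (forall M : G, (U `&` W) (fl M) <-> F M * Fi M != 0) ->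
  (forall d M, (forall i, d i != 0) -> F M != 0 -> w (scl d M) = w M) ->
  pol (@coordM k n n) g ->
  (forall M, w M = g M * Fi M ^+ N.+1 / F1 M ^+ K) ->
  pol (@coordU k n n) a ->
  bar_sec p.+1 (U `&` W) s ->
  (forall (M : G) us, F M * Fi M != 0 -> size us = p.+1 ->
    s (M, us) = a (M : 'M_n, us) / (F M * Fi M) ^+ N') ->
  bar_sec p.+1 U (fun e => w (first_pt (e.1 : 'M_n, e.2)) * s e).
Proof.
move=> sF sF1 FF1 N'N UF sFi UWF wT pg wE pa [s0 sb _] sE.
have wz (M : G) us : U (fl M) -> Fi M = 0 -> w (first_pt (M : 'M_n, us)) = 0.
  by move=> _ Fi0; rewrite wE (first_pt_semi _ sFi) Fi0 exprS mul0r mulr0 mul0r.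
have UW (M : G) : U (fl M) -> Fi M != 0 -> (U `&` W) (fl M).
  by move=> /UF FM FiM; apply/UWF; apply: mulf_neq0.
split=> [M us UM us_p|b M us UM tb us_p|M0 UM0] /=.
- have [Fi0|/(UW M UM) UWM] := eqVneq (Fi M) 0; first by rewrite wz // mul0r.
  by rewrite s0 // mulr0.
- have wb : w (first_pt ((b *m M), map (cj b) us)) = w (first_pt (M : 'M_n, us)).
    rewrite first_pt_cj //; last by case: us us_p.
    rewrite -scl_dg wT //.
      by move=> i; apply: trig_unit_diag => //; apply: glmxP.
    by rewrite (first_pt_semi _ sF); apply/UF.
  rewrite wb; have [Fi0|/(UW M UM) UWM] := eqVneq (Fi M) 0.
    by rewrite wz // !mul0r mulr0.
  by rewrite sb // mulrCA.
have [pF _ _] := sF; have [pFi _ _] := sFi; have [pF1 _ _] := sF1.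
exists (fun M => F1 M ^+ K * F M ^+ N'),
  (fun x => g (first_pt x) * (Fi x.1 ^+ (N - N')) * Fi x.1 * a x).
split=> [|||M us UM us_p _].
- by apply: polM; apply: polX.
- apply: polM => //; apply: polM; last exact: pol_coordM_U.
  apply: polM; first exact: pol_first_pt.
  exact: (polX _ (pol_coordM_U pFi)).
- by rewrite mulf_neq0 // expf_neq0 //; [apply/FF1/UF | apply/UF].
have FM : F M != 0 by apply/UF.
have F1M : F1 M != 0 by apply: FF1.
have [Fi0|FiM] := eqVneq (Fi M) 0; first by rewrite wz // Fi0 mulr0 !mul0r.
rewrite sE ?mulf_neq0 // wE (first_pt_semi _ sF1) (first_pt_semi _ sFi) /= exprMn.
rewrite -{1}(subnK N'N) exprS exprD.
by field; rewrite !expf_neq0.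
Qed.

Lemma semi_pol_prod m (F : 'I_m -> 'M[k]_n -> k) F0 (t : seq 'I_m) :
  semi_pol F0 -> (forall i, semi_pol (F i)) ->
  semi_pol (fun M => F0 M * \prod_(i <- t) F i M).
Proof.
move=> sF0 sF; elim: t => [|i t IHt].
  suff <- : F0 = (fun M => F0 M * \prod_(i <- [::]) F i M) by [].
  by apply/funext => M; rewrite big_nil mulr1.
suff <- : (fun M => F i M * (F0 M * \prod_(i <- t) F i M)) =
    (fun M => F0 M * \prod_(i <- i :: t) F i M) by apply: semi_polM.
by apply/funext => M; rewrite big_cons mulrCA.
Qed.

(** The usual homotopy y_t = sum of w_i c_(i t) of a partition of unity. The weights are evaluated
    at the first point of the cochain, hence p + 1 points. *)
Lemma bar_cech p U m (W : 'I_m -> set (flag k n)) : bas U ->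
  (forall i, bas (W i) /\ W i `<=` U) ->
  (forall y, U y -> exists i, W i y) -> cech_exact base (bar_sec p.+1) U W.
Proof.
move=> [F sF UF] bW cW q c Sc Nc.
have /choice[Fi FiP] i : exists Fi, semi_pol Fi /\ forall M : G, W i (fl M) <-> Fi M != 0.
  by have [[Q sQ WQ] _] := bW i; exists Q.
pose Ft t M := F M * \prod_(i <- t) Fi i M.
have sFt t : semi_pol (Ft t) by apply: semi_pol_prod => // i; case: (FiP i).
have UFt t (M : G) : covered U W t (fl M) <-> Ft t M != 0.
  rewrite /Ft /covered /= mulf_eq0 negb_or; elim: t => [|i t IHt].
    by rewrite big_nil oner_eq0 andbT; split=> [[/UF]|/UF].
  rewrite big_cons mulf_eq0 negb_or; have [_ WE] := FiP i; split.
    move=> [UM [/WE -> tM]] /=; exact/IHt.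
  by move=> /and3P[FM /WE WM tM]; have [|UM tM'] := (IHt).2; rewrite ?FM.
case: q Sc Nc => [|q] Sc Nc.
  move=> [M us] UM; have [i Wi] := cW _ UM.
  have := Nc [:: i] erefl (M, us); rewrite /= subr0; apply.
  by split.
have /choice[N NP] (ti : q.-tuple 'I_m * 'I_m) : exists N, exists a, pol (@coordU k n n) a /\
    forall (M : G) us, Ft (ti.2 :: ti.1) M != 0 -> size us = p.+1 ->
    c (ti.2 :: ti.1) (M, us) = a (M : 'M_n, us) / Ft (ti.2 :: ti.1) M ^+ N.
  have st : size (ti.2 :: ti.1) = q.+1 by rewrite /= size_tuple.
  exact: bar_sec_global (sFt _) (UFt _) (Sc _ st).
pose N0 := (\max_ti N ti)%N.
have [wF tF] := semi_tsemi sF.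
have /choice[wi twi] i : exists w, tsemi w (Fi i) by apply/semi_tsemi; case: (FiP i).
have [||M FM|K [g [pg g1 gT]]] := partition_of_unity N0.+1 _ tF _ twi.
- by case: sF.
- by move=> i; case: (FiP i) => -[].
- have [_ _ uF] := sF; have [|i] := cW (fl (MkGL (uF M FM))); first exact/UF.
  by case: (FiP i) => _ WE /WE; exists i.
pose w i M := g i M * Fi i M ^+ N0.+1 / F M ^+ K.
pose wf i (e : frames) := w i (first_pt (e.1 : 'M_n, e.2)).
pose y (t : seq 'I_m) : frames -> k^o := \sum_i (fun e => wf i e * c (i :: t) e).
have yE t e : y t e = \sum_i wf i e * c (i :: t) e by rewrite /y fct_sumE.
have Scy i t : size t = q -> bar_sec p.+1 (covered U W t) (fun e => wf i e * c (i :: t) e).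
  move=> st; pose tt : q.-tuple 'I_m := tcast st (in_tuple t).
  have ttE : tt = t :> seq _ by rewrite val_tcast.
  have [a [pa aE]] := NP (tt, i); rewrite /= ttE in aE.
  have [_ WE] := FiP i.
  have FiFt M : Ft t M * Fi i M = Ft (i :: t) M.
    by rewrite /Ft big_cons mulrCA mulrC.
  apply: (@bar_sec_mul p (covered U W t) (Ft t) F N0 (N (tt, i)) (c (i :: t)) (w i) (W i) (Fi i)
    (g i) K a) => //.
  - by move=> M; rewrite /Ft mulf_eq0 negb_or => /andP[].
  - exact: leq_bigmax.
  - by case: (FiP i).
  - move=> M; rewrite FiFt -UFt /covered /=; split=> [[[UM tM] WM]|[UM [WM tM]]] //.
  - move=> d M d0; rewrite /Ft mulf_eq0 negb_or => /andP[FM _].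
    exact: gT.
  - have := Sc (i :: t) (congr1 succn st); apply: bar_sec_res => M [[UM tM] WM].
    by split.
  by move=> M us; rewrite FiFt; apply: aE.
exists y; first by move=> t st; rewrite /y; elim/big_ind: _ => [|u v Su Sv|i _];
  [exact: bar_sec_van | by have := bar_secP 1 Su Sv; rewrite scale1r | exact: Scy].
move=> t st e te.
have Dy : D y t e = \sum_i wf i e * (c t e - D c (i :: t) e).
  rewrite -(D_morph (L := fun s : frames -> k^o => s e)) //.
  rewrite (_ : (fun u => y u e) = fun u => \sum_i wf i e * c (i :: u) e); last first.
    by apply/funext => u; apply: yE.
  rewrite D_sum; apply: eq_bigr => i _ /=.
  have -> : (c t - D (fun u => c (i :: u)) t) e = c t e - D (fun u => c (i :: u)) t e by [].
  rewrite opprB addrC subrK -(D_morph (L := fun s : frames -> k^o => s e)) //.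
  by apply: (D_morph (L := fun z => wf i e * z)) => u v; rewrite mulrBr.
have -> : (c t - D y t) e = c t e - D y t e by [].
have [Ue te'] := te; have Fe : F e.1 != 0 by apply/UF.
have w1 : \sum_i wf i e = 1.
  apply: g1; rewrite first_pt_semi //.
apply/eqP; rewrite subr_eq0 Dy eq_sym; apply/eqP.
transitivity (\sum_i wf i e * c t e); last by rewrite -mulr_suml w1 mul1r.
apply: eq_bigr => i _; have [Fi0|Fin0] := eqVneq (Fi i e.1) 0.
  have [sFi _] := FiP i; rewrite /wf /w (first_pt_semi _ sFi) /=.
  by rewrite Fi0 exprS mul0r mulr0 !mul0r.
rewrite (Nc (i :: t) (congr1 succn st) e) ?subr0 //.
by split=> //=; split=> //; have [_ WE] := FiP i; apply/WE.
Qed.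

End BarSheaf.

(** * The bar complex as an acyclic resolution *)

Section BarComplex.
Local Open Scope classical_set_scope.

Lemma nth_face (A : Type) (x0 : A) i t l :
  nth x0 (take i t ++ drop i.+1 t) l = nth x0 t (if (l < i)%N then l else l.+1).
Proof.
elim: t i l => [|x t IHt] [|i] [|l] //=; rewrite ?drop0 ?nth_nil //; try by case: ifP.
by rewrite IHt ltnS; case: ifP.
Qed.

Lemma size_face (A : Type) i (t : seq A) p : size t = p.+1 -> (i <= p)%N ->
  size (take i t ++ drop i.+1 t) = p.
Proof.
move=> st ip; rewrite size_cat size_take size_drop st ltnS ip subSS.
by rewrite subnKC.
Qed.

Lemma D_support (A : Type) (V : zmodType) p (f : seq A -> V) t :
  (forall t, size t <> p -> f t = 0) -> size t <> p.+1 -> D f t = 0.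
Proof.
move=> f0; case: t => [|x t] // st.
rewrite -(D0 V (x :: t)); apply: (@eq_D _ _ (size t)) => // u su.
by apply: f0 => su'; apply: st; rewrite /= -su su'.
Qed.

Lemma loc_and (X : topologicalType) T (Q Q' : set X -> T -> Prop) m U s :
  restrictive Q -> restrictive Q' -> loc Q m U s -> loc Q' m U s ->
  loc (fun U v => Q U v /\ Q' U v) m U s.
Proof.
move=> Qr Q'r; elim: m U s => [|m IHm] U s //= Us Us' x Ux.
have [W xW Ws] := Us x Ux; have [W' xW' Ws'] := Us' x Ux.
exists (W `&` W'); first exact: open_nbhsI.
by apply: IHm; [apply: loc_res Ws | apply: loc_res Ws'] => // y [].
Qed.

Lemma loc_comp (X : topologicalType) T T' (Q : set X -> T' -> Prop) (h : T -> T') m U s :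
  loc Q m U (fun t => h (s t)) -> loc (fun U v => Q U (h v)) m U s.
Proof.
elim: m U s => [|m IHm] U s //= Us x /Us[W xW Ws].
by exists W => //; apply: IHm.
Qed.

Variables (k : closedFieldType) (n : nat) (lam : 'I_n -> int).
Notation G := (GL k n).
Notation frames := (frames k n).
Notation base := (@base k n).
Notation bar_sec := (@bar_sec k n lam).

Definition dbar (s : frames -> k^o) : frames -> k^o :=
  fun e => D (fun us => s (e.1, us)) e.2.

Lemma dbarP (a : k) s t : dbar (a *: s + t) = a *: dbar s + dbar t.
Proof.
apply/funext => e.
exact: (DP a (fun us => s (e.1, us)) (fun us => t (e.1, us)) e.2).
Qed.

Lemma dbarB s t : dbar (s - t) = dbar s - dbar t.
Proof. by rewrite -scaleN1r addrC dbarP addrC scaleN1r. Qed.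

Lemma dbar_dbar s : dbar (dbar s) = 0.
Proof.
by apply/funext => -[M us]; rewrite /dbar /= (DD (fun us => s (M, us))).
Qed.

Lemma pol_face p f : pol (@coordU k n n) f ->
  pol (@coordU k n n) (fun x => \sum_(i < p) (-1) ^+ i *
    f (x.1, take i x.2 ++ drop i.+1 x.2)).
Proof.
move=> pf; apply: pol_sum => i _; apply: polM; first exact: pol_cst.
apply: (pol_subst (phi := fun x => (x.1, take i x.2 ++ drop i.+1 x.2))) pf.
move=> _ [[a [b ->]]|[l [a [b ->]]]]; apply: pol_gen; [left | right].
  by exists a, b.
by exists (if (l < i)%N then l else l.+1), a, b; apply/funext => x; rewrite nth_face.
Qed.

Lemma bar_sec_d p U s : bar_sec p U s -> bar_sec p.+1 U (dbar s).
Proof.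
move=> [s0 sb sr]; split=> [M us UM us_p|b M us UM tb us_p|M0 UM0].
- by apply: (@D_support _ _ p) => // t st; apply: s0.
- rewrite /dbar /= D_map.
  rewrite (@eq_D _ _ p _ (fun us => chi lam b * s (M, us))) //.
    by apply: (D_morph (L := fun z => chi lam b * z)) => u v; rewrite mulrBr.
  by move=> t st; apply: sb.
have [q [a [pq pa q0 sE]]] := sr M0 UM0.
exists q, (fun x => \sum_(i < p.+1) (-1) ^+ i * a (x.1, take i x.2 ++ drop i.+1 x.2)).
split=> // [|M us UM us_p qM]; first exact: pol_face.
rewrite /dbar /= mulr_suml.
rewrite -[LHS]/(D (fun us => s (M, us) : k) us) D_sumE us_p.
apply: eq_bigr => i _; rewrite sE ?mulrA //.
by apply: size_face => //; rewrite -ltnS.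
Qed.

Lemma dbar_van U s : vanishes base U s -> vanishes base U (dbar s).
Proof.
move=> s0 [M us] UM; rewrite -(D0 _ us) /dbar /=; congr D; apply/funext => t.
exact: (s0 (M, t)).
Qed.

Lemma bar_exact0 U s : bar_sec 0 U s -> vanishes base U (dbar s) -> vanishes base U s.
Proof.
move=> [s0 _ _] ds0 [M [|u us]] UM; last exact: s0.
by have := ds0 (M, [:: UT1 k n]) UM; rewrite /dbar /= subr0.
Qed.

(** Over a translated big cell, inserting [t0 M] in front of the points contracts the complex; by
    [tau_cj] this respects semi-invariance. *)
Lemma bar_exact p U s x : open U -> U x -> bar_sec p.+1 U s ->
  vanishes base U (dbar s) -> exists2 W, open_nbhs x W &
    exists y, bar_sec p W y /\ vanishes base W (s - dbar y).
Proof.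
move=> oU Ux [s0 sb sr] ds0.
have [h [W [bW Wx WU WD]]] := bas_nbhs oU Ux.
exists W; first by split=> //; apply: bas_open.
pose t0 (M : 'M[k]_n) := tau (M *m h).
pose y (e : frames) : k^o := if size e.2 == p then s (e.1, t0 e.1 :: e.2) else 0.
exists y; split.
  split=> [M us WM us_p|b M us WM tb us_p|M0 WM0].
  - by rewrite /y /= (introF eqP us_p).
  - rewrite /y /= size_map us_p eqxx -(sb b M (t0 M :: us) (WU _ WM) tb (congr1 succn us_p)) /=.
    congr (s (_, _ :: _)); rewrite /t0 /= -mulmxA tau_cj //.
    + by rewrite /lowu tb glmxP.
    + exact: WD.
    by rewrite mulmxA; apply: (WD (GLmul b M)); rewrite fl_low.
  have [q [a [pq pa q0 sE]]] := sr M0 (WU _ WM0).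
  pose Dh (M : 'M[k]_n) := Delta (M *m h).
  have [pDh _ _] : semi_pol Dh by apply: semi_pol_Delta.
  have pDU := pol_coordM_U pDh.
  have [|N [b [pb bE]]] := reg_subst (dom := fun=> True) pDU
    (phi := fun x : 'M[k]_n * seq (UT k n) => (x.1, t0 x.1 :: x.2)) _ pa.
    move=> _ [[i [j ->]]|[[|l] [i [j ->]]]] /=.
    - by apply/reg_pol/(@pol_coordM_U _ _ _ (fun M => M i j))/pol_entry.
    - have [N [b [pb bE]]] := reg_translate h (@tau_reg k n i j).
      by exists N, (fun x => b x.1); split=> [|z _ Dz]; [apply: pol_coordM_U | apply: bE].
    by apply/reg_pol/pol_entryU.
  exists (fun M => q M * Dh M ^+ N), b; split=> // [||M us WM us_p].
  - by apply: polM => //; apply: polX.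
  - by rewrite mulf_neq0 // expf_neq0 //; apply: WD.
  rewrite mulf_eq0 negb_or => /andP[qM _]; have DM : Dh M != 0 by apply: WD.
  rewrite /y /= us_p eqxx sE //=; [|exact: (WU _ WM)|by rewrite us_p].
  by rewrite (bE (M : 'M_n, us)) //= mulrAC -mulrA -invfM.
move=> [M us] WM.
have -> : (s - dbar y) (M, us) = s (M, us) - dbar y (M, us) by [].
case: (eqVneq (size us) p.+1) => [us_p|/eqP us_p]; last first.
  rewrite s0 ?(WU _ WM) //; last exact: (WU _ WM).
  rewrite sub0r /dbar /= (@D_support _ _ p) ?oppr0 // => t st.
  by rewrite /y /= (introF eqP st).
have := ds0 (M, t0 M :: us) (WU _ WM); rewrite /dbar /= => /eqP; rewrite subr_eq0.
move=> /eqP ->; apply/eqP; rewrite subr_eq0; apply/eqP.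
by apply: (eq_D (n := p)) => // t st; rewrite /y /= st eqxx.
Qed.

Lemma bas_setT : bas [set: flag k n].
Proof.
exists (fun M => \det M); last by move=> M; split=> // _; apply: det_neq0.
split.
- by apply: pol_det => i j; apply: pol_entry.
- exists (fun=> 1) => b M /andP[tb _]; rewrite det_mulmx det_trig //.
by move=> M; rewrite unitmxE unitfE.
Qed.

Lemma bar_godement_exact p m :
  godement_exact base (bar_sec p.+1) [set: flag k n] m.
Proof.
apply: (@cartan_acyclicity k (flag k n) frames base (bar_sec p.+1) _ _ _ (@bas k n)).
- exact: bar_sec_res.
- by move=> *; apply: bar_secP.
- by move=> *; apply: bar_sec_van.
- exact: bas_open.
- exact: basI.
- by move=> U x oU /(bas_nbhs oU)[_ [W [? ? ? _]]]; exists W.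
- exact: bas_compact.
- exact: bar_cech.
exact: bas_setT.
Qed.

Let V : lmodType k := seq (flag k n) -> frames -> k^o.
Definition bd (f : V) : V := fun t => dbar (f t).
Definition gd (f : V) : V := D f.
(** p counts bar points and m Godement points. Column p = 0 is the Godement complex of O(lam), row m
    = 0 consists of the global bar cochains, and bidegree (0, 0) augments both; cohomological degree
    j thus sits at j + 1 points. *)
Definition bS p m (f : V) := loc (bar_sec p) m setT f.
Definition bN (p m : nat) (f : V) := loc (vanishes base) m setT f.

Lemma bar_dcx : dcx bd gd bS bN.
Proof.
split.
- by move=> a u v; apply/funext => t; apply: dbarP.
- by move=> a u v; apply/funext => t; exact: (DP a u v t).
- by move=> u; apply/funext => t; apply: dbar_dbar.
- by move=> u; apply/funext => t; exact: (DD u t).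
- by move=> u; apply/funext => t; rewrite /bd /gd (D_morph (L := dbar)) //; apply: dbarB.
- by move=> p m a u v; apply: loc_lin; [exact: bar_sec_res | move=> *; exact: bar_secP].
- by move=> p m a u v; apply: loc_lin; [exact: vanishes_res | move=> *; exact: vanishesP].
- by move=> p m; apply: loc0.
- by move=> p m u; apply: (loc_map (h := id)) => *; apply: bar_sec_van.
- by move=> p m u; apply: loc_map => *; apply: bar_sec_d.
- move=> p m u; apply: loc_D; last exact: openT.
    exact: bar_sec_res.
  by move=> *; apply: bar_secP.
- by move=> p m u; apply: loc_map => *; apply: dbar_van.
move=> p m u; apply: loc_D; last exact: openT.
  exact: vanishes_res.
by move=> *; apply: vanishesP.
Qed.

(** With at least one Godement point the values are sections over arbitrarily small neighbourhoods,
    so local exactness of the bar complex is enough. *)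
Lemma bar_rowex p m : rowex bd bS bN p m.+1.
Proof.
move=> z Sz Nz.
have Qz : loc (fun U v => bar_sec p U v /\ vanishes base U (dbar v)) m.+1 setT z.
  apply: loc_and => //; first exact: bar_sec_res.
    by move=> U W v WU; apply: vanishes_res.
  exact: (loc_comp (h := dbar)).
case: p Sz Nz Qz => [|p] Sz Nz Qz.
  by apply: (loc_map (h := id)) Qz => U v [Sv Nv]; apply: bar_exact0 Nv.
pose R U (vy : (frames -> k^o) * (frames -> k^o)) :=
  bar_sec p U vy.2 /\ vanishes base U (vy.1 - dbar vy.2).
have [|y yR] := loc_choice (R := R) 0 _ Qz.
  move=> U v x oU Ux [Sv Nv]; have [W xW [y Ry]] := bar_exact oU Ux Sv Nv.
  by exists W => //; exists y.
exists y.
  by apply: (loc_map (h := snd)) yR => U v [].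
by apply: (loc_map (h := fun v => v.1 - dbar v.2)) yR => U v [].
Qed.

Lemma bar_colex p m : colex gd bS bN p.+1 m.
Proof.
by move=> z Sz Nz; have := bar_godement_exact Sz Nz; case: m Sz Nz.
Qed.

End BarComplex.

(** * Comparison of cohomologies *)

Section Correspondence.
Variable k : fieldType.

(* A linear relation inducing an isomorphism Z/B -> Z'/B'. *)
Definition corr (V W : lmodType k) (Z B : V -> Prop) (Z' B' : W -> Prop)
    (R : V -> W -> Prop) :=
  [/\ forall a u v u' v', R u u' -> R v v' -> R (a *: u + v) (a *: u' + v'),
      forall z, Z z -> exists2 z', Z' z' & R z z',
      forall z', Z' z' -> exists2 z, Z z & R z z' &
      forall z z', Z z -> Z' z' -> R z z' -> (B z <-> B' z')].

Lemma corr_comp (V W U : lmodType k) (Z B : V -> Prop) (Z' B' : W -> Prop)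
    (Z2 B2 : U -> Prop) R R' :
  (forall a u v, Z' u -> Z' v -> Z' (a *: u + v)) ->
  corr Z B Z' B' R -> corr Z' B' Z2 B2 R' ->
  corr Z B Z2 B2 (fun z u => exists z', [/\ Z' z', R z z' & R' z' u]).
Proof.
move=> Z'P [RP Rt Rs Ri] [R'P R't R's R'i]; split.
- move=> a u v u' v' [x [Zx ux xu']] [y [Zy vy yv']].
  by exists (a *: x + y); split; [exact: Z'P | exact: RP | exact: R'P].
- move=> z /Rt[z' Zz' zz']; have [u Zu z'u] := R't z' Zz'.
  by exists u => //; exists z'.
- move=> u /R's[z' Zz' z'u]; have [z Zz zz'] := Rs z' Zz'.
  by exists z => //; exists z'.
move=> z u Zz Zu [z' [Zz' zz' z'u]].
by rewrite (Ri z z') // (R'i z' u).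
Qed.

End Correspondence.

Section Godement.
Local Open Scope classical_set_scope.
Variable X : topologicalType.

(** [near_chain] adds points at the end of a chain, [loc] at its front. Moving the last quantifier
    into the values lets an induction reconcile the two. *)
Definition last_sec T (Q : set X -> T -> Prop) (U : set X) (f : X -> T) :=
  forall x, U x -> exists2 W, open_nbhs x W & Q W (f x).

Lemma loc_last T (Q : set X -> T -> Prop) m U (s : seq X -> T) :
  loc (last_sec Q) m U (fun t x => s (rcons t x)) <-> loc Q m.+1 U s.
Proof.
elim: m U s => [|m IHm] U s //.
by split=> Us x /Us[W xW Ws]; exists W => //; apply/(IHm W (fun t => s (x :: t))).
Qed.

Lemma near_chain_loc n T (Q : set X -> T -> Prop) (s : seq X -> T) :
  restrictive Q ->
  near_chain (fun t : n.+1.-tuple X => exists2 W, open_nbhs (tlast t) W & Q W (s t))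
  <-> loc Q n.+1 setT s.
Proof.
elim: n T Q s => [|n IHn] T Q s Qr.
  by split=> [ns x _|ns x]; [exact: (ns x) | exact: (ns x I)].
have Qr' : restrictive (last_sec Q) by move=> U W v WU Uv x /WU /Uv.
rewrite -loc_last -IHn //=; split; apply: near_chain_mono => t.
  rewrite /prop_near1 nbhsE => -[W xW sW]; exists W => // x /sW[W' xW' Qs].
  by exists W'; rewrite ?tlast_rcons // in xW' *.
move=> [W xW sW]; rewrite /prop_near1 nbhsE; exists W => // x /sW[W' xW' Qs].
by exists W'; rewrite ?tlast_rcons.
Qed.

Lemma tval_face n (i : 'I_n.+2) (t : n.+2.-tuple X) :
  face i t = take i t ++ drop i.+1 t :> seq X.
Proof.
case: t => -[//|x0 t] st; apply: (@eq_from_nth _ x0) => [|l].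
  by rewrite size_tuple (size_face (p := n.+1)) ?(eqP st) // -ltnS.
rewrite size_tuple => ln; rewrite nth_face.
have := tnth_mktuple (fun l => tnth (Tuple st) (lift i l)) (Ordinal ln).
rewrite (tnth_nth x0) /= => ->; rewrite (tnth_nth x0) /= /bump.
by rewrite leqNgt; case: ltnP.
Qed.

Lemma diff_D (k : fieldType) (E : Type) n (z : precochain k X E n) (s : seq X -> E -> k^o) :
  (forall t : n.+1.-tuple X, z t = s t) ->
  forall t : n.+2.-tuple X, diff z t = D s t.
Proof.
move=> zs t; apply/funext => e.
rewrite -[RHS](D_morph (L := fun v : E -> k^o => v e)) //.
rewrite -[RHS]/(D (fun u => s u e : k) t) D_sumE size_tuple; apply: eq_bigr => i _.
by rewrite zs tval_face.
Qed.

End Godement.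

(** * The line bundle as the bar sheaf without points *)

Section LineBundle.
Local Open Scope classical_set_scope.
Variables (k : closedFieldType) (n : nat) (lt : n.-tuple int).
Let lam i := tnth lt i.
Notation G := (GL k n).
Notation frames := (frames k n).
Notation base := (@base k n).
Notation bar_sec := (@bar_sec k n lam).

Definition to_bar (v : G -> k^o) : frames -> k^o :=
  fun e => if e.2 is [::] then v (gof e.1) else 0.
Definition of_bar (v : frames -> k^o) : G -> k^o := fun g => v (Mof g, [::]).

Lemma to_barK v : of_bar (to_bar v) = v.
Proof. by apply/funext => g; rewrite /of_bar /to_bar /= MofK. Qed.

(** Passing from a frame to its rows of linear forms inverts b, which changes the exponents - lam_i
    into lam_i, and conjugation by the antidiagonal matrix reverses the indices. *)
Lemma chi_frame_char (b : 'M[k]_n) : is_trig_mx b^T -> b \in unitmx ->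
  chi lam (antidiag k n *m invmx b *m antidiag k n) = frame_char lt b.
Proof.
move=> tb ub; apply: eq_bigr => i _.
rewrite mul_antidiag antidiag_mul.
have -> : invmx b = (invmx b^T)^T by rewrite -trmx_inv trmxK.
rewrite [_^T _ _]mxE trig_invmx_diag ?unitmx_tr // [_^T _ _]mxE.
by rewrite exprz_inv.
Qed.

Lemma of_bar_sec U v : bar_sec 0 U v -> line_sec lt U (of_bar v).
Proof.
move=> [_ vb vr]; split=> [g b Ug tb|g Ug].
  pose c : 'M_n := antidiag k n *m invmx b *m antidiag k n.
  have uc : c \in unitmx by rewrite !unitmx_mul antidiag_unit unitmx_inv glmxP.
  have tc : is_trig_mx c.
    by apply: trig_antidiag'; rewrite trmx_inv trig_invmx // unitmx_tr glmxP.
  rewrite /of_bar -chi_frame_char ?glmxP // -/c.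
  have -> : Mof (GLmul g b) = GLmul (MkGL uc) (Mof g).
    apply: GL_inj; rewrite /= invmx_mul ?glmxP // /c -!mulmxA.
    by rewrite [antidiag k n *m (antidiag k n *m _)]mulmxA antidiagK mul1mx.
  by rewrite (vb (MkGL uc) (Mof g) [::]) // /fl MofK.
have [|q [a [pq pa q0 vE]]] := vr (Mof g); first by rewrite /fl MofK.
have pa0 : pol (@coordM k n n) (fun M => a (M, [::])).
  apply: pol_subst pa => _ [[i [j ->]]|[l [i [j ->]]]] /=; first exact: pol_entry.
  exact: pol_cst.
have [N1 [q1 q1E]] := pol_to_G pq; have [N2 [a1 a1E]] := pol_to_G pa0.
have dG (h : G) N : \det h ^+ N != 0 by rewrite expf_neq0 // det_neq0.
have [d dE] : exists d : mpoly (n * n) k, forall M, mxeval d M = \det M.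
  by apply: pol_mxeval; apply: pol_det => i j; apply: pol_entry.
have eX (q' : mpoly (n * n) k) N (M : 'M_n) : mxeval (q' ^+ N) M = mxeval q' M ^+ N.
  by rewrite /mxeval rmorphXn.
exists (a1 * d ^+ N1), (q1 * d ^+ N2); split.
  by rewrite mxevalM eX q1E dE !mulf_neq0.
move=> g' Ug'; rewrite !mxevalM !eX q1E a1E !dE => nz.
rewrite /of_bar vE //; last 2 first.
- by rewrite /fl MofK.
- by move: nz; rewrite !mulf_eq0 !negb_or => /andP[/andP[]].
have := dG g' 1; rewrite expr1 => dg0.
have qn0 : q (Mof g') != 0 by move: nz; rewrite !mulf_eq0 !negb_or => /andP[/andP[]].
by field; rewrite qn0 !expf_neq0.
Qed.

Lemma to_bar_sec U v : line_sec lt U v -> bar_sec 0 U (to_bar v).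
Proof.
move=> [vb vr]; split=> [M [|u us] //|b M [|//] UM tb _|M0 UM0].
  rewrite /to_bar /=.
  pose c : 'M_n := antidiag k n *m invmx b *m antidiag k n.
  have uc : c \in unitmx by rewrite !unitmx_mul antidiag_unit unitmx_inv glmxP.
  have tc : is_trig_mx c^T by apply/trig_antidiag/trig_invmx => //; apply: glmxP.
  have -> : gof (GLmul b M) = GLmul (gof M) (MkGL uc).
    apply: GL_inj; rewrite /= invmx_mul ?glmxP // /c !mulmxA; congr (_ *m _).
    by rewrite -[_ *m antidiag k n *m antidiag k n]mulmxA antidiagK mulmx1.
  rewrite vb // -chi_frame_char //=; congr (chi lam _ * _).
  rewrite /c !invmx_mul ?unitmx_mul ?antidiag_unit ?unitmx_inv ?glmxP // invmxK invJ.
  by rewrite !mulmxA antidiagK mul1mx -mulmxA antidiagK mulmx1.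
have [a [q [q0 vE]]] := vr (gof M0) UM0.
have [N1 [q1 [pq1 q1E]]] := pol_of_G q; have [N2 [a1 [pa1 a1E]]] := pol_of_G a.
have dG (h : G) N : \det h ^+ N != 0 by rewrite expf_neq0 // det_neq0.
have pd : pol (@coordM k n n) (fun M => \det M).
  by apply: pol_det => i j; apply: pol_entry.
exists (fun M => q1 M * \det M ^+ N2), (fun x => a1 x.1 * \det x.1 ^+ N1); split.
- by apply: polM => //; apply: polX.
- by apply: polM; [apply: pol_coordM_U | apply/polX/(pol_coordM_U pd)].
- by rewrite mulf_neq0 // q1E mulf_neq0.
move=> M [|//] UM _; rewrite q1E => nz; rewrite /to_bar /= a1E vE //; last first.
  by move: nz; rewrite !mulf_eq0 !negb_or => /andP[/andP[]].
have dg0 : \det M != 0 := det_neq0 M.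
have qn0 : mxeval q (gof M) != 0 by move: nz; rewrite !mulf_eq0 !negb_or => /andP[/andP[]].
by field; rewrite qn0 !expf_neq0.
Qed.

End LineBundle.

(** * From Godement cohomology to bar cohomology, with the action of GL_n *)

Section GodementToBar.
Local Open Scope classical_set_scope.
Variables (k : closedFieldType) (n : nat) (lt : n.-tuple int).
Let lam i := tnth lt i.
Notation G := (GL k n).
Notation frames := (frames k n).
Notation base := (@base k n).
Notation bar_sec := (@bar_sec k n lam).
Notation bS := (@bS k n lam).
Notation bN := (@bN k n).
Notation bd := (@bd k n).
Notation gd := (@gd k n).
Let V : lmodType k := seq (flag k n) -> frames -> k^o.
Notation LB := (line_bundle k lt).

Definition R1 m (z : precochain k (flag k n) G m) (z' : V) :=
  forall t, z t = of_bar (z' (tval t)).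

Lemma R1_diff m z z' : @R1 m z z' -> R1 (diff z) (gd z').
Proof.
move=> zz' t; rewrite (diff_D (s := fun u => of_bar (z' u))) //.
by rewrite (D_morph (L := @of_bar k n)).
Qed.

Lemma R1B m z z' y y' : @R1 m z z' -> R1 y y' -> R1 (z - y) (z' - y').
Proof.
move=> zz' yy' t; have -> : (z - y) t = z t - y t by [].
by rewrite zz' yy'.
Qed.

Lemma R1_null m z z' : @R1 m z z' -> bS 0 m.+1 z' ->
  (null (@frame_flag k n) z <-> bN 0 m.+1 z').
Proof.
move=> zz' Sz.
have -> : null (@frame_flag k n) z <->
    loc (vanishes (@frame_flag k n)) m.+1 setT (fun u => of_bar (z' u)).
  rewrite -near_chain_loc; last exact: vanishes_res.
  split; apply: near_chain_mono => t; rewrite /prop_near1 nbhsE.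
    move=> -[W xW W0]; exists W => // g Wg; rewrite -zz'.
    by apply: (W0 _ Wg g).
  move=> [W xW W0]; exists W => // x Wx g gx; rewrite zz'.
  by apply: W0; rewrite gx.
split=> [Nz|]; last first.
  by apply: loc_map => U v v0 g Ug; apply: v0; rewrite /base /= /fl MofK.
have Qr : restrictive (fun U (v : frames -> k^o) => vanishes (@frame_flag k n) U (of_bar v)).
  by move=> U W v WU; apply: vanishes_res.
have := loc_and (@bar_sec_res k n lam 0) Qr Sz (loc_comp Nz).
apply: (loc_map (h := id)) => U v [[v0 _ _] van] [M [|u us]] UM; last exact: v0.
by have := van (gof M) UM; rewrite /of_bar gofK.
Qed.

Lemma R1_cochain m z z' : @R1 m z z' -> bS 0 m.+1 z' -> cochain LB z.
Proof.
move=> zz' Sz; have : loc (line_sec lt) m.+1 setT (fun u => of_bar (z' u)).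
  by apply: loc_map Sz => U v; apply: of_bar_sec.
move/(near_chain_loc _ _ (@line_sec_res k n lt)); apply: near_chain_mono => t [W tW sW].
by exists W; rewrite // zz'.
Qed.

Definition extend m (z : precochain k (flag k n) G m) : V :=
  fun u => if insub u is Some t then to_bar (z t) else 0.

Lemma R1_extend m z : @R1 m z (extend z).
Proof. by move=> t; rewrite /extend valK to_barK. Qed.

Lemma extend_cochain m z : cochain LB z -> bS 0 m.+1 (@extend m z).
Proof.
move=> cz; have : loc (line_sec lt) m.+1 setT (fun u => of_bar (extend z u)).
  apply/(near_chain_loc _ _ (@line_sec_res k n lt)).
  by apply: near_chain_mono cz => t [W tW sW]; exists W; rewrite -?R1_extend.
move=> Lz; apply: (eq_loc (s := fun u => to_bar (of_bar (extend z u)))).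
  by move=> u _; rewrite /extend; case: insub => [t|//]; rewrite ?to_barK //; apply/funext => -[M []].
by apply: loc_map Lz => U v; apply: to_bar_sec.
Qed.

Definition Z2 j (z : V) := bS 0 j.+1 z /\ bN 0 j.+2 (gd z).
Definition B2 j (z : V) := if j is q.+1
  then exists2 y, bS 0 q.+1 y & bN 0 q.+2 (z - gd y) else bN 0 1 z.

Let H := @bar_dcx k n lam.

Let bS_gd m z : bS 0 m z -> bS 0 m.+1 (gd z).
Proof. exact: (dcx_eS H). Qed.

Let bS_sub p m u v : bS p m u -> bS p m v -> bS p m (u - v).
Proof.
by move=> Su Sv; rewrite -scaleN1r addrC; apply: (dcx_SP H).
Qed.

Lemma godement_corr j :
  corr (cocycle LB j) (coboundary LB j) (Z2 j) (B2 j) (@R1 j).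
Proof.
split.
- move=> a u v u' v' uu' vv' t.
  by have -> : (a *: u + v) t = a *: u t + v t by []; rewrite uu' vv'.
- move=> z [cz nz]; exists (extend z); last exact: R1_extend.
  have Sz := extend_cochain cz; split=> //.
  by apply/(R1_null (R1_diff (R1_extend z))); first exact: bS_gd.
- move=> z' [Sz Nz]; pose z : precochain k (flag k n) G j := fun t => of_bar (z' (tval t)).
  have zz' : R1 z z' by [].
  exists z => //; split; first exact: R1_cochain zz' Sz.
  by apply/(R1_null (R1_diff zz')); first exact: bS_gd.
move=> z z' [cz nz] [Sz Nz] zz'; case: j z cz nz Sz Nz zz' => [|q] z cz nz Sz Nz zz'.
  exact: R1_null zz' Sz.
split=> [[y cy ny]|[y Sy Ny]].
  have Sy := extend_cochain cy; exists (extend y) => //.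
  by apply/(R1_null (R1B zz' (R1_diff (R1_extend y)))) => //; apply: bS_sub => //; apply: bS_gd.
pose y0 : precochain k (flag k n) G q := fun t => of_bar (y (tval t)).
have yy : R1 y0 y by [].
exists y0; first exact: R1_cochain yy Sy.
by apply/(R1_null (R1B zz' (R1_diff yy))) => //; apply: bS_sub => //; apply: bS_gd.
Qed.

Definition Z3 j (b : frames -> k^o) := bar_sec j.+1 setT b /\ vanishes base setT (dbar b).
Definition B3 j (b : frames -> k^o) := if j is q.+1
  then exists2 x, bar_sec q.+1 setT x & vanishes base setT (b - dbar x)
  else vanishes base setT b.

Notation zig := (zig bd gd bS bN).

(** Row 0 has no Godement point, so b matters only through its value at the empty sequence; [R2]
    uses the constant representative. *)
Lemma zig_nil i p z b : zig i p z b -> zig i p z (fun=> b [::]).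
Proof.
elim: i p z => [|i IHi] p z /=; last by move=> [y Sy [Ny yb]]; exists y => //; split=> //; exact: IHi.
by apply: eq_loc => -[|x []].
Qed.

Definition R2 j z (b : frames -> k^o) := zig j 0 z (fun=> b).

Lemma bar_corr j : corr (Z2 j) (B2 j) (Z3 j) (B3 j) (R2 j).
Proof.
have rex := @bar_rowex k n lam; have cex := @bar_colex k n lam.
split.
- by move=> a u v u' v'; apply: zigP.
- move=> z [Sz Nz]; have [b Sb [Nb zb]] := zig_total H cex Sz (dcx_dN H Nz).
  by exists (b [::]); [split | exact: zig_nil zb].
- move=> b [Sb Nb].
  have [//|//|z Sz [Nz zb]] := @zig_surj _ _ _ _ _ _ H rex j 0 (fun=> b).
  exists z => //; split=> //; apply: (rex 0) Nz; exact: (dcx_eS H Sz).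
move=> z b [Sz Nz] [Sb Nb] zb.
have i1 := zig_inj1 H cex Sz (Sb : bS (0 + j).+1 0 (fun=> b)) zb.
have i2 := zig_inj2 H rex Sz (Sb : bS (0 + j).+1 0 (fun=> b)) zb.
have bd0 : bd 0 = 0 by apply/funext => t; apply/funext => e; exact: (D0 k^o).
have gd0 : gd 0 = 0 by apply/funext => t; exact: (D0 _ t).
split=> [Bz|Bb].
  have {}/i1 : zbound bd gd bS bN 0 j z.
    case: (j) Bz => [|q] Bz.
      by exists 0, 0; split=> //; [apply: (dcx_NS H); apply: (dcx_N0 H)|rewrite gd0 bd0 !subr0].
    by have [y Sy Ny] := Bz; exists y, 0; split=> //; rewrite bd0 subr0.
  by case: (j) => [|q] //= [x Sx Nx]; exists (x [::]).
have {}/i2 : bbound bd bS bN 0 j (fun=> b).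
  by case: (j) Bb => [|q] //= [x Sx Nx]; exists (fun=> x).
move=> [y [x [Sy -> y0]]]; rewrite bd0 subr0; case: (j) Sy y0 => [|q] Sy y0 Ny.
  by rewrite y0 // gd0 subr0 in Ny.
by exists y.
Qed.

Section Action.
Variable h : G.

(** Right translation of M by h covers the action of h^-1 on flags ([fl_mulr]) and commutes with the
    left action of B; it corresponds to the pullback that defines [GLact]. *)
Definition frame_act (f : frames -> k^o) : frames -> k^o :=
  fun e => f (GLmul e.1 h, e.2).
Definition chain_act (f : V) : V :=
  fun t => frame_act (f (map (GLflag (GLinv h)) t)).

Lemma fl_mulr (M : G) : fl (GLmul M h) = GLflag (GLinv h) (fl M).
Proof.
rewrite /fl -frame_flagM; congr frame_flag; apply: GL_inj => /=.
by rewrite invmx_mul ?glmxP // mulmxA.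
Qed.

Lemma bar_sec_act p U s : bar_sec p U s ->
  bar_sec p (GLflag (GLinv h) @^-1` U) (frame_act s).
Proof.
move=> [s0 sb sr]; split=> [M us UM us_p|b M us UM tb us_p|M0 UM0].
- by rewrite /frame_act /= s0 // fl_mulr.
- by rewrite /frame_act /= -GLmulA sb // fl_mulr.
have [|q [a [pq pa q0 sE]]] := sr (GLmul M0 h); first by rewrite fl_mulr.
exists (fun M => q (M *m h)), (fun x => a (x.1 *m h, x.2)); split=> //.
- apply: (pol_subst (phi := fun M => M *m h)) pq => _ [i [j ->]].
  by apply: pol_mulmx => ? ?; [apply: pol_entry | apply: pol_cst].
- apply: (pol_subst (phi := fun x => (x.1 *m h, x.2))) pa => _ [[i [j ->]]|[l [i [j ->]]]] /=.
    apply: (pol_mulmx (A := fun x => x.1)) => ? ?; last exact: pol_cst.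
    by apply/(@pol_coordM_U _ _ _ (fun M => M _ _))/pol_entry.
  exact: pol_entryU.
by move=> M us UM us_p; apply: (sE (GLmul M h)); rewrite ?fl_mulr.
Qed.

Lemma vanishes_act U s : vanishes base U s ->
  vanishes base (GLflag (GLinv h) @^-1` U) (frame_act s).
Proof. by move=> s0 [M us] UM; apply: s0; rewrite /base /= fl_mulr. Qed.

Lemma loc_act (Q : set (flag k n) -> (frames -> k^o) -> Prop) m U f :
  (forall U s, Q U s -> Q (GLflag (GLinv h) @^-1` U) (frame_act s)) ->
  loc Q m U f -> loc Q m (GLflag (GLinv h) @^-1` U) (chain_act f).
Proof.
move=> Qa; elim: m U f => [|m IHm] U f /=; first exact: Qa.
move=> Uf x /Uf[W [oW Wx] Wf]; exists (GLflag (GLinv h) @^-1` W).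
  by split=> //; apply: GLflag_open.
exact: (IHm W (fun t => f (GLflag (GLinv h) x :: t))).
Qed.

Lemma bS_act p m f : bS p m f -> bS p m (chain_act f).
Proof. by apply: loc_act => U s; apply: bar_sec_act. Qed.
Lemma bN_act p m f : bN p m f -> bN p m (chain_act f).
Proof. by apply: loc_act => U s; apply: vanishes_act. Qed.

Lemma gd_act f : gd (chain_act f) = chain_act (gd f).
Proof.
apply/funext => t; rewrite /gd /chain_act D_map.
by rewrite (D_morph (L := frame_act)).
Qed.

Lemma zig_act i p z b : zig i p z b -> zig i p (chain_act z) (chain_act b).
Proof.
have E u v : bd (chain_act u) - gd (chain_act v) = chain_act (bd u - gd v).
  by rewrite gd_act.
elim: i p z => [|i IHi] p z /=; first by move=> /bN_act; rewrite -E.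
move=> [y Sy [Ny yb]]; exists (chain_act y); first exact: bS_act.
by rewrite E; split; [apply: bN_act | apply: IHi].
Qed.

Lemma R2_act j z b : R2 j z b -> R2 j (chain_act z) (frame_act b).
Proof. exact: zig_act. Qed.

Lemma R1_act m z z' : @R1 m z z' ->
  R1 (pull_cochain (line_endo lt (GLinv h)) z) (chain_act z').
Proof.
move=> zz' t; apply/funext => g; rewrite /pull_cochain zz' /=.
rewrite /of_bar /chain_act /frame_act /=; congr (z' _ (_, _)).
by apply: GL_inj; rewrite /= invmx_mul ?unitmx_inv ?glmxP // invmxK mulmxA.
Qed.

Lemma Z2_act j z : Z2 j z -> Z2 j (chain_act z).
Proof. by move=> [Sz Nz]; split; [apply: bS_act | rewrite gd_act; apply: bN_act]. Qed.

Lemma Z3_act j z : Z3 j z -> Z3 j (frame_act z).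
Proof.
by move=> [Sz Nz]; split; [exact: (bar_sec_act Sz) | exact: (vanishes_act Nz)].
Qed.

End Action.
End GodementToBar.

(** * Polynomial cochains *)

Section RelativeCochains.
Variables (k : closedFieldType) (r : nat) (lam : 'I_r -> int) (T : Type).
Variables (mul : 'M[k]_r -> T -> T) (C : (T * seq (UT k r) -> k) -> Prop).
Notation fn := (T * seq (UT k r) -> k^o).

Definition delta (f : fn) : fn := fun x => D (fun us => f (x.1, us)) x.2.

Lemma deltaP (a : k) f g : delta (a *: f + g) = a *: delta f + delta g.
Proof.
apply/funext => x.
exact: (DP a (fun us => f (x.1, us)) (fun us => g (x.1, us)) x.2).
Qed.

Lemma deltaB f g : delta (f - g) = delta f - delta g.
Proof. by rewrite -scaleN1r addrC deltaP addrC scaleN1r. Qed.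

Lemma delta0 : delta 0 = 0.
Proof. by have := deltaB 0 0; rewrite !subrr. Qed.

Lemma delta_delta f : delta (delta f) = 0.
Proof. by apply/funext => -[M us]; rewrite /delta /= (DD (fun us => f (M, us))). Qed.

Lemma delta_sum (I : Type) (s : seq I) (c : I -> T -> k) (f : I -> fn) M us :
  delta (fun x => \sum_(i <- s) c i x.1 * f i x) (M, us) =
  \sum_(i <- s) c i M * delta (f i) (M, us).
Proof.
rewrite /delta /= D_sum; apply: eq_bigr => i _.
by apply: (D_morph (L := fun z : k^o => c i M * z : k^o)) => u v; rewrite mulrBr.
Qed.

Definition null_on (dom : T -> Prop) (f : fn) := forall M us, dom M -> f (M, us) = 0.

Lemma delta_null dom f : null_on dom f -> null_on dom (delta f).
Proof.
move=> f0 M us dM; rewrite -(D0 k^o us) /delta /=; congr D.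
by apply/funext => t; apply: f0.
Qed.

(* Cochains with m points on dom, with powers of F as denominators; there are
   none with 0 points, the complex being truncated. *)
Definition coch dom (F : T -> k) m (f : fn) := if m is 0 then null_on dom f else
  [/\ forall M us, dom M -> size us <> m -> f (M, us) = 0,
      forall b M us, dom M -> lowu b -> size us = m ->
        f (mul b M, map (cj b) us) = chi lam b * f (M, us)
    & exists N a, pol C a /\ forall M us, dom M -> size us = m ->
        f (M, us) = a (M, us) / F M ^+ N].

Section Domain.
Variables (dom : T -> Prop) (F : T -> k).
Hypothesis dom_mul : forall b M, dom M -> lowu b -> dom (mul b M).
Hypothesis F0 : forall M, dom M -> F M != 0.
Hypothesis pF : pol C (fun x => F x.1).
Notation coch := (coch dom F).

Lemma coch_null m f : null_on dom f -> coch m f.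
Proof.
move=> f0; case: m => [|m] //; split=> [M us dM _|b M us dM lb _|].
- exact: f0.
- by rewrite !f0 ?mulr0 //; apply: dom_mul.
exists 0, (fun=> 0); split=> [|M us dM _]; first exact: pol_cst.
by rewrite f0 // mul0r.
Qed.

Lemma eq_coch m f g : null_on dom (f - g) -> coch m f -> coch m g.
Proof.
move=> fg; have E M us : dom M -> f (M, us) = g (M, us).
  by move=> dM; have /eqP := fg M us dM; rewrite subr_eq0 => /eqP.
case: m => [|m] /=; first by move=> f0 M us dM; rewrite -E // f0.
move=> [f0 fs [N [a [pa aE]]]]; split=> [M us dM us_m|b M us dM lb us_m|].
- by rewrite -E // f0.
- by rewrite -!E ?fs //; apply: dom_mul.
by exists N, a; split=> // M us dM us_m; rewrite -E // aE.
Qed.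

Lemma cochP m (a : k) f g : coch m f -> coch m g -> coch m (a *: f + g).
Proof.
have E x : (a *: f + g) x = a * f x + g x by [].
case: m => [|m] /=; first by move=> f0 g0 M us dM; rewrite E f0 // g0 // mulr0 addr0.
move=> [f0 fs [N [A [pA AE]]]] [g0 gs [N' [B [pB BE]]]].
split=> [M us dM us_m|b M us dM lb us_m|].
- by rewrite E f0 // g0 // mulr0 addr0.
- by rewrite !E fs // gs // mulrDr mulrCA.
exists (N + N')%N, (fun x => a * A x * F x.1 ^+ N' + B x * F x.1 ^+ N); split.
  apply: polD; apply: polM => //; try exact: polX.
  by apply: polM => //; apply: pol_cst.
move=> M us dM us_m; rewrite E AE // BE //= mulrA addf_div ?expf_neq0 ?F0 //.
by rewrite exprD.
Qed.

Lemma cochB m f g : coch m f -> coch m g -> coch m (f - g).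
Proof. by move=> fm gm; rewrite -scaleN1r addrC; apply: cochP. Qed.

Lemma coch_sum m (I : Type) (s : seq I) (c : I -> k) (f : I -> fn) :
  (forall i, coch m (f i)) -> coch m (fun x => \sum_(i <- s) c i * f i x).
Proof.
move=> fm; elim: s => [|i s IHs].
  by apply: coch_null => M us _; rewrite big_nil.
have -> : (fun x => \sum_(j <- i :: s) c j * f j x) =
    c i *: f i + (fun x => \sum_(j <- s) c j * f j x).
  by apply/funext => x; rewrite big_cons.
exact: cochP.
Qed.

End Domain.

Lemma coch_denom dom F F' (g : T -> k) m f : pol C (fun x => g x.1) ->
  (forall M, dom M -> F' M = F M * g M) -> (forall M, dom M -> g M != 0) ->
  coch dom F m f -> coch dom F' m f.
Proof.
case: m => [|m] //= pg F'E g0 [f0 fs [N [a [pa aE]]]]; split=> //.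
exists N, (fun x => a x * g x.1 ^+ N); split; first by apply/polM/polX.
move=> M us dM us_m; rewrite aE // F'E // exprMn invfM mulrACA.
by rewrite mulfV ?mulr1 // expf_neq0 // g0.
Qed.

Lemma coch_res dom dom' F m f : (forall M, dom' M -> dom M) ->
  coch dom F m f -> coch dom' F m f.
Proof.
move=> dd'; case: m => [|m] /=; first by move=> f0 M us /dd'; apply: f0.
move=> [f0 fs [N [a [pa aE]]]]; split=> [M us /dd'|b M us /dd'|]; [exact: f0|exact: fs|].
by exists N, a; split=> // M us /dd'; apply: aE.
Qed.

Hypothesis Cface : forall i f, C f ->
  pol C (fun x => f (x.1, take i x.2 ++ drop i.+1 x.2)).

Lemma coch_delta dom F m f : (forall b M, dom M -> lowu b -> dom (mul b M)) ->
  coch dom F m f -> coch dom F m.+1 (delta f).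
Proof.
move=> dom_mul; case: m => [|m]; first by move=> f0; apply/coch_null/delta_null.
move=> [f0 fs [N [a [pa aE]]]]; split=> [M us dM us_m|b M us dM lb us_m|].
- by apply: (@D_support _ _ m.+1) => // t st; apply: f0.
- rewrite /delta /= D_map.
  rewrite (@eq_D _ _ m.+1 _ (fun us => chi lam b * f (M, us))) //.
    by apply: (D_morph (L := fun z : k^o => chi lam b * z : k^o)) => u v; rewrite mulrBr.
  by move=> t st; apply: fs.
exists N, (fun x => \sum_(i < m.+2) (-1) ^+ i * a (x.1, take i x.2 ++ drop i.+1 x.2)).
split=> [|M us dM us_m].
  apply: pol_sum => i _; apply: polM; first exact: pol_cst.
  by apply: (pol_subst (phi := fun x => (x.1, take i x.2 ++ drop i.+1 x.2))) pa; apply: Cface.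
rewrite /delta /= mulr_suml -[LHS]/(D (fun us => f (M, us) : k) us) D_sumE us_m.
apply: eq_bigr => i _; rewrite aE ?mulrA //.
by apply: size_face => //; rewrite -ltnS.
Qed.

End RelativeCochains.

Section Faces.
Variable k : closedFieldType.

Lemma coordU_face r n i f : @coordU k r n f ->
  pol (@coordU k r n) (fun x => f (x.1, take i x.2 ++ drop i.+1 x.2)).
Proof.
move=> [[a [b ->]]|[l [a [b ->]]]]; apply: pol_gen; [left | right].
  by exists a, b.
by exists (if (l < i)%N then l else l.+1), a, b; apply/funext => x; rewrite nth_face.
Qed.

End Faces.

(** * Common denominators, monomial expansions, density of the chart *)

Section CommonDenominator.
Variables (k : closedFieldType) (r : nat) (lam : 'I_r -> int) (T : Type).
Variables (mul : 'M[k]_r -> T -> T) (C : (T * seq (UT k r) -> k) -> Prop).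

Lemma pol_subst_on X X' (C1 : (X -> k) -> Prop) (C2 : (X' -> k) -> Prop)
    (dom : X -> Prop) (phi : X -> X') f :
  (forall g, C2 g -> exists h, pol C1 h /\ forall x, dom x -> h x = g (phi x)) ->
  pol C2 f -> exists h, pol C1 h /\ forall x, dom x -> h x = f (phi x).
Proof.
move=> Cp; elim=> {f} [c|f /Cp //|f g _ [a [pa aE]] _ [b [pb bE]]
  |f g _ [a [pa aE]] _ [b [pb bE]]].
- by exists (fun=> c); split=> //; apply: pol_cst.
- by exists (fun x => a x + b x); split=> [|x dx]; [apply: polD | rewrite aE ?bE].
by exists (fun x => a x * b x); split=> [|x dx]; [apply: polM | rewrite aE ?bE].
Qed.

Lemma common_denom dom s p (F : seq 'I_s -> T -> k) m N0 w :
  (forall t, pol C (fun x => F t x.1)) -> (forall t M, dom M -> F t M != 0) ->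
  (forall t, size t = p -> coch lam mul C dom (F t) m.+1 (w t)) ->
  exists N (a : seq 'I_s -> T * seq (UT k r) -> k), (N0 <= N)%N /\
    forall t, size t = p -> pol C (a t) /\
      forall M us, dom M -> size us = m.+1 -> w t (M, us) = a t (M, us) / F t M ^+ N.
Proof.
move=> pF F0 Sw.
have /choice[N NP] (t : p.-tuple 'I_s) : exists N, exists a, pol C a /\
    forall M us, dom M -> size us = m.+1 -> w t (M, us) = a (M, us) / F t M ^+ N.
  by have [_ _ ?] := Sw t (size_tuple t).
pose N1 := maxn N0 (\max_t N t)%N; exists N1.
have /choice[a aP] (t : seq 'I_s) : exists a, size t = p -> pol C a /\
    forall M us, dom M -> size us = m.+1 -> w t (M, us) = a (M, us) / F t M ^+ N1.
  case: (eqVneq (size t) p) => [st|/eqP st]; last by exists (fun=> 0).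
  have [a [pa aE]] := NP (tcast st (in_tuple t)); rewrite val_tcast /= in aE.
  have NN : (N (tcast st (in_tuple t)) <= N1)%N.
    by rewrite leq_max (leq_bigmax (F := N)) orbT.
  have [|a' [pa' aE']] := reg_ge (dom := fun x => dom x.1 /\ size x.2 = m.+1)
    (f := w t) (pF t) pa NN.
    by move=> [M us] [dM us_m] _; apply: aE.
  exists a' => _; split=> // M us dM us_m.
  by apply: aE' => //; apply: F0.
by exists a; split=> //; rewrite leq_maxl.
Qed.

End CommonDenominator.

Section Expansion.
Variable k : closedFieldType.

(** Separation of variables. [A] and [B] only have to be stable under products, so that the left
    factors can be kept monomials. *)
Lemma pol_tensor_sum X X1 X2 (C : (X -> k) -> Prop) (A : (X1 -> k) -> Prop)
    (B : (X2 -> k) -> Prop) (phi : X1 -> X2 -> X) f :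
  A (fun=> 1) -> (forall a a', A a -> A a' -> A (fun x => a x * a' x)) ->
  (forall c, B (fun=> c)) -> (forall b b', B b -> B b' -> B (fun x => b x * b' x)) ->
  (forall g, C g -> exists (I : finType) (a : I -> X1 -> k) (b : I -> X2 -> k),
    [/\ forall i, A (a i), forall i, B (b i) &
        forall x y, g (phi x y) = \sum_i a i x * b i y]) ->
  pol C f -> exists (I : finType) (a : I -> X1 -> k) (b : I -> X2 -> k),
    [/\ forall i, A (a i), forall i, B (b i) &
        forall x y, f (phi x y) = \sum_i a i x * b i y].
Proof.
move=> A1 AM BC BM AB; elim=> {f} [c|f /AB //
  |f g _ [I [a [b [Aa Bb fE]]]] _ [J [a' [b' [Aa' Bb' gE]]]]
  |f g _ [I [a [b [Aa Bb fE]]]] _ [J [a' [b' [Aa' Bb' gE]]]]].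
- by exists unit, (fun=> fun=> 1), (fun=> fun=> c); split=> // x y; rewrite big_const card_unit /= mul1r addr0.
- exists (I + J)%type, (fun ij => match ij with inl i => a i | inr j => a' j end),
    (fun ij => match ij with inl i => b i | inr j => b' j end).
  by split=> [[]|[]|x y] //; rewrite big_sumType /= fE gE.
exists (I * J)%type, (fun ij x => a ij.1 x * a' ij.2 x), (fun ij x => b ij.1 x * b' ij.2 x).
split=> [ij|ij|x y]; [exact: AM | exact: BM |].
rewrite fE gE big_distrlr /= pair_big; apply: eq_bigr => ij _ /=.
by rewrite mulrACA.
Qed.

Lemma pol_tensor X X1 X2 (C : (X -> k) -> Prop) (A : (X1 -> k) -> Prop)
    (B : (X2 -> k) -> Prop) (phi : X1 -> X2 -> X) f :
  A (fun=> 1) -> (forall a a', A a -> A a' -> A (fun x => a x * a' x)) ->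
  (forall c, B (fun=> c)) -> (forall b b', B b -> B b' -> B (fun x => b x * b' x)) ->
  (forall g, C g -> exists a b, [/\ A a, B b & forall x y, g (phi x y) = a x * b y]) ->
  pol C f -> exists (I : finType) (a : I -> X1 -> k) (b : I -> X2 -> k),
    [/\ forall i, A (a i), forall i, B (b i) &
        forall x y, f (phi x y) = \sum_i a i x * b i y].
Proof.
move=> A1 AM BC BM AB; apply: pol_tensor_sum => // g /AB[a [b [Aa Bb gE]]].
by exists unit, (fun=> a), (fun=> b); split=> // x y; rewrite big_const card_unit /= addr0.
Qed.

Lemma pol_line_dense X (C : (X -> k) -> Prop) (gam : k -> X) (q : {poly k}) f g :
  (forall h, C h -> exists P : {poly k}, forall c, h (gam c) = P.[c]) ->
  pol C f -> pol C g -> q != 0 -> (forall c, q.[c] != 0 -> f (gam c) = g (gam c)) ->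
  f (gam 0) = g (gam 0).
Proof.
move=> Cg pf pg q0 fg.
have [P PE] := pol_curve Cg pf; have [Q QE] := pol_curve Cg pg.
rewrite PE QE; congr (_.[0]); apply/eqP; rewrite -subr_eq0; apply/eqP.
by apply: (poly_eq0_open q0) => c /fg; rewrite hornerD hornerN PE QE => ->; rewrite subrr.
Qed.

Section Rows.
Variable n : nat.
Notation X := ('M[k]_n.+1 * seq (UT k n.+1))%type.
Notation mon K := {ffun 'I_n.+1 -> 'I_K}.

Definition ins (l : 'rV[k]_n.+1) (x : X) : X :=
  (\matrix_(i, j) (if i == ord0 then l 0 j else x.1 i j), x.2).

Lemma ins_row x : ins (row ord0 x.1) x = x.
Proof.
case: x => M us; congr pair; apply/matrixP => i j; rewrite !mxE /=.
by case: eqP => // ->.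
Qed.

Lemma insins l l' x : ins l (ins l' x) = ins l x.
Proof. by congr pair; apply/matrixP => i j; rewrite !mxE; case: eqP. Qed.

Definition expo K (be : mon K) (l : 'rV[k]_n.+1) : k := \prod_i l 0 i ^+ be i.

(** The exponents e are those of a pole that has been cleared; no smaller monomial occurs. The bound
    serves every K >= K0, so that the finitely many components of a cochain can share one set of
    exponents. *)
Lemma row_expand (e : 'I_n.+1 -> nat) f : pol (@coordU k n.+1 n.+1) f ->
  exists K0, forall K, (K0 <= K)%N -> exists h : mon K -> X -> k,
    [/\ forall be, pol (@coordU k n.+1 n.+1) (h be),
        forall be x, h be x != 0 -> forall i, (e i <= be i)%N &
        forall l x, f (ins l x) * \prod_i l 0 i ^+ e i = \sum_be expo be l * h be x].
Proof.
move=> pf; pose A (a : 'rV[k]_n.+1 -> k) := exists mu : 'I_n.+1 -> nat,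
  forall l, a l = \prod_i l 0 i ^+ mu i.
have [|||||I [a [b [Aa Bb fE]]]] := pol_tensor (A := A)
    (B := pol (@coordU k n.+1 n.+1)) (phi := ins) _ _ _ _ _ pf.
- by exists (fun=> 0); move=> l; rewrite big1.
- move=> a a' [mu aE] [mu' a'E]; exists (fun i => mu i + mu' i)%N => l.
  by rewrite aE a'E -big_split; apply: eq_bigr => i _; rewrite exprD.
- by move=> c; apply: pol_cst.
- by move=> *; apply: polM.
- move=> _ [[i [j ->]]|[l [i [j ->]]]]; last first.
    exists (fun=> 1), (fun x => sval (nth (UT1 k n.+1) x.2 l) i j).
    split=> [||x y]; [by exists (fun=> 0) => l'; rewrite big1|exact: pol_entryU|by rewrite mul1r].
  have [->|i0] := eqVneq i ord0.
    exists (fun l => l 0 j), (fun=> 1); split=> [||x y].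
    + exists (fun i => i == j) => l; rewrite (bigD1 j) //= eqxx expr1 big1 ?mulr1 //.
      by move=> i' /negPf ->.
    + exact: pol_cst.
    + by rewrite mxE eqxx mulr1.
  exists (fun=> 1), (fun x : X => x.1 i j); split=> [||x y].
  - by exists (fun=> 0) => l'; rewrite big1.
  - exact/(@pol_coordM_U _ _ _ (fun M => M i j))/pol_entry.
  by rewrite mxE (negPf i0) mul1r.
have [mu muE] := choice Aa.
exists (\max_i \max_j (mu i j + e j).+1)%N => K muK.
have muK' i j : (mu i j + e j < K)%N.
  apply: leq_trans muK; apply: leq_trans (leq_bigmax i).
  exact: (leq_bigmax (F := fun j => (mu i j + e j).+1) j).
pose m i : mon K := [ffun j => Ordinal (muK' i j)].
exists (fun be x => \sum_(i | m i == be) b i x); split=> [be|be x|l x].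
- by apply: pol_sum => i _; apply: Bb.
- apply: contraNP => /existsNP[j ej]; rewrite big1 // => i /eqP mbe; case: ej.
  by rewrite -mbe ffunE /= leq_addl.
rewrite fE mulr_suml (partition_big m predT) //=; apply: eq_bigr => be _.
rewrite mulr_sumr; apply: eq_bigr => i /eqP <-; rewrite muE mulrAC; congr (_ * _).
by rewrite -big_split; apply: eq_bigr => j _; rewrite ffunE exprD.
Qed.

(** Kronecker's substitution l_i = c^(K^i) separates the monomials with exponents below K. *)
Lemma expo_unique K (h : mon K -> k) :
  (forall l : 'rV[k]_n.+1, (forall i, l 0 i != 0) -> \sum_be expo be l * h be = 0) ->
  forall be, h be = 0.
Proof.
move=> h0 be.
pose w (be : mon K) := (\sum_i be i * K ^ i)%N.
have : \sum_be h be *: 'X^(w be) = 0 :> {poly k}.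
  apply: poly_eq0_nz => c c0; rewrite horner_sum -[RHS](h0 (\row_i c ^+ (K ^ i))); last first.
    by move=> i; rewrite mxE expf_neq0.
  apply: eq_bigr => b _; rewrite hornerZ hornerXn mulrC; congr (_ * _).
  rewrite /w -prodrXr; apply: eq_bigr => i _.
  by rewrite mxE -exprM mulnC.
move/(congr1 (fun p : {poly k} => p`_(w be))); rewrite coef_sum coef0 (bigD1 be) //=.
rewrite coefZ coefXn eqxx mulr1 big1 ?addr0 // => b bbe; rewrite coefZ coefXn.
case: eqP => [wE|_]; last by rewrite mulr0.
case/negP: bbe; apply/eqP/ffunP => i; apply: val_inj.
exact: (kronecker_inj (K := K) (u := fun i => b i) (v := fun i => be i)).
Qed.

Lemma expo_eq K (h h' : mon K -> k) :
  (forall l : 'rV[k]_n.+1, (forall i, l 0 i != 0) -> \sum_be expo be l * h be = \sum_be expo be l * h' be) ->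
  forall be, h be = h' be.
Proof.
move=> hh' be; apply/eqP; rewrite -subr_eq0; apply/eqP.
apply: (expo_unique (h := fun be => h be - h' be)) => l /hh' /eqP.
rewrite -subr_eq0 -sumrB => /eqP E; rewrite -[RHS]E.
by apply: eq_bigr => b _; rewrite mulrBr.
Qed.

Definition torus_chart (M : 'M[k]_n.+1) := M \in unitmx /\ forall i, M ord0 i != 0.

(** The line from M to [M0], a matrix of determinant 1 whose first row consists of ones, meets the
    chart outside the zeros of a nonzero polynomial. *)
Lemma torus_dense f g : pol (@coordU k n.+1 n.+1) f -> pol (@coordU k n.+1 n.+1) g ->
  forall us, (forall M, torus_chart M -> f (M, us) = g (M, us)) ->
  forall M, f (M, us) = g (M, us).
Proof.
move=> pf pg us fg M.
pose M0 : 'M[k]_n.+1 := \matrix_(i, j) ((i == ord0) || (i == j))%:R.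
have uM0 : \det M0 = 1.
  rewrite -det_tr det_trig; first by apply: big1 => i _; rewrite !mxE eqxx orbT.
  apply/is_trig_mxP => i j ij; rewrite !mxE.
  have -> : (j == ord0) = false.
    by rewrite -val_eqE /=; apply: gtn_eqF; apply: leq_ltn_trans ij.
  by rewrite -val_eqE /= (gtn_eqF ij).
pose L i j : {poly k} := (M i j)%:P + (M0 i j - M i j) *: 'X.
pose Mc c := \matrix_(i, j) (L i j).[c].
have McE c i j : Mc c i j = M i j + c * (M0 i j - M i j).
  by rewrite mxE /L !hornerE mulrC.
pose q := \det (\matrix_(i, j) L i j) * \prod_j L ord0 j.
have qE c : q.[c] = \det (Mc c) * \prod_j Mc c ord0 j.
  rewrite /q hornerM -[X in X * _]/(horner_eval c _) -det_map_mx; congr (\det _ * _).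
    by apply/matrixP => i j; rewrite !mxE.
  by rewrite -[LHS]/(horner_eval c _) rmorph_prod; apply: eq_bigr => j _; rewrite mxE.
have M1 : Mc 1 = M0 by apply/matrixP => i j; rewrite McE mul1r addrC subrK.
have Mc0 : Mc 0 = M by apply/matrixP => i j; rewrite McE mul0r addr0.
rewrite -{1 2}Mc0; apply: (@pol_line_dense _ _ (fun c => (Mc c, us)) q) pf pg _ _.
- move=> _ [[i [j ->]]|[l [i [j ->]]]]; first by exists (L i j) => c; rewrite /= mxE.
  by exists (sval (nth (UT1 k n.+1) us l) i j)%:P => c; rewrite hornerC.
- apply/eqP => q0; have := qE 1; rewrite q0 horner0 M1 uM0 mul1r => /esym/eqP.
  by rewrite big1 ?oner_eq0 // => j _; rewrite mxE eqxx.
move=> c; rewrite qE mulf_eq0 negb_or => /andP[dM xM]; apply: fg; split.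
  by rewrite unitmxE unitfE.
by move=> i; move: xM; rewrite prodf_seq_neq0 => /allP/(_ i (mem_index_enum i)).
Qed.

End Rows.
End Expansion.

(** * Exactness of the rows of the Cech complex *)

Section Normalization.
Variables (k : closedFieldType) (n : nat).
Notation X := ('M[k]_n.+1 * seq (UT k n.+1))%type.

Definition base_pt (x : X) : 'M[k]_n.+1 := sval (nth (UT1 k n.+1) x.2 0).
(** Translation by the first unipotent matrix turns that matrix into 1, after which B acts through
    its torus ([nrm_low]). Splitting off the first row respects the torus but not U, since U adds
    multiples of the first row to the others; evaluation at [nrm x] restores semi-invariance. *)
Definition nrm (x : X) : X := (base_pt x *m x.1, map (cj (base_pt x)) x.2).

Lemma base_unitri x : unitri (base_pt x).
Proof. exact: (svalP (nth (UT1 k n.+1) x.2 0)). Qed.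

Lemma low_row0 (b M : 'M[k]_n.+1) j :
  is_trig_mx b -> (b *m M) ord0 j = b ord0 ord0 * M ord0 j.
Proof.
move=> /is_trig_mxP tb; rewrite mxE (bigD1 ord0) //= big1 ?addr0 // => l l0.
by rewrite tb ?mul0r // lt0n.
Qed.

Lemma nrm_row0 x j : (nrm x).1 ord0 j = x.1 ord0 j.
Proof.
by have /unitriP[tu du] := base_unitri x; rewrite low_row0 // du mul1r.
Qed.

Lemma chart_low (b M : 'M[k]_n.+1) : torus_chart M -> lowu b -> torus_chart (b *m M).
Proof.
move=> [uM x0] /andP[tb ub]; split=> [|j]; first by rewrite unitmx_mul ub.
by rewrite low_row0 // mulf_neq0 // trig_unit_diag.
Qed.

Lemma lowu_dg (b : 'M[k]_n.+1) : lowu b -> lowu (dg b).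
Proof.
move=> /andP[tb ub]; rewrite /lowu dg_trig trig_unitP ?dg_trig //.
by apply/forallP => i; rewrite dg_diag trig_unit_diag.
Qed.

Lemma nrm_low (b M : 'M[k]_n.+1) us : lowu b -> us <> [::] ->
  nrm (b *m M, map (cj b) us) =
  (dg b *m (nrm (M, us)).1, map (cj (dg b)) (nrm (M, us)).2).
Proof.
move=> lb us0; rewrite /nrm /=.
have -> : base_pt (b *m M, map (cj b) us) = sval (cj b (nth (UT1 k n.+1) us 0)).
  by case: us us0.
set u0 := nth _ us 0; rewrite -/(base_pt (M, us)) cj_mul //; congr pair.
rewrite -!map_comp; apply: eq_map => u.
change (cj (sval (cj b u0)) (cj b u) = cj (dg b) (cj (sval u0) u)).
have lu : lowu (sval u0) := unitri_lowu (svalP u0).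
have lc : lowu (sval (cj b u0)) := unitri_lowu (svalP (cj b u0)).
rewrite !cjM ?lowu_dg //; congr cj; rewrite cjE // mulmxKV //.
by case/andP: lb.
Qed.

Lemma pol_nrm m f : pol (@coordU k n.+1 n.+1) f -> exists g,
  pol (@coordU k n.+1 n.+1) g /\ forall x, size x.2 = m -> g x = f (nrm x).
Proof.
apply: pol_subst_on => _ [[i [j ->]]|[l [i [j ->]]]].
  exists (fun x : X => (nrm x).1 i j); split=> //.
  apply: pol_mulmx => a b; first exact: pol_entryU.
  exact/(@pol_coordM_U _ _ _ (fun M => M a b))/pol_entry.
have [lm|ml] := ltnP l m; last first.
  exists (fun=> (1%:M : 'M[k]_n.+1) i j); split=> [|x sx]; first exact: pol_cst.
  by rewrite nth_default ?UT1E // size_map sx.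
exists (fun x => (sval (nth (UT1 k n.+1) x.2 l) *m \adj (base_pt x)) i j); split.
  by apply: pol_mulmx => a b; [apply: pol_entryU | apply: pol_adj => *; apply: pol_entryU].
move=> x sx; have uu := base_unitri x.
have /unitriP[tu du] := uu.
rewrite (nth_map (UT1 k n.+1)) ?sx // cjE ?unitri_lowu // unitri_dg // mul1mx.
rewrite /invmx unitri_unit // det_trig // big1 ?invr1 ?scale1r // => a _.
Qed.

End Normalization.

Section MatrixRow.
Variables (k : closedFieldType) (n : nat) (lam : 'I_n.+1 -> int).
Notation X := ('M[k]_n.+1 * seq (UT k n.+1))%type.
Notation chart := (@torus_chart k n).
Notation coch := (coch lam (fun b M : 'M[k]_n.+1 => b *m M) (@coordU k n.+1 n.+1)).
Notation pol := (pol (@coordU k n.+1 n.+1)).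

Definition rowprod (t : seq 'I_n.+1) (M : 'M[k]_n.+1) : k := \prod_(i <- t) M ord0 i.

Lemma rowprod_count t M : rowprod t M = \prod_i M ord0 i ^+ count_mem i t.
Proof.
elim: t => [|j t IHt]; first by rewrite /rowprod big_nil big1.
rewrite /rowprod big_cons -/(rowprod t M) IHt [RHS](bigD1 j) //= eqxx exprS -mulrA.
congr (_ * _); rewrite [LHS](bigD1 j) //=; congr (_ * _); apply: eq_bigr => i /negPf ij.
by rewrite eq_sym ij.
Qed.

Lemma rowprod_neq0 t M : chart M -> rowprod t M != 0.
Proof. by move=> [_ x0]; rewrite prodf_seq_neq0; apply/allP => i _ /=; apply: x0. Qed.

Lemma pol_row0 i : pol (fun x => x.1 ord0 i).
Proof. exact/(@pol_coordM_U _ _ _ (fun M => M ord0 i))/pol_entry. Qed.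

Lemma pol_rowprod t : pol (fun x => rowprod t x.1).
Proof. by apply: pol_prod => i _; apply: pol_row0. Qed.

(** Multiplication by a power of all the first-row entries clears the poles, and the result splits
    into monomials be in these entries, with true exponents be_i - E. If some be_i >= E, prepending
    i contracts the part of this monomial; if all are smaller, the weight of the first row kills
    it. *)
Lemma mat_row q m w : - n%:Z <= lam ord0 ->
  (forall t, size t = q.+1 -> coch chart (rowprod t) m (w t)) ->
  (forall t, size t = q.+2 -> null_on chart (D w t)) ->
  exists y, (forall t, size t = q -> coch chart (rowprod t) m (y t)) /\
    forall t, size t = q.+1 -> null_on chart (w t - D y t).
Proof.
move=> lam0; case: m => [|m] Sw Dw.
  exists (fun=> 0); split=> [t _ M us _ //|t st M us dM].
  rewrite (D0 (X -> k^o)) subr0.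
  exact: (Sw t st M us dM).
have [N [A [N1 AP]]] := common_denom 1 pol_rowprod rowprod_neq0 Sw.
pose E := (N * q.+1)%N.
(* The pole of w t along x_i has order at most N times the multiplicity of i in t, a sequence of
   length q + 1; so x_i divides P t at least to this power. *)
pose ga t (i : 'I_n.+1) := (E - N * count_mem i t)%N.
pose P t (x : X) := A t x * \prod_i x.1 ord0 i ^+ ga t i.
have pP t : size t = q.+1 -> pol (P t).
  move=> /AP[pA _]; apply: polM => //; apply: pol_prod => i _; apply: polX.
  exact: pol_row0.
pose xa (M : 'M[k]_n.+1) := \prod_i M ord0 i.
have xa0 M : chart M -> xa M != 0.
  by move=> [_ x0]; rewrite prodf_seq_neq0; apply/allP => i _ /=.
have xaM b M : lowu b -> xa (b *m M) = b ord0 ord0 ^+ n.+1 * xa M.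
  have -> : b ord0 ord0 ^+ n.+1 = \prod_(i < n.+1) b ord0 ord0.
    by rewrite prodr_const card_ord.
  move=> /andP[tb _]; rewrite /xa -big_split.
  by apply: eq_bigr => i _; rewrite low_row0.
have wE t M us : size t = q.+1 -> chart M -> size us = m.+1 ->
    P t (M, us) = xa M ^+ E * w t (M, us).
  move=> st cM us_m; have [_ ->] := AP t st => //.
  rewrite /P mulrCA; congr (_ * _).
  rewrite -[LHS](mulfK (expf_neq0 N (rowprod_neq0 t cM))); congr (_ / _).
  rewrite rowprod_count /xa -!prodrXl -big_split; apply: eq_bigr => i _ /=.
  rewrite -exprM -exprD [(count_mem i t * N)%N]mulnC subnK // /E leq_mul2l -st count_size.
  by rewrite orbT.
have /choice[K0 K0P] t : exists K0, size t = q.+1 -> forall K, (K0 <= K)%N ->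
    exists h : {ffun 'I_n.+1 -> 'I_K} -> X -> k,
    [/\ forall be, pol (h be),
        forall be x, h be x != 0 -> forall i, (ga t i <= be i)%N &
        forall l x, P t (ins l x) = \sum_be expo be l * h be x].
  case: (eqVneq (size t) q.+1) => [st|/eqP st]; last by exists 0.
  have [pA _] := AP t st; have [K0 K0P] := row_expand (ga t) pA.
  exists K0 => _ K /K0P[h [ph hg hE]]; exists h; split=> // l x.
  rewrite -hE; congr (_ * _); apply: eq_bigr => i _.
  by rewrite mxE eqxx.
pose K := (\max_(t : q.+1.-tuple 'I_n.+1) K0 t)%N.
have /choice[h hP] t : exists h : {ffun 'I_n.+1 -> 'I_K} -> X -> k, size t = q.+1 ->
    [/\ forall be, pol (h be),
        forall be x, h be x != 0 -> forall i, (ga t i <= be i)%N &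
        forall l x, P t (ins l x) = \sum_be expo be l * h be x].
  case: (eqVneq (size t) q.+1) => [st|/eqP st]; last by exists (fun _ _ => 0).
  have [|h ?] := K0P t st K; last by exists h.
  have := leq_bigmax (F := fun t : q.+1.-tuple 'I_n.+1 => K0 t) (tcast st (in_tuple t)).
  by rewrite val_tcast.
have hrow0 t be l x : size t = q.+1 -> h t be (ins l x) = h t be x.
  move=> st; have [_ _ hE] := hP t st; move: be; apply: expo_eq => l' _.
  by rewrite -!hE insins.
have Psemi t b M us : size t = q.+1 -> lowu b -> size us = m.+1 ->
    P t (b *m M, map (cj b) us) = b ord0 ord0 ^+ (n.+1 * E) * chi lam b * P t (M, us).
  move=> st lb us_m.
  apply: (@torus_dense k n (fun x => P t (b *m x.1, map (cj b) us))
    (fun x => b ord0 ord0 ^+ (n.+1 * E) * chi lam b * P t x)).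
  - apply: (pol_subst (phi := fun x : X => (b *m x.1, map (cj b) us))) (pP t st).
    move=> _ [[i [j ->]]|[l [i [j ->]]]] /=; last exact: pol_cst.
    apply: (pol_mulmx (A := fun=> b) (B := fun x => x.1)) => ? ?; first exact: pol_cst.
    exact/(@pol_coordM_U _ _ _ (fun M => M _ _))/pol_entry.
  - by apply: polM; [apply: pol_cst | apply: pP].
  move=> M' cM; have [_ ws _] := Sw t st.
  rewrite /= !wE ?size_map //; last exact: chart_low.
  by rewrite ws // xaM // exprMn -exprM; ring.
pose deg (be : {ffun 'I_n.+1 -> 'I_K}) := (\sum_i be i)%N.
have expoZ be c l : expo be (c *: l) = c ^+ deg be * expo be l.
  rewrite -prodrXr -big_split; apply: eq_bigr => i _.
  by rewrite mxE exprMn.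
have hsemi t be b x : size t = q.+1 -> lowu b -> size x.2 = m.+1 ->
    b ord0 ord0 ^+ deg be * h t be (dg b *m x.1, map (cj (dg b)) x.2) =
    b ord0 ord0 ^+ (n.+1 * E) * chi lam b * h t be x.
  move=> st lb us_m; have [_ _ hE] := hP t st; move: be.
  apply: (expo_eq (h := fun be => _ ^+ deg be * _) (h' := fun be => _ * h t be x)) => l _.
  have db : dg b ord0 ord0 = b ord0 ord0 by rewrite dg_diag.
  have cb : chi lam (dg b) = chi lam b by apply: eq_bigr => i _; rewrite dg_diag.
  transitivity (P t (dg b *m (ins l x).1, map (cj (dg b)) x.2)); last first.
    rewrite Psemi ?lowu_dg // db cb -[(_, x.2)]/(ins l x) hE mulr_sumr.
    by apply: eq_bigr => be _; rewrite mulrCA.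
  have -> : (dg b *m (ins l x).1, map (cj (dg b)) x.2) =
      ins (b ord0 ord0 *: l) (dg b *m x.1, map (cj (dg b)) x.2).
    congr pair; apply/matrixP => i j; rewrite dg_mul [RHS]mxE [X in _ * X = _]mxE.
    by case: eqP => [->|_]; [rewrite [RHS]mxE | rewrite dg_mul].
  by rewrite hE; apply: eq_bigr => be _; rewrite expoZ mulrCA mulrA.
(* Suppose that all be_i < E. The torus element diag(1/c, 1, ..., 1) multiplies by c the first
   columns of the unipotents below the diagonal, and h does not see the first row of M. Its weight
   gives Q(c) c^(e+1) = h with e >= 0, because lam_1 >= - n; at c = 0 this yields h = 0. *)
have hbig t be x : size t = q.+1 -> size x.2 = m.+1 -> h t be x != 0 ->
    exists i, (E <= be i)%N.
  move=> st us_m; apply: contraNP => /forallNP small; apply/eqP.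
  have dE : (deg be + n.+1 <= n.+1 * E)%N.
    have -> : (n.+1 * E)%N = (\sum_(i < n.+1) E)%N by rewrite sum_nat_const card_ord.
    have -> : (deg be + n.+1)%N = (\sum_(i < n.+1) (be i + 1))%N.
      by rewrite big_split sum_nat_const card_ord muln1.
    apply: leq_sum => i _; rewrite addn1 ltnNge.
    exact/negP/small.
  have [e eE] : exists e : nat, e.+1%:Z + (deg be)%:Z = (n.+1 * E)%N%:Z + lam ord0.
    exists (absz ((n.+1 * E)%N%:Z + lam ord0 - (deg be)%:Z - 1)%R); move: lam0 dE; lia.
  pose sc (c : k) (u : UT k n.+1) : UT k n.+1 :=
    UTof (\matrix_(i, j) if j == ord0 then c * sval u i j else sval u i j).
  have [ph _ _] := hP t st.
  have [Q QE] : exists Q : {poly k}, forall c, h t be (x.1, map (sc c) x.2) = Q.[c].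
    apply: (pol_curve (gam := fun c => (x.1, map (sc c) x.2))) (ph be).
    move=> _ [[i [j ->]]|[l [i [j ->]]]] /=; first by exists (x.1 i j)%:P => c; rewrite hornerC.
    have [lm|ml] := ltnP l (size x.2); last first.
      by exists ((sval (UT1 k n.+1) i j)%:P) => c; rewrite nth_default ?hornerC ?size_map.
    exists (if (j < i)%N then if j == ord0 then (sval (nth (UT1 k n.+1) x.2 l) i j) *: 'X
      else (sval (nth (UT1 k n.+1) x.2 l) i j)%:P else ((i == j)%:R)%:P) => c.
    rewrite (nth_map (UT1 k n.+1)) // !mxE; case: ifP => _; last by rewrite hornerC.
    by case: ifP => _; rewrite !hornerE // mulrC.
  have : Q * 'X^(e.+1) = (h t be x)%:P.
    apply: poly_inj => c c0; rewrite hornerM hornerXn hornerC -QE.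
    pose b : 'M[k]_n.+1 := diag_mx (\row_i (if i == ord0 then c^-1 else 1)).
    have tb : is_trig_mx b by apply: diag_mx_is_trig.
    have bE i : b i i = if i == ord0 then c^-1 else 1 by rewrite !mxE eqxx.
    have b0 : b ord0 ord0 = c^-1 by rewrite bE eqxx.
    have lb : lowu b.
      rewrite /lowu tb trig_unitP //; apply/forallP => i; rewrite bE.
      by case: ifP => _; rewrite ?invr_eq0 ?c0 ?oner_neq0.
    have cb : chi lam b = (c^-1) ^ lam ord0.
      rewrite /chi (bigD1 ord0) //= b0 big1 ?mulr1 // => i /negPf i0.
      by rewrite bE i0 exp1rz.
    have dgb : dg b = b.
      by apply/matrixP => i j; rewrite !mxE eqxx.
    have bM : (b *m x.1, map (cj b) x.2) =
        ins (c^-1 *: row ord0 x.1) (x.1, map (sc c) x.2).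
      congr pair.
        apply/matrixP => i j; rewrite -{1}dgb dg_mul bE !mxE.
        by case: eqP => [->|]; rewrite ?mul1r.
      apply: eq_map => u; apply: UT_inj; rewrite cjE // dgb.
      have ib : invmx b = diag_mx (\row_i (if i == ord0 then c else 1)).
        apply: (can_inj (mulKmx (proj2 (andP lb)))).
        rewrite mulmxV ?(proj2 (andP lb)) // /b mulmx_diag -(diag_const_mx n.+1 1).
        congr diag_mx; apply/rowP => i; rewrite !mxE; case: eqP => _; last by rewrite mulr1.
        by rewrite mulVf.
      have /unitriP[/is_trig_mxP tu du] := svalP u.
      apply/matrixP => i j; rewrite ib mul_mx_diag mxE -{1}dgb dg_mul bE !mxE.
      have [ji|ij|/val_inj ->] := ltngtP j i.
      + rewrite -[i == ord0]val_eqE /= (gtn_eqF (leq_ltn_trans (leq0n j) ji)) mul1r.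
        by case: ifP => _; rewrite ?mulr1 // mulrC.
      + by rewrite tu // mulr0 mul0r -val_eqE /= (ltn_eqF ij).
      rewrite eqxx du mulr1; case: eqP => _; last by rewrite mulr1.
      by rewrite mulVf.
    have := hsemi t be b x st lb us_m; rewrite dgb bM hrow0 // b0 cb.
    have ci : c^-1 != 0 by rewrite invr_eq0.
    move: (h t be _) => Hd Hx.
    have cd : c^-1 ^+ deg be != 0 by apply: expf_neq0.
    apply: (mulfI cd); rewrite mulrA Hx -[_ ^+ (n.+1 * E)]/(c^-1 ^ (n.+1 * E)%N%:Z).
    rewrite -expfzDr // -eE expfzDr // -[c^-1 ^ (deg be)%:Z]/(c^-1 ^+ deg be).
    rewrite -[c^-1 ^ e.+1%:Z]/(c^-1 ^+ e.+1) [_ * _ ^+ deg be]mulrC -!mulrA; congr (_ * _).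
    by rewrite mulrCA -exprMn mulVf // expr1n mulr1.
  move/(congr1 (fun p : {poly k} => p.[0])).
  by rewrite hornerM hornerXn expr0n /= mulr0 hornerC => <-.
have hD t' be x : size t' = q.+2 -> size x.2 = m.+1 -> D (fun t => h t be x) t' = 0.
  move=> st' us_m; move: be; apply: (expo_unique (h := fun be => D (fun t => h t be x) t')) => l _.
  transitivity (D (fun t => P t (ins l x)) t').
    rewrite (@eq_D _ _ q.+1 _ (fun t => \sum_be expo be l * h t be x)) // => [|t st].
      rewrite D_sum; apply: eq_bigr => be _.
      by rewrite -(D_morph (L := fun z => expo be l * z)) // => u v; rewrite mulrBr.
    by have [_ _ hE] := hP t st; rewrite hE.
  have pD : pol (D (P : seq 'I_n.+1 -> X -> k^o) t').
    apply: (D_closed (Q := fun _ v => pol (v : X -> k^o))) st' => //.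
    by move=> _ u v; apply: polB.
  have DE y : D (P : seq 'I_n.+1 -> X -> k^o) t' y = D (fun t => P t y) t'.
    by rewrite -(D_morph (L := fun v : X -> k^o => v y)).
  case: (ins l x) (us_m : size (ins l x).2 = m.+1) => M us /= {}us_m.
  rewrite -DE; apply: (torus_dense pD (pol_cst _ 0)) => M' cM; rewrite DE.
  rewrite (@eq_D _ _ q.+1 _ (fun t => xa M' ^+ E * w t (M', us))) => // [|t st]; last exact: wE.
  rewrite (D_morph (L := fun z : k => xa M' ^+ E * z)) => [|u v]; last by rewrite mulrBr.
  have := Dw t' st' M' us cM; rewrite -(D_morph (L := fun v : X -> k^o => v (M', us))) //.
  by move=> ->; rewrite mulr0.
(* The prepended index depends on the monomial and not on t, as the homotopy identity requires. *)
pose jj (be : {ffun 'I_n.+1 -> 'I_K}) := odflt ord0 [pick i | (E <= be i)%N].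
have jjP t be x : size t = q.+1 -> size x.2 = m.+1 -> h t be x != 0 -> (E <= be (jj be))%N.
  move=> st us_m /(hbig t be x st us_m)[i Ei]; rewrite /jj; case: pickP => //= /(_ i).
  by rewrite Ei.
pose y t' (x : X) : k^o := if size x.2 == m.+1 then
  (\sum_be expo be (row ord0 x.1) * h (jj be :: t') be (nrm x)) / xa x.1 ^+ E else 0.
have nsz x : size (nrm x).2 = size x.2 by rewrite size_map.
exists y; split=> [t st|t st M us cM].
  split=> [M us cM /eqP us_m|b M us cM lb us_m|].
  - by rewrite /y /= (negPf us_m).
  - have us0 : us <> [::] by move=> us0; move: us_m; rewrite us0.
    have [tb ub] := andP lb.
    have b0 : b ord0 ord0 != 0 by apply: trig_unit_diag.
    rewrite /y /= size_map us_m eqxx nrm_low //.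
    rewrite xaM //.
    have -> : row ord0 (b *m M) = b ord0 ord0 *: row ord0 M.
      by apply/rowP => j; rewrite !mxE -low_row0 // mxE.
    rewrite (eq_bigr (fun be => b ord0 ord0 ^+ (n.+1 * E) * chi lam b *
        (expo be (row ord0 M) * h (jj be :: t) be (nrm (M, us))))); last first.
      move=> be _; have st' : size (jj be :: t) = q.+1 by rewrite /= st.
      have us_m' : size (nrm (M, us)).2 = m.+1 by rewrite nsz.
      rewrite expoZ mulrAC (hsemi (jj be :: t) be b (nrm (M, us)) st' lb us_m').
      by rewrite -!mulrA [h _ _ _ * _]mulrC.
    rewrite -mulr_sumr exprMn -exprM; field.
    by rewrite !expf_neq0 ?xa0.
  have /choice[g gP] (be : {ffun 'I_n.+1 -> 'I_K}) : exists g, pol g /\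
      forall x, size x.2 = m.+1 -> g x = h (jj be :: t) be (nrm x).
    by have [ph _ _] := hP (jj be :: t) (congr1 succn st); apply: pol_nrm.
  (* The truncated subtraction is exact where the coefficient is nonzero: be_i < E can then occur
     only for i in t, and there the denominator [rowprod t] supplies another E. *)
  exists E, (fun x : X => \sum_(be : {ffun 'I_n.+1 -> 'I_K}) (\prod_i x.1 ord0 i ^+ (be i + E * count_mem i t - E)) * g be x).
  split=> [|M us cM us_m].
    apply: pol_sum => be _; apply: polM; last by case: (gP be).
    by apply: pol_prod => i _; apply: polX; apply: pol_row0.
  rewrite /y /= us_m eqxx !mulr_suml; apply: eq_bigr => be _.
  have [_ ->] := gP be => //; rewrite mulrAC [RHS]mulrAC.
  have [->|h0] := eqVneq (h (jj be :: t) be (nrm (M, us))) 0; first by rewrite !mulr0.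
  congr (_ * _).
  have xE : xa M ^+ E != 0 by rewrite expf_neq0 // xa0.
  have rE : rowprod t M ^+ E != 0 by rewrite expf_neq0 // rowprod_neq0.
  apply/eqP; rewrite eqr_div //; apply/eqP.
  rewrite rowprod_count /expo /xa -!prodrXl -!big_split /=; apply: eq_bigr => i _.
  rewrite mxE -exprM -!exprD mulnC subnK //.
  have st' : size (jj be :: t) = q.+1 by rewrite /= st.
  have us_m' : size (nrm (M, us)).2 = m.+1 by rewrite nsz.
  have [it|it] := boolP (i \in t).
    rewrite -[X in (X <= _)%N]add0n leq_add // -{1}[E]muln1 leq_mul2l.
    by rewrite -has_pred1 has_count in it; rewrite it orbT.
  have [->|ij] := eqVneq i (jj be).
    by apply: leq_trans (leq_addr _ _); exact: jjP h0.
  have [_ hg _] := hP _ st'; have := hg be _ h0 i; rewrite /ga.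
  rewrite (count_memPn _) ?muln0 ?subn0 ?inE ?negb_or ?ij //.
  by move=> /leq_trans; apply; apply: leq_addr.
have E1 : (w t - D y t) (M, us) = w t (M, us) - D (fun t => y t (M, us)) t.
  by rewrite (D_morph (L := fun v : X -> k^o => v (M, us)) y t (fun _ _ => erefl)).
rewrite E1; case: (eqVneq (size us) m.+1) => [us_m|us_m]; last first.
  have [w0 _ _] := Sw t st; rewrite w0 //; last exact/eqP.
  rewrite (@eq_D _ _ q _ (fun=> 0)) // ?D0 ?subr0 // => t' _.
  by rewrite /y /= (negPf us_m).
have xE : xa M ^+ E != 0 by rewrite expf_neq0 // xa0.
apply/eqP; rewrite subr_eq0; apply/eqP; apply: (mulfI xE); rewrite -wE //.
have us_m' : size (nrm (M, us)).2 = m.+1 by rewrite nsz.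
have PN : P t (M, us) = \sum_be expo be (row ord0 M) * h t be (nrm (M, us)).
  have [_ _ hE] := hP t st; rewrite -hE.
  have -> : ins (row ord0 M) (nrm (M, us)) = nrm (M, us).
    rewrite -[RHS]ins_row; congr (ins _ _); apply/rowP => j.
    by rewrite [LHS]mxE [RHS]mxE nrm_row0.
  have uu := base_unitri (M, us); have /unitriP[tu du] := uu.
  rewrite /nrm /= Psemi ?unitri_lowu // chi_unitri // du expr1n !mul1r.
  by [].
rewrite PN -(D_morph (L := fun z => xa M ^+ E * z)); last by move=> u v; rewrite mulrBr.
rewrite (@eq_D _ _ q _ (fun t' => \sum_be expo be (row ord0 M) * h (jj be :: t') be (nrm (M, us)))) //.
  rewrite D_sum; apply: eq_bigr => be _.
  rewrite (D_morph (L := fun z => expo be (row ord0 M) * z)) => [|u v]; last by rewrite mulrBr.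
  congr (_ * _); apply/eqP; rewrite -subr_eq0; apply/eqP.
  exact: (hD (jj be :: t) be _ (congr1 succn st) us_m').
by move=> t' _; rewrite /y /= us_m eqxx mulrC mulfVK.
Qed.

End MatrixRow.

Section LinearRow.
Variables (k : closedFieldType) (n : nat) (lam : 'I_n.+1 -> int).
Notation X := ('M[k]_n.+1 * seq (UT k n.+1))%type.
Notation chart := (@torus_chart k n).
Notation coch := (coch lam (fun b M : 'M[k]_n.+1 => b *m M) (@coordU k n.+1 n.+1)).
Notation pol := (pol (@coordU k n.+1 n.+1)).

Lemma pol_detU : pol (fun x => \det x.1).
Proof.
apply: (@pol_coordM_U _ _ _ (fun M => \det M)).
by apply: pol_det => i j; apply: pol_entry.
Qed.

Lemma chart_det M : chart M -> \det M != 0.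
Proof. by move=> [uM _]; rewrite -unitfE -unitmxE. Qed.

(** With det inverted, the entries of the first row have no common zero. A power of det is a
    combination of their N-th powers, and the resulting partition of unity, evaluated at normalized
    points, contracts the row for every weight. *)
Lemma gl_row q m w :
  (forall t, size t = q.+1 -> coch chart (fun M => rowprod t M * \det M) m (w t)) ->
  (forall t, size t = q.+2 -> null_on chart (D w t)) ->
  exists y,
    (forall t, size t = q -> coch chart (fun M => rowprod t M * \det M) m (y t)) /\
    forall t, size t = q.+1 -> null_on chart (w t - D y t).
Proof.
case: m => [|m] Sw Dw.
  exists (fun=> 0); split=> [t _ M us _ //|t st M us dM].
  rewrite (D0 (X -> k^o)) subr0.
  exact: (Sw t st M us dM).
have [||N [a [_ aP]]] := common_denom 0 _ _ Sw.
- by move=> t; apply: polM; [apply: pol_rowprod | apply: pol_detU].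
- by move=> t M cM; rewrite mulf_neq0 ?rowprod_neq0 ?chart_det.
have pdet : tsemi (fun=> 1) (fun M : 'M[k]_n.+1 => \det M).
  move=> d M d0; have -> : scl d M = diag_mx (\row_i d i) *m M.
    by apply/matrixP => i j; rewrite mul_diag_mx !mxE.
  by rewrite det_mulmx det_diag; congr (_ * _); apply: eq_bigr => i _; rewrite mxE.
have prow (i : 'I_n.+1) : tsemi (fun l => l == ord0) (fun M : 'M[k]_n.+1 => M ord0 i).
  move=> d M d0; rewrite mxE (bigD1 ord0) //= big1 ?mulr1 // => l /negPf -> //.
have [||M dM|K [g [pg g1 gT]]] := partition_of_unity N _ pdet _ prow.
- by apply: pol_det => i j; apply: pol_entry.
- by move=> i; apply: pol_entry.
- apply: contrapT => x0; case/eqP: dM; rewrite (expand_det_row _ ord0) big1 // => i _.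
  have -> : M ord0 i = 0 by apply/eqP; apply: contraT => Mi; case: x0; exists i.
  by rewrite mul0r.
pose fp (x : X) := (nrm x).1.
have dfp x : \det (fp x) = \det x.1.
  have /unitriP[tu du] := base_unitri x.
  by rewrite det_mulmx det_trig // big1 ?mul1r.
pose W i (x : X) := g i (fp x) * fp x ord0 i ^+ N / \det (fp x) ^+ K.
have W1 x : chart x.1 -> \sum_i W i x = 1.
  by move=> cx; apply: g1; rewrite dfp chart_det.
pose y t (x : X) : k^o := \sum_i W i x * w (i :: t) x.
exists y; split=> [t st|t st M us cM].
  have si i : size (i :: t) = q.+1 by rewrite /= st.
  split=> [M us cM us_m|b M us cM lb us_m|].
  - by apply: big1 => i _; have [w0 _ _] := Sw _ (si i); rewrite w0 // mulr0.
  - rewrite /y mulr_sumr; apply: eq_bigr => i _; have [_ ws _] := Sw _ (si i).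
    rewrite ws // mulrCA; congr (_ * (_ * _)); rewrite /W /fp nrm_low //; last first.
      by move=> us0; move: us_m; rewrite us0.
    rewrite /= -scl_dg gT //; first by move=> l; case/andP: lb => tb ub; apply: trig_unit_diag.
    by rewrite -[_ *m M]/(fp (M, us)) dfp chart_det.
  exists (N + K)%N, (fun x => \sum_i g i (fp x) * a (i :: t) x * rowprod t x.1 ^+ K).
  split=> [|M us cM us_m].
    apply: pol_sum => i _; have [pa _] := aP _ (si i).
    apply: polM; last by apply/polX/pol_rowprod.
    apply: polM => //; apply: (pol_subst (phi := fp)) (pg i) => _ [j [l ->]].
    apply: pol_mulmx => ? ?; first exact: pol_entryU.
    exact/(@pol_coordM_U _ _ _ (fun M => M _ _))/pol_entry.
  rewrite /y mulr_suml; apply: eq_bigr => i _; have [_ ->] := aP _ (si i) => //.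
  rewrite /W dfp nrm_row0 /= /rowprod big_cons -/(rowprod t M) !exprMn !exprD.
  have := rowprod_neq0 t cM; have := chart_det cM; have [_ /(_ i)] := cM.
  move: (M ord0 i) (\det M) (rowprod t M) => xi d r xi0 d0 r0.
  by field; rewrite !expf_neq0.
have -> : (w t - D y t) (M, us) = w t (M, us) - D y t (M, us) by [].
rewrite -(D_morph (L := fun v : X -> k^o => v (M, us))) //.
rewrite /y D_sum; apply/eqP; rewrite subr_eq0; apply/eqP.
rewrite -[LHS]mul1r -(W1 (M, us)) // mulr_suml; apply: eq_bigr => i _.
rewrite (D_morph (L := fun z : k^o => W i (M, us) * z : k^o) (fun u => w (i :: u) (M, us))).
  congr (_ * _); have := Dw (i :: t) (congr1 succn st) M us cM.
  have -> : D w (i :: t) (M, us) = w t (M, us) - D (fun u => w (i :: u)) t (M, us) by [].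
  rewrite -(D_morph (L := fun v : X -> k^o => v (M, us))) // => /eqP.
  by rewrite subr_eq0 => /eqP.
by move=> u v; rewrite mulrBr.
Qed.

End LinearRow.

(** * Reduction of the rank *)

Section Blocks.
Variables (k : closedFieldType) (n : nat).
Notation M1 := 'M[k]_(1 + n).

Definition blk (s : k) (A : 'M[k]_n) : M1 := block_mx s%:M 0 0 A.

Lemma blkM s t A B : blk s A *m blk t B = blk (s * t) (A *m B).
Proof.
by rewrite /blk mulmx_block !mulmx0 !mul0mx !addr0 !add0r -scalar_mxM.
Qed.

Lemma low_block (b : M1) : is_trig_mx b ->
  b = block_mx (b ord0 ord0)%:M 0 (dlsubmx b) (drsubmx b).
Proof.
move=> /is_trig_mxP tb; rewrite -{1}[b]submxK; congr block_mx.
  rewrite [ulsubmx b]mx11_scalar; congr (_ %:M); rewrite !mxE; congr (b _ _); exact: val_inj.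
by apply/matrixP => i j; rewrite !mxE tb //= [i]ord1.
Qed.

Lemma drsub_trig (b : M1) : is_trig_mx b -> is_trig_mx (drsubmx b).
Proof. by move=> /is_trig_mxP tb; apply/is_trig_mxP => i j ij; rewrite !mxE tb. Qed.

Lemma drsub_diag (b : M1) i : (drsubmx b) i i = b (lift ord0 i) (lift ord0 i).
Proof. by rewrite !mxE; congr (b _ _); apply: val_inj. Qed.

Lemma drsub_lowu (b : M1) : lowu b -> lowu (drsubmx b).
Proof.
move=> /andP[tb ub]; rewrite /lowu drsub_trig // trig_unitP ?drsub_trig //.
by apply/forallP => i; rewrite drsub_diag trig_unit_diag.
Qed.

Lemma drsub_unitri (b : M1) : unitri b -> unitri (drsubmx b).
Proof.
by move=> /unitriP[tb db]; apply/unitriP; split=> [|i]; rewrite ?drsub_trig ?drsub_diag.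
Qed.

Lemma drsubM (b c : M1) : is_trig_mx b -> is_trig_mx c ->
  drsubmx (b *m c) = drsubmx b *m drsubmx c.
Proof.
move=> tb tc; rewrite {1}(low_block tb) {1}(low_block tc) mulmx_block block_mxKdr.
by rewrite mulmx0 add0r.
Qed.

Lemma drsub_dg (b : M1) : drsubmx (dg b) = dg (drsubmx b).
Proof.
by apply/matrixP => i j; rewrite !mxE (inj_eq (@rshift_inj _ _)).
Qed.

Lemma dg_low (b : M1) : is_trig_mx b -> dg b = blk (b ord0 ord0) (dg (drsubmx b)).
Proof.
move=> tb; rewrite (low_block (dg_trig b)) drsub_dg /blk; congr block_mx.
  by rewrite dg_diag.
by apply/matrixP => i j; rewrite !mxE eq_rlshift.
Qed.

Lemma drsubV (b : M1) : lowu b -> drsubmx (invmx b) = invmx (drsubmx b).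
Proof.
move=> lb; have [tb ub] := andP lb; have [_ ud] := andP (drsub_lowu lb).
apply: (can_inj (mulKmx ud)); rewrite mulmxV // -drsubM ?trig_invmx // mulmxV //.
by apply/matrixP => i j; rewrite !mxE (inj_eq (@rshift_inj 1 n)).
Qed.

Definition drU (u : UT k (1 + n)) : UT k n := UTof (drsubmx (sval u)).
Definition iota (u : UT k n) : UT k (1 + n) := UTof (blk 1 (sval u)).

Lemma drUE u : sval (drU u) = drsubmx (sval u).
Proof. exact/UTofE/drsub_unitri/(svalP u). Qed.

Lemma blk_trig s (A : 'M[k]_n) : is_trig_mx A -> is_trig_mx (blk s A).
Proof.
move=> /is_trig_mxP tA; apply/is_trig_mxP => i j.
rewrite /blk; case: (split_ordP i) => i' ->; case: (split_ordP j) => j' -> /=.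
- by rewrite [i']ord1 [j']ord1.
- by rewrite block_mxEur mxE.
- by rewrite [j']ord1.
by rewrite block_mxEdr ltn_add2l => /tA.
Qed.

Lemma blk_diag s (A : 'M[k]_n) : (blk s A) ord0 ord0 = s /\
  forall i, (blk s A) (lift ord0 i) (lift ord0 i) = A i i.
Proof.
have e0 : ord0 = lshift n (ord0 : 'I_1) by apply: val_inj.
split=> [|i]; first by rewrite {1 2}e0 /blk block_mxEul mxE eqxx.
have -> : lift ord0 i = rshift 1 i by apply: val_inj.
by rewrite /blk block_mxEdr.
Qed.

Lemma blk_lowu s A : s != 0 -> lowu A -> lowu (blk s A).
Proof.
move=> s0 /andP[tA uA]; have [b0 bi] := blk_diag s A.
rewrite /lowu blk_trig // trig_unitP ?blk_trig //; apply/forallP => i.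
by case: (unliftP ord0 i) => [j|] ->; rewrite ?b0 // bi trig_unit_diag.
Qed.

Lemma iotaE u : sval (iota u) = blk 1 (sval u).
Proof.
have /unitriP[tu du] := svalP u; have [b0 bi] := blk_diag 1 (sval u).
apply: UTofE; apply/unitriP; split=> [|i]; first exact: blk_trig.
by case: (unliftP ord0 i) => [j|] ->; rewrite ?b0 // bi.
Qed.

Lemma iota1 : iota (UT1 k n) = UT1 k (1 + n).
Proof. by apply: UT_inj; rewrite iotaE !UT1E /blk -scalar_mx_block. Qed.

Lemma drU1 : drU (UT1 k (1 + n)) = UT1 k n.
Proof.
apply: UT_inj; rewrite drUE !UT1E; apply/matrixP => i j.
by rewrite !mxE (inj_eq (@rshift_inj 1 n)).
Qed.

Lemma drU_cj b u : lowu b -> drU (cj b u) = cj (drsubmx b) (drU u).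
Proof.
move=> lb; have [tb ub] := andP lb; have [tu _] := unitriP _ (svalP u).
apply: UT_inj; rewrite drUE !cjE ?drsub_lowu // drUE !drsubM ?trig_invmx ?trig_mulmx ?dg_trig //.
by rewrite drsub_dg drsubV.
Qed.

Lemma block_entry (s : k) (v : 'cV[k]_n) (A : 'M[k]_n) (i j : 'I_(1 + n)) :
  block_mx s%:M 0 v A i j = match unlift ord0 i, unlift ord0 j with
    | Some i', Some j' => A i' j'
    | Some i', None => v i' 0
    | None, None => s
    | None, Some _ => 0
  end.
Proof.
have e0 : ord0 = lshift n (ord0 : 'I_1) by apply: val_inj.
have eS (l : 'I_n) : lift ord0 l = rshift 1 l by apply: val_inj.
case: unliftP => [i'|] ->; case: unliftP => [j'|] ->; rewrite ?eS ?e0.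
- by rewrite block_mxEdr.
- by rewrite block_mxEdl.
- by rewrite block_mxEur mxE.
by rewrite block_mxEul mxE eqxx.
Qed.

Lemma blkV s A : s != 0 -> A \in unitmx -> invmx (blk s A) = blk s^-1 (invmx A).
Proof.
move=> s0 uA.
have E : blk s A *m blk s^-1 (invmx A) = 1%:M.
  by rewrite blkM mulfV // mulmxV // /blk -scalar_mx_block.
have [ub _] := mulmx1_unit E.
by rewrite -[RHS](mulKmx ub) E mulmx1.
Qed.

Lemma iota_cj s b u : s != 0 -> lowu b -> cj (blk s b) (iota u) = iota (cj b u).
Proof.
move=> s0 lb; have [tb ub] := andP lb; have [b0 bi] := blk_diag s b.
apply: UT_inj; rewrite cjE ?blk_lowu // !iotaE cjE // dg_low ?blk_trig // b0.
by rewrite /blk block_mxKdr -!/(blk _ _) blkV // !blkM mulr1 mulfV.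
Qed.

Section Elimination.
Variables (c : 'I_n.+1).
Implicit Type M : 'M[k]_(1 + n, n.+1).

(** Gaussian elimination with the entry of the first row in column c as pivot: [el M] clears the
    rest of that column, [mm M] is the remaining block, and [nn] rebuilds a matrix from a first row
    and a block ([el_nn]). *)
Definition elv M : 'cV[k]_n := - (M ord0 c)^-1 *: dsubmx (col c M).
Definition el M : M1 := block_mx 1%:M 0 (elv M) 1%:M.
Definition mm M : 'M[k]_n := col' c (dsubmx (el M *m M)).
Definition nn (l : 'rV[k]_n.+1) (A : 'M[k]_n) : 'M[k]_(1 + n, n.+1) :=
  col_mx l (\matrix_(i, j) if unlift c j is Some j' then A i j' else 0).

Lemma elE M (i j : 'I_(1 + n)) :
  el M i j = match unlift ord0 i, unlift ord0 j with
    | Some i', Some j' => (i' == j')%:R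
    | Some i', None => - (M ord0 c)^-1 * M (rshift 1 i') c
    | None, None => 1
    | None, Some _ => 0
  end.
Proof.
rewrite /el block_entry; case: unliftP => [i'|] _; case: unliftP => [j'|] _ //.
  by rewrite mxE.
by rewrite !mxE.
Qed.

Lemma el_unitri M : unitri (el M).
Proof.
apply/unitriP; split=> [|i].
  apply/is_trig_mxP => i j; rewrite /el.
  case: (split_ordP i) => i' ->; case: (split_ordP j) => j' -> /=.
  - by rewrite [i']ord1 [j']ord1.
  - by rewrite block_mxEur mxE.
  - by rewrite [j']ord1.
  by rewrite block_mxEdr ltn_add2l !mxE -val_eqE => /ltn_eqF /= ->.
by rewrite /el; case: (split_ordP i) => i' ->; rewrite ?block_mxEul ?block_mxEdr mxE eqxx.
Qed.

Lemma row0_usub M : usubmx M = row ord0 M.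
Proof. by apply/matrixP => i j; rewrite !mxE; congr (M _ _); apply: val_inj; rewrite [i]ord1. Qed.

Lemma el_mul M : el M *m M = col_mx (row ord0 M) (elv M *m row ord0 M + dsubmx M).
Proof.
rewrite -{2}[M]vsubmxK /el mul_block_col !mul1mx mul0mx addr0.
by rewrite row0_usub.
Qed.

Lemma mmE M i j :
  mm M i j = M (rshift 1 i) (lift c j) - M (rshift 1 i) c / M ord0 c * M ord0 (lift c j).
Proof.
rewrite /mm el_mul mxE col_mxKd mxE [X in X + _]mxE big_ord1 !mxE addrC; congr (_ + _).
by rewrite !mulNr [_^-1 * _]mulrC.
Qed.

Lemma el_nn M : M ord0 c != 0 -> el M *m M = nn (row ord0 M) (mm M).
Proof.
move=> M0; rewrite el_mul; congr col_mx; apply/matrixP => i j; rewrite mxE addrC [RHS]mxE.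
rewrite [X in _ + X]mxE big_ord1 !mxE; case: unliftP => [j'|] ->.
  by rewrite mmE !mulNr [_^-1 * _]mulrC.
by rewrite !mulNr [_^-1 * _]mulrC mulfVK // subrr.
Qed.

Lemma el_low b M : lowu b -> M ord0 c != 0 ->
  el (b *m M) *m b = blk (b ord0 ord0) (drsubmx b) *m el M.
Proof.
move=> lb M0; have [tb ub] := andP lb; have b0 := trig_unit_diag ord0 tb ub.
rewrite {2}(low_block tb) /el /blk !mulmx_block !mul1mx !mulmx1 !mulmx0 !mul0mx !addr0 !add0r.
congr block_mx; rewrite /elv.
have -> : (b *m M) ord0 c = b ord0 ord0 * M ord0 c.
  rewrite -[M]/((M : 'M_n.+1)) mxE (bigD1 ord0) //= big1 ?addr0 // => l l0.
  by move/is_trig_mxP: tb => ->; rewrite ?mul0r // lt0n.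
have -> : dsubmx (col c (b *m M)) = dlsubmx b *m usubmx (col c M) + drsubmx b *m dsubmx (col c M).
  have -> : col c (b *m M) = b *m col c M by rewrite !colE mulmxA.
  by rewrite -{1}[col c M]vsubmxK {1}(low_block tb) mul_block_col col_mxKd.
have -> : usubmx (col c M) = (M ord0 c)%:M.
  rewrite [LHS]mx11_scalar; congr (_ %:M); rewrite !mxE; congr (M _ _); exact: val_inj.
rewrite -scalemxAl !mul_mx_scalar scalerA -scalemxAr !invfM.
rewrite [_ * b _ _]mulNr [_ / _ * _]mulrC mulrA mulfV // mul1r scalerDr scalerA mulNr mulVf //.
by rewrite scaleN1r addrAC addNr add0r.
Qed.

Lemma mm_low b M : lowu b -> M ord0 c != 0 -> mm (b *m M) = drsubmx b *m mm M.
Proof.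
move=> lb M0; rewrite /mm mulmxA el_low // -mulmxA el_mul /blk.
rewrite mul_block_col !col_mxKd mul0mx add0r; apply/matrixP => i j.
rewrite [LHS]mxE [LHS]mxE [RHS]mxE; apply: eq_bigr => l _.
by congr (_ * _); rewrite [RHS]mxE.
Qed.

Lemma nn_mul s b l A : blk s b *m nn l A = nn (s *: l) (b *m A).
Proof.
rewrite /nn /blk mul_block_col !mul0mx addr0 add0r mul_scalar_mx; congr col_mx.
apply/matrixP => i j; rewrite !mxE; case: unliftP => [j'|] ->.
  by rewrite mxE; apply: eq_bigr => a _; rewrite mxE liftK.
by rewrite big1 // => a _; rewrite mxE unlift_none mulr0.
Qed.

Lemma nn_row0 l A j : nn l A ord0 j = l 0 j.
Proof.
have -> : ord0 = lshift n (ord0 : 'I_1) by apply: val_inj.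
by rewrite /nn col_mxEu.
Qed.

Lemma nn_rowS l A i j :
  nn l A (lift ord0 i) j = if unlift c j is Some j' then A i j' else 0.
Proof.
have -> : lift ord0 i = rshift 1 i by apply: val_inj.
by rewrite /nn col_mxEd mxE.
Qed.

Lemma det_nn l A : \det (nn l A : 'M_n.+1) = (-1) ^+ c * l 0 c * \det A.
Proof.
rewrite (expand_det_col _ c) (bigD1 ord0) //= big1 ?addr0 => [|i i0].
  rewrite nn_row0 /cofactor /= add0n mulrCA -mulrA; congr (_ * (_ * \det _)).
  by apply/matrixP => i j; rewrite [LHS]mxE [LHS]mxE nn_rowS liftK.
case: (unliftP ord0 i) i0 => [i'|] -> // _.
by rewrite nn_rowS unlift_none mul0r.
Qed.

Lemma det_mm M : M ord0 c != 0 -> \det (M : 'M_n.+1) = (-1) ^+ c * M ord0 c * \det (mm M).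
Proof.
move=> M0; have -> : M ord0 c = row ord0 M 0 c by rewrite mxE.
rewrite -det_nn -el_nn // det_mulmx.
have /unitriP[te de] := el_unitri M; rewrite det_trig // big1 ?mul1r // => i _.
Qed.

(** An equivariant self-map of U ([phi_low]), hence homotopic to the identity through [prism]. Up to
    translation by [el M], its values lie in the unipotent group of rank one less ([phi_cj]): this
    is the geometric content of Shapiro's lemma here. *)
Definition phi M (u : UT k (1 + n)) : UT k (1 + n) :=
  UTof (blk 1 (drsubmx (sval u)) *m el M).

Lemma phiE M u : sval (phi M u) = blk 1 (drsubmx (sval u)) *m el M.
Proof.
apply: UTofE; apply: unitriM (el_unitri M); rewrite -drUE -iotaE.
exact: (svalP (iota (drU u))).
Qed.

Lemma phi_cj M u : cj (el M) (phi M u) = iota (drU u).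
Proof.
apply: UT_inj; have ue := el_unitri M; rewrite cjE ?unitri_lowu // unitri_dg // mul1mx phiE.
by rewrite mulmxK ?unitri_unit // iotaE drUE.
Qed.

Lemma phi_low b M u : lowu b -> M ord0 c != 0 ->
  phi (b *m M) (cj b u) = cj b (phi M u).
Proof.
move=> lb M0; have [tb ub] := andP lb; have b0 := trig_unit_diag ord0 tb ub.
have [_ ud] := andP (drsub_lowu lb).
apply: UT_inj; rewrite phiE -drUE drU_cj // !cjE ?drsub_lowu // drUE phiE.
apply: (can_inj (mulmxK ub)); rewrite -[RHS]mulmxA mulVmx // mulmx1 -[LHS]mulmxA el_low //.
rewrite mulmxA blkM mul1r mulmxKV // dg_low // [RHS]mulmxA blkM mulr1.
by [].
Qed.

End Elimination.
End Blocks.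

Section HomogeneousInterpolation.
Variables (k : closedFieldType) (n : nat).

Definition good (l : 'rV[k]_n) := forall i, l 0 i != 0.

(** As in [interpolation], but the coefficients keep the degree w: they are the coefficients of s^w
    after the argument is scaled by s. The rows [l j] are good so that the slices at them stay in
    the chart. *)
Lemma homog_interp (I : finType) (a : I -> 'rV[k]_n -> k) (Y : Type)
    (v : I -> Y -> k) w :
  (forall i, pol (@coordM k 1 n) (a i)) ->
  (forall l s y, good l -> s != 0 ->
    \sum_i a i (s *: l) * v i y = s ^+ w * \sum_i a i l * v i y) ->
  exists m (l : 'I_m -> 'rV[k]_n) (b : 'I_m -> 'rV[k]_n -> k),
  [/\ forall j, good (l j), forall j, pol (@coordM k 1 n) (b j),
      forall j s u, b j (s *: u) = s ^+ w * b j u &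
      forall u y, good u ->
        \sum_i a i u * v i y = \sum_j b j u * \sum_i a i (l j) * v i y].
Proof.
move=> pa aH; pose H (l : 'rV[k]_n) (y : Y) : k^o := \sum_i a i l * v i y.
have [|m [l [c cE]]] := @interpolation k {l | good l} (Y -> k^o) #|I|
    (fun i l => a (enum_val i) (sval l)) (fun i => v (enum_val i)) (fun l => H (sval l)).
  move=> l; apply/funext => y; rewrite fct_sumE /H (eq_bigl (mem I)) // big_enum_val.
  by apply: eq_bigr.
pose b0 j u := \sum_i c j i * a (enum_val i) u.
have HE u y : good u -> H u y = \sum_j b0 j u * H (sval (l j)) y.
  move=> gu; have /(congr1 (@^~ y)) := cE (exist _ u gu); rewrite /= fct_sumE => ->.
  by [].
have ex j : exists P : 'rV[k]_n -> {poly k}, [/\ forall d, pol (@coordM k 1 n) (fun u => (P u)`_d),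
    exists K, forall u, (size (P u) <= K)%N & forall s u, b0 j (s *: u) = (P u).[s]].
  apply: (@pol_expand k _ _ (@coordM k 1 n) _ (fun s u => s *: u)); last first.
    by apply: pol_sum => i _; apply: polM; [apply: pol_cst | apply: pa].
  move=> _ [i [i' ->]]; exists (fun u : 'rV[k]_n => u i i' *: 'X); split=> [d||s u].
  - apply: (@eq_pol _ _ _ (fun u : 'rV[k]_n => u i i' * (d == 1)%:R)) => [u|].
      by rewrite coefZ coefX.
    by apply: polM; [apply: pol_entry | apply: pol_cst].
  - by exists 2 => u; rewrite (leq_trans (size_scale_leq _ _)) // size_polyX.
  by rewrite mxE hornerZ hornerX mulrC.
have [P PP] := choice ex.
exists m, (fun j => sval (l j)), (fun j u => (P j u)`_w); split.
- by move=> j; apply: (svalP (l j)).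
- by move=> j; case: (PP j).
- move=> j s u; have [_ _ PE] := PP j.
  have -> : P j (s *: u) = \poly_(d < size (P j u)) (s ^+ d * (P j u)`_d).
    apply: poly_inj => c' _; rewrite -PE scalerA PE horner_poly horner_coef.
    by apply: eq_bigr => d _; rewrite exprMn; ring.
  by rewrite coef_poly; case: ltnP => // nw; rewrite nth_default ?mulr0.
move=> u y gu; have : H u y *: 'X^w = \sum_j H (sval (l j)) y *: P j u.
  apply: poly_inj => s s0; rewrite hornerZ hornerXn mulrC -aH // -/(H _ _).
  rewrite HE; last by move=> i; rewrite mxE mulf_neq0.
  rewrite horner_sum; apply: eq_bigr => j _; have [_ _ ->] := PP j.
  by rewrite hornerZ mulrC.
move/(congr1 (fun p : {poly k} => p`_w)); rewrite coefZ coefXn eqxx mulr1 => E.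
rewrite -[LHS]/(H u y) E.
by rewrite coef_sum; apply: eq_bigr => j _; rewrite coefZ mulrC.
Qed.

End HomogeneousInterpolation.

(** * Shapiro's lemma for the columns of the Cech complex *)

Section Column.
Variables (k : closedFieldType) (n : nat) (lam : 'I_n.+1 -> int) (c : 'I_n.+1).
Let lam' i := lam (lift ord0 i).
Notation X1 := ('M[k]_n.+1 * seq (UT k n.+1))%type.
Notation X0 := ('M[k]_n * seq (UT k n))%type.
Notation chart := (@torus_chart k n).
Notation unit0 := (fun A : 'M[k]_n => A \in unitmx).
Notation coch1 := (coch lam (fun b M : 'M[k]_n.+1 => b *m M) (@coordU k n.+1 n.+1) chart).
Notation coch0 := (coch lam' (fun b M : 'M[k]_n => b *m M) (@coordU k n n) unit0).
Notation pol1 := (pol (@coordU k n.+1 n.+1)).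
Notation mm := (@mm k n c).
Notation nn := (@nn k n c).
Notation phi := (@phi k n c).

Definition pz (z : X1 -> k^o) : X1 -> k^o :=
  fun x => prism (phi x.1) (fun us => z (x.1, us) : k) x.2.

Lemma prism_support (z : X1 -> k^o) m M us : chart M ->
  (forall us, size us <> m.+1 -> z (M, us) = 0) -> size us <> m -> pz z (M, us) = 0.
Proof.
move=> cM z0 us_m; rewrite /pz prism_sumE big1 // => i _ /=.
have iu := ltn_ord i; rewrite z0 ?mulr0 // size_cat size_map size_takel // size_drop.
by rewrite addSn subnKC ?(ltnW iu) // => -[].
Qed.

Lemma reg_phi (F g : 'M[k]_n.+1 -> k) dom l i j :
  pol1 (fun x => F x.1) -> pol1 (fun x => g x.1) ->
  (forall x, dom x -> F x.1 = x.1 ord0 c * g x.1) ->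
  reg (@coordU k n.+1 n.+1) dom (fun x => F x.1)
    (fun x => sval (phi x.1 (nth (UT1 k n.+1) x.2 l)) i j).
Proof.
move=> pF pg FE.
have rx : reg (@coordU k n.+1 n.+1) dom (fun x => F x.1) (fun x => (x.1 ord0 c)^-1).
  exact: (reg_inv_factor pg).
apply: (@eq_reg _ _ _ _ _ (fun x => (blk 1 (drsubmx (sval (nth (UT1 k n.+1) x.2 l) : 'M_(1 + n)))
   *m el c x.1) i j)); first by move=> x _ _; rewrite phiE.
apply: (@reg_mulmx _ _ _ _ _ pF) => a b.
  apply: reg_pol; under eq_fun do rewrite /blk block_entry.
  case: unlift => [a'|]; case: unlift => [b'|]; try exact: pol_cst.
    by under eq_fun do rewrite !mxE; apply: pol_entryU.
apply: (@eq_reg _ _ _ _ _ (fun x : X1 => match unlift ord0 a, unlift ord0 b return k with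
    | Some i', Some j' => (i' == j')%:R
    | Some i', None => - (x.1 ord0 c)^-1 * x.1 (rshift 1 i') c
    | None, None => 1
    | None, Some _ => 0
  end)); first by move=> x _ _; exact/esym/elE.
case: unlift => [a'|]; case: unlift => [b'|]; try exact/reg_pol/pol_cst.
apply: regM; first exact: regN rx.
exact/reg_pol/(@pol_coordM_U _ _ _ (fun M => M _ _))/pol_entry.
Qed.

Lemma coch_prism (F g : 'M[k]_n.+1 -> k) m z :
  pol1 (fun x => F x.1) -> pol1 (fun x => g x.1) ->
  (forall M, chart M -> F M = M ord0 c * g M) -> (forall M, chart M -> F M != 0) ->
  coch1 F m.+1 z -> coch1 F m (pz z).
Proof.
move=> pF pg FE F0 [z0 zs [N [a [pa aE]]]].
have supp M us : chart M -> size us <> m -> pz z (M, us) = 0.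
  by move=> cM; apply: prism_support => // us'; apply: z0.
case: m z0 zs aE supp => [|m] z0 zs aE supp.
  by move=> M [|u us] cM //; apply: supp.
split=> [M us|b M us cM lb us_m|]; first exact: supp.
  have M0 : M ord0 c != 0 by case: cM.
  rewrite /pz !prism_sumE size_map mulr_sumr; apply: eq_bigr => i _ /=.
  have sz : size (take i.+1 us ++ [seq phi M u | u <- drop i us]) = m.+2.
    rewrite size_cat size_map size_takel // size_drop addSn subnKC ?us_m //.
    exact: ltnW.
  rewrite mulrCA -zs //; congr (_ * z (_, _)).
  rewrite map_cat -map_take -map_drop -!map_comp; congr (_ ++ _).
  by apply: eq_map => u /=; rewrite phi_low.
pose dom (x : X1) := chart x.1 /\ size x.2 = m.+1.
have : reg (@coordU k n.+1 n.+1) dom (fun x => F x.1) (pz z).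
  apply: (@eq_reg _ _ _ _ _ (fun x => \sum_(i < m.+1) (-1) ^+ i *
      (a (x.1, take i.+1 x.2 ++ map (phi x.1) (drop i x.2)) * (F x.1)^-1 ^+ N))).
    move=> [M us] [cM us_m] _; rewrite /pz prism_sumE /= us_m; apply: eq_bigr => i _.
    rewrite aE ?exprVn // size_cat size_map size_takel ?size_drop ?us_m //.
    by have := ltn_ord i => iu; rewrite addSn subnKC // ltnW.
  apply: (@reg_sum _ _ _ _ _ pF) => i _; apply: regM; first exact/reg_pol/pol_cst.
  apply: regM; last first.
    apply: regX; apply: (@reg_inv_factor _ _ _ _ _ _ (fun=> 1)); first exact: pol_cst.
    by move=> x _; rewrite mulr1.
  apply: (reg_subst pF (C' := @coordU k n.+1 n.+1)
    (phi := fun x : X1 => (x.1, take i.+1 x.2 ++ map (phi x.1) (drop i x.2)))) pa.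
  move=> _ [[a' [b ->]]|[l [a' [b ->]]]] /=.
    exact/reg_pol/(@pol_coordM_U _ _ _ (fun M => M a' b))/pol_entry.
  have im : (i.+1 <= m.+1)%N by [].
  have [li|il] := ltnP l i.+1.
    apply: (@eq_reg _ _ _ _ _ (fun x : X1 => sval (nth (UT1 k n.+1) x.2 l) a' b)) => [x [_ sx] _|].
      by rewrite nth_cat size_takel ?sx // li nth_take.
    exact/reg_pol/pol_entryU.
  have [lm|ml] := ltnP (i + (l - i.+1)) m.+1.
    apply: (@eq_reg _ _ _ _ _ (fun x : X1 => sval (phi x.1 (nth (UT1 k n.+1) x.2 (i + (l - i.+1)))) a' b)) => [x [_ sx] _|].
      rewrite nth_cat size_takel ?sx // ltnNge il /= (nth_map (UT1 k n.+1)) ?nth_drop //.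
      by rewrite size_drop sx ltn_subRL.
    by apply: (reg_phi _ _ _ pF pg) => x [cx _]; apply: FE.
  apply: (@eq_reg _ _ _ _ _ (fun x : X1 => (1%:M : 'M[k]_n.+1) a' b)) => [x [_ sx] _|]; last exact/reg_pol/pol_cst.
  rewrite nth_default ?UT1E // size_cat size_map size_takel ?size_drop ?sx //.
  by rewrite -(leq_add2l i) addnA; lia.
move=> [N' [a' [pa' a'E]]]; exists N', a'; split=> // M us cM us_m.
by apply: a'E => //; apply: F0.
Qed.

Definition slice (l : 'rV[k]_n.+1) (z : X1 -> k^o) : X0 -> k^o :=
  fun y => z (nn l y.1, map (@iota k n) y.2).

Lemma nn_chart l A : good l -> A \in unitmx -> chart (nn l A).
Proof.
move=> gl uA; split=> [|i]; last by rewrite nn_row0.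
rewrite unitmxE unitfE det_nn !mulf_neq0 ?expf_neq0 ?oppr_eq0 ?oner_neq0 //.
by rewrite -unitfE -unitmxE.
Qed.

Lemma pol_slice X (C : (X -> k) -> Prop) (L : X -> 'rV[k]_n.+1) (Y : X -> X0) f :
  (forall i, pol C (fun x => L x 0 i)) -> (forall g, @coordU k n n g -> pol C (fun x => g (Y x))) ->
  pol1 f -> pol C (fun x => f (nn (L x) (Y x).1, map (@iota k n) (Y x).2)).
Proof.
move=> pL pY; apply: (pol_subst (phi := fun x => (nn (L x) (Y x).1, map (@iota k n) (Y x).2))).
move=> _ [[i [j ->]]|[l [i [j ->]]]] /=.
  case: (unliftP ord0 i) => [i'|] ->.
    under eq_fun do rewrite nn_rowS.
    case: unlift => [j'|]; last exact: pol_cst.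
    by apply: (pY (fun y => y.1 i' j')); left; exists i', j'.
  by under eq_fun do rewrite nn_row0.
have E x : nth (UT1 k n.+1) (map (@iota k n) (Y x).2) l = iota (nth (UT1 k n) (Y x).2 l).
  have [lm|ml] := ltnP l (size (Y x).2); first by rewrite (nth_map (UT1 k n)).
  by rewrite !nth_default ?size_map // iota1.
under eq_fun do rewrite E iotaE /blk block_entry.
case: unlift => [a'|]; case: unlift => [b'|]; try exact: pol_cst.
by apply: (pY (fun y => sval (nth (UT1 k n) y.2 l) a' b')); right; exists l, a', b'.
Qed.

Lemma coch_slice l F F0 e m z : good l -> e != 0 ->
  (forall A, A \in unitmx -> F (nn l A) = e * F0 A) ->
  coch1 F m z -> coch0 F0 m (slice l z).
Proof.
move=> gl e0 FE; case: m => [|m].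
  by move=> z0 A vs uA; apply/z0/nn_chart.
move=> [z0 zs [N [a [pa aE]]]]; split=> [A vs uA vs_m|b A vs uA lb vs_m|].
- by apply: z0; rewrite ?size_map //; apply: nn_chart.
- have E : nn l (b *m A) = blk 1 b *m nn l A by rewrite nn_mul scale1r.
  have lB : lowu (blk 1 b) by apply: blk_lowu; rewrite ?oner_neq0.
  have iE : map (@iota k n) (map (cj b) vs) = map (cj (blk 1 b)) (map (@iota k n) vs).
    by rewrite -!map_comp; apply: eq_map => u /=; rewrite iota_cj ?oner_neq0.
  rewrite /slice /= E iE zs ?size_map //; last exact: nn_chart.
  congr (_ * _); have [b0 bi] := blk_diag 1 b.
  rewrite /chi big_ord_recl b0 exp1rz mul1r.
  by apply: eq_bigr => i _; rewrite bi.
exists N, (fun y => a (nn l y.1, map (@iota k n) y.2) * (e ^+ N)^-1); split.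
  apply: polM; last exact: pol_cst.
  by apply: (pol_slice (L := fun=> l) (Y := id)) pa => [i|g]; [apply: pol_cst | apply: pol_gen].
move=> A vs uA vs_m; rewrite /slice aE ?size_map //; last exact: nn_chart.
by rewrite /= FE // exprMn invfM mulrA.
Qed.

Lemma slice_delta l z : delta (slice l z) = slice l (delta z).
Proof. by apply/funext => y; rewrite /delta /slice /= D_map. Qed.

(** Induction from rank n back to rank n + 1. Homogeneity of q in the first row supplies the weight
    lam_1, and r the remaining weights. *)
Definition pull (q : 'rV[k]_n.+1 -> k) (r : X0 -> k^o) : X1 -> k^o :=
  fun x => q (row ord0 x.1) * r (mm x.1, map (@drU k n) x.2).

Lemma mm_unit (M : 'M[k]_n.+1) : chart M -> mm M \in unitmx.
Proof.
move=> cM; have := chart_det cM; have [_ x0] := cM.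
by rewrite (det_mm (x0 c)) mulf_eq0 negb_or unitmxE unitfE => /andP[].
Qed.

Lemma coch_pull (F g : 'M[k]_n.+1 -> k) F0 m (q : 'rV[k]_n.+1 -> k) r :
  pol1 (fun x => F x.1) -> pol1 (fun x => g x.1) ->
  (forall M, chart M -> F M = M ord0 c * g M) -> (forall M, chart M -> F M != 0) ->
  reg (@coordU k n.+1 n.+1) (fun x => chart x.1) (fun x => F x.1) (fun x => q (row ord0 x.1)) ->
  reg (@coordU k n.+1 n.+1) (fun x => chart x.1) (fun x => F x.1) (fun x => (F0 (mm x.1))^-1) ->
  (forall s l, s != 0 -> good l -> q (s *: l) = s ^ lam ord0 * q l) ->
  coch0 F0 m r -> coch1 F m (pull q r).
Proof.
move=> pF pg FE Fn0 rq rF0 qh; case: m => [|m].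
  by move=> r0 M us cM; rewrite /pull r0 ?mulr0 //; apply: mm_unit.
move=> [r0 rs [N [a [pa aE]]]]; split=> [M us cM us_m|b M us cM lb us_m|].
- by rewrite /pull r0 ?mulr0 ?size_map //; apply: mm_unit.
- have [tb ub] := andP lb; have [_ x0] := cM.
  have -> : pull q r (b *m M, map (cj b) us) = q (b ord0 ord0 *: row ord0 M) *
      r (drsubmx (b : 'M_(1 + n)) *m mm M, map (cj (drsubmx (b : 'M_(1 + n)))) (map (@drU k n) us)).
    rewrite /pull /= mm_low //; congr (q _ * r (_, _)).
      by apply/rowP => j; rewrite !mxE -low_row0 // mxE.
    by rewrite -!map_comp; apply: eq_map => u /=; rewrite drU_cj.
  rewrite qh ?trig_unit_diag //; last by move=> i; rewrite mxE.
  rewrite rs ?size_map ?mm_unit ?drsub_lowu // /chi big_ord_recl mulrACA; congr (_ * _ * _).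
  by apply: eq_bigr => i _; rewrite drsub_diag.
have : reg (@coordU k n.+1 n.+1) (fun x => chart x.1 /\ size x.2 = m.+1) (fun x => F x.1) (pull q r).
  apply: (@eq_reg _ _ _ _ _ (fun x => q (row ord0 x.1) *
      (a (mm x.1, map (@drU k n) x.2) * (F0 (mm x.1))^-1 ^+ N))).
    move=> [M us] [cM us_m] _; rewrite /pull aE ?size_map ?mm_unit //.
    by rewrite exprVn.
  have wk f : reg (@coordU k n.+1 n.+1) (fun x => chart x.1) (fun x => F x.1) f ->
      reg (@coordU k n.+1 n.+1) (fun x => chart x.1 /\ size x.2 = m.+1) (fun x => F x.1) f.
    by move=> [N1 [a1 [p1 E1]]]; exists N1, a1; split=> // x [cx _]; apply: E1.
  apply: regM; first exact: wk.
  apply: regM; last by apply: regX; apply: wk.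
  apply: wk; apply: (reg_subst pF (phi := fun x : X1 => (mm x.1, map (@drU k n) x.2))) pa.
  move=> _ [[i [j ->]]|[l [i [j ->]]]] /=.
    apply: (@eq_reg _ _ _ _ _ (fun x : X1 => x.1 (rshift 1 i) (lift c j) -
        x.1 (rshift 1 i) c / x.1 ord0 c * x.1 ord0 (lift c j) : k)).
      by move=> x _ _; exact/esym/mmE.
    have pe a' b : pol1 (fun x : X1 => x.1 a' b).
      exact/(@pol_coordM_U _ _ _ (fun M => M a' b))/pol_entry.
    apply: (regB pF); first exact/reg_pol/pe.
    apply: regM; last exact/reg_pol/pe.
    apply: regM; first exact/reg_pol/pe.
    by apply: (reg_inv_factor pg) => x cx; apply: FE.
  have E us : nth (UT1 k n) (map (@drU k n) us) l = drU (nth (UT1 k n.+1) us l).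
    have [lm|ml] := ltnP l (size us); first by rewrite (nth_map (UT1 k n.+1)).
    by rewrite !nth_default ?size_map // drU1.
  apply: (@eq_reg _ _ _ _ _ (fun x : X1 =>
      sval (nth (UT1 k n.+1) x.2 l) (rshift 1 i) (rshift 1 j) : k)).
    by move=> x _ _; rewrite (E x.2) drUE !mxE.
  exact/reg_pol/pol_entryU.
move=> [N' [a' [pa' a'E]]]; exists N', a'; split=> // M us cM us_m.
by apply: a'E => //; apply: Fn0.
Qed.

End Column.

Section Shapiro.
Variables (k : closedFieldType).

Definition unit_dom n (M : 'M[k]_n) := M \in unitmx.
Definition coch_gl n (lam : 'I_n -> int) :=
  coch lam (fun b M : 'M[k]_n => b *m M) (@coordU k n n) (@unit_dom n) (fun M => \det M).
Definition coch_mat n (lam : 'I_n -> int) :=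
  coch lam (fun b M : 'M[k]_n => b *m M) (@coordU k n n) (@unit_dom n) (fun=> 1).
(** Acyclicity of the quotient coch_gl / coch_mat, that is, the inclusion of the polynomial cochains
    into the regular ones is a quasi-isomorphism. *)
Definition acyclic n (lam : 'I_n -> int) := forall q f, coch_gl lam q.+1 f ->
  coch_mat lam q.+2 (delta f) -> exists2 y, coch_gl lam q y & coch_mat lam q.+1 (f - delta y).

Variables (n : nat) (lam : 'I_n.+1 -> int).
Notation X1 := ('M[k]_n.+1 * seq (UT k n.+1))%type.
Notation X0 := ('M[k]_n * seq (UT k n))%type.
Notation chart := (@torus_chart k n).
Notation coch1 := (coch lam (fun b M : 'M[k]_n.+1 => b *m M) (@coordU k n.+1 n.+1) chart).
Notation pol1 := (pol (@coordU k n.+1 n.+1)).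
Hypothesis IH : acyclic (fun i => lam (lift ord0 i)).

Lemma delta_pull c q (r : X0 -> k^o) : delta (pull c q r) = pull c q (delta r).
Proof.
apply/funext => -[M us]; rewrite /delta /pull /= D_map.
by rewrite (D_morph (L := fun z : k^o => q (row ord0 M) * z : k^o)) // => u v; rewrite mulrBr.
Qed.

Lemma slice_el c z m (M : 'M[k]_n.+1) us : chart M ->
  coch1 (fun M => 1) m.+1 z \/ (exists F, coch1 F m.+1 z) ->
  z (M, map (phi c M) us) = slice c (row ord0 M) z (mm c M, map (@drU k n) us).
Proof.
move=> cM Sz; have [F [z0 zs _]] : exists F, coch1 F m.+1 z by case: Sz => // ?; exists (fun=> 1).
have ue := el_unitri c M; have [_ x0] := cM.
have iE : map (@iota k n) (map (@drU k n) us) = map (cj (el c M)) (map (phi c M) us).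
  by rewrite -!map_comp; apply: eq_map => u /=; rewrite phi_cj.
rewrite /slice /= iE -el_nn //.
case: (eqVneq (size us) m.+1) => [us_m|/eqP us_m].
  by rewrite zs ?unitri_lowu ?size_map // chi_unitri // mul1r.
by rewrite !z0 ?size_map //; apply: chart_low => //; apply: unitri_lowu.
Qed.

(** Composed with [phi], z depends on the first row and on the eliminated block only, and is a
    finite combination of slices z(l_j, -) with coefficients Q_j in the first row. The induction
    hypothesis corrects each slice, and the prism homotopy leads from the composite back to z. *)
Lemma column c t q z :
  coch1 (fun M => rowprod (c :: t) M * \det M) q.+1 z ->
  coch1 (rowprod (c :: t)) q.+2 (delta z) ->
  exists2 y, coch1 (fun M => rowprod (c :: t) M * \det M) q y &
    coch1 (rowprod (c :: t)) q.+1 (z - delta y).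
Proof.
pose F1 (M : 'M[k]_n.+1) := rowprod (c :: t) M * \det M.
pose F2 (M : 'M[k]_n.+1) := rowprod (c :: t) M.
rewrite -/F1 -/F2 => Sz Nz.
have pF2 : pol1 (fun x => F2 x.1) by apply: pol_rowprod.
have pF1 : pol1 (fun x => F1 x.1) by apply: polM => //; apply: pol_detU.
have F2n0 M : chart M -> F2 M != 0 by apply: rowprod_neq0.
have F1n0 M : chart M -> F1 M != 0 by move=> cM; rewrite mulf_neq0 ?F2n0 ?chart_det.
pose g2 (M : 'M[k]_n.+1) := rowprod t M.
pose g1 (M : 'M[k]_n.+1) := rowprod t M * \det M.
have pg2 : pol1 (fun x => g2 x.1) by apply: pol_rowprod.
have pg1 : pol1 (fun x => g1 x.1) by apply: polM => //; apply: pol_detU.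
have F2E M : chart M -> F2 M = M ord0 c * g2 M by rewrite /F2 /g2 /rowprod big_cons.
have F1E M : chart M -> F1 M = M ord0 c * g1 M.
  by rewrite /F1 /g1 /rowprod big_cons mulrA.
have [z0 zs [N0 [a0 [pa0 a0E]]]] := Sz.
(* N also bounds the absolute value of lam_1, so that the degree w of the cleared slices in the
   first row is a natural number. *)
pose N := maxn N0 (absz (lam ord0)).
have [a [pa aE]] : exists a, pol1 a /\ forall M us, chart M -> size us = q.+1 ->
    z (M, us) = a (M, us) / F1 M ^+ N.
  have [|a [pa aE]] := reg_ge (dom := fun x => chart x.1 /\ size x.2 = q.+1) (f := z) pF1 pa0
    (leq_maxl N0 (absz (lam ord0))).
    by move=> [M us] [cM us_m] _; apply: a0E.
  by exists a; split=> // M us cM us_m; apply: aE => //; apply: F1n0.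
have [|||||I [aa [bb [paa pbb aaE]]]] := pol_tensor (A := pol (@coordM k 1 n.+1))
    (B := pol (@coordU k n n)) (phi := fun l (y : X0) => (nn c l y.1, map (@iota k n) y.2))
    _ _ _ _ _ pa.
- exact: pol_cst.
- by move=> *; apply: polM.
- exact: pol_cst.
- by move=> *; apply: polM.
- move=> g Cg; have pg : pol (@coordU k n n) (fun y => g (nn c 0 y.1, map (@iota k n) y.2)).
    apply: (@pol_slice k n c _ _ (fun=> 0) id) (pol_gen Cg) => [i|h]; [exact: pol_cst | exact: pol_gen].
  case: Cg => [[i [j gE]]|[l [i [j gE]]]]; last first.
    exists (fun=> 1), (fun y => g (nn c 0 y.1, map (@iota k n) y.2)).
    by split=> // [|x y]; [apply: pol_cst | rewrite mul1r gE].
  case: (unliftP ord0 i) gE => [i'|] -> gE.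
    exists (fun=> 1), (fun y => g (nn c 0 y.1, map (@iota k n) y.2)).
    by split=> // [|x y]; [apply: pol_cst | rewrite mul1r gE /= !nn_rowS].
  exists (fun l => l 0 j), (fun=> 1); split=> [||x y]; [exact: pol_entry|exact: pol_cst|].
  by rewrite mulr1 gE /= nn_row0.
pose rp (l : 'rV[k]_n.+1) := \prod_(i <- c :: t) l 0 i.
(* This clears the poles of z in the first row; the additional factor l_c comes from the determinant
   of [nn c l A]. *)
pose eL l := (rp l * l 0 c) ^+ N.
have rp0 l : good l -> rp l != 0.
  by move=> gl; rewrite prodf_seq_neq0; apply/allP => i _ /=; apply: gl.
have eL0 l : good l -> eL l != 0 by move=> gl; rewrite expf_neq0 // mulf_neq0 // rp0.
have eLZ s l : eL (s *: l) = s ^+ (N * (size t).+2) * eL l.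
  rewrite /eL mulnC exprM -exprMn; congr (_ ^+ _); rewrite !mxE exprSr mulrACA; congr (_ * _).
  rewrite /rp; elim: (c :: t) (size t).+1 (erefl : size (c :: t) = (size t).+1) => [|i u IHu] m.
    by move=> <-; rewrite !big_nil mulr1.
  by case: m => // m [/IHu uE]; rewrite !big_cons uE mxE exprS mulrACA.
have F1nn l A : F1 (nn c l A) = rp l * ((-1) ^+ c * l 0 c * \det A).
  by rewrite /F1 det_nn; congr (_ * _); apply: eq_bigr => i _; rewrite nn_row0.
have F2nn l A : F2 (nn c l A) = rp l by apply: eq_bigr => i _; rewrite nn_row0.
have m1 : ((-1) ^+ c : k) != 0 by rewrite expf_neq0 // oppr_eq0 oner_neq0.
pose v i (y : X0) : k := if (y.1 \in unitmx) && (size y.2 == q.+1)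
  then bb i y / ((-1) ^+ c * \det y.1) ^+ N else 0.
have vE l A vs : good l -> A \in unitmx ->
    \sum_i aa i l * v i (A, vs) = eL l * slice c l z (A, vs).
  move=> gl uA; have cA := nn_chart c gl uA.
  rewrite /v /= uA /=; case: eqP => [vs_m|vs_m]; last first.
    by rewrite /slice z0 ?size_map // mulr0 big1 // => i _; rewrite mulr0.
  rewrite /slice aE ?size_map // F1nn (aaE l (A, vs)) !mulr_suml mulr_sumr.
  apply: eq_bigr => i _; rewrite /eL.
  have dA : \det A != 0 by rewrite -unitfE -unitmxE.
  have := rp0 _ gl; have := gl c; rewrite !exprMn.
  move: (rp l) (l 0 c) (\det A) dA => r x d d0 x0 r0.
  by field; rewrite (expf_neq0 N m1) !expf_neq0.
have v0 i A vs : A \notin unitmx -> v i (A, vs) = 0 by rewrite /v /= => /negPf ->.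
have sliceZ s l A vs : good l -> s != 0 -> A \in unitmx ->
    slice c (s *: l) z (A, vs) = s ^ lam ord0 * slice c l z (A, vs).
  move=> gl s0 uA; have cA := nn_chart c gl uA.
  have l1 : lowu (1%:M : 'M[k]_n) by rewrite /lowu scalar_mx_is_trig unitmx1.
  have lB := blk_lowu s0 l1.
  case: (eqVneq (size vs) q.+1) => [vs_m|/eqP vs_m]; last first.
    rewrite /slice /= !z0 ?size_map ?mulr0 //.
    by apply: nn_chart => // i; rewrite mxE mulf_neq0.
  rewrite /slice /= -[X in nn c _ X]mul1mx -nn_mul.
  have E : map (@iota k n) vs = map (cj (blk s 1%:M)) (map (@iota k n) vs).
    rewrite -map_comp; apply: eq_map => u /=; rewrite iota_cj //; congr iota.
    apply: UT_inj; rewrite cjE // invmx1 mulmx1 (_ : dg 1%:M = 1%:M) ?mul1mx //.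
    by rewrite unitri_dg // -UT1E; apply: (svalP (UT1 k n)).
  rewrite {1}E zs ?size_map //; congr (_ * _).
    have [b0 bi] := blk_diag s (1%:M : 'M[k]_n).
    rewrite /chi (bigD1 ord0) //= b0 big1 ?mulr1 // => i.
    by case: (unliftP ord0 i) => [i'|] -> // _; rewrite bi mxE eqxx exp1rz.
have [w wE] : exists w : nat, w%:Z = lam ord0 + (N * (size t).+2)%N%:Z.
  exists (absz (lam ord0 + (N * (size t).+2)%N%:Z)%R).
  have NN : (absz (lam ord0) <= N * (size t).+2)%N.
    by rewrite (leq_trans (leq_maxr N0 _)) // leq_pmulr.
  by move: NN; lia.
have wX (s : k) : s != 0 -> s ^+ w = s ^ lam ord0 * s ^+ (N * (size t).+2).
  move=> s0; rewrite -[s ^+ w]/(exprz s w%:Z) wE. by rewrite expfzDr.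
have [|m [l [b [gl pb bH bE]]]] := homog_interp (v := v) (w := w) paa.
  move=> l s [A vs] gl s0; have [uA|uA] := boolP (A \in unitmx); last first.
    by rewrite !big1 ?mulr0 // => i _; rewrite v0 // mulr0.
  rewrite !vE // ?eLZ ?sliceZ ?wX //; last by move=> i; rewrite mxE mulf_neq0.
  by rewrite mulrACA [X in X * _]mulrC.
pose Q j (u : 'rV[k]_n.+1) := b j u * eL (l j) / eL u.
have QE u A vs : good u -> A \in unitmx ->
    slice c u z (A, vs) = \sum_j Q j u * slice c (l j) z (A, vs).
  move=> gu uA; apply: (mulfI (eL0 u gu)); rewrite -vE // bE // mulr_sumr.
  apply: eq_bigr => j _; rewrite vE // /Q; field; exact: eL0.
have /choice[y yP] j : exists y, coch_gl (fun i => lam (lift ord0 i)) q y /\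
    coch_mat (fun i => lam (lift ord0 i)) q.+1 (slice c (l j) z - delta y).
  have [||y Sy Ny] := IH (f := slice c (l j) z) (q := q); last by exists y.
    apply: (@coch_slice _ _ _ _ (l j) F1 _ (rp (l j) * ((-1) ^+ c * l j 0 c)) _ z (gl j) _ _ Sz).
      by rewrite !mulf_neq0 ?rp0 //; apply: gl.
    by move=> A _; rewrite F1nn !mulrA.
  rewrite slice_delta.
  apply: (@coch_slice _ _ _ _ (l j) F2 _ (rp (l j)) _ _ (gl j) (rp0 _ (gl j)) _ Nz).
  by move=> A _; rewrite F2nn mulr1.
have cg (M : 'M[k]_n.+1) : chart M -> good (row ord0 M) by move=> [_ x0] i; rewrite mxE.
have Qreg F g j : pol1 (fun x => F x.1) -> (forall M, chart M -> F M = F2 M * g M) ->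
    pol1 (fun x => g x.1) ->
    reg (@coordU k n.+1 n.+1) (fun x => chart x.1) (fun x => F x.1) (fun x => Q j (row ord0 x.1)).
  move=> pF FE pg; apply: regM.
    apply: reg_pol; apply: polM; last exact: pol_cst.
    apply: (pol_subst (phi := fun x : X1 => row ord0 x.1)) (pb j) => _ [i [i' ->]].
    by apply: (@eq_pol _ _ _ (fun x : X1 => x.1 ord0 i')) => [x|]; [rewrite mxE | exact: pol_row0].
  apply: (@eq_reg _ _ _ _ _ (fun x => ((F2 x.1)^-1 * (x.1 ord0 c)^-1) ^+ N)).
    move=> x cx _; rewrite /eL -invfM exprVn mxE; congr ((_ * _) ^+ N)^-1.
    by apply: eq_bigr => i _; rewrite mxE.
  apply: regX; apply: regM.
    by apply: (reg_inv_factor pg) => x cx; rewrite FE.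
  apply: (@reg_inv_factor _ _ _ _ _ _ (fun x => g2 x.1 * g x.1)); first exact: polM.
  by move=> x cx; rewrite FE // F2E // mulrA.
have QH j s u : s != 0 -> good u -> Q j (s *: u) = s ^ lam ord0 * Q j u.
  move=> s0 gu; rewrite /Q bH eLZ wX //.
  have := expf_neq0 (N * (size t).+2) s0; have := eL0 u gu.
  move: (s ^+ _) (s ^ _) (eL u) => x x' e e0 x0.
  by field; rewrite x0 e0.
have Spull j : coch1 F1 q (pull c (Q j) (y j)).
  have [Sy _] := yP j.
  apply: (coch_pull pF1 pg1 F1E F1n0 _ _ (QH j) Sy).
    by apply: (Qreg F1 (fun M => \det M)) => //; apply: pol_detU.
  apply: (@eq_reg _ _ _ _ _ (fun x => (\det x.1)^-1 * ((-1) ^+ c * x.1 ord0 c))).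
    move=> x cx _; have [_ x0] := cx; have := chart_det cx; rewrite (det_mm (x0 c)).
    move: (\det (mm c x.1)) => d; rewrite !mulf_eq0 !negb_or => /andP[_ d0].
    by field; rewrite d0 x0 m1.
  apply: regM; first by apply: (reg_inv_factor pF2) => x cx; rewrite mulrC.
  by apply/reg_pol/polM; [apply: pol_cst | apply: pol_row0].
have Npull j : coch1 F2 q.+1 (pull c (Q j) (slice c (l j) z - delta (y j))).
  have [_ Ny] := yP j.
  apply: (coch_pull pF2 pg2 F2E F2n0 _ _ (QH j) Ny).
    by apply: (Qreg F2 (fun=> 1)) => // [M|]; [rewrite mulr1 | apply: pol_cst].
  by apply: (@eq_reg _ _ _ _ _ (fun=> 1)) => [x _ _|]; [rewrite invr1 | apply/reg_pol/pol_cst].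
have cl := @chart_low k n.
pose Y (x : X1) : k^o := \sum_j (1 : k) * pull c (Q j) (y j) x.
exists (Y - pz c z).
  have SY : coch1 F1 q Y by exact: (coch_sum (@cl) F1n0 pF1).
  have Spz : coch1 F1 q (pz c z) by exact: coch_prism pF1 pg1 F1E F1n0 Sz.
  exact: (cochB F1n0 pF1 SY Spz).
(* The difference z - delta (Y - pz z) equals (z o phi - delta Y) - pz (delta z), whose first term
   is R; both terms have poles along the first-row entries only. *)
pose R (x : X1) : k^o := \sum_j (1 : k) * pull c (Q j) (slice c (l j) z - delta (y j)) x.
have NR : coch1 F2 q.+1 R by exact: (coch_sum (@cl) F2n0 pF2).
have Npz : coch1 F2 q.+1 (pz c (delta z)) by apply: coch_prism pF2 pg2 F2E F2n0 Nz.
have := cochB F2n0 pF2 NR Npz; apply: eq_coch; first exact: cl.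
move=> M us cM.
have -> : (R - pz c (delta z) - (z - delta (Y - pz c z))) (M, us) =
  R (M, us) - pz c (delta z) (M, us) - (z (M, us) - delta (Y - pz c z) (M, us)) by [].
rewrite deltaB.
have -> : (delta Y - delta (pz c z)) (M, us) = delta Y (M, us) - delta (pz c z) (M, us) by [].
have hom := prism_homotopy (phi c M) (fun us => z (M, us) : k) us.
rewrite -[D _ us]/(delta (pz c z) (M, us)) -[prism _ _ us]/(pz c (delta z) (M, us)) in hom.
have RE : R (M, us) = z (M, map (phi c M) us) - delta Y (M, us).
  rewrite (@slice_el c z q) //; last by right; exists F1.
  rewrite QE ?mm_unit //; last exact: cg.
  have -> : delta Y (M, us) = \sum_j 1 * delta (pull c (Q j) (y j)) (M, us).
    exact: (delta_sum _ (fun _ _ => 1)).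
  rewrite -sumrB; apply: eq_bigr => j _; rewrite !mul1r delta_pull /pull /=.
  by rewrite -mulrBr.
rewrite RE; move: hom; set A := delta (pz c z) _; set B := pz c _ _ => /eqP.
rewrite -subr_eq0 => /eqP hom; rewrite -[RHS]oppr0 -hom; ring.
Qed.

End Shapiro.

(** * Polynomial and regular cochains have the same cohomology *)

Section Acyclicity.
Variable k : closedFieldType.

Section Chart.
Variables (n : nat) (lam : 'I_n.+1 -> int).
Notation X := ('M[k]_n.+1 * seq (UT k n.+1))%type.
Notation chart := (@torus_chart k n).
Notation coch1 := (coch lam (fun b M : 'M[k]_n.+1 => b *m M) (@coordU k n.+1 n.+1) chart).
Notation pol1 := (pol (@coordU k n.+1 n.+1)).
Let S t := coch1 (fun M => rowprod t M * \det M).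
Let N t := coch1 (rowprod t).
Hypothesis lam0 : - n%:Z <= lam ord0.
Hypothesis IH : acyclic k (fun i => lam (lift ord0 i)).

Let cl := @chart_low k n.
Let pN t : pol1 (fun x => rowprod t x.1). Proof. exact: pol_rowprod. Qed.
Let pS t : pol1 (fun x => rowprod t x.1 * \det x.1).
Proof. by apply: polM => //; apply: pol_detU. Qed.
Let N0 t (M : 'M[k]_n.+1) : chart M -> rowprod t M != 0.
Proof. exact: rowprod_neq0. Qed.
Let S0 t (M : 'M[k]_n.+1) : chart M -> rowprod t M * \det M != 0.
Proof. by move=> cM; rewrite mulf_neq0 ?N0 ?chart_det. Qed.

Let NS t m f : N t m f -> S t m f.
Proof. by apply: coch_denom => [|//|M /chart_det //]; apply: pol_detU. Qed.

Let rp_insert t1 i t2 (M : 'M[k]_n.+1) :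
  rowprod (t1 ++ i :: t2) M = rowprod (t1 ++ t2) M * M ord0 i.
Proof. by rewrite /rowprod !big_cat big_cons /=; ring. Qed.

Lemma chart_acyclic q f : S [::] q.+1 f -> N [::] q.+2 (delta f) ->
  exists2 y, S [::] q y & N [::] q.+1 (f - delta y).
Proof.
have x0 i (M : 'M[k]_n.+1) : chart M -> M ord0 i != 0 by case.
have ins_S t1 i t2 m u : S (t1 ++ t2) m u -> S (t1 ++ i :: t2) m u.
  apply: (coch_denom (g := fun M : 'M[k]_n.+1 => M ord0 i)) => [|M _|M /x0 //].
    exact: pol_row0.
  by rewrite rp_insert mulrAC.
have ins_N t1 i t2 m u : N (t1 ++ t2) m u -> N (t1 ++ i :: t2) m u.
  apply: (coch_denom (g := fun M : 'M[k]_n.+1 => M ord0 i)) => [|M _|M /x0 //].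
    exact: pol_row0.
  by rewrite rp_insert.
have face := @coordU_face k n.+1 n.+1.
have dS t m u : S t m u -> S t m.+1 (delta u) by apply: coch_delta => //; exact: cl.
have dN t m u : N t m u -> N t m.+1 (delta u) by apply: coch_delta => //; exact: cl.
have H := @dcx_cech k 'I_n.+1 (X -> k^o) (@delta k n.+1 'M[k]_n.+1) S N.
have {}H := H _ _ _ _ _ NS ins_S ins_N dS dN.
have {}H : dcx (V := seq 'I_n.+1 -> X -> k^o) (@D 'I_n.+1 (X -> k^o))
    (fun c t => delta (c t)) (fun p m c => forall t, size t = p -> S t m (c t))
    (fun p m c => forall t, size t = p -> N t m (c t)).
  apply: H => [a u v|u|t m a u v|t m a u v|t m].
  - exact: deltaP.
  - exact: delta_delta.
  - exact: (cochP (@S0 t) (pS t)).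
  - exact: (cochP (@N0 t) (pN t)).
  exact: coch_null.
(* D z is a cocycle of N, so [mat_row] subtracts from z an element of N and leaves a cocycle of S,
   to which [gl_row] applies. *)
have rex p m : rowex (fun c : seq 'I_n.+1 -> X -> k^o => D c)
    (fun p m c => forall t, size t = p -> S t m (c t))
    (fun p m c => forall t, size t = p -> N t m (c t)) p m.
  move=> z Sz NDz.
  have [|y' [Ny' y'E]] := mat_row lam0 NDz.
    by move=> t _; rewrite DD => M us _.
  pose z' : seq 'I_n.+1 -> X -> k^o := z - y'.
  have Sz' t : size t = p -> S t m (z' t).
    by move=> st; apply: (cochB (@S0 t) (pS t)); [apply: Sz | apply/NS/Ny'].
  have Dz' t : size t = p.+1 -> null_on chart (D z' t).
    by move=> st; rewrite (DB z y'); apply: y'E.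
  have zE t x : z' t x = z t x - y' t x by [].
  case: p z Sz NDz y' Ny' y'E z' Sz' Dz' zE => [|p] z Sz NDz y' Ny' y'E z' Sz' Dz' zE.
    move=> t /size0nil ->; have z'0 : null_on chart (z' [::]).
      by have := Dz' [:: ord0] erefl; rewrite /= subr0.
    apply: (eq_coch (@cl)) (Ny' [::] erefl) => M us cM; have := z'0 M us cM.
    rewrite zE.
    move/eqP; rewrite subr_eq0 => /eqP E.
    by rewrite -[LHS]/(y' [::] (M, us) - z [::] (M, us)) E subrr.
  have [y [Sy yE]] := gl_row Sz' Dz'; exists y => // t st.
  apply: (eq_coch (@cl)) (Ny' t st) => M us cM; have := yE t st M us cM.
  have -> : (z' t - D y t) (M, us) = z t (M, us) - y' t (M, us) - D y t (M, us).
    by rewrite -zE.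
  have -> : (y' t - (z - (fun t => D y t)) t) (M, us) = y' t (M, us) - (z t (M, us) - D y t (M, us)) by [].
  move=> E; rewrite -[RHS]oppr0 -E; ring.
(* A nonempty sequence provides an invertible entry of the first row, the pivot in [column]. *)
have cex p m : colex (fun c : seq 'I_n.+1 -> X -> k^o => fun t => delta (c t))
    (fun p m c => forall t, size t = p -> S t m (c t))
    (fun p m c => forall t, size t = p -> N t m (c t)) p.+1 m.
  move=> z Sz Nz; case: m Sz Nz => [|q'] Sz Nz; first by move=> t /Sz.
  have /choice[y yP] t : exists y, size t = p.+1 -> S t q' y /\ N t q'.+1 (z t - delta y).
    case: (eqVneq (size t) p.+1) => [st|/eqP st]; last by exists 0.
    case: t st => // c t st; have [y Sy Ny] := column IH (Sz _ st) (Nz _ st).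
    by exists y.
  by exists y => t /yP[].
move=> Sf Nf.
have [||y Sy Ny] := first_column_exact H rex cex (m := q.+1) (z := fun=> f).
- by move=> t /size0nil ->.
- by move=> t /size0nil ->.
by exists (y [::]); [apply: Sy | apply: Ny].
Qed.

(** If A / det^K equals a polynomial a on the chart, then A = a det^K there, hence everywhere by
    density. *)
Lemma chart_ext m f : coch_gl lam m.+1 f -> coch1 (fun=> 1) m.+1 f -> coch_mat lam m.+1 f.
Proof.
move=> [f0 fs [K [A [pA AE]]]] [_ _ [K' [a [pa aE]]]]; split=> //.
exists 0, a; split=> // M us uM us_m; rewrite divr1.
have dM : \det M != 0 by rewrite -unitfE -unitmxE.
rewrite AE //; apply: (mulIf (expf_neq0 K dM)); rewrite mulfVK ?expf_neq0 //.
apply: (@torus_dense k n A (fun x => a x * \det x.1 ^+ K)) => //.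
  by apply: polM => //; apply/polX/pol_detU.
move=> M' cM'; have dM' := chart_det cM'.
apply: (mulIf (invr_neq0 (expf_neq0 K dM'))); rewrite mulfK ?expf_neq0 //.
by rewrite -AE //; [rewrite aE // expr1n divr1 | case: cM'].
Qed.

(** The primitive found on the chart is a fraction a / det^K, which makes sense on all of GL_n; its
    semi-invariance spreads there by density. *)
Lemma gl_acyclic : acyclic k lam.
Proof.
have r1 (M : 'M[k]_n.+1) : rowprod [::] M = 1 by apply: big_nil.
have dom_gl (b M : 'M[k]_n.+1) : unit_dom M -> lowu b -> unit_dom (b *m M).
  by move=> uM /andP[_ ub]; rewrite /unit_dom unitmx_mul ub.
have det_gl (M : 'M[k]_n.+1) : unit_dom M -> \det M != 0 by rewrite -unitfE -unitmxE.
have cu (M : 'M[k]_n.+1) : chart M -> unit_dom M by case.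
have pd : pol1 (fun x => \det x.1) := @pol_detU k n.
move=> q f Sf Nf.
have [||y Sy Ny] := @chart_acyclic q f.
- apply: (coch_denom (F := fun M => \det M) (g := fun=> 1)) (coch_res cu Sf) => [|M _|M _].
  + exact: pol_cst.
  + by rewrite r1 mul1r mulr1.
  exact: oner_neq0.
- apply: (coch_denom (F := fun=> 1) (g := fun=> 1)) (coch_res cu Nf) => [|M _|M _].
  + exact: pol_cst.
  + by rewrite r1 mulr1.
  exact: oner_neq0.
have N1 g : N [::] q.+1 g -> coch1 (fun=> 1) q.+1 g.
  apply: (coch_denom (g := fun=> 1)) => [|M _|M _]; first exact: pol_cst.
    by rewrite r1 mulr1.
  exact: oner_neq0.
suff [y0 Sy0 yy0] : exists2 y0, coch_gl lam q y0 & null_on chart (y - y0).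
  exists y0 => //; apply: chart_ext.
    apply: (cochB det_gl pd) => //; apply: coch_delta => //; exact: coordU_face.
  apply: (eq_coch (@cl)) (N1 _ Ny).
  have -> : f - delta y - (f - delta y0) = - delta (y - y0).
    by rewrite deltaB opprB addrC addrA addrNK opprB.
  move=> M us cM; have := delta_null yy0 us cM => d0.
  by rewrite -[LHS]/(- (delta (y - y0) (M, us))) d0 oppr0.
case: q y Sy {f Sf Nf Ny N1} => [|q] y Sy.
  exists 0 => [M us _ //|M us cM].
  by rewrite -[LHS]/(y (M, us) - 0) Sy // subr0.
have [y0 ys [K [a [pa aE]]]] := Sy.
have aE' M us : chart M -> size us = q.+1 -> y (M, us) = a (M, us) / \det M ^+ K.
  by move=> cM us_m; rewrite aE // r1 mul1r.
pose y1 (x : X) : k^o := if size x.2 == q.+1 then a x / \det x.1 ^+ K else 0.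
exists y1; last first.
  move=> M us cM; rewrite -[LHS]/(y (M, us) - y1 (M, us)) /y1 /=.
  by case: eqP => us_m; [rewrite aE' // subrr | rewrite y0 // subr0].
split=> [M us uM /eqP/negPf us_m|b M us uM lb us_m|].
- by rewrite /y1 us_m.
- have [tb ub] := andP lb; have dM := det_gl M uM; have db := det_gl b ub.
  rewrite /y1 size_map us_m eqxx /= det_mulmx exprMn invfM.
  suff -> : a (b *m M, map (cj b) us) = chi lam b * \det b ^+ K * a (M, us).
    by field; rewrite !expf_neq0.
  apply: (@torus_dense k n (fun x => a (b *m x.1, map (cj b) us))
    (fun x => chi lam b * \det b ^+ K * a x)).
  - apply: (pol_subst (phi := fun x : X => (b *m x.1, map (cj b) us))) pa.
    move=> _ [[i [j ->]]|[l [i [j ->]]]] /=; last exact: pol_cst.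
    apply: (pol_mulmx (A := fun=> b) (B := fun x : X => x.1)) => ? ?; first exact: pol_cst.
    exact/(@pol_coordM_U _ _ _ (fun M => M _ _))/pol_entry.
  - by apply: polM => //; apply: pol_cst.
  move=> M' cM'; have cbM' := chart_low cM' lb; have dM' := chart_det cM'.
  have := ys b M' us cM' lb us_m; rewrite !aE' ?size_map // det_mulmx exprMn => E.
  apply: (mulIf (invr_neq0 (mulf_neq0 (expf_neq0 K db) (expf_neq0 K dM')))).
  rewrite E; field; by rewrite !expf_neq0.
by exists K, a; split=> // M us uM us_m; rewrite /y1 us_m eqxx.
Qed.

End Chart.

(** The bound on lam_1 is the one that [mat_row] uses, and the bounds on the other weights are those
    for the rank one less. In rank 0 the determinant is 1, so regular cochains are polynomial. *)
Lemma acyclicP n (lam : 'I_n -> int) :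
  (forall i : 'I_n, i.+1%:Z - n%:Z <= lam i) -> acyclic k lam.
Proof.
elim: n lam => [|n IHn] lam lamn.
  have dm (b M : 'M[k]_0) : unit_dom M -> lowu b -> unit_dom (b *m M).
    by move=> _ _; rewrite /unit_dom unitmxE det_mx00 unitr1.
  move=> q f Sf Nf; exists 0; first exact: (coch_null _ _ _ dm).
  rewrite delta0 subr0; apply: (coch_denom (g := fun=> 1)) Sf => [|M _|M _]; first exact: pol_cst.
    by rewrite det_mx00 mulr1.
  exact: oner_neq0.
apply: gl_acyclic; first by have := lamn ord0; lia.
by apply: IHn => i; have := lamn (lift ord0 i); rewrite lift0; lia.
Qed.

End Acyclicity.

Section FiniteQuotient.
Variables (k : fieldType) (W : lmodType k) (Z B : subspace W).

(** A family in Z of maximal size among those independent modulo B. Its size is at most s: more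
    vectors in the span of the g_i would be linearly dependent. *)
Lemma finite_quotient s (g : 'I_s -> W) :
  (forall z, Z z -> exists a : 'I_s -> k, z = \sum_i a i *: g i) ->
  exists d (z : 'I_d -> W), [/\ forall i, Z (z i),
    forall w, Z w -> exists a : 'rV[k]_d, B (w - \sum_i a 0 i *: z i) &
    forall a : 'rV[k]_d, B (\sum_i a 0 i *: z i) -> a = 0].
Proof.
move=> Zg.
pose free_mod d (z : 'I_d -> W) := (forall i, Z (z i)) /\
  forall a : 'rV[k]_d, B (\sum_i a 0 i *: z i) -> a = 0.
have bound d (z : 'I_d -> W) : free_mod d z -> (d <= s)%N.
  move=> [Zz fz]; have /choice[c cE] i := Zg _ (Zz i).
  pose C := \matrix_(i, l) c i l.
  have : row_free C.
    apply: inj_row_free => v vC; apply: fz.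
    rewrite (_ : \sum_i _ = 0); first exact: subspace0.
    under eq_bigr => i _ do rewrite cE scaler_sumr.
    rewrite exchange_big big1 // => l _ /=.
    under eq_bigr => i _ do rewrite scalerA.
    rewrite -scaler_suml; have /rowP/(_ l) := vC; rewrite !mxE.
    by under eq_bigr => i _ do rewrite mxE; move=> ->; rewrite scale0r.
  by rewrite -row_leq_rank => /leq_trans; apply; apply: rank_leq_col.
pose P d := `[< exists z, free_mod d z >].
have P0 : exists d, P d.
  exists 0; apply/asboolP; exists (fun=> 0); split=> [[] //|a _].
  by apply/rowP => -[].
have Pb d : P d -> (d <= s)%N by move=> /asboolP[z /bound].
have [d /asboolP[z [Zz fz]] dmax] := ex_maxnP P0 Pb.
exists d, z; split=> // w Zw.
pose z' (i : 'I_d.+1) := if unlift ord0 i is Some j then z j else w.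
have sumz' (a : 'rV[k]_d.+1) : \sum_i a 0 i *: z' i =
    a 0 ord0 *: w + \sum_i a 0 (lift ord0 i) *: z i.
  rewrite big_ord_recl /z' unlift_none; congr (_ + _).
  by apply: eq_bigr => i _; rewrite liftK.
have [a [Ba a0]] : exists a : 'rV[k]_d.+1, B (\sum_i a 0 i *: z' i) /\ a <> 0.
  apply: contrapT => na; have : P d.+1.
    apply/asboolP; exists z'; split=> [i|a Ba].
      by rewrite /z'; case: unlift.
    by apply: contrapT => a0; apply: na; exists a.
  by move/dmax; rewrite ltnn.
rewrite sumz' in Ba.
have aw : a 0 ord0 != 0.
  apply/eqP => aw; apply: a0; rewrite aw scale0r add0r in Ba.
  have E := fz (\row_i a 0 (lift ord0 i)).
  have /E/rowP {}E : B (\sum_i (\row_i a 0 (lift ord0 i)) 0 i *: z i).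
    by under eq_bigr => i _ do rewrite mxE.
  apply/rowP => i; rewrite [RHS]mxE; case: (unliftP ord0 i) => [j|] -> //.
  by have := E j; rewrite !mxE.
exists (\row_i - (a 0 (lift ord0 i) / a 0 ord0)).
rewrite (_ : w - _ = (a 0 ord0)^-1 *: (a 0 ord0 *: w + \sum_i a 0 (lift ord0 i) *: z i)).
  exact: subspaceZ.
rewrite scalerDr scalerA mulVf // scale1r; congr (_ + _).
rewrite scaler_sumr -sumrN; apply: eq_bigr => i _.
by rewrite mxE scaleNr opprK scalerA mulrC.
Qed.

End FiniteQuotient.

(** * The polynomial functor *)

Section FunctorCochains.
Variables (k : closedFieldType) (r : nat) (lam : 'I_r -> int).
Notation T V := ('Hom(V, 'cV[k]_r)).
Notation fn V := (T V * seq (UT k r) -> k^o).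

Definition lmul (V : vectType k) (b : 'M[k]_r) (psi : T V) : T V :=
  (linfun (mulmx b) \o psi)%VF.

Lemma lmulE (V : vectType k) b (psi : T V) v : lmul b psi v = b *m psi v.
Proof. by rewrite comp_lfunE lfunE. Qed.

Definition coordH (V : vectType k) (f : T V * seq (UT k r) -> k) :=
  (exists v i, f = fun x => x.1 v i 0) \/
  (exists l i j, f = fun x => sval (nth (UT1 k r) x.2 l) i j).

Definition fcoch (V : vectType k) :=
  coch lam (@lmul V) (@coordH V) (fun=> True) (fun=> 1).

Lemma fcochP (V : vectType k) m a (f g : fn V) : fcoch m f -> fcoch m g -> fcoch m (a *: f + g).
Proof. by apply: cochP => [M _|]; [apply: oner_neq0 | apply: pol_cst]. Qed.

Lemma fcoch0 (V : vectType k) m : fcoch m (0 : fn V).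
Proof. exact: coch_null. Qed.

Lemma fcoch_delta (V : vectType k) m (f : fn V) : fcoch m f -> fcoch m.+1 (delta f).
Proof.
apply: coch_delta => // i _ [[v [a ->]]|[l [a [b ->]]]]; apply: pol_gen; [left | right].
  by exists v, a.
by exists (if (l < i)%N then l else l.+1), a, b; apply/funext => x; rewrite nth_face.
Qed.

Lemma fcoch_pol (V : vectType k) m (f : fn V) : fcoch m.+1 f -> exists a, pol (@coordH V) a /\
  forall psi us, size us = m.+1 -> f (psi, us) = a (psi, us).
Proof.
move=> [_ _ [N [a [pa aE]]]]; exists a; split=> // psi us us_m.
by rewrite aE // expr1n divr1.
Qed.

(** Functions on Hom(V, k^r) depend covariantly on V; this is the source of functoriality. *)
Definition push (V W : vectType k) (phi : 'Hom(V, W)) (f : fn V) : fn W :=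
  fun x => f ((x.1 \o phi)%VF, x.2).

Lemma push_fcoch (V W : vectType k) (phi : 'Hom(V, W)) m f : fcoch m f -> fcoch m (push phi f).
Proof.
case: m => [|m] /=; first by move=> f0 M us _; apply: f0.
move=> [f0 fs [N [a [pa aE]]]]; split=> [M us _|b M us _ lb us_m|]; first exact: f0.
  rewrite /push /= -fs //; congr (f (_, _)).
  by rewrite /lmul comp_lfunA.
exists N, (fun x => a ((x.1 \o phi)%VF, x.2)); split=> [|M us _ us_m]; last exact: aE.
apply: (pol_subst (phi := fun x : T W * seq (UT k r) => ((x.1 \o phi)%VF, x.2))) pa.
move=> _ [[v [i ->]]|[l [i [j ->]]]]; apply: pol_gen; [left | right]; last by exists l, i, j.
by exists (phi v), i; apply/funext => x; rewrite comp_lfunE.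
Qed.

Lemma push_delta (V W : vectType k) (phi : 'Hom(V, W)) f : delta (push phi f) = push phi (delta f).
Proof. by []. Qed.

Lemma push_id (V : vectType k) (f : fn V) : push \1%VF f = f.
Proof. by apply/funext => -[M us]; rewrite /push /= comp_lfun1r. Qed.

Lemma push_comp (U V W : vectType k) (phi : 'Hom(V, W)) (phi' : 'Hom(U, V)) f :
  push (phi \o phi')%VF f = push phi (push phi' f).
Proof. by apply/funext => -[M us]; rewrite /push /= comp_lfunA. Qed.

Section Cohomology.
Variable j : nat.

Section Object.
Variable V : vectType k.

Fact fZ0 : fcoch j.+1 (0 : fn V) /\ delta (0 : fn V) = 0.
Proof. by split; [apply: fcoch0 | apply: delta0]. Qed.
Fact fZP a (f g : fn V) : fcoch j.+1 f /\ delta f = 0 -> fcoch j.+1 g /\ delta g = 0 ->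
  fcoch j.+1 (a *: f + g) /\ delta (a *: f + g) = 0.
Proof.
move=> [Sf f0] [Sg g0]; split; first exact: fcochP.
by rewrite deltaP f0 g0 scaler0 addr0.
Qed.
Definition fZ : subspace (fn V) := Subspace fZ0 fZP.

Definition fbounds (f : fn V) :=
  if j is q.+1 then exists2 x, fcoch q.+1 x & f = delta x else f = 0.
Fact fB0 : fbounds 0.
Proof.
by rewrite /fbounds; case: j => [|q] //; exists 0; [apply: fcoch0 | rewrite delta0].
Qed.
Fact fBP a f g : fbounds f -> fbounds g -> fbounds (a *: f + g).
Proof.
rewrite /fbounds; case: j => [|q]; first by move=> -> ->; rewrite scaler0 addr0.
move=> [x Sx ->] [y Sy ->]; exists (a *: x + y); first exact: fcochP.
by rewrite deltaP.
Qed.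
Definition fB : subspace (fn V) := Subspace fB0 fBP.

(* Under the torus element with entries c^(i+1), all the coordinates of a cochain
   have positive weights, so that only finitely many monomials have the weight
   of a semi-invariant. *)
Lemma fcoch_finite m : exists s (g : 'I_s -> fn V), forall f, fcoch m.+1 f ->
  exists a : 'I_s -> k, f = \sum_i a i *: g i.
Proof.
pose J := ('I_(\dim {:V}) * 'I_r + 'I_m.+1 * 'I_r * 'I_r)%type.
pose bs := vbasis {:V}.
pose xx (a : J) (x : T V * seq (UT k r)) : k := match a with
  | inl bi => x.1 bs`_bi.1 bi.2 0
  | inr lij => if (lij.2 < lij.1.2)%N then sval (nth (UT1 k r) x.2 lij.1.1) lij.1.2 lij.2 else 0
  end.
(* Entries not below the diagonal are listed with the value 0; giving them weight 1 keeps all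
   weights positive. *)
pose wt (a : J) : nat := match a with
  | inl bi => bi.2.+1
  | inr lij => if (lij.2 < lij.1.2)%N then (lij.1.2 - lij.2)%N else 1%N
  end.
have wt0 a : (0 < wt a)%N.
  by case: a => [[b i]|[[l i] i']] //=; case: ifP => // ii; rewrite subn_gt0.
pose S := #|{: J}|; pose x' (a : 'I_S) := xx (enum_val a).
pose dc (c : k) : 'M[k]_r := diag_mx (\row_i c ^+ i.+1).
have dcE c i : dc c i i = c ^+ i.+1 by rewrite !mxE eqxx.
have tdc c : is_trig_mx (dc c) by apply: diag_mx_is_trig.
have ldc c : c != 0 -> lowu (dc c).
  move=> c0; rewrite /lowu tdc trig_unitP //; apply/forallP => i.
  by rewrite dcE expf_neq0.
have dgdc c : dg (dc c) = dc c by congr diag_mx; apply/rowP => i; rewrite !mxE eqxx.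
have xxZ c a psi us : c != 0 -> size us = m.+1 ->
    xx a (lmul (dc c) psi, map (cj (dc c)) us) = c ^+ wt a * xx a (psi, us).
  move=> c0 us_m; case: a => [[b i]|[[l i] i']] /=.
    by rewrite lmulE mul_diag_mx !mxE.
  case: ltnP => ii; last by rewrite mulr0.
  rewrite (nth_map (UT1 k r)) ?us_m // cjE ?ldc // dgdc mul_diag_mx.
  have iv : invmx (dc c) = diag_mx (\row_i (c ^+ i.+1)^-1).
    have [_ ud] := andP (ldc c c0); apply: (can_inj (mulKmx ud)).
    rewrite mulmxV // mulmx_diag -(diag_const_mx r 1); congr diag_mx.
    by apply/rowP => a; rewrite !mxE mulfV // expf_neq0.
  have cE : c ^+ i.+1 = c ^+ (i - i') * c ^+ i'.+1 by rewrite -exprD addnS subnK // ltnW.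
  by rewrite iv mul_mx_diag !mxE cE mulrAC mulfK // expf_neq0.
pose e := \sum_(i < r) i.+1%:Z * lam i.
have chiE c : c != 0 -> chi lam (dc c) = c ^ e.
  move=> c0; rewrite /e (big_morph (exprz c) (fun a b => expfzDr a b c0) (expr0z c)).
  by apply: eq_bigr => i _; rewrite dcE exprnP exprz_exp.
have fP f : fcoch m.+1 f -> exists P : mpoly S k, forall psi us, size us = m.+1 ->
    f (psi, us) = meval (fun a => x' a (psi, us)) P.
  move=> /fcoch_pol[a [pa aE]].
  have [|h [/pol_mpoly[P PE] hE]] := pol_subst_on (C1 := gens x')
      (dom := fun x : T V * seq (UT k r) => size x.2 = m.+1) (phi := id) _ pa.
    have px b : pol (gens x') (xx b).
      by apply: pol_gen; exists (enum_rank b); rewrite /x' enum_rankK.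
    move=> _ [[v [i ->]]|[l [i [i' ->]]]].
      exists (fun x => \sum_(b < \dim {:V}) coord bs b v * xx (inl (b, i)) x); split.
        by apply: pol_sum => b _; apply: polM; [apply: pol_cst | apply: px].
      move=> x _; rewrite {2}(coord_vbasis (memvf v)) linear_sum summxE.
      by apply: eq_bigr => b _; rewrite linearZ !mxE.
    have [lm|ml] := ltnP l m.+1; last first.
      exists (fun=> (1%:M : 'M[k]_r) i i'); split=> [|x sx]; first exact: pol_cst.
      by rewrite nth_default ?UT1E ?sx.
    have [ii|ii] := ltnP i' i.
      by exists (xx (inr (Ordinal lm, i, i'))); split=> // x sx; rewrite /= ii.
    exists (fun=> (i == i')%:R); split=> [|x sx]; first exact: pol_cst.
    have /unitriP[/is_trig_mxP tu du] := svalP (nth (UT1 k r) x.2 l).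
    by move: ii; rewrite leq_eqVlt => /orP[/eqP/val_inj ->|ii]; rewrite ?eqxx ?du // tu // -val_eqE /= (ltn_eqF ii).
  by exists P => psi us us_m; rewrite aE // -(hE (psi, us)) // PE.
case eE : e => [e0|e0]; last first.
  exists 0, (fun=> 0) => f Sf; exists (fun=> 0); rewrite big_ord0.
  have [P PE] := fP f Sf; have [f0 fs _] := Sf.
  apply/funext => -[psi us]; case: (eqVneq (size us) m.+1) => [us_m|/eqP]; last exact: f0.
  have : (\sum_(mm <- msupp P) (mcoeff mm P * \prod_a x' a (psi, us) ^+ mm a) *: 'X^(\sum_a wt (enum_val a) * mm a)%N) * 'X^(e0.+1)
      = (f (psi, us))%:P.
    apply: poly_inj => c c0; rewrite hornerM hornerXn horner_sum hornerC.
    have := fs (dc c) psi us I (ldc c c0) us_m; rewrite PE ?size_map // chiE // eE.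
    rewrite -[c ^ Negz e0]/((c ^+ e0.+1)^-1) mevalE => E.
    have -> : f (psi, us) = (c ^+ e0.+1)^-1 * f (psi, us) * c ^+ e0.+1.
      by rewrite mulrAC mulVf ?mul1r // expf_neq0.
    rewrite -E; congr (_ * _); apply: eq_bigr => mm _; rewrite hornerZ hornerXn -mulrA.
    congr (_ * _); rewrite mulrC -prodrXr -big_split; apply: eq_bigr => a _.
    by rewrite /x' xxZ // exprMn exprM.
  move/(congr1 (fun p : {poly k} => p.[0])).
  by rewrite hornerM hornerXn expr0n mulr0 hornerC => <-.
pose Be := {ffun 'I_S -> 'I_e0.+1}.
pose gb (be : Be) (x : T V * seq (UT k r)) : k^o :=
  if size x.2 == m.+1 then \prod_a x' a x ^+ be a else 0.
exists #|{: Be}|, (fun i => gb (enum_val i)) => f Sf.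
have [P PE] := fP f Sf; have [f0 fs _] := Sf.
pose wm (mm : multinom S) := (\sum_a wt (enum_val a) * mm a)%N.
pose bm (mm : multinom S) : Be := [ffun a => inord (mm a)].
pose al (be : Be) := \sum_(mm <- msupp P | (wm mm == e0) && (bm mm == be)) mcoeff mm P.
exists (fun i => al (enum_val i)).
apply/funext => -[psi us]; rewrite fct_sumE.
have -> : \sum_(i < #|{: Be}|) (al (enum_val i) *: gb (enum_val i)) (psi, us) =
    \sum_(be : Be) al be * gb be (psi, us).
  rewrite (reindex (@enum_rank Be)); last exact/onW_bij/enum_rank_bij.
  by apply: eq_bigr => be _; rewrite enum_rankK.
case: (eqVneq (size us) m.+1) => [us_m|us_m]; last first.
  rewrite f0 //; last exact/eqP.
  by rewrite big1 // => be _; rewrite /gb /= (negPf us_m) mulr0.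
have : \sum_(mm <- msupp P) (mcoeff mm P * \prod_a x' a (psi, us) ^+ mm a) *: 'X^(wm mm) =
    f (psi, us) *: 'X^e0.
  apply: poly_inj => c c0; rewrite horner_sum hornerZ hornerXn.
  have := fs (dc c) psi us I (ldc c c0) us_m; rewrite PE ?size_map // chiE // eE -exprnP mevalE.
  rewrite [RHS]mulrC => <-; apply: eq_bigr => mm _; rewrite hornerZ hornerXn -mulrA.
  congr (_ * _); rewrite mulrC -prodrXr -big_split; apply: eq_bigr => a _.
  by rewrite /x' xxZ // exprMn exprM.
move/(congr1 (fun p : {poly k} => p`_e0)); rewrite coefZ coefXn eqxx mulr1 coef_sum => <-.
under eq_bigr => mm _ do rewrite coefZ coefXn.
rewrite (bigID (fun mm => wm mm == e0)) /= [X in _ + X]big1 ?addr0 => [|mm /negPf]; last first.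
  by rewrite eq_sym => ->; rewrite mulr0.
rewrite (partition_big bm predT) //=; apply: eq_bigr => be _.
rewrite /al mulr_suml; apply: eq_bigr => mm /andP[/eqP wmm /eqP <-].
rewrite wmm eqxx mulr1 /gb /= us_m eqxx; congr (_ * _); apply: eq_bigr => a _.
rewrite ffunE inordK // ltnS -wmm /wm (bigD1 a) //=.
by apply: leq_trans (leq_addr _ _); rewrite leq_pmull.
Qed.

Lemma fH_exists : exists d (z : 'I_d -> fn V), [/\ forall i, fZ (z i),
    forall w, fZ w -> exists a : 'rV[k]_d, fB (w - \sum_i a 0 i *: z i) &
    forall a : 'rV[k]_d, fB (\sum_i a 0 i *: z i) -> a = 0].
Proof.
have [s [g gP]] := fcoch_finite j.
by apply: (@finite_quotient _ _ fZ fB s g) => z [/gP].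
Qed.

(** The values of the functor have to be of type [vectType], so a basis of the cohomology is chosen
    once for each V and classes are replaced by coordinate vectors. *)
Definition fdim : nat := sval (cid fH_exists).
Definition fbase : 'I_fdim -> fn V := sval (cid (svalP (cid fH_exists))).

Lemma fbaseP : [/\ forall i, fZ (fbase i),
    forall w, fZ w -> exists a : 'rV[k]_fdim, fB (w - \sum_i a 0 i *: fbase i) &
    forall a : 'rV[k]_fdim, fB (\sum_i a 0 i *: fbase i) -> a = 0].
Proof. exact: (svalP (cid (svalP (cid fH_exists)))). Qed.

Fact fcoord_exists w : exists a : 'rV[k]_fdim, fZ w -> fB (w - \sum_i a 0 i *: fbase i).
Proof.
case: (pselect (fZ w)) => [Zw|nZ]; last by exists 0.
by have [_ /(_ w Zw)[a ?] _] := fbaseP; exists a.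
Qed.
Definition fcoord w : 'rV[k]_fdim := sval (cid (fcoord_exists w)).

Lemma fcoordP w : fZ w -> fB (w - \sum_i fcoord w 0 i *: fbase i).
Proof. exact: (svalP (cid (fcoord_exists w))). Qed.

Lemma fcoord_unique w (a : 'rV[k]_fdim) : fZ w -> fB (w - \sum_i a 0 i *: fbase i) -> fcoord w = a.
Proof.
move=> Zw Ba; have Bw := fcoordP Zw; have [_ _ free] := fbaseP.
apply/eqP; rewrite -subr_eq0; apply/eqP/free.
rewrite (_ : \sum_i _ = (w - \sum_i a 0 i *: fbase i) - (w - \sum_i fcoord w 0 i *: fbase i)).
  exact: subspaceB.
rewrite opprB [RHS]addrC [RHS]addrA subrK -sumrB.
by apply: eq_bigr => i _; rewrite !mxE scalerBl.
Qed.

Lemma fcoord_lin a w w' : fZ w -> fZ w' -> fcoord (a *: w + w') = a *: fcoord w + fcoord w'.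
Proof.
move=> Zw Zw'; apply: fcoord_unique; first exact: subspaceP.
rewrite (_ : _ - _ = a *: (w - \sum_i fcoord w 0 i *: fbase i) +
    (w' - \sum_i fcoord w' 0 i *: fbase i)).
  by apply: subspaceP; apply: fcoordP.
rewrite scalerBr addrACA -opprD; congr (_ - _); rewrite scaler_sumr -big_split.
by apply: eq_bigr => i _; rewrite !mxE scalerDl scalerA.
Qed.

Lemma fcoord_eq0 w : fZ w -> fcoord w = 0 <-> fB w.
Proof.
move=> Zw; split=> [w0|Bw].
  by have := fcoordP Zw; rewrite w0 big1 ?subr0 // => i _; rewrite mxE scale0r.
by apply: fcoord_unique => //; rewrite big1 ?subr0 // => i _; rewrite mxE scale0r.
Qed.

End Object.

Lemma push_fZ (V W : vectType k) (phi : 'Hom(V, W)) f : fZ V f -> fZ W (push phi f).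
Proof. by move=> [Sf f0]; split; [apply: push_fcoch | rewrite push_delta f0]. Qed.

Lemma push_fB (V W : vectType k) (phi : 'Hom(V, W)) f : fB V f -> fB W (push phi f).
Proof.
rewrite /= /fbounds; case: j => [|q]; first by move=> ->.
by move=> [x Sx ->]; exists (push phi x); first exact: push_fcoch.
Qed.

Definition fmat (V W : vectType k) (phi : 'Hom(V, W)) : 'M[k]_(fdim V, fdim W) :=
  \matrix_(i, l) fcoord (push phi (@fbase V i)) 0 l.

Lemma fcoord_push (V W : vectType k) (phi : 'Hom(V, W)) w : fZ V w ->
  fcoord (push phi w) = fcoord w *m fmat phi.
Proof.
move=> Zw; have [Zb _ _] := fbaseP V; have [ZbW _ _] := fbaseP W.
have fsum (I : Type) (s : seq I) (c : I -> k) (g : I -> fn V) : (forall i, fZ V (g i)) ->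
    fcoord (push phi (\sum_(i <- s) c i *: g i)) = \sum_(i <- s) c i *: fcoord (push phi (g i))
    /\ fZ V (\sum_(i <- s) c i *: g i).
  move=> Zg; elim: s => [|i s [IHs Zs]].
    rewrite !big_nil; split; last exact: subspace0.
    by apply: (proj2 (fcoord_eq0 _)); [apply/push_fZ/subspace0 | apply/push_fB/subspace0].
  rewrite !big_cons; split; last exact: subspaceP.
  rewrite -IHs -fcoord_lin //; exact: push_fZ.
have [Es Zs] := fsum _ (index_enum 'I_(fdim V)) (fun i => fcoord w 0 i) (@fbase V) Zb.
transitivity (fcoord (push phi (\sum_i fcoord w 0 i *: fbase i))).
  apply/eqP; rewrite -subr_eq0; apply/eqP.
  have ZS := push_fZ phi Zs; have Zp := push_fZ phi Zw.
  rewrite addrC -scaleN1r -(fcoord_lin (-1) ZS Zp).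
  apply: (proj2 (fcoord_eq0 (subspaceP (-1) ZS Zp))).
  by rewrite scaleN1r addrC; exact: (push_fB phi (fcoordP Zw)).
rewrite Es; apply/rowP => l; rewrite summxE [RHS]mxE; apply: eq_bigr => i _.
by rewrite !mxE.
Qed.

End Cohomology.
End FunctorCochains.

(** * Polynomiality and degree of the functor *)

Section Polyfunctor.
Variables (k : closedFieldType) (r : nat) (lt : r.-tuple int) (j : nat).
Let lam i := tnth lt i.
Notation T V := ('Hom(V, 'cV[k]_r)).
Notation fn V := (T V * seq (UT k r) -> k^o).
Notation fZ := (@fZ k r lam j).
Notation fB := (@fB k r lam j).
Notation fcoord := (@fcoord k r lam j _).
Notation fbase := (@fbase k r lam j _).
Notation fmat := (@fmat k r lam j).
Notation fdim := (@fdim k r lam j).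

(** Composition with c id is also the action of the scalar matrix c in B, whose weight is |lam| and
    which fixes the unipotents. The left side is polynomial in c, which settles c = 0 and forces f =
    0 when |lam| is negative. *)
Lemma push_scalar (V : vectType k) m c (f : fn V) : fcoch lam m.+1 f ->
  push (c *: \1)%VF f = c ^ weight_sum lt *: f.
Proof.
move=> Sf; have [f0 fs _] := Sf; have [a [pa aE]] := fcoch_pol Sf.
apply/funext => -[psi us]; rewrite /push /=.
have -> : (c ^ weight_sum lt *: f) (psi, us) = c ^ weight_sum lt * f (psi, us) by [].
case: (eqVneq (size us) m.+1) => [us_m|/eqP us_m]; last by rewrite !f0 ?mulr0.
have [P PE] : exists P : {poly k}, forall c, f ((psi \o (c *: \1))%VF, us) = P.[c].
  have [|P PE] := pol_curve (gam := fun c => ((psi \o (c *: \1))%VF, us)) _ pa.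
    move=> _ [[v [i ->]]|[l [i [i' ->]]]] /=; last first.
      by exists (sval (nth (UT1 k r) us l) i i')%:P => c'; rewrite hornerC.
    exists (psi v i 0 *: 'X) => c'.
    by rewrite comp_lfunE scale_lfunE id_lfunE linearZ mxE hornerZ hornerX mulrC.
  by exists P => c'; rewrite aE.
have cE c' : c' != 0 -> P.[c'] = c' ^ weight_sum lt * f (psi, us).
  move=> c0; have tb : is_trig_mx (c'%:M : 'M[k]_r) by apply: scalar_mx_is_trig.
  have ub : (c'%:M : 'M[k]_r) \in unitmx by rewrite unitmxE det_scalar unitfE expf_neq0.
  have lb : lowu (c'%:M : 'M[k]_r) by apply/andP.
  have dgb : dg (c'%:M : 'M[k]_r) = c'%:M.
    by rewrite /dg -diag_const_mx; congr diag_mx; apply/rowP => i; rewrite !mxE eqxx.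
  have := fs _ psi us I lb us_m.
  have -> : chi lam (c'%:M : 'M[k]_r) = c' ^ weight_sum lt.
    rewrite /weight_sum (big_morph (exprz c') (fun a b => expfzDr a b c0) (expr0z c')).
    by apply: eq_bigr => i _; rewrite mxE eqxx.
  move=> <-; rewrite -PE; congr (f (_, _)).
    by apply/lfunP => v; rewrite lmulE comp_lfunE scale_lfunE id_lfunE linearZ mul_scalar_mx.
  rewrite -[LHS]map_id; apply: eq_map => u; apply: UT_inj; rewrite cjE // dgb.
  by rewrite mul_scalar_mx -mul_mx_scalar mulmxK.
rewrite PE; have [->|c0] := eqVneq c 0; last exact: cE.
case: (weight_sum lt) cE => [[|e]|e] cE.
- have -> : P = (f (psi, us))%:P.
    by apply: poly_inj => c' c0; rewrite cE // expr0z mul1r hornerC.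
  by rewrite hornerC expr0z mul1r.
- have -> : P = f (psi, us) *: 'X^(e.+1).
    by apply: poly_inj => c' c0; rewrite cE // hornerZ hornerXn mulrC.
  by rewrite hornerZ hornerXn expr0n mulr0 exp0rz mul0r.
have E : P * 'X^(e.+1) = (f (psi, us))%:P.
  apply: poly_inj => c' c0; rewrite hornerM hornerXn cE // hornerC.
  by rewrite -[c' ^ Negz e]/((c' ^+ e.+1)^-1) mulrAC mulVf ?mul1r // expf_neq0.
have f00 : f (psi, us) = 0.
  by have := congr1 (fun p : {poly k} => p.[0]) E; rewrite hornerM hornerXn expr0n mulr0 hornerC.
move/eqP: E; rewrite f00 polyC0 mulf_eq0 expf_eq0 polyX_eq0 andbF orbF => /eqP ->.
by rewrite horner0 mulr0.
Qed.

Lemma fcoord_sum (V : vectType k) (I : Type) (s : seq I) (c : I -> k) (g : I -> fn V) :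
  (forall i, fZ V (g i)) -> fZ V (\sum_(i <- s) c i *: g i) /\
  fcoord (\sum_(i <- s) c i *: g i) = \sum_(i <- s) c i *: fcoord (g i).
Proof.
move=> Zg; elim: s => [|i s [Zs IHs]].
  rewrite !big_nil; split; first exact: subspace0.
  exact: (proj2 (fcoord_eq0 (subspace0 (fZ V))) (subspace0 (fB V))).
rewrite !big_cons; split; first exact: subspaceP.
by rewrite -IHs fcoord_lin.
Qed.

Definition hom_coord (V W : vectType k) (l : 'I_(\dim {:'Hom(V, W)})) (phi : 'Hom(V, W)) : k :=
  coord (vbasis {:'Hom(V, W)}) l phi.

(** Expanding z(psi o phi) in the coordinates of phi gives coefficients that need not be cocycles.
    Interpolation replaces them by pushed cocycles, whose classes can be taken, with coefficients
    still polynomial in phi. *)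
Lemma push_interpolation (V W : vectType k) (z : fn V) : fZ V z ->
  exists m (y : 'I_m -> 'Hom(V, W)) (p : 'I_m -> 'Hom(V, W) -> k),
    (forall i, pol (gens (@hom_coord V W)) (p i)) /\
    forall phi, push phi z = \sum_i p i phi *: push (y i) z.
Proof.
move=> [Sz _]; have [a [pa aE]] := fcoch_pol Sz; have [z0 _ _] := Sz.
have [|||||I [aa [bb [paa _ aaE]]]] := pol_tensor_sum (A := pol (gens (@hom_coord V W)))
    (B := fun=> True) (phi := fun (phi : 'Hom(V, W)) (x : T W * seq (UT k r)) => ((x.1 \o phi)%VF, x.2))
    _ _ _ _ _ pa; try by [].
- exact: pol_cst.
- by move=> *; apply: polM.
- move=> _ [[v [i ->]]|[l [i [i' ->]]]]; last first.
    exists unit, (fun=> fun=> 1), (fun=> fun x : T W * seq (UT k r) => sval (nth (UT1 k r) x.2 l) i i').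
    split=> // [_|x y]; first exact: pol_cst.
    by rewrite big_const card_unit /= mul1r addr0.
  exists 'I_(\dim {:'Hom(V, W)}), (@hom_coord V W),
    (fun (l : 'I_(\dim {:'Hom(V, W)})) (x : T W * seq (UT k r)) => x.1 ((vbasis {:'Hom(V, W)})`_l v) i 0).
  split=> // [l|x y]; first by apply: pol_gen; exists l.
  rewrite /= comp_lfunE {1}(coord_vbasis (memvf x)) sum_lfunE linear_sum summxE.
  by apply: eq_bigr => l _; rewrite scale_lfunE linearZ mxE.
have [|m [y [c cE]]] := @interpolation k 'Hom(V, W) (fn W) #|I|
    (fun i phi => aa (enum_val i) phi)
    (fun i x => if size x.2 == j.+1 then bb (enum_val i) x : k^o else 0) (fun phi => push phi z).
  move=> phi; apply/funext => -[psi us]; rewrite fct_sumE /push /=.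
  have E F : \sum_(i < #|I|) F (enum_val i) = \sum_(i : I) F i :> k^o.
    rewrite (reindex (@enum_rank I)); last exact/onW_bij/enum_rank_bij.
    by apply: eq_bigr => i _; rewrite enum_rankK.
  case: (eqVneq (size us) j.+1) => [us_m|/eqP us_m].
    rewrite aE // (aaE phi (psi, us)) -(E (fun i => aa i phi * bb i (psi, us))).
    by apply: eq_bigr => i _; rewrite -[RHS]/(_ * (if _ then _ else _)) /= us_m eqxx.
  rewrite z0 // big1 // => i _; rewrite -[LHS]/(_ * (if _ then _ else _)) /=.
  by move/eqP/negPf: us_m => ->; rewrite mulr0.
exists m, y, (fun i phi => \sum_l c i l * aa (enum_val l) phi); split=> // i.
by apply: pol_sum => l _; apply: polM; [apply: pol_cst | apply: paa].
Qed.

Lemma pol_fmat (V W : vectType k) a b :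
  pol (gens (@hom_coord V W)) (fun phi => fmat phi a b).
Proof.
have [Zb _ _] := fbaseP lam j V.
have [m [y [p [pp pE]]]] := push_interpolation W (Zb a).
apply: (@eq_pol _ _ _ (fun phi => \sum_i p i phi * fcoord (push (y i) (fbase a)) 0 b)).
  move=> phi; rewrite mxE pE.
  have [|_ ->] := fcoord_sum (index_enum 'I_m) (p^~ phi) (g := fun i => push (y i) (fbase a)).
    by move=> i; apply: push_fZ.
  by rewrite summxE; apply: eq_bigr => i _; rewrite mxE.
by apply: pol_sum => i _; apply: polM; [apply: pp | apply: pol_cst].
Qed.

Definition fobj (V : vectType k) : vectType k := 'rV[k]_(fdim V).
Definition fmap (V W : vectType k) (phi : 'Hom(V, W)) : 'Hom(fobj V, fobj W) :=
  linfun (mulmxr (fmat phi)).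

Lemma fmapE (V W : vectType k) (phi : 'Hom(V, W)) (v : 'rV[k]_(fdim V)) :
  fmap phi v = v *m fmat phi.
Proof. by rewrite lfunE. Qed.

Lemma fcoord_base (V : vectType k) i : fcoord (fbase i) = delta_mx 0 i :> 'rV[k]_(fdim V).
Proof.
have [Zb _ _] := fbaseP lam j V; apply: fcoord_unique => //.
rewrite (bigD1 i) //= mxE !eqxx scale1r big1 => [|l li]; first by rewrite addr0 subrr; exact: (subspace0 (fB V)).
by rewrite mxE (negPf li) andbF scale0r.
Qed.

Lemma fmap_id (V : vectType k) : fmap (\1 : 'End(V))%VF = \1%VF.
Proof.
apply/lfunP => v; rewrite fmapE id_lfunE -[RHS]mulmx1; congr (_ *m _).
by apply/matrixP => i l; rewrite mxE push_id fcoord_base !mxE eqxx eq_sym.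
Qed.

Lemma fmap_comp (U V W : vectType k) (f : 'Hom(V, W)) (g : 'Hom(U, V)) :
  fmap (f \o g)%VF = (fmap f \o fmap g)%VF.
Proof.
have [Zb _ _] := fbaseP lam j U.
apply/lfunP => v; rewrite comp_lfunE !fmapE -mulmxA; congr (_ *m _).
apply/matrixP => i l; rewrite mxE push_comp fcoord_push; last exact: push_fZ.
by rewrite !mxE; apply: eq_bigr => a _; rewrite !mxE.
Qed.

Lemma fmap_poly (V W : vectType k) : polynomial_map (@fmap V W).
Proof.
have fE phi : fmap phi = \sum_a \sum_b fmat phi a b *:
    (linfun (mulmxr (delta_mx a b)) : 'Hom(fobj V, fobj W)).
  apply/lfunP => v; rewrite fmapE {1}[fmat phi]matrix_sum_delta mulmx_sumr sum_lfunE.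
  apply: eq_bigr => a _; rewrite mulmx_sumr sum_lfunE; apply: eq_bigr => b _.
  by rewrite scale_lfunE lfunE /= scalemxAr.
have /choice[q qE] (i : 'I_(\dim {:'Hom(fobj V, fobj W)})) : exists q : mpoly _ k, forall phi,
    coord (vbasis {:'Hom(fobj V, fobj W)}) i (fmap phi) = meval (fun l => hom_coord l phi) q.
  apply: pol_mpoly.
  apply: (@eq_pol _ _ _ (fun phi => \sum_a \sum_b fmat phi a b *
    coord (vbasis {:'Hom(fobj V, fobj W)}) i (linfun (mulmxr (delta_mx a b))))).
    move=> phi; rewrite fE linear_sum; apply: eq_bigr => a _.
    by rewrite linear_sum; apply: eq_bigr => b _; rewrite linearZ.
  apply: pol_sum => a _; apply: pol_sum => b _; apply: polM; last exact: pol_cst.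
  exact: pol_fmat.
by exists q => phi i; rewrite qE.
Qed.

Lemma fmap_scalar (V : vectType k) (c : k) :
  fmap (c *: (\1 : 'End(V))%VF) = c ^ weight_sum lt *: \1%VF.
Proof.
have [Zb _ _] := fbaseP lam j V.
apply/lfunP => v; rewrite fmapE scale_lfunE id_lfunE -mul_mx_scalar; congr (_ *m _).
apply/matrixP => i l; rewrite mxE; have [Sb _] := Zb i.
rewrite (push_scalar c Sb) -[_ *: fbase i]addr0 fcoord_lin //; last exact: subspace0.
rewrite (proj2 (fcoord_eq0 (subspace0 (fZ V))) (subspace0 (fB V))) addr0 fcoord_base.
by rewrite !mxE eqxx eq_sym; case: eqP => _; rewrite ?mulr1 ?mulr0.
Qed.

Definition cohomology_functor : polyfunctor k (weight_sum lt) :=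
  PolyFunctor fmap_id fmap_comp fmap_poly fmap_scalar.

End Polyfunctor.

(** * Truncation to the first rows *)

Section Truncation.
Variable k : closedFieldType.

Lemma gl_dense n f g : pol (@coordU k n n) f -> pol (@coordU k n n) g ->
  forall us, (forall M, M \in unitmx -> f (M, us) = g (M, us)) ->
  forall M, f (M, us) = g (M, us).
Proof.
case: n f g => [|n] f g pf pg us fg M.
  by apply: fg; rewrite unitmxE det_mx00 unitr1.
by apply: torus_dense => // M' [uM' _]; apply: fg.
Qed.

Variables (r p : nat).
Notation n := (r + p)%N.
Notation Mn := 'M[k]_(r + p).
Notation X := ('M[k]_(r + p) * seq (UT k (r + p)))%type.

Lemma low_block_n (b : Mn) : is_trig_mx b ->
  b = block_mx (ulsubmx b) 0 (dlsubmx b) (drsubmx b).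
Proof.
move=> /is_trig_mxP tb; rewrite -{1}[b]submxK; congr block_mx.
by apply/matrixP => i j; rewrite !mxE tb //= ltn_addr.
Qed.

Lemma ulsub_trig (b : Mn) : is_trig_mx b -> is_trig_mx (ulsubmx b).
Proof. by move=> /is_trig_mxP tb; apply/is_trig_mxP => i j ij; rewrite !mxE tb. Qed.

Lemma ulsub_diag (b : Mn) i : (ulsubmx b) i i = b (lshift p i) (lshift p i).
Proof. by rewrite !mxE. Qed.

Lemma ulsub_lowu (b : Mn) : lowu b -> lowu (ulsubmx b).
Proof.
move=> /andP[tb ub]; rewrite /lowu ulsub_trig // trig_unitP ?ulsub_trig //.
by apply/forallP => i; rewrite ulsub_diag trig_unit_diag.
Qed.

Lemma ulsub_unitri (b : Mn) : unitri b -> unitri (ulsubmx b).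
Proof.
by move=> /unitriP[tb db]; apply/unitriP; split=> [|i]; rewrite ?ulsub_trig ?ulsub_diag.
Qed.

Lemma usub_low q (b : Mn) (M : 'M[k]_(r + p, q)) : is_trig_mx b ->
  usubmx (b *m M) = ulsubmx b *m usubmx M.
Proof.
move=> tb; rewrite {1}(low_block_n tb) -{1}[M]vsubmxK mul_block_col col_mxKu.
by rewrite mul0mx addr0.
Qed.

Lemma ulsubM (b c : Mn) : is_trig_mx b -> is_trig_mx c ->
  ulsubmx (b *m c) = ulsubmx b *m ulsubmx c.
Proof.
move=> tb tc; rewrite {1}(low_block_n tb) {1}(low_block_n tc) mulmx_block block_mxKul.
by rewrite mul0mx addr0.
Qed.

Lemma ulsub_dg (b : Mn) : ulsubmx (dg b) = dg (ulsubmx b).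
Proof. by apply/matrixP => i j; rewrite !mxE (inj_eq (@lshift_inj _ _)). Qed.

Lemma ulsubV (b : Mn) : lowu b -> ulsubmx (invmx b) = invmx (ulsubmx b).
Proof.
move=> lb; have [tb ub] := andP lb; have [_ ud] := andP (ulsub_lowu lb).
apply: (can_inj (mulKmx ud)); rewrite mulmxV // -ulsubM ?trig_invmx // mulmxV //.
by apply/matrixP => i j; rewrite !mxE (inj_eq (@lshift_inj _ _)).
Qed.

Definition tlU (u : UT k (r + p)) : UT k r := UTof (ulsubmx (sval u)).

Lemma tlUE u : sval (tlU u) = ulsubmx (sval u).
Proof. exact/UTofE/ulsub_unitri/(svalP u). Qed.

Lemma tlU_cj b u : lowu b -> tlU (cj b u) = cj (ulsubmx b) (tlU u).
Proof.
move=> lb; have [tb ub] := andP lb; have [tu _] := unitriP _ (svalP u).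
apply: UT_inj; rewrite tlUE !cjE ?ulsub_lowu // tlUE !ulsubM ?trig_invmx ?trig_mulmx ?dg_trig //.
by rewrite ulsub_dg ulsubV.
Qed.

Lemma tlU1 : tlU (UT1 k n) = UT1 k r.
Proof.
apply: UT_inj; rewrite tlUE !UT1E; apply/matrixP => i j.
by rewrite !mxE (inj_eq (@lshift_inj _ _)).
Qed.

Definition bl1 (b : 'M[k]_r) : Mn := block_mx b 0 0 1%:M.

Lemma bl1M b c : bl1 b *m bl1 c = bl1 (b *m c).
Proof. by rewrite /bl1 mulmx_block !mulmx0 !mul0mx mulmx1 !addr0 add0r. Qed.

Lemma bl1_low b : lowu b -> lowu (bl1 b).
Proof.
move=> /andP[tb ub]; apply/andP; split; last first.
  have : bl1 b *m bl1 (invmx b) = 1%:M by rewrite bl1M mulmxV // /bl1 -scalar_mx_block.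
  by case/mulmx1_unit.
move/is_trig_mxP: tb => tb; apply/is_trig_mxP => i j.
rewrite /bl1; case: (split_ordP i) => i' ->; case: (split_ordP j) => j' -> /=.
- by rewrite block_mxEul => /tb.
- by rewrite block_mxEur mxE.
- by rewrite block_mxEdl mxE.
by rewrite block_mxEdr ltn_add2l !mxE -val_eqE => /ltn_eqF /= ->.
Qed.

Lemma bl1_dg b : dg (bl1 b) = bl1 (dg b).
Proof.
apply/matrixP => i j; rewrite [LHS]mxE [X in X *+ _]mxE /bl1.
case: (split_ordP i) => i' ->; case: (split_ordP j) => j' ->.
- by rewrite !block_mxEul !mxE (inj_eq (@lshift_inj _ _)).
- by rewrite eq_lrshift mulr0n block_mxEur mxE.
- by rewrite eq_rlshift mulr0n block_mxEdl mxE.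
by rewrite !block_mxEdr !mxE eqxx (inj_eq (@rshift_inj _ _)).
Qed.

Lemma bl1V b : b \in unitmx -> invmx (bl1 b) = bl1 (invmx b).
Proof.
move=> ub; have E : bl1 b *m bl1 (invmx b) = 1%:M.
  by rewrite bl1M mulmxV // /bl1 -scalar_mx_block.
by have [u _] := mulmx1_unit E; rewrite -[RHS](mulKmx u) E mulmx1.
Qed.

Definition embU (v : UT k r) : UT k n := UTof (bl1 (sval v)).

Lemma embUE v : sval (embU v) = bl1 (sval v).
Proof.
apply: UTofE; have uv := svalP v; have /andP[tb _] := bl1_low (unitri_lowu uv).
apply/unitriP; split=> // i; have /unitriP[_ dv] := uv; rewrite /bl1.
by case: (split_ordP i) => i' ->; rewrite ?block_mxEul ?block_mxEdr ?dv // mxE eqxx.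
Qed.

Lemma embU1 : embU (UT1 k r) = UT1 k n.
Proof. by apply: UT_inj; rewrite embUE !UT1E /bl1 -scalar_mx_block. Qed.

Lemma embU_cj b v : lowu b -> cj (bl1 b) (embU v) = embU (cj b v).
Proof.
move=> lb; have [tb ub] := andP lb; apply: UT_inj.
by rewrite cjE ?bl1_low // !embUE cjE // bl1_dg bl1V // !bl1M.
Qed.

Lemma tlU_emb v : tlU (embU v) = v.
Proof. by apply: UT_inj; rewrite tlUE embUE /bl1 block_mxKul. Qed.

Variable lt : r.-tuple int.
Let lam i := tnth lt i.
Let lamn i := tnth (pad lt n) i.
Notation cVn := 'cV[k]_(r + p).
Notation T := ('Hom('cV[k]_(r + p), 'cV[k]_r)).
Notation fcoch := (@fcoch k r lam cVn).

Lemma pad_lshift i : lamn (lshift p i) = lam i.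
Proof. by rewrite /lamn tnth_mktuple /lam (tnth_nth 0). Qed.
Lemma pad_rshift i : lamn (rshift r i) = 0.
Proof. by rewrite /lamn tnth_mktuple nth_default // size_tuple leq_addr. Qed.

Lemma chi_ulsub (b : Mn) : chi lamn b = chi lam (ulsubmx b).
Proof.
rewrite /chi big_split_ord /= [X in _ * X]big1 ?mulr1 => [|i _].
  by apply: eq_bigr => i _; rewrite pad_lshift !mxE.
by rewrite pad_rshift expr0z.
Qed.

Definition toHom (A : 'M[k]_(r, r + p)) : T := linfun (mulmx A).
Definition ofHom (psi : T) : 'M[k]_(r, r + p) := \matrix_(i, l) psi (delta_mx l 0) i 0.

Lemma toHomE A v : toHom A v = A *m v. Proof. by rewrite lfunE. Qed.
Lemma toHomK A : ofHom (toHom A) = A.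
Proof. by apply/matrixP => i l; rewrite mxE toHomE -colE mxE. Qed.
Lemma ofHomK psi : toHom (ofHom psi) = psi.
Proof.
apply/lfunP => v; rewrite toHomE [in RHS](matrix_sum_delta v) linear_sum.
apply/matrixP => i l; rewrite [l]ord1 mxE summxE; apply: eq_bigr => a _.
by rewrite big_ord1 linearZ !mxE mulrC.
Qed.
Lemma lmul_toHom b A : toHom (b *m A) = lmul b (toHom A).
Proof. by apply/lfunP => v; rewrite lmulE !toHomE mulmxA. Qed.

Definition rho (f : T * seq (UT k r) -> k^o) : X -> k^o :=
  fun x => f (toHom (usubmx x.1), map tlU x.2).

Lemma rho_delta f : delta (rho f) = rho (delta f).
Proof. by apply/funext => x; rewrite /delta /rho /= D_map. Qed.

Lemma rho_pol m f : fcoch m.+1 f -> exists a, pol (@coordU k n n) a /\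
  forall M us, size us = m.+1 -> rho f (M, us) = a (M, us).
Proof.
move=> /fcoch_pol[a [pa aE]]; exists (fun x => a (toHom (usubmx x.1), map tlU x.2)).
split=> [|M us us_m]; last by rewrite /rho aE ?size_map.
apply: (pol_subst (phi := fun x : X => (toHom (usubmx x.1), map tlU x.2))) pa.
move=> _ [[v [i ->]]|[l [i [i' ->]]]] /=.
  apply: (@eq_pol _ _ _ (fun x : X => (usubmx x.1 *m v) i 0)) => [x|]; first by rewrite toHomE.
  apply: pol_mulmx => a' b; last exact: pol_cst.
  apply: (@eq_pol _ _ _ (fun x : X => x.1 (lshift p a') b)) => [x|]; first by rewrite mxE.
  exact/(@pol_coordM_U _ _ _ (fun M => M (lshift p a') b))/pol_entry.
apply: (@eq_pol _ _ _ (fun x : X => sval (nth (UT1 k n) x.2 l) (lshift p i) (lshift p i'))).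
  move=> x; have -> : nth (UT1 k r) (map tlU x.2) l = tlU (nth (UT1 k n) x.2 l).
    have [lm|ml] := ltnP l (size x.2); first by rewrite (nth_map (UT1 k n)).
    by rewrite !nth_default ?size_map // tlU1.
  by rewrite tlUE !mxE.
exact: pol_entryU.
Qed.

Lemma rho_coch m f : fcoch m.+1 f -> coch_mat lamn m.+1 (rho f).
Proof.
move=> Sf; have [a [pa aE]] := rho_pol Sf; have [f0 fs _] := Sf.
split=> [M us uM us_m|b M us uM lb us_m|].
- by rewrite /rho f0 ?size_map.
- have [tb ub] := andP lb; rewrite /rho /= usub_low // lmul_toHom chi_ulsub.
  have -> : map tlU (map (cj b) us) = map (cj (ulsubmx b)) (map tlU us).
    by rewrite -!map_comp; apply: eq_map => u /=; rewrite tlU_cj.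
  by rewrite fs ?size_map // ulsub_lowu.
by exists 0, a; split=> // M us uM us_m; rewrite divr1 aE.
Qed.

(** The matrix with rows psi followed by zeros can be singular; the vanishing reaches it because
    invertible matrices are dense. *)
Lemma rho_inj m f : fcoch m.+1 f -> null_on (@unit_dom k n) (rho f) -> f = 0.
Proof.
move=> Sf rf0; have [a [pa aE]] := rho_pol Sf; have [f0 _ _] := Sf.
apply/funext => -[psi vs]; case: (eqVneq (size vs) m.+1) => [vs_m|/eqP]; last exact: f0.
have -> : f (psi, vs) = rho f (col_mx (ofHom psi) 0, map embU vs).
  rewrite /rho /= col_mxKu ofHomK -map_comp; congr (f (_, _)).
  by rewrite -[LHS]map_id; apply: eq_map => v /=; rewrite tlU_emb.
rewrite aE ?size_map //; apply: (gl_dense pa (pol_cst _ 0)) => M uM.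
by rewrite -aE ?size_map // rf0.
Qed.

(* The limit c -> 0 along the torus element with entries c^(w i), which has
   trivial weight since the padded weights vanish where w does not. *)
Lemma rho_surj m g : coch_mat lamn m.+1 g ->
  exists2 f, fcoch m.+1 f & null_on (@unit_dom k n) (g - rho f).
Proof.
move=> [g0 gs [N [a [pa aE]]]].
have gE M us : M \in unitmx -> size us = m.+1 -> g (M, us) = a (M, us).
  by move=> uM us_m; rewrite aE // expr1n divr1.
have asemi b M us : lowu b -> size us = m.+1 ->
    a (b *m M, map (cj b) us) = chi lamn b * a (M, us).
  move=> lb us_m; apply: (gl_dense (f := fun x => a (b *m x.1, map (cj b) us))
    (g := fun x => chi lamn b * a x)).
  - apply: (pol_subst (phi := fun x : X => (b *m x.1, map (cj b) us))) pa.
    move=> _ [[i [j ->]]|[l [i [j ->]]]] /=; last exact: pol_cst.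
    apply: (pol_mulmx (A := fun=> b) (B := fun x : X => x.1)) => ? ?; first exact: pol_cst.
    exact/(@pol_coordM_U _ _ _ (fun M => M _ _))/pol_entry.
  - by apply: polM => //; apply: pol_cst.
  move=> M' uM'; rewrite -!gE ?size_map ?gs //.
  by rewrite unitmx_mul uM' andbT; case/andP: lb.
(* Zero on the first r rows, then 1, 2, ...: at c = 0 the lower rows of M disappear, and so do the
   entries of the unipotents below the diagonal and outside the top-left block. *)
pose w (i : 'I_n) := (i.+1 - r)%N.
pose dc (c : k) : Mn := diag_mx (\row_i c ^+ w i).
pose sc (c : k) (u : UT k n) : UT k n := UTof (\matrix_(i, l) (c ^+ (w i - w l) * sval u i l)).
have lim M us : size us = m.+1 ->
    a (M, us) = a (col_mx (usubmx M) 0, map (fun u => embU (tlU u)) us).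
  move=> us_m.
  have [|P PE] := pol_curve (gam := fun c => (dc c *m M, map (sc c) us)) _ pa.
    move=> _ [[i [l ->]]|[l [i [i' ->]]]] /=.
      exists (M i l *: 'X^(w i)) => c.
      by rewrite mul_diag_mx !mxE hornerZ hornerXn mulrC.
    have [lm|ml] := ltnP l (size us); last first.
      by exists (sval (UT1 k n) i i')%:P => c; rewrite nth_default ?size_map // hornerC.
    exists (if (i' < i)%N then sval (nth (UT1 k n) us l) i i' *: 'X^(w i - w i') else ((i == i')%:R)%:P) => c.
    rewrite (nth_map (UT1 k n)) // !mxE; case: ifP => _; last by rewrite hornerC.
    by rewrite hornerZ hornerXn mulrC.
  have PC : P = (a (M, us))%:P.
    apply: poly_inj => c c0; rewrite hornerC -PE.
    have dcE i : dc c i i = c ^+ w i by rewrite !mxE eqxx.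
    have tdc : is_trig_mx (dc c) by apply: diag_mx_is_trig.
    have udc : dc c \in unitmx.
      by rewrite trig_unitP //; apply/forallP => i; rewrite dcE expf_neq0.
    have ldc : lowu (dc c) by apply/andP.
    have dgdc : dg (dc c) = dc c by congr diag_mx; apply/rowP => i; rewrite !mxE eqxx.
    have chi1 : chi lamn (dc c) = 1.
      rewrite chi_ulsub; apply: big1 => i _; rewrite ulsub_diag dcE /w /=.
      have -> : (i.+1 - r)%N = 0%N by apply/eqP; rewrite subn_eq0; exact: (ltn_ord i).
      by rewrite expr0 exp1rz.
    rewrite -[RHS]mul1r -chi1 -asemi //; congr (a (_, _)); apply: eq_map => u.
    have iv : invmx (dc c) = diag_mx (\row_i (c ^+ w i)^-1).
      apply: (can_inj (mulKmx udc)); rewrite mulmxV // mulmx_diag -(diag_const_mx n 1).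
      by congr diag_mx; apply/rowP => i; rewrite !mxE mulfV // expf_neq0.
    have /unitriP[/is_trig_mxP tu du] := svalP u.
    apply: UT_inj; rewrite cjE // dgdc iv; apply/matrixP => i l.
    rewrite mul_mx_diag mul_diag_mx !mxE.
    have [li|il|/val_inj ->] := ltngtP l i.
    + have wl : (w l <= w i)%N by rewrite leq_sub2r // ltnS ltnW.
      have -> : c ^+ w i = c ^+ (w i - w l) * c ^+ w l by rewrite -exprD subnK.
      by rewrite mulrAC mulfK // expf_neq0.
    + by rewrite tu // mulr0 mul0r -val_eqE /= (ltn_eqF il).
    by rewrite eqxx du mulr1 mulfV // expf_neq0.
  have := PE 0; rewrite PC hornerC => <-; congr (a (_, _)).
    apply/matrixP => i l; rewrite mul_diag_mx !mxE expr0n /w.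
    rewrite -[M]vsubmxK !col_mxKu; case: (split_ordP i) => i' ->.
      have -> : ((lshift p i').+1 - r)%N = 0%N by apply/eqP; rewrite subn_eq0; exact: (ltn_ord i').
      by rewrite !col_mxEu mul1r.
    by rewrite col_mxEd [RHS]mxE /= -addnS addKn mul0r.
  apply: eq_map => u; apply: UT_inj; rewrite embUE tlUE; apply/matrixP => i l; rewrite mxE.
  have /unitriP[/is_trig_mxP tu du] := svalP u.
  rewrite mxE expr0n /bl1 /w; case: (split_ordP i) => i' ->; case: (split_ordP l) => l' ->.
  - rewrite block_mxEul !mxE /=.
    have -> : (i'.+1 - r - (l'.+1 - r))%N = 0%N by move: (ltn_ord i') => /= ?; lia.
    rewrite mul1r (inj_eq (@lshift_inj _ _)).
    have [//|il|/val_inj ->] := ltngtP l' i'; last by rewrite eqxx du.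
    by rewrite tu // -val_eqE /= (ltn_eqF il).
  - rewrite block_mxEur mxE eq_lrshift /= ltnNge.
    by rewrite (leq_trans (ltnW (ltn_ord i')) (leq_addr _ _)).
  - rewrite block_mxEdl mxE eq_rlshift /= -addnS addKn.
    have -> : (l'.+1 - r)%N = 0%N by apply/eqP; rewrite subn_eq0; exact: (ltn_ord l').
    by rewrite /= mul0r; case: ifP.
  rewrite block_mxEdr mxE (inj_eq (@rshift_inj _ _)) /= ltn_add2l -!addnS !addKn subSS.
  case: ifP => // li; rewrite subn_eq0 leqNgt li mul0r.
  by rewrite -val_eqE /= (gtn_eqF li).
pose f (x : T * seq (UT k r)) : k^o :=
  if size x.2 == m.+1 then a (col_mx (ofHom x.1) 0, map embU x.2) else 0.
exists f.
  split=> [psi vs _ /eqP/negPf vs_m|b psi vs _ lb vs_m|].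
  - by rewrite /f /= vs_m.
  - rewrite /f /= size_map vs_m eqxx.
    have -> : map embU (map (cj b) vs) = map (cj (bl1 b)) (map embU vs).
      by rewrite -!map_comp; apply: eq_map => v /=; rewrite embU_cj.
    have -> : col_mx (ofHom (lmul b psi)) 0 = bl1 b *m col_mx (ofHom psi) 0 :> 'M_(r + p, r + p).
      rewrite /bl1 mul_block_col !mul0mx mulmx0 !addr0; congr col_mx.
      by rewrite -{1}(ofHomK psi) -lmul_toHom toHomK.
    rewrite asemi ?size_map ?bl1_low // chi_ulsub.
    by congr (chi lam _ * _); rewrite /bl1 block_mxKul.
  exists 0, (fun x => a (col_mx (ofHom x.1) 0, map embU x.2)); split; last first.
    by move=> psi vs _ vs_m; rewrite divr1 /f /= vs_m eqxx.
  apply: (pol_subst (phi := fun x : T * seq (UT k r) => (col_mx (ofHom x.1) 0, map embU x.2))) pa.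
  move=> _ [[i [l ->]]|[l [i [i' ->]]]] /=.
    case: (split_ordP i) => i0 ->.
      apply: (@eq_pol _ _ _ (fun x : T * seq (UT k r) => x.1 (delta_mx l 0) i0 0)) => [x|].
        by rewrite col_mxEu mxE.
      by apply: pol_gen; left; exists (delta_mx l 0), i0.
    apply: (@eq_pol _ _ _ (fun=> 0)) => [x|]; last exact: pol_cst.
    by rewrite col_mxEd mxE.
  have E vs : nth (UT1 k n) (map embU vs) l = embU (nth (UT1 k r) vs l).
    have [lm|ml] := ltnP l (size vs); first by rewrite (nth_map (UT1 k r)).
    by rewrite !nth_default ?size_map // embU1.
  case: (split_ordP i) => i0 ->; case: (split_ordP i') => i0' ->.
  - apply: (@eq_pol _ _ _ (fun x : T * seq (UT k r) => sval (nth (UT1 k r) x.2 l) i0 i0')) => [x|].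
      by rewrite (E x.2) embUE /bl1 block_mxEul.
    by apply: pol_gen; right; exists l, i0, i0'.
  - apply: (@eq_pol _ _ _ (fun=> 0)) => [x|]; last exact: pol_cst.
    by rewrite (E x.2) embUE /bl1 block_mxEur mxE.
  - apply: (@eq_pol _ _ _ (fun=> 0)) => [x|]; last exact: pol_cst.
    by rewrite (E x.2) embUE /bl1 block_mxEdl mxE.
  apply: (@eq_pol _ _ _ (fun=> (1%:M : 'M[k]_p) i0 i0')) => [x|]; last exact: pol_cst.
  by rewrite (E x.2) embUE /bl1 block_mxEdr.
move=> M us uM; rewrite -[LHS]/(g (M, us) - rho f (M, us)) /rho /f /= size_map toHomK.
case: eqP => us_m; last by rewrite g0 // subr0.
rewrite gE // (lim M us us_m) -map_comp; exact: subrr.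
Qed.

End Truncation.

(** * Comparison of bar cohomology with the functor at k^n *)

Section Comparison.
Local Open Scope classical_set_scope.
Variables (k : closedFieldType) (r p : nat) (lt : r.-tuple int) (j : nat).
Notation n := (r + p)%N.
Let lam i := tnth lt i.
Let pl := pad lt (r + p).
Let lamn i := tnth pl i.
Notation G := (GL k (r + p)).
Notation frames := (frames k (r + p)).
Notation base := (@base k (r + p)).
Notation bar_sec := (@bar_sec k (r + p) lamn).
Notation X := ('M[k]_(r + p) * seq (UT k (r + p)))%type.
Notation T := ('Hom('cV[k]_(r + p), 'cV[k]_r)).
Notation fcoch := (@fcoch k r lam 'cV[k]_(r + p)).
Notation rho := (@rho k r p).

Definition res (h : X -> k^o) : frames -> k^o := fun e => h (e.1 : 'M_n, e.2).
Definition ext (b : frames -> k^o) : X -> k^o := fun x =>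
  if pselect (x.1 \in unitmx) is left u then b (MkGL u, x.2) else 0.

Lemma extE b (M : G) us : ext b (M : 'M_n, us) = b (M, us).
Proof.
rewrite /ext /=; case: pselect => [u|]; last by case; apply: glmxP.
by congr (b (_, _)); apply: GL_inj.
Qed.

Lemma unit_GL (M : 'M[k]_n) : unit_dom M -> exists g : G, M = g.
Proof. by move=> uM; exists (MkGL uM). Qed.

Lemma ext_gl m b : bar_sec m.+1 setT b -> coch_gl lamn m.+1 (ext b).
Proof.
move=> Sb; have [b0 bs _] := Sb; split=> [M us /unit_GL[g ->]|b' M us /unit_GL[g ->] lb us_m|].
- by rewrite extE; apply: b0.
- have [tb ub] := andP lb; rewrite extE -(bs (MkGL ub)) //.
  by rewrite -[b' *m g]/(GLmul (MkGL ub) g : 'M_n) extE.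
have sd : semi_pol (fun M : 'M[k]_n => \det M).
  split; first by apply: pol_det => ? ?; apply: pol_entry.
    exists (fun=> 1) => b' M /andP[tb _]; rewrite det_mulmx det_trig //.
  by move=> M; rewrite unitmxE unitfE.
have [|N [a [pa aE]]] := bar_sec_global sd _ Sb.
  by move=> M; split=> // _; apply: det_neq0.
exists N, a; split=> // M us /unit_GL[g ->] us_m.
by rewrite extE aE // det_neq0.
Qed.

Lemma res_gl m (h : X -> k^o) : coch_gl lamn m.+1 h -> bar_sec m.+1 setT (res h).
Proof.
move=> [h0 hs [N [a [pa aE]]]]; split=> [M us _ us_m|b M us _ tb us_m|M0 _].
- by rewrite /res h0 //; apply: glmxP.
- by rewrite /res /= hs //; [apply: glmxP | rewrite /lowu tb glmxP].
exists (fun M => \det M ^+ N), a; split=> //.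
- by apply: polX; apply: pol_det => ? ?; apply: pol_entry.
- by rewrite expf_neq0 // det_neq0.
by move=> M us _ us_m _; rewrite /res aE //; apply: glmxP.
Qed.

Lemma mat_gl m (h : X -> k^o) : coch_mat lamn m h -> coch_gl lamn m h.
Proof.
apply: (coch_denom (g := fun M : 'M[k]_n => \det M)) => [|M _|M uM].
- apply: (@pol_coordM_U _ _ _ (fun M => \det M)).
  by apply: pol_det => ? ?; apply: pol_entry.
- by rewrite mul1r.
by have [g ->] := unit_GL uM; apply: det_neq0.
Qed.

Lemma bounds_lin (a : k) (b b' : frames -> k^o) : B3 pl j b -> B3 pl j b' -> B3 pl j (a *: b + b').
Proof.
rewrite /B3; case: j => [|q]; first exact: vanishesP.
move=> [x Sx Nx] [y Sy Ny]; exists (a *: x + y); first exact: bar_secP.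
have -> : a *: b + b' - dbar (a *: x + y) = a *: (b - dbar x) + (b' - dbar y).
  by rewrite dbarP opprD addrACA scalerBr.
exact: vanishesP.
Qed.

Lemma bounds0 : B3 pl j (0 : frames -> k^o).
Proof.
rewrite /B3; case: j => [|q] //; exists 0; first exact: bar_sec_van.
by rewrite sub0r => -[M us] _; rewrite -[LHS]/(- dbar 0 (M, us)) /dbar /= D0 oppr0.
Qed.

Lemma boundsB (b b' : frames -> k^o) : B3 pl j b -> B3 pl j b' -> B3 pl j (b - b').
Proof. by move=> Bb Bb'; rewrite -scaleN1r addrC; apply: bounds_lin. Qed.

(** Equality up to a coboundary, because a regular cocycle becomes polynomial only after its
    representative is changed. *)
Definition R3 (b : frames -> k^o) (f : T * seq (UT k r) -> k^o) := B3 pl j (b - res (rho f)).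

Hypothesis range : forall i : 'I_n, i.+1%:Z - n%:Z <= lamn i.
Let acy := @acyclicP k n lamn range.

Let dom_gl (b M : 'M[k]_n) : unit_dom M -> lowu b -> unit_dom (b *m M).
Proof. by move=> uM /andP[_ ub]; rewrite /unit_dom unitmx_mul ub. Qed.

(** A regular primitive of a polynomial cocycle becomes polynomial after subtraction of a
    coboundary, by acyclicity, and a polynomial cochain comes from the first r rows by
    [rho_surj]. *)
Lemma rho_boundary f : fZ lam j 'cV[k]_n f -> (B3 pl j (res (rho f)) <-> fB lam j 'cV[k]_n f).
Proof.
move=> [Sf df]; split; last first.
  rewrite /= /fbounds /B3; case: j Sf df => [|q] Sf df.
    by move=> -> [M us] _.
  move=> [x Sx ->]; exists (res (rho x)); first exact/res_gl/mat_gl/rho_coch.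
  have -> : dbar (res (rho x)) = res (rho (delta x)) by rewrite -rho_delta.
  by rewrite subrr.
rewrite /= /fbounds /B3; case: j Sf df => [|q] Sf df.
  move=> rf0; apply: (rho_inj Sf) => M us /unit_GL[g ->].
  exact: (rf0 (g, us)).
move=> [x Sx Nx].
have dx : null_on (@unit_dom k n) (rho f - delta (ext x)).
  move=> M us /unit_GL[g ->]; have := Nx (g, us) I.
  rewrite -[LHS]/(rho f (g : 'M_n, us) - dbar x (g, us)).
  rewrite -[X in _ -> X = _]/(rho f (g : 'M_n, us) - delta (ext x) (g : 'M_n, us)).
  have -> // : delta (ext x) (g : 'M_n, us) = dbar x (g, us).
  by rewrite /delta /dbar /=; congr D; apply/funext => t; apply: extE.
have [y Sy Ny] := acy (ext_gl Sx) (eq_coch dom_gl dx (rho_coch Sf)).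
have [x' Sx' x'E] := rho_surj Ny.
exists x' => //; apply/eqP; rewrite -subr_eq0; apply/eqP.
apply: (@rho_inj _ _ _ lt q.+1) => [|M us uM].
  by rewrite addrC -scaleN1r; apply: fcochP => //; apply: fcoch_delta.
have E1 := dx M us uM; have E2 := delta_null x'E us uM.
have -> : rho (f - delta x') (M, us) = rho f (M, us) - delta (rho x') (M, us).
  by rewrite rho_delta.
move: E2; rewrite deltaB deltaB delta_delta subr0.
rewrite -[X in X = 0 -> _]/(delta (ext x) (M, us) - delta (rho x') (M, us)) => E2.
move: E1; rewrite -[X in X = 0 -> _]/(rho f (M, us) - delta (ext x) (M, us)) => E1.
by rewrite -[LHS](subrKA (delta (ext x) (M, us))) E1 E2 addr0.
Qed.

Lemma comparison_corr : corr (Z3 pl j) (B3 pl j) (fZ lam j 'cV[k]_n) (fB lam j 'cV[k]_n) R3.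
Proof.
split.
- move=> a u v u' v' uu' vv'; rewrite /R3.
  have -> : a *: u + v - res (rho (a *: u' + v')) =
      a *: (u - res (rho u')) + (v - res (rho v')).
    rewrite scalerBr addrACA -opprD; congr (_ - _).
  exact: bounds_lin.
- move=> b [Sb Nb].
  have dom : null_on (@unit_dom k n) (delta (ext b)).
    move=> M us /unit_GL[g ->]; have := Nb (g, us) I; rewrite /delta /dbar /= => E.
    by rewrite -[RHS]E; congr D; apply/funext => t; apply: extE.
  have [y Sy Ny] := acy (ext_gl Sb) (coch_null _ _ _ dom_gl j.+2 dom).
  have [f Sf fE] := rho_surj Ny.
  have df : delta f = 0.
    apply: (rho_inj (fcoch_delta Sf)) => M us uM.
    have := delta_null fE us uM; rewrite !deltaB delta_delta subr0 rho_delta.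
    rewrite -[X in X = 0 -> _]/(delta (ext b) (M, us) - rho (delta f) (M, us)).
    by rewrite dom // sub0r => /eqP; rewrite oppr_eq0 => /eqP.
  exists f; first by split.
  have E (g : G) us : b (g, us) - delta y (g : 'M_n, us) - rho f (g : 'M_n, us) = 0.
    by have := fE g us (glmxP g); rewrite -extE.
  rewrite /R3 /B3; case: (j) y Sy E {Ny fE} => [|q] y Sy E.
    move=> [g us] _; rewrite -[LHS]/(b (g, us) - rho f (g : 'M_n, us)).
    have := E g us; have -> : delta y (g : 'M_n, us) = 0 by apply: (delta_null Sy); apply: glmxP.
    by rewrite subr0.
  exists (res y); first exact: res_gl.
  move=> [g us] _; rewrite -[RHS](E g us) addrAC.
  by [].
- move=> f [Sf df]; exists (res (rho f)); last by rewrite /R3 subrr; apply: bounds0.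
  split; first exact/res_gl/mat_gl/rho_coch.
  have -> : dbar (res (rho f)) = res (rho (delta f)) by rewrite -rho_delta.
  by rewrite df => -[M us].
move=> b f _ Zf bf; rewrite -rho_boundary //; split=> [Bb|Bf].
  by have := boundsB Bb bf; rewrite opprB addrC subrK.
by have := bounds_lin 1 bf Bf; rewrite scale1r subrK.
Qed.

Lemma R3_act (h : G) b f : R3 b f -> R3 (frame_act h b) (push (GLlin h) f).
Proof.
rewrite /R3 => bf.
have -> : frame_act h b - res (rho (push (GLlin h) f)) = frame_act h (b - res (rho f)).
  apply/funext => -[M us]; rewrite /frame_act /res.
  rewrite -[LHS]/(b (GLmul M h, us) - rho (push (GLlin h) f) (M : 'M_n, us)).
  rewrite -[RHS]/(b (GLmul M h, us) - rho f (M *m h, us)); congr (_ - _).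
  rewrite /rho /push /=; congr (f (_, _)); apply/lfunP => v.
  rewrite comp_lfunE !toHomE GLlinE mulmxA; congr (_ *m v).
  by apply/matrixP => i l; rewrite !mxE; apply: eq_bigr => a _; rewrite !mxE.
move: bf; rewrite /B3; case: j => [|q].
  by move=> /(vanishes_act (h := h)).
move=> [x Sx Nx]; exists (frame_act h x); first exact: (bar_sec_act h Sx).
exact: (vanishes_act (h := h) Nx).
Qed.

End Comparison.

(** * From relations to an equivariant isomorphism *)

Section Final.
Variables (k : fieldType) (V W : lmodType k) (Z B : subspace V) (Z' B' : subspace W).

Lemma corr_iso d (co : W -> 'rV[k]_d) (R : V -> W -> Prop) :
  corr Z B Z' B' R ->
  (forall a w w', Z' w -> Z' w' -> co (a *: w + w') = a *: co w + co w') ->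
  (forall w, Z' w -> co w = 0 <-> B' w) ->
  (forall a, exists2 w, Z' w & co w = a) ->
  exists phi : {linear subquot Z B -> 'rV[k]_d}, bijective phi /\
    forall z (Zz : Z z) w, Z' w -> R z w -> phi (cls B Zz) = co w.
Proof.
move=> [RP Rt Rs Ri] coP co0 cosurj.
have /choice[t tP] (A : subquot Z B) : exists w, Z' w /\ R (crepr A) w.
  by have [w ? ?] := Rt _ (crepr_in A); exists w.
have coB w w' : Z' w -> Z' w' -> co w = co w' <-> B' (w - w').
  move=> Zw Zw'; have Zd : Z' (w - w') by apply: subspaceB.
  have E : co (w - w') = co w - co w'.
    by rewrite -scaleN1r addrC coP // scaleN1r addrC.
  rewrite -co0 // E; split=> [->|/eqP]; first by rewrite subrr.
  by rewrite subr_eq0 => /eqP.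
have RB z z' w w' : R z w -> R z' w' -> R (z - z') (w - w').
  move=> zw zw'; rewrite -!scaleN1r addrC [w + _]addrC; exact: RP.
pose f (A : subquot Z B) := co (t A).
have fE z (Zz : Z z) w : Z' w -> R z w -> f (cls B Zz) = co w.
  move=> Zw zw; have [Zt Rtz] := tP (cls B Zz).
  apply/coB => //; rewrite -(Ri (crepr (cls B Zz) - z)).
  - exact: crepr_cls.
  - by apply: subspaceB => //; apply: crepr_in.
  - exact: subspaceB.
  exact: RB.
have flin : linear f.
  move=> a A A'; have [Zt Rt1] := tP A; have [Zt' Rt2] := tP A'.
  rewrite -coP //; have Zs : Z (a *: crepr A + crepr A') by apply: subspaceP; apply: crepr_in.
  have -> : a *: A + A' = cls B Zs.
    rewrite [A in LHS]clsE [A' in LHS]clsE -[a *: _]/(subquot_scale a _) cls_scale.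
    rewrite -[_ + _]/(subquot_add _ _) cls_add; exact/subquot_inj.
  by apply: fE; [apply: subspaceP | apply: RP].
pose fl : {linear subquot Z B -> 'rV[k]_d} := HB.pack f (GRing.isLinear.Build _ _ _ _ f flin).
exists fl; split=> //.
have /choice[g gP] (a : 'rV[k]_d) : exists A, f A = a.
  have [w Zw <-] := cosurj a; have [z Zz zw] := Rs w Zw.
  by exists (cls B Zz); apply: fE.
exists g => [A|a]; last exact: gP.
have [Zt RA] := tP A; have [Zt' RA'] := tP (g (f A)).
rewrite [RHS]clsE [LHS]clsE; apply/cls_eq.
rewrite (Ri _ (t (g (f A)) - t A)) //; last exact: RB.
- by apply/coB => //; apply: gP.
- by apply: subspaceB; apply: crepr_in.
exact: subspaceB.
Qed.

End Final.

Theorem corollary3p4 (k : closedFieldType) (r : nat) (lam : r.-tuple int)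
    (j : nat) :
  exists P : polyfunctor k (weight_sum lam),
  forall n : nat, (r <= n)%N ->
    (forall i : 'I_r, i.+1%:Z - tnth lam i <= n%:Z) ->
  exists phi : {linear flag_cohomology k (pad lam n) j -> P 'cV[k]_n},
    bijective phi /\
    forall (h : GL k n) (c : flag_cohomology k (pad lam n) j),
      phi (GLact h c) = pf_map P (GLlin h) (phi c).
Proof.
exists (cohomology_functor k lam j) => n rn lamn.
have [p nE] : exists p, n = (r + p)%N by exists (n - r)%N; rewrite subnKC.
subst n; pose l i := tnth lam i.
(* For i < r this is the hypothesis on n; the padded weights are 0, and there i + 1 <= n. *)
have range (i : 'I_(r + p)) : i.+1%:Z - (r + p)%N%:Z <= tnth (pad lam (r + p)) i.
  rewrite tnth_mktuple; have [ir|ri] := ltnP i r; last first.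
    by rewrite nth_default ?size_tuple //; have := ltn_ord i; lia.
  have := lamn (Ordinal ir); rewrite (tnth_nth 0) /=; lia.
have c1 := @godement_corr k _ (pad lam (r + p)) j.
have c2 := @bar_corr k _ (pad lam (r + p)) j.
have c3 := @comparison_corr k _ _ lam j range.
have Z2P : forall (a : k) u v, Z2 (pad lam (r + p)) j u -> Z2 (pad lam (r + p)) j v ->
    Z2 (pad lam (r + p)) j (a *: u + v).
  move=> a u v [Su Nu] [Sv Nv]; have H := bar_dcx k (fun i => tnth (pad lam (r + p)) i).
  by split; [apply: (dcx_SP H) | rewrite (dcx_eP H); apply: (dcx_NP H)].
have Z3P : forall (a : k) u v, Z3 (pad lam (r + p)) j u -> Z3 (pad lam (r + p)) j v ->
    Z3 (pad lam (r + p)) j (a *: u + v).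
  by move=> a u v [Su Nu] [Sv Nv]; split; [apply: bar_secP | rewrite dbarP; apply: vanishesP].
have c12 := corr_comp Z2P c1 c2; have c123 := corr_comp Z3P c12 c3.
have [Zb _ _] := fbaseP l j 'cV[k]_(r + p).
have [|||phi [bphi phiE]] := corr_iso (co := fcoord l j (V := _)) c123.
- by move=> a w w' Zw Zw'; apply: fcoord_lin.
- by move=> w; apply: fcoord_eq0.
- move=> a; have [Za aE] := fcoord_sum (lt := lam) (j := j) (index_enum _) (fun i => a 0 i) Zb.
  exists (\sum_i a 0 i *: fbase i) => //; rewrite aE [RHS]row_sum_delta.
  by apply: eq_bigr => i _; rewrite fcoord_base.
exists phi; split=> // h c.
(* Equivariance is read off a partner w of the representative of c: translating both sides preserves
   each of the three relations composed in [c123]. *)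
have [_ tot _ _] := c123; have [w Zw Rw] := tot _ (crepr_in c).
have -> : phi c = fcoord l j w by rewrite [c in LHS]clsE; apply: phiE.
have -> : phi (GLact h c) = fcoord l j (push (GLlin h) w).
  apply: phiE; first exact: push_fZ.
  case: Rw => b [Zb3 [z [Zz2 r1 r2]] r3].
  exists (frame_act h b); split; [exact: Z3_act | | exact: R3_act].
  by exists (chain_act h z); split; [exact: Z2_act | exact: R1_act | exact: R2_act].
by rewrite fcoord_push //; symmetry; apply: fmapE.
Qed.
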